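(* Let $A_j:(0,2)\to\mathfrak{gl}(k,\mathbb{C})$, $j=0,1,2,3,4$, satisfy the generalized Nahm's equations $$\dot A_0=\tfrac12[A_0,A_2],\quad \dot A_1=[A_0,A_3]+\tfrac12[A_1,A_2],\quad \dot A_2=[A_1,A_3]+[A_0,A_4],$$ $$\dot A_3=[A_1,A_4]+\tfrac12[A_2,A_3],\quad \dot A_4=\tfrac12[A_2,A_4]$$ and be such that: (1) $A_1$ and $A_3$ are analytic on the whole interval $[0,2]$; (2) $A_0$, $A_4$ and $A_2$ are analytic on $(0,2)$ and have simple poles at $z=0$ and $z=2$ with residues $a_0,a_4$ and $a_2$ defining the irreducible representation of $\mathfrak{sl}(2,\mathbb{C})$ of rank $k$. Then the curve $S\subset\mathbb{T}$ defined by $\det(\eta-A)=0$, where $A=A_0+\xi A_1+\xi^2A_2+\xi^3A_3+\xi^4A_4$, satisfies: (i) $S$ is compact; (ii) $L^2$ is trivial on $S$; (iii) $H^0(S,L^z(2k-3))=0$ for $z\in(0,2)$.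
   Context: $\mathbb{T}$ is the total space of $\pi:\mathcal{O}(4)\to\mathbb{C}P^1$, with coordinates $(\eta,\xi)$ on $U_0=\pi^{-1}(\{\xi\neq\infty\})$ and $(\eta/\xi^4,1/\xi)$ on $U_1=\pi^{-1}(\{\xi\ne0\})$. $\det(\eta-A)$ is regarded as a section of $\pi^*\mathcal{O}(4k)$ over $\mathbb{T}$, and $S$ is its zero divisor (independent of $z\in(0,2)$ by Nahm's equations). For $z\in\mathbb{C}$ and $l\in\mathbb{Z}$, $L^z(l)$ is the holomorphic line bundle on $\mathbb{T}$ whose sections are pairs $f_0$ on $U_0$, $f_1$ on $U_1$ with $f_0=\exp(z\eta/\xi^2)\,\xi^{l}f_1$ on $U_0\cap U_1$; $L^2=L^2(0)$. Dots denote derivatives in the variable $z\in(0,2)$. ''Simple pole'' means a pole of order at most one; the residues at an endpoint ''define the irreducible representation of rank $k$'' means that their linear span in $\mathfrak{gl}(k,\mathbb{C})$ is the image of the irreducible $k$-dimensional representation of $\mathfrak{sl}(2,\mathbb{C})$. *)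

(* Defs.v *)
From HB Require Import structures.
From mathcomp Require Import all_boot all_order all_algebra.
From mathcomp Require Import complex.
From mathcomp Require Import all_classical all_reals all_analysis.

Set Implicit Arguments.
Unset Strict Implicit.
Unset Printing Implicit Defensive.

Import Order.TTheory GRing.Theory Num.Theory.
Import numFieldNormedType.Exports.

Local Open Scope classical_set_scope.
Local Open Scope complex_scope.
Local Open Scope ring_scope.
Local Open Scope quotient_scope.

(* As for any numFieldType, the topology and the normed module structure
   of R[i] are those of the regular module R[i]^o. *)
Section ComplexTopology.
Variable R : rcfType.
HB.instance Definition _ := PseudoPointedMetric.copy R[i] (R[i])^o.
HB.instance Definition _ := GRing.ComAlgebra.copy R[i] (R[i])^o.
HB.instance Definition _ := Vector.copy R[i] (R[i])^o.
HB.instance Definition _ := NormedModule.copy R[i] (R[i])^o.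
End ComplexTopology.

Definition cexp (R : realType) (w : R[i]) : R[i] :=
  (expR (complex.Re w) * cos (complex.Im w)) +i*
  (expR (complex.Re w) * sin (complex.Im w)).

Section TotalSpace.
Variable R : realType.
Local Notation C := R[i].

(* The change of coordinates (eta, xi) |-> (eta / xi^4, 1 / xi); it is an
   involution on {xi != 0}, so it serves in both directions. *)
Definition transition (p : C * C) : C * C := (p.1 / p.2 ^+ 4, p.2^-1).

(* T is glued from two copies of C^2: (false, p) is the point of U_0 with
   coordinates p, and (true, p) the point of U_1 with coordinates p. *)
Definition glue (x y : bool * (C * C)) : bool :=
  (x == y) ||
  [&& y.1 != x.1, x.2.2 != 0 & y.2 == transition x.2].

Lemma transitionK p : p.2 != 0 -> transition (transition p) = p.
Proof.
case: p => e x /= x0; rewrite /transition /= invrK; congr pair.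
by rewrite exprVn invrK divfK // expf_neq0.
Qed.

Lemma glue_refl : reflexive glue.
Proof. by move=> x; rewrite /glue eqxx. Qed.

Lemma glue_imp_sym x y : glue x y -> glue y x.
Proof.
rewrite /glue => /orP[/eqP->|/and3P[n x0 /eqP e]]; first by rewrite eqxx.
by apply/orP; right; rewrite eq_sym n e transitionK // eqxx andbT /= invr_neq0.
Qed.

Lemma glue_sym : symmetric glue.
Proof. by move=> x y; apply/idP/idP; exact: glue_imp_sym. Qed.

Lemma glue_trans : transitive glue.
Proof.
move=> y x z; rewrite /glue => /orP[/eqP->//|/and3P[n x0 /eqP e]].
move=> /orP[/eqP<-|/and3P[n' y0 /eqP e']].
  by rewrite n x0 e eqxx orbT.
apply/orP; left; apply/eqP.
rewrite e transitionK // in e'.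
case: x z y n n' e' {x0 y0 e} => [a p] [b q] [c r] /= n n' ->; congr pair.
by case: a b c n n' => [] [] [].
Qed.

Canonical glue_equiv := EquivRel glue glue_refl glue_sym glue_trans.

Definition totalO4 := quotient_topology {eq_quot glue_equiv}.

Definition chart (b : bool) (p : C * C) : totalO4 :=
  \pi_({eq_quot glue_equiv}) (b, p).

End TotalSpace.

(* Below, an effective divisor S on T is given by its local equations P0 on
   U_0 and P1 on U_1. It may be non-reduced: O_S is the quotient of O_T by the
   ideal generated by the equations, not a sheaf of functions on the support. *)

Section Divisors.
Variable R : realType.
Local Notation C := R[i].
Implicit Types (P f g : C * C -> C) (p q : C * C).

Definition divisor_support P0 P1 : set (totalO4 R) :=
  (chart false @` [set p | P0 p = 0]) `|` (chart true @` [set p | P1 p = 0]).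

Definition holomorphic_at f p := \forall q \near p, differentiable f q.

(* f and g define the same element of O_p / (P). *)
Definition germ_eqmod P p f g :=
  exists h, holomorphic_at h p /\ \forall q \near p, f q - g q = h q * P q.

(* A section over C^2 of the sheaf O / (P), supported on {P = 0}, is a
   family of germs s p that is locally induced by one holomorphic function.
   The values s p with P p <> 0 are irrelevant: the stalk there is 0. *)
Definition Osection P (s : C * C -> C * C -> C) :=
  forall p, P p = 0 ->
    holomorphic_at (s p) p /\
    \forall q \near p, P q = 0 -> germ_eqmod P q (s q) (s p).

Definition Ozero P (s : C * C -> C * C -> C) :=
  forall p, P p = 0 -> germ_eqmod P p (s p) (fun=> 0).

Definition Oinvertible P (s : C * C -> C * C -> C) :=
  exists2 t, Osection P t &
    forall p, P p = 0 -> germ_eqmod P p (fun q => s p q * t p q) (fun=> 1).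

(* Sections of L^z(l) on S: pairs of sections s0, s1 of O_S over U_0 and U_1
   with s0 = exp(z eta / xi^2) xi^l s1 on the overlap. *)
Definition Lsection P0 P1 (z : C) (l : int) (s0 s1 : C * C -> C * C -> C) :=
  [/\ Osection P0 s0, Osection P1 s1 &
    forall p, p.2 != 0 -> P0 p = 0 ->
      germ_eqmod P0 p (s0 p)
        (fun q => cexp (z * q.1 / q.2 ^+ 2) * q.2 ^ l *
                  s1 (transition p) (transition q))].

(* An isomorphism of O_S with L^z(l) on S is multiplication by a section
   whose two components are units. *)
Definition Ltrivial P0 P1 (z : C) (l : int) :=
  exists s0 s1,
    [/\ Lsection P0 P1 z l s0 s1, Oinvertible P0 s0 & Oinvertible P1 s1].

Definition LH0_eq0 P0 P1 (z : C) (l : int) :=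
  forall s0 s1, Lsection P0 P1 z l s0 s1 -> Ozero P0 s0 /\ Ozero P1 s1.

End Divisors.

Section MatrixFunctions.
Variables (R : realType) (k : nat).
Local Notation C := R[i].
Implicit Types (A B : R -> 'M[C]_k) (t x : R).

Definition lie (X Y : 'M[C]_k) : 'M[C]_k := X *m Y - Y *m X.

Definition has_derivative A t (D : 'M[C]_k) :=
  (fun h : R => (h^-1)%:C *: (A (t + h) - A t)) @ 0^' --> D.

Definition analytic_at A t :=
  exists c : nat -> 'M[C]_k, \forall x \near t,
    (fun N => \sum_(n < N) ((x - t) ^+ n)%:C *: c n) @ \oo --> A x.

Definition analytic_open A := forall t, 0 < t < 2 -> analytic_at A t.

Definition analytic_closed A :=
  exists2 B, (forall t, 0 <= t <= 2 -> analytic_at B t) &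
    forall t, 0 < t < 2 -> B t = A t.

(* A, considered on (0,2) only, has a pole of order at most one at the
   endpoint t, with residue a. *)
Definition simple_pole A t (a : 'M[C]_k) :=
  exists B, [/\ analytic_at B t, B t = a &
    \forall x \near t, 0 < x < 2 -> A x = ((x - t)^-1)%:C *: B x].

Definition Nahm (A0 A1 A2 A3 A4 : R -> 'M[C]_k) :=
  forall t, 0 < t < 2 ->
  [/\ has_derivative A0 t (2^-1 *: lie (A0 t) (A2 t)),
      has_derivative A1 t (lie (A0 t) (A3 t) + 2^-1 *: lie (A1 t) (A2 t)),
      has_derivative A2 t (lie (A1 t) (A3 t) + lie (A0 t) (A4 t)),
      has_derivative A3 t (lie (A1 t) (A4 t) + 2^-1 *: lie (A2 t) (A3 t)) &
      has_derivative A4 t (2^-1 *: lie (A2 t) (A4 t))].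

End MatrixFunctions.

Section Sl2.
Variables (R : realType) (k : nat).
Local Notation C := R[i].

(* rho is a linear map on gl(2,C) of which only the restriction to the
   traceless matrices matters. *)
Definition sl2_rep (rho : {linear 'M[C]_2 -> 'M[C]_k}) :=
  forall X Y, \tr X = 0 -> \tr Y = 0 -> rho (lie X Y) = lie (rho X) (rho Y).

(* The transpose is there because stablemx refers to the action on row
   vectors, whereas gl(k,C) acts on column vectors. *)
Definition sl2_irreducible (rho : {linear 'M[C]_2 -> 'M[C]_k}) :=
  [/\ (0 < k)%N, sl2_rep rho &
    forall U : 'M[C]_k, (forall X, \tr X = 0 -> stablemx U (rho X)^T) ->
      \rank U = 0%N \/ \rank U = k].

Definition defines_irreducible (a0 a2 a4 : 'M[C]_k) :=
  exists2 rho, sl2_irreducible rho &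
    forall M : 'M[C]_k,
      M \in <<[:: a0; a2; a4]>>%VS <-> exists2 X, \tr X = 0 & M = rho X.

End Sl2.

Section SpectralCurve.
Variables (R : realType) (k : nat) (A0 A1 A2 A3 A4 : 'M[R[i]]_k).
Local Notation C := R[i].

(* The section det(eta - A) of the pullback of O(4k), in the trivialisations
   over U_0 and U_1. *)
Definition spectral0 (p : C * C) : C :=
  let xi := p.2 in
  \det (p.1%:M - (A0 + xi *: A1 + xi ^+ 2 *: A2 + xi ^+ 3 *: A3
                  + xi ^+ 4 *: A4)).

Definition spectral1 (p : C * C) : C :=
  let xi := p.2 in
  \det (p.1%:M - (xi ^+ 4 *: A0 + xi ^+ 3 *: A1 + xi ^+ 2 *: A2 + xi *: A3
                  + A4)).

End SpectralCurve.

(* Main.v *)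
From HB Require Import structures.
Require Import Defs.
From mathcomp Require Import all_boot all_order all_algebra.
From mathcomp Require Import complex.
From mathcomp Require Import all_classical all_reals all_analysis.
From mathcomp Require Import ring lra zify.

Set Implicit Arguments.
Unset Strict Implicit.
Unset Printing Implicit Defensive.

Import Order.TTheory GRing.Theory Num.Theory.
Import numFieldNormedType.Exports.

Local Open Scope classical_set_scope.
Local Open Scope complex_scope.
Local Open Scope ring_scope.

(** Write A(xi) for the pencil and A+ = A_2/2 + xi A_3 + xi^2 A_4. For every xi
    Nahm's equations are the Lax equation A' = [A, A+], so parallel transport
    for d/dt + A+ conjugates the matrices A(t) into each other (transport_conj)
    and S does not depend on t (spec_constant). The family B_j = - A_(4-j)
    solves the same equations. Up to the sign of eta it describes S in the
    chart with coordinate 1/xi, and A/xi^2 = A+(xi) - B+(1/xi). Hence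
    exp(t A(t)/xi^2) carries solutions of x' = - A+ x to solutions of the
    equation for B at 1/xi (transport_ex).

    The cokernel of eta - A is a line bundle on S. Over the two charts it is
    trivialised by vectors that are cyclic for A and for B. A frame with
    parameter a consists of entire vectors x0(xi) and x1(1/xi), cyclic at every
    point, with exp(a A/xi^2) x0 = xi^(-2(k-1)) x1. Two frames with parameters
    a and b differ by two units whose quotient on the overlap is
    exp((a-b) eta/xi^2), so that a - b = 2 makes L^2 trivial (frame_trivial). A
    section of L^z(2k-3), applied to a frame with parameter z, gives entire
    vectors with w0(xi) = xi^-1 w1(1/xi), which vanish by Liouville's theorem
    (frame_vanish). The theorem thus follows from the existence of frames for
    A(t) with the parameters t and t - 2. The latter are the
    former for the time-reversed family (frame_back), and parallel transport moves a frame with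
    parameter t along the whole interval (framed_all). It remains to find one
    near t = 0.

    There x' = - A+ x has a regular singularity. By Nahm's equations the
    residues satisfy the relations of sl(2) (residue_relations). A lowest
    weight vector v of this irreducible representation starts a solution
    t^((k-1)/2) X(t), X(0) = v, where X is a power series in t with entire
    coefficients (lowest_solution); X is cyclic because v is cyclic for
    a_0 + xi^2 a_2 + xi^4 a_4 (pencil_cyclic). In the same way B has a solution
    X1 that starts from a highest weight vector. In the basis X1, B X1, ... the
    coordinates of exp(t A/xi^2) X do not depend on t, and for t tending to 0 all but
    the first are seen to vanish (endpoint_match). How the first one depends on
    xi is determined by the action of the torus on the weight basis
    (ex_lowest_scaling): this is the power of xi in a frame.

    The link with sheaves is complex analytic: a section of O_S over a chart is
    a polynomial in eta of degree less than k with entire coefficients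
    (section_poly), and such polynomials correspond to matrices commuting with
    A (calculus_faithful). The first statement comes from Weierstrass division
    near a fibre and the continuity of roots. The division rests on Cauchy's
    estimates in one variable, which are derived from Goursat's lemma with
    dyadic trapezoid sums along segments in the place of contour integrals. *)

(** * Modulus and differentials of complex functions *)

Notation cn := ComplexField.Normc.normc.

Section Modulus.
Variable R : realType.
Local Notation C := R[i].
Implicit Types (x y z : C).

Lemma normCE z : `|z| = (cn z)%:C. Proof. by []. Qed.

Lemma cn_ge0 z : 0 <= cn z.
Proof. by case: z => a b /=; rewrite sqrtr_ge0. Qed.

Lemma cn0 : cn (0 : C) = 0. Proof. exact: ComplexField.Normc.normc0. Qed.

Lemma cn1 : cn (1 : C) = 1. Proof. exact: ComplexField.Normc.normc1. Qed.

Lemma cnM x y : cn (x * y) = cn x * cn y.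
Proof. exact: ComplexField.Normc.normcM. Qed.

Lemma cnV x : cn x^-1 = (cn x)^-1.
Proof. exact: ComplexField.Normc.normcV. Qed.

Lemma cnX x n : cn (x ^+ n) = cn x ^+ n.
Proof. by elim: n => [|n IH]; rewrite ?expr0 ?cn1 // !exprS cnM IH. Qed.

Lemma cnN x : cn (- x) = cn x.
Proof. by case: x => a b /=; rewrite !sqrrN. Qed.

Lemma cnB x y : cn (x - y) = cn (y - x).
Proof. by rewrite -cnN opprB. Qed.

Lemma cnD x y : cn (x + y) <= cn x + cn y.
Proof. by have := ler_normD x y; rewrite !normCE -rmorphD lecR. Qed.

Lemma cnDB x y : cn (x - y) <= cn x + cn y.
Proof. by rewrite -(cnN y) cnD. Qed.

Lemma cn_dist x y z : cn (x - z) <= cn (x - y) + cn (y - z).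
Proof. by have := cnD (x - y) (y - z); rewrite addrA subrK. Qed.

Lemma cn_subr x y : cn x - cn y <= cn (x - y).
Proof. by have := cnD (x - y) y; rewrite subrK; lra. Qed.

Lemma cn_eq0 x : (cn x == 0) = (x == 0).
Proof.
by apply/eqP/eqP => [/ComplexField.Normc.eq0_normc//|->]; exact: cn0.
Qed.

Lemma cn_gt0 x : (0 < cn x) = (x != 0).
Proof. by rewrite lt_def cn_eq0 cn_ge0 andbT. Qed.

Lemma cnR (a : R) : cn a%:C = `|a|.
Proof. by rewrite /= expr0n addr0 sqrtr_sqr. Qed.

Lemma cn_nat n : cn (n%:R : C) = n%:R.
Proof.
by rewrite -(rmorph_nat (real_complex R)) cnR ger0_norm.
Qed.

Lemma cn_Re x : `|complex.Re x| <= cn x.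
Proof.
by case: x => a b /=; rewrite -sqrtr_sqr ler_wsqrtr // lerDl sqr_ge0.
Qed.

Lemma cn_Im x : `|complex.Im x| <= cn x.
Proof.
by case: x => a b /=; rewrite -sqrtr_sqr ler_wsqrtr // lerDr sqr_ge0.
Qed.

Lemma cn_ReIm x : cn x <= `|complex.Re x| + `|complex.Im x|.
Proof.
rewrite {1}[x]complexE; apply: (le_trans (cnD _ _)); rewrite cnM !cnR /=.
by rewrite expr0n expr1n /= add0r sqrtr1 mul1r.
Qed.

Lemma ReD x y : complex.Re (x + y) = complex.Re x + complex.Re y.
Proof. by case: x y => [a b] [c d]. Qed.
Lemma ImD x y : complex.Im (x + y) = complex.Im x + complex.Im y.
Proof. by case: x y => [a b] [c d]. Qed.
Lemma ReN x : complex.Re (- x) = - complex.Re x.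
Proof. by case: x. Qed.
Lemma ImN x : complex.Im (- x) = - complex.Im x.
Proof. by case: x. Qed.
Lemma ReM x y : complex.Re (x * y) =
  complex.Re x * complex.Re y - complex.Im x * complex.Im y.
Proof. by case: x y => [a b] [c d]. Qed.
Lemma ImM x y : complex.Im (x * y) =
  complex.Re x * complex.Im y + complex.Im x * complex.Re y.
Proof. by case: x y => [a b] [c d] /=; rewrite addrC. Qed.

Lemma cn_sum (I : Type) (r : seq I) (P : pred I) (F : I -> C) :
  cn (\sum_(i <- r | P i) F i) <= \sum_(i <- r | P i) cn (F i).
Proof.
elim/big_rec2: _ => [|i u v _ h]; first by rewrite cn0.
by apply: (le_trans (cnD _ _)); rewrite lerD2l.
Qed.

Lemma cn_eps0 x : (forall e : R, 0 < e -> cn x <= e) -> x = 0.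
Proof.
move=> h; apply/eqP; rewrite -cn_eq0 eq_le cn_ge0 andbT.
by apply/ler_addgt0Pl => e e0; rewrite addr0; exact: h.
Qed.

End Modulus.

(** Locked, so that conversion never unfolds the choice behind the
    differential. *)
HB.lock Definition dv (R : realType) (V : normedModType R[i]) (f : V -> R[i])
  (q v : V) : R[i] := 'd f q v.

Section ModuleNorm.
Variables (R : realType) (V : normedModType R[i]).
Implicit Types (u v : V).

(** The norm of V takes its values in R[i]; estimates are made with its real
    part. *)
Definition vn v : R := complex.Re `|v|.

Lemma vnE v : `|v| = (vn v)%:C.
Proof. by rewrite /vn RRe_real // normr_real. Qed.

Lemma vn_ge0 v : 0 <= vn v.
Proof. by rewrite -ler0c -vnE. Qed.

Lemma vn_eq0 v : (vn v == 0) = (v == 0).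
Proof. by rewrite -[RHS]normr_eq0 vnE -(inj_eq (@complexI R)). Qed.

Lemma vnD u v : vn (u + v) <= vn u + vn v.
Proof. by have := ler_normD u v; rewrite !vnE -rmorphD lecR. Qed.

Lemma vnZ (a : R[i]) v : vn (a *: v) = cn a * vn v.
Proof. by apply: complexI; rewrite -vnE normrZ vnE normCE rmorphM. Qed.

Lemma vn0 : vn 0 = 0. Proof. by apply/eqP; rewrite vn_eq0. Qed.

Lemma near_vnP (q : V) (P : V -> Prop) :
  (\forall x \near q, P x) <->
  (exists2 e : R, 0 < e & forall x, vn (x - q) < e -> P x).
Proof.
split.
  move=> /nbhs_normP[e /= e0 he].
  have ee : e = (complex.Re e)%:C by rewrite RRe_real // gtr0_real.
  exists (complex.Re e); first by rewrite -ltcR -ee.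
  by move=> x hx; apply: he => /=; rewrite distrC vnE ee ltcR.
move=> [e e0 he]; apply/nbhs_normP; exists e%:C => /=; first by rewrite ltcR.
by move=> x /=; rewrite distrC vnE ltcR; exact: he.
Qed.

Lemma dv_linear (f : V -> R[i]) q a u v :
  dv f q (a *: u + v) = a * dv f q u + dv f q v.
Proof. by rewrite dv.unlock linearP. Qed.

Lemma dv0 (f : V -> R[i]) q : dv f q 0 = 0.
Proof. by rewrite dv.unlock linear0. Qed.

Lemma dvZ (f : V -> R[i]) q a v : dv f q (a *: v) = a * dv f q v.
Proof. by rewrite dv.unlock linearZ. Qed.

Lemma dif_eps (f : V -> R[i]) q : differentiable f q ->
  forall e : R, 0 < e -> exists2 d : R, 0 < d &
    forall v, vn v < d -> cn (f (q + v) - f q - dv f q v) <= e * vn v.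
Proof.
move=> /diff_locallyP [_ h] e e0; rewrite dv.unlock.
move/eqaddoP: h => /(_ e%:C); rewrite ltcR => /(_ e0) /near_vnP[d d0 hd].
exists d => // v hv; have := hd v; rewrite subr0 => /(_ hv) /=.
rewrite -[(_ - _) v]/(f (v + q) - (f q + 'd f q v)) normCE vnE -rmorphM lecR.
by rewrite [v + q]addrC opprD addrA.
Qed.

Lemma dif_bounded (f : V -> R[i]) q : differentiable f q ->
  exists2 B : R, 0 < B & forall v, cn (dv f q v) <= B * vn v.
Proof.
move=> df; rewrite dv.unlock.
have cf : continuous ('d f q) by exact: diff_continuous.
have /cvgrPdist_lt/(_ 1 ltr01)/near_vnP[e e0 he] := cf 0.
exists (2 / e); first by rewrite divr_gt0.
move=> v; have [->|v0] := eqVneq v 0.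
  by rewrite linear0 vn0 mulr0 cn0.
have vp : 0 < vn v by rewrite lt_def vn_eq0 v0 vn_ge0.
pose a := (e / 2 / vn v); have a0 : 0 < a by rewrite !divr_gt0.
have := he (a%:C *: v); rewrite subr0 vnZ cnR gtr0_norm // /a divfK ?gt_eqF //.
move=> /(_ ltac:(lra)); rewrite linear0 sub0r normrN linearZ normCE ltcR /= cnM.
rewrite cnR gtr0_norm // => hh.
have -> : 2 / e * vn v = a^-1 by rewrite /a; field; rewrite !gt_eqF.
by rewrite -[leRHS]mul1r ler_pdivlMr // mulrC; exact: ltW.
Qed.

Lemma dif_intro (f L : V -> R[i]) q (B : R) :
  linear_for *%R L -> (forall v, cn (L v) <= B * vn v) ->
  (forall e : R, 0 < e -> exists2 d : R, 0 < d &
    forall v, vn v < d -> cn (f (q + v) - f q - L v) <= e * vn v) ->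
  differentiable f q /\ forall v, dv f q v = L v.
Proof.
move=> Llin Lb h.
pose Lz := GRing.isLinear.Build R[i] V R[i] *:%R L Llin.
pose LL : {linear V -> R[i]} := HB.pack L Lz.
have Lc : continuous LL.
  apply/continuousfor0_continuous/cvgrPdist_lt => e e0.
  have ee : e = (complex.Re e)%:C by rewrite RRe_real // gtr0_real.
  move: e0; rewrite ee ltcR; set e' := complex.Re e => e0.
  apply/near_vnP; exists (e' / (`|B| + 1)).
    by rewrite divr_gt0 // ltr_wpDl.
  move=> v; rewrite subr0 => hv; rewrite linear0 sub0r normrN normCE ltcR.
  apply: le_lt_trans (Lb v) _; move: hv; rewrite ltr_pdivlMr ?ltr_wpDl //.
  apply: le_lt_trans; rewrite mulrC ler_wpM2l ?vn_ge0 //.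
  by rewrite (le_trans (ler_norm _)) // lerDl.
have ho : f \o shift q = cst (f q) + LL +o_ 0 id.
  apply/eqaddoP => e e0.
  have ee : e = (complex.Re e)%:C by rewrite RRe_real // gtr0_real.
  move: e0; rewrite ee ltcR => e0; have [d d0 hd] := h _ e0.
  apply/near_vnP; exists d => // v; rewrite subr0 => /hd.
  rewrite -[(_ - _) v]/(f (v + q) - (f q + L v)) normCE vnE -rmorphM lecR.
  by rewrite [v + q]addrC opprD addrA.
have dE : 'd f q = LL :> (V -> R[i]) by apply: diff_unique.
by split=> [|v]; [apply/diff_locallyP; rewrite dE | rewrite dv.unlock dE].
Qed.

End ModuleNorm.

Section RealSequences.
Variable R : realType.

Lemma half_small (x : R) : 0 < x -> exists n, 2^-1 ^+ n < x.
Proof.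
move=> x0; exists (Num.bound x^-1); rewrite exprVn.
rewrite invf_plt ?posrE ?exprn_gt0 //.
apply: lt_trans (archi_boundP (ltW _)) _; first by rewrite invr_gt0.
by rewrite -natrX ltr_nat ltn_expl.
Qed.

Lemma half_mul_small (c x : R) : 0 < x -> exists n, c * 2^-1 ^+ n < x.
Proof.
move=> x0; have c0 : 0 < `|c| + 1 by rewrite ltr_wpDl.
have [n hn] := half_small (divr_gt0 x0 c0); exists n.
move: hn; rewrite ltr_pdivlMr // mulrC; apply: le_lt_trans.
by rewrite ler_wpM2r ?exprn_ge0 // (le_trans (ler_norm c)) // lerDl.
Qed.

(** Lowering x n by a bound for the remaining increments makes the sequence
    monotone; the limit is the supremum. *)
Lemma geo_limit (x : nat -> R) (c : R) :
  (forall n, `|x n.+1 - x n| <= c * 2^-1 ^+ n) ->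
  exists l, forall n, `|l - x n| <= 2 * c * 2^-1 ^+ n.
Proof.
move=> h.
pose y n := x n - 2 * c * 2^-1 ^+ n; pose z n := x n + 2 * c * 2^-1 ^+ n.
have stepy n : y n <= y n.+1.
  by have := h n; rewrite /y exprS ler_norml => /andP[]; lra.
have stepz n : z n.+1 <= z n.
  by have := h n; rewrite /z exprS ler_norml => /andP[]; lra.
have c0 n : 0 <= c * 2^-1 ^+ n by apply: le_trans (normr_ge0 _) (h n).
have yz n : y n <= z n by have := c0 n; rewrite /y /z; lra.
have my n m : y n <= y (n + m)%N.
  by elim: m => [|m IH]; rewrite ?addn0 // addnS (le_trans IH).
have mz n m : z (n + m)%N <= z n.
  by elim: m => [|m IH]; rewrite ?addn0 // addnS (le_trans _ IH).
have yzn n m : y n <= z m.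
  by rewrite (le_trans (my n m)) // (le_trans (yz _)) // addnC mz.
have yS : has_sup (range y).
  by split; [exists (y 0%N); exists 0%N | exists (z 0%N) => _ [n _ <-]].
exists (sup (range y)) => n.
have h1 : y n <= sup (range y) by apply: (ub_le_sup yS.2); exists n.
have h2 : sup (range y) <= z n by apply: (ge_sup yS.1) => _ [m _ <-].
by move: h1 h2; rewrite /y /z ler_norml; lra.
Qed.

Lemma geo_limitC (x : nat -> R[i]) (c : R) :
  (forall n, cn (x n.+1 - x n) <= c * 2^-1 ^+ n) ->
  exists l, forall n, cn (l - x n) <= 4 * c * 2^-1 ^+ n.
Proof.
move=> h.
have [a ha] : exists l, forall n,
    `|l - complex.Re (x n)| <= 2 * c * 2^-1 ^+ n.
  apply: geo_limit => n; apply: le_trans (h n).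
  by rewrite -ReN -ReD; exact: cn_Re.
have [b hb] : exists l, forall n,
    `|l - complex.Im (x n)| <= 2 * c * 2^-1 ^+ n.
  apply: geo_limit => n; apply: le_trans (h n).
  by rewrite -ImN -ImD; exact: cn_Im.
exists (a +i* b) => n; apply: (le_trans (cn_ReIm _)).
by rewrite ReD ImD ReN ImN /=; have := ha n; have := hb n; lra.
Qed.

End RealSequences.

(** * Goursat's lemma without integrals *)

Section Goursat.
Variable R : realType.
Local Notation C := R[i].
Implicit Types (F G : C -> C) (K : C -> Prop) (p q w z : C).

Definition mid p q : C := (p + q) / 2.

(** The trapezoid sum of F along the segment from p to q cut into 2^m pieces.
    Such sums replace contour integrals: they are additive under bisection by
    definition and exact on affine functions. *)
Fixpoint trap F m p q : C :=
  if m is m'.+1 then trap F m' p (mid p q) + trap F m' (mid p q) q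
  else (F p + F q) / 2 * (q - p).

Lemma trap0 F p q : trap F 0 p q = (F p + F q) / 2 * (q - p).
Proof. by []. Qed.

Lemma trapS F m p q :
  trap F m.+1 p q = trap F m p (mid p q) + trap F m (mid p q) q.
Proof. by []. Qed.

Definition midconvex K := forall p q, K p -> K q -> K (mid p q).

Lemma midC p q : mid p q = mid q p.
Proof. by rewrite /mid addrC. Qed.

Lemma trap_rev F m p q : trap F m q p = - trap F m p q.
Proof.
elim: m p q => [|m IH] p q /=; first by ring.
by rewrite (midC q p) IH (IH p) opprD addrC.
Qed.

Lemma trapD F G m p q :
  trap (fun z => F z + G z) m p q = trap F m p q + trap G m p q.
Proof. by elim: m p q => [|m IH] p q /=; rewrite ?IH; ring. Qed.

Lemma trapZ a F m p q : trap (fun z => a * F z) m p q = a * trap F m p q.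
Proof. by elim: m p q => [|m IH] p q /=; rewrite ?IH; ring. Qed.

Lemma trap_affine a b m p q :
  trap (fun z => a + b * z) m p q = a * (q - p) + b / 2 * (q ^+ 2 - p ^+ 2).
Proof.
elim: m p q => [|m IH] p q /=; first by field.
by rewrite !IH; ring.
Qed.

Lemma trap_bound K F m p q (e : R) : midconvex K -> K p -> K q ->
  (forall z, K z -> cn (F z) <= e) -> cn (trap F m p q) <= e * cn (q - p).
Proof.
move=> Km Kp Kq h; have cn2 : cn (2 : C)^-1 = 2^-1 by rewrite cnV cn_nat.
elim: m p q Kp Kq => [|m IH] p q Kp Kq /=.
  rewrite cnM ler_wpM2r ?cn_ge0 // cnM cn2.
  by have := cnD (F p) (F q); have := h _ Kp; have := h _ Kq; lra.
have KM := Km _ _ Kp Kq.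
have e1 : cn (mid p q - p) = cn (q - p) / 2.
  by rewrite -cn2 -cnM; congr cn; rewrite /mid; field.
have e2 : cn (q - mid p q) = cn (q - p) / 2.
  by rewrite -cn2 -cnM; congr cn; rewrite /mid; field.
have := IH _ _ Kp KM; have := IH _ _ KM Kq; rewrite e1 e2.
by have := cnD (trap F m p (mid p q)) (trap F m (mid p q) q); lra.
Qed.

Definition tri F m p q w := trap F m p q + trap F m q w + trap F m w p.

Lemma tri_split F m p q w : tri F m.+1 p q w =
  tri F m p (mid p q) (mid p w) + tri F m (mid p q) q (mid q w) +
  tri F m (mid p w) (mid q w) w + tri F m (mid p q) (mid q w) (mid p w).
Proof.
rewrite /tri /= (midC w p) (trap_rev F m (mid p q) (mid p w)).
rewrite (trap_rev F m (mid p q) (mid q w)) (trap_rev F m (mid p w) (mid q w)).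
by ring.
Qed.

(** With e arbitrary, this is the form in which a vanishing contour integral
    appears. *)
Definition small_tri F (e : R) p q w :=
  exists m0, forall m, (m0 <= m)%N -> cn (tri F m p q w) <= e.

Lemma small_tri_split F (e1 e2 e3 e4 : R) p q w :
  small_tri F e1 p (mid p q) (mid p w) ->
  small_tri F e2 (mid p q) q (mid q w) ->
  small_tri F e3 (mid p w) (mid q w) w ->
  small_tri F e4 (mid p q) (mid q w) (mid p w) ->
  small_tri F (e1 + e2 + e3 + e4) p q w.
Proof.
move=> [m1 h1] [m2 h2] [m3 h3] [m4 h4].
exists (maxn (maxn m1 m2) (maxn m3 m4)).+1 => -[//|m].
rewrite ltnS !geq_max => /andP[/andP[/h1 H1 /h2 H2] /andP[/h3 H3 /h4 H4]].
rewrite tri_split; move: H1 H2 H3 H4.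
set a := tri _ _ _ _ _; set b := tri _ _ _ _ _; set c := tri _ _ _ _ _.
set d := tri _ _ _ _ _.
by have := cnD (a + b + c) d; have := cnD (a + b) c; have := cnD a b; lra.
Qed.

Lemma dif_mul1 F z v : dv F z v = v * dv F z 1.
Proof.
by rewrite -[v in LHS]mulr1 -[_ * 1]/(v *: (1 : C^o)) dvZ.
Qed.

(** Near a point of differentiability F is affine up to e s, and the boundary
    sum of an affine function vanishes. *)
Lemma small_tri_near K F z (e : R) : differentiable F z -> 0 < e ->
  exists2 d : R, 0 < d & forall p q w (s : R), 0 < s -> s < d ->
    cn (p - z) <= s -> cn (q - z) <= s -> cn (w - z) <= s ->
    small_tri F (e * s ^+ 2) p q w.
Proof.
move=> dF e0; have e6 : 0 < e / 6 by lra.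
have [d d0 hd] := dif_eps dF e6; exists d => // p q w s s0 sd hp hq hw.
exists 0%N => m _.
pose b := dv F z 1; pose a := F z - b * z.
pose K' x := cn (x - z) <= s.
have Km : midconvex K'.
  move=> x y; rewrite /K' => hx hy.
  have -> : mid x y - z = (x - z + (y - z)) / 2 by rewrite /mid; field.
  rewrite cnM cnV cn_nat; have := cnD (x - z) (y - z); lra.
pose G x := F x + -1 * (a + b * x).
have hG x : K' x -> cn (G x) <= e / 6 * s.
  move=> hx; have := hd (x - z) (le_lt_trans hx sd); rewrite dif_mul1 -/b.
  have -> : F (z + (x - z)) - F z - (x - z) * b = G x.
    by rewrite (addrC z) subrK /G /a; ring.
  move=> h; apply: (le_trans h); rewrite ler_wpM2l //; lra.
have hT x y : K' x -> K' y -> cn (trap G m x y) <= e / 6 * s * (2 * s).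
  move=> hx hy; apply: (le_trans (trap_bound m Km hx hy hG)).
  rewrite ler_wpM2l //; first by rewrite mulr_ge0 //; lra.
  have := cn_dist y z x; rewrite (cnB z x); move: hx hy; rewrite /K'; lra.
have -> : tri F m p q w = tri G m p q w.
  by rewrite /tri /G !trapD !trapZ !trap_affine; ring.
rewrite /tri; have := hT _ _ hp hq; have := hT _ _ hq hw; have := hT _ _ hw hp.
have := cnD (trap G m p q + trap G m q w) (trap G m w p).
have := cnD (trap G m p q) (trap G m q w).
by rewrite expr2; nra.
Qed.

(** Goursat's lemma: subdividing a triangle with a large boundary sum produces
    nested triangles contradicting differentiability at their common point. *)
Lemma goursat K F p q w : midconvex K ->
  (forall z, (forall e : R, 0 < e -> exists2 x, K x & cn (x - z) < e) -> K z) ->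
  (forall z, K z -> differentiable F z) -> K p -> K q -> K w ->
  forall e : R, 0 < e -> small_tri F e p q w.
Proof.
move=> Km Kc Kd Kp Kq Kw e e0; apply: contrapT => bad.
pose d : R := cn (p - q) + cn (q - w) + cn (p - w) + 1.
have d0 : 0 < d.
  by rewrite /d; have := cn_ge0 (p - q); have := cn_ge0 (q - w);
     have := cn_ge0 (p - w); lra.
pose Inv n (s : C * C * C) := let: (p, q, w) := s in
  [/\ [/\ K p, K q & K w],
      [/\ cn (p - q) <= d * 2^-1 ^+ n, cn (q - w) <= d * 2^-1 ^+ n &
          cn (p - w) <= d * 2^-1 ^+ n] &
      ~ small_tri F (e * (2^-1 ^+ n) ^+ 2) p q w].
have inv0 : Inv 0%N (p, q, w).
  split => //; last by rewrite expr0 expr1n mulr1.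
  by rewrite expr0 mulr1 /d; have := cn_ge0 (p - q); have := cn_ge0 (q - w);
     have := cn_ge0 (p - w); split; lra.
have cn2 : cn (2 : C)^-1 = 2^-1 by rewrite cnV cn_nat.
have step n s : Inv n s -> exists s', Inv n.+1 s' /\
    cn (s'.1.1 - s.1.1) <= d * 2^-1 ^+ n.
  move: s => [[p' q'] w'] [[kp kq kw] [h1 h2 h3] b'].
  have half (x y : C) : cn ((x - y) / 2) = cn (x - y) / 2 by rewrite cnM cn2.
  have kpq := Km _ _ kp kq; have kqw := Km _ _ kq kw; have kpw := Km _ _ kp kw.
  have dn : 0 <= d * 2^-1 ^+ n by rewrite mulr_ge0 ?exprn_ge0 // ltW.
  have f1 : cn (mid p' q' - p') = cn (p' - q') / 2.
    by rewrite cnB -half; congr cn; rewrite /mid; field.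
  have f2 : cn (mid p' w' - p') = cn (p' - w') / 2.
    by rewrite cnB -half; congr cn; rewrite /mid; field.
  have f3 : cn (q' - mid q' w') = cn (q' - w') / 2.
    by rewrite -half; congr cn; rewrite /mid; field.
  have f4 : cn (mid p' q' - q') = cn (p' - q') / 2.
    by rewrite -half; congr cn; rewrite /mid; field.
  have f5 : cn (mid q' w' - w') = cn (q' - w') / 2.
    by rewrite -half; congr cn; rewrite /mid; field.
  have f6 : cn (mid p' w' - w') = cn (p' - w') / 2.
    by rewrite -half; congr cn; rewrite /mid; field.
  have g1 : cn (mid p' q' - mid p' w') = cn (q' - w') / 2.
    by rewrite -half; congr cn; rewrite /mid; field.
  have g2 : cn (mid p' q' - mid q' w') = cn (p' - w') / 2.
    by rewrite -half; congr cn; rewrite /mid; field.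
  have g3 : cn (mid p' w' - mid q' w') = cn (p' - q') / 2.
    by rewrite -half; congr cn; rewrite /mid; field.
  (* if the four quarters were small, so would be the whole *)
  apply: contrapT => nex; apply: b'.
  pose e' := e * (2^-1 ^+ n.+1) ^+ 2.
  have -> : e * (2^-1 ^+ n) ^+ 2 = e' + e' + e' + e' :> R.
    by rewrite /e' (exprS _ n); move: (2^-1 ^+ n) => y; field.
  have hs : d * 2^-1 ^+ n.+1 = d * 2^-1 ^+ n / 2 :> R.
    by rewrite (exprS _ n); move: (2^-1 ^+ n) => y; field.
  have pp : cn (p' - p') <= d * 2^-1 ^+ n by rewrite subrr cn0.
  apply: small_tri_split; apply: contrapT => ns; apply: nex.
  - exists (p', mid p' q', mid p' w'); split=> //; split => //.
    by rewrite hs cnB f1 g1 (cnB p' (mid p' w')) f2; split; lra.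
  - exists (mid p' q', q', mid q' w'); split=> //=; last by rewrite f1; lra.
    by split => //; rewrite hs f4 f3 g2; split; lra.
  - exists (mid p' w', mid q' w', w'); split=> //=; last by rewrite f2; lra.
    by split => //; rewrite hs g3 f5 f6; split; lra.
  - exists (mid p' q', mid q' w', mid p' w'); split=> //=.
      by split => //; rewrite hs g2 g1 (cnB (mid q' w')) g3; split; lra.
    by rewrite f1; lra.
(* dependent choice of the nested triangles; x lists their first vertices *)
pose nxt n (s : {s | Inv n s}) : {s' | Inv n.+1 s'} :=
  let c := cid (step n (sval s) (svalP s)) in exist _ (sval c) (svalP c).1.
pose sq := fix sq n : {s | Inv n s} :=
  if n is n'.+1 then nxt n' (sq n') else exist _ _ inv0.
pose x n := (sval (sq n)).1.1.
have [z hz] : exists l, forall n, cn (l - x n) <= 4 * d * 2^-1 ^+ n.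
  apply: geo_limitC => n; rewrite /x /= /nxt /=.
  by case: cid => s' [] /=.
have Kz : K z.
  apply: Kc => e' e'0; have [n hn] := half_mul_small (4 * d) e'0.
  exists (x n); last by rewrite cnB; apply: le_lt_trans (hz n) hn.
  by rewrite /x; case: (sq n) => -[[? ?] ?] [[]].
have e25 : 0 < e / (5 * d) ^+ 2 by rewrite divr_gt0 // exprn_gt0 // mulr_gt0.
have [del del0 hdel] := small_tri_near K (Kd _ Kz) e25.
have [n hn] := half_mul_small (5 * d) del0.
have dn : 0 < 5 * d * 2^-1 ^+ n by rewrite !mulr_gt0 // exprn_gt0.
move: (hz n); rewrite /x; case: (sq n) => -[[p' q'] w'] [_ [h1 h2 h3] nb] /= hz'.
apply: nb.
have -> : e * (2^-1 ^+ n) ^+ 2 =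
    e / (5 * d) ^+ 2 * (5 * d * 2^-1 ^+ n) ^+ 2 :> R.
  by move: (2^-1 ^+ n) => y; field; rewrite gt_eqF.
have dn' : 0 <= d * 2^-1 ^+ n by rewrite mulr_ge0 ?exprn_ge0 // ltW.
apply: hdel => //.
- by rewrite cnB; lra.
- by have := cn_dist q' p' z; rewrite (cnB q' p') (cnB p' z); lra.
- by have := cn_dist w' p' z; rewrite (cnB w' p') (cnB p' z); lra.
Qed.

Lemma cn_mid_le p q z (s : R) :
  cn (p - z) <= s -> cn (q - z) <= s -> cn (mid p q - z) <= s.
Proof.
have -> : mid p q - z = (p - z + (q - z)) / 2 by rewrite /mid; field.
by rewrite cnM cnV cn_nat; have := cnD (p - z) (q - z); lra.
Qed.

Lemma Re_mid (c a p q : C) : complex.Re (c * (mid p q - a)) =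
  (complex.Re (c * (p - a)) + complex.Re (c * (q - a))) / 2.
Proof.
have -> : c * (mid p q - a) = (c * (p - a) + c * (q - a)) * (2^-1)%:C.
  by rewrite /mid fmorphV rmorph_nat; field.
by rewrite ReM ReD /= mulr0 subr0.
Qed.

(** Goursat's lemma with a bounded singularity at the vertex a: bisection
    isolates it in triangles of vanishing perimeter. The half plane through a
    keeps the other pieces away from it. *)
Lemma goursat_corner F (a c p q : C) (r B : R) :
  (forall z, cn z <= r -> z != a -> differentiable F z) ->
  (forall z, cn z <= r -> cn (F z) <= B) ->
  cn a <= r -> cn p <= r -> cn q <= r ->
  0 < complex.Re (c * (p - a)) -> 0 < complex.Re (c * (q - a)) ->
  forall e : R, 0 < e -> small_tri F e a p q.
Proof.
move=> Fd FB ar.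
pose L p q := cn (p - a) + cn (q - p) + cn (a - q).
have L0 x y : 0 <= L x y.
  by rewrite /L; have := cn_ge0 (x - a); have := cn_ge0 (y - x);
    have := cn_ge0 (a - y); lra.
have B0 : 0 <= B by apply: le_trans (cn_ge0 _) (FB a ar).
have Dmid x y : cn x <= r -> cn y <= r -> cn (mid x y) <= r.
  by have := @cn_mid_le x y 0 r; rewrite !subr0.
suff main : forall n p q (e : R), cn p <= r -> cn q <= r ->
    0 < complex.Re (c * (p - a)) -> 0 < complex.Re (c * (q - a)) ->
    0 < e -> small_tri F (e + B * L p q * 2^-1 ^+ n) a p q.
  move=> pr qr hp hq e e0.
  have [n hn] := half_mul_small (B * L p q) (divr_gt0 e0 (ltr0Sn R 1)).
  have [|m0 hm] := main n p q (e / 2) pr qr hp hq; first lra.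
  by exists m0 => m /hm; lra.
elim=> [|n IH] {}p {}q e pr qr hp hq e0.
  exists 0%N => m _; rewrite expr0 mulr1 /tri.
  have Km : midconvex (fun z => cn z <= r) by move=> x y; exact: Dmid.
  have T x y : cn x <= r -> cn y <= r -> cn (trap F m x y) <= B * cn (y - x).
    by move=> hx hy; exact: (trap_bound m Km hx hy FB).
  have := T _ _ ar pr; have := T _ _ pr qr; have := T _ _ qr ar; rewrite /L.
  have := cnD (trap F m a p + trap F m p q) (trap F m q a).
  by have := cnD (trap F m a p) (trap F m p q); lra.
pose eta := Num.min (complex.Re (c * (p - a))) (complex.Re (c * (q - a))) / 2.
have eta0 : 0 < eta by rewrite divr_gt0 // lt_min hp hq.
have etap : 2 * eta <= complex.Re (c * (p - a)).
  by rewrite /eta mulrC divfK // ge_min lexx.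
have etaq : 2 * eta <= complex.Re (c * (q - a)).
  by rewrite /eta mulrC divfK // ge_min lexx orbT.
pose K z := cn z <= r /\ eta <= complex.Re (c * (z - a)).
have Km : midconvex K.
  move=> x y [h1 h2] [h3 h4]; split; first exact: Dmid.
  by rewrite Re_mid; lra.
have Kc z : (forall e : R, 0 < e -> exists2 x, K x & cn (x - z) < e) -> K z.
  move=> h; split; apply/ler_addgt0Pl => e' e'0.
    have [x [h1 h2] h3] := h _ e'0.
    by have := cn_subr z x; rewrite cnB; lra.
  have c0 : 0 < cn c + 1 by rewrite ltr_wpDl ?cn_ge0.
  have [x [h1 h2] h3] := h _ (divr_gt0 e'0 c0).
  have : complex.Re (c * (x - a)) - complex.Re (c * (z - a)) <= e'.
    rewrite -ReN -ReD.
    have -> : c * (x - a) - c * (z - a) = c * (x - z) by ring.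
    apply: le_trans (ler_norm _) _; apply: le_trans (cn_Re _) _.
    rewrite cnM; move: h3; rewrite ltr_pdivlMr //.
    by have := cn_ge0 c; have := cn_ge0 (x - z); nra.
  lra.
have Kd z : K z -> differentiable F z.
  move=> [h1 h2]; apply: Fd => //; apply/eqP => za.
  by move: h2; rewrite za subrr mulr0 /=; lra.
have Rea : complex.Re (c * (a - a)) = 0 by rewrite subrr mulr0.
have ap := Dmid _ _ ar pr; have aq := Dmid _ _ ar qr; have pq := Dmid _ _ pr qr.
have Kap : K (mid a p) by split => //; rewrite Re_mid Rea; lra.
have Kaq : K (mid a q) by split => //; rewrite Re_mid Rea; lra.
have Kpq : K (mid p q) by split => //; rewrite Re_mid; lra.
have Kp : K p by split => //; lra.
have Kq : K q by split => //; lra.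
have e4 : 0 < e / 4 by lra.
have LL : L (mid a p) (mid a q) = L p q / 2.
  have half (x y : C) : cn ((x - y) / 2) = cn (x - y) / 2.
    by rewrite cnM cnV cn_nat.
  have -> : L p q / 2 = cn ((p - a) / 2) + cn ((q - p) / 2) + cn ((a - q) / 2).
    by rewrite !half /L; field.
  by rewrite /L; congr (cn _ + cn _ + cn _); rewrite /mid; field.
have -> : e + B * L p q * 2^-1 ^+ n.+1 =
    (e / 4 + B * L (mid a p) (mid a q) * 2^-1 ^+ n) + e / 4 + e / 4 + e / 4.
  by rewrite LL exprS; move: (2^-1 ^+ n) => y; field.
apply: small_tri_split; try exact: (goursat Km Kc Kd).
by apply: IH => //; rewrite Re_mid Rea; lra.
Qed.

End Goursat.

(** * Cauchy estimates *)

Section Cauchy.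
Variable R : realType.
Local Notation C := R[i].
Implicit Types (F G : C -> C) (p q w z a : C).

Definition square (r : R) F m :=
  trap F m (r -i* r) (r +i* r) + trap F m (r +i* r) (- r +i* r) +
  trap F m (- r +i* r) (- r -i* r) + trap F m (- r -i* r) (r -i* r).

Lemma squareD r F G m :
  square r (fun z => F z + G z) m = square r F m + square r G m.
Proof. by rewrite /square !trapD; ring. Qed.

Lemma squareZ r a F m : square r (fun z => a * F z) m = a * square r F m.
Proof. by rewrite /square !trapZ; ring. Qed.

Lemma cn_corner (r a b : R) : 0 < r -> `|a| = r -> `|b| = r ->
  cn (a +i* b) <= 2 * r.
Proof. by move=> r0 ha hb; have := cn_ReIm (a +i* b); rewrite /= ha hb; lra. Qed.

Lemma square_bound r F m (e : R) : 0 < r ->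
  (forall z, r <= cn z -> cn z <= 2 * r -> cn (F z) <= e) ->
  cn (square r F m) <= 8 * r * e.
Proof.
move=> r0 h; have rr : `|r| = r by rewrite gtr0_norm.
have rn : `|- r| = r by rewrite normrN.
have edge (c p q : C) : cn c = 1 -> cn p <= 2 * r -> cn q <= 2 * r ->
    cn (q - p) = 2 * r ->
    r <= complex.Re (c * p) -> r <= complex.Re (c * q) ->
    cn (trap F m p q) <= e * (2 * r).
  move=> c1 hp hq <- cp cq.
  pose K z := cn z <= 2 * r /\ r <= complex.Re (c * z).
  have Km : midconvex K.
    move=> x y [h1 h2] [h3 h4]; split.
      by have := @cn_mid_le _ x y 0 (2 * r); rewrite !subr0; exact.
    by have := Re_mid c 0 x y; rewrite !subr0 => ->; lra.
  apply: (trap_bound m Km) => // z [h1 h2]; apply: h => //.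
  apply: (le_trans h2); rewrite -[cn z]mul1r -c1 -cnM.
  by apply: le_trans (ler_norm _) (cn_Re _).
have ci : cn 'i%C = 1 :> R by rewrite /= expr0n expr1n /= add0r sqrtr1.
have len (x : C) (s : R) : `|s| = 2 * r -> x = s%:C \/ x = 'i%C * s%:C ->
    cn x = 2 * r.
  by move=> hs [->|->]; rewrite ?cnM ?ci ?mul1r cnR.
have n2 : `|2 * r| = 2 * r by rewrite gtr0_norm // mulr_gt0.
have n2' : `|- (2 * r)| = 2 * r by rewrite normrN.
have E1 : cn (trap F m (r -i* r) (r +i* r)) <= e * (2 * r).
  apply: (edge (1)).
  - exact: cn1.
  - exact: cn_corner.
  - exact: cn_corner.
  - apply: (len _ (2 * r)) => //; right.
    by apply/eqP; rewrite eq_complex /=; apply/andP; split; apply/eqP; ring.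
  - by rewrite /=; lra.
  - by rewrite /=; lra.
have E2 : cn (trap F m (r +i* r) (- r +i* r)) <= e * (2 * r).
  apply: (edge (- 'i%C)).
  - by rewrite cnN ci.
  - exact: cn_corner.
  - exact: cn_corner.
  - apply: (len _ (- (2 * r))) => //; left.
    by apply/eqP; rewrite eq_complex /=; apply/andP; split; apply/eqP; ring.
  - by rewrite /=; lra.
  - by rewrite /=; lra.
have E3 : cn (trap F m (- r +i* r) (- r -i* r)) <= e * (2 * r).
  apply: (edge (- 1)).
  - by rewrite cnN cn1.
  - exact: cn_corner.
  - exact: cn_corner.
  - apply: (len _ (- (2 * r))) => //; right.
    by apply/eqP; rewrite eq_complex /=; apply/andP; split; apply/eqP; ring.
  - by rewrite /=; lra.
  - by rewrite /=; lra.
have E4 : cn (trap F m (- r -i* r) (r -i* r)) <= e * (2 * r).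
  apply: (edge ('i%C)).
  - exact: ci.
  - exact: cn_corner.
  - exact: cn_corner.
  - apply: (len _ (2 * r)) => //; left.
    by apply/eqP; rewrite eq_complex /=; apply/andP; split; apply/eqP; ring.
  - by rewrite /=; lra.
  - by rewrite /=; lra.
move: E1 E2 E3 E4; rewrite /square.
set t1 := trap _ _ _ _; set t2 := trap _ _ _ _; set t3 := trap _ _ _ _.
set t4 := trap _ _ _ _.
by have := cnD (t1 + t2 + t3) t4; have := cnD (t1 + t2) t3;
  have := cnD t1 t2; lra.
Qed.

Lemma eq_square r F G m : 0 < r ->
  (forall z, r <= cn z -> cn z <= 2 * r -> F z = G z) ->
  square r F m = square r G m.
Proof.
move=> r0 h; apply/eqP; rewrite -subr_eq0 -cn_eq0 eq_le cn_ge0 andbT.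
have -> : square r F m - square r G m = square r (fun z => F z + -1 * G z) m.
  by rewrite squareD squareZ; ring.
rewrite -(mulr0 (8 * r)); apply: square_bound => // z h1 h2.
by rewrite h // mulN1r subrr cn0.
Qed.

(** The square is cut into four triangles with vertex a, each with the corner
    a as its only possible singularity. *)
Lemma square_small r F a (B : R) : 0 < r -> cn a <= r / 2 ->
  (forall z, cn z <= 2 * r -> z != a -> differentiable F z) ->
  (forall z, cn z <= 2 * r -> cn (F z) <= B) ->
  forall e : R, 0 < e ->
  exists m0, forall m, (m0 <= m)%N -> cn (square r F m) <= e.
Proof.
move=> r0 ar Fd FB e e0; have rr : `|r| = r by rewrite gtr0_norm.
have rn : `|- r| = r by rewrite normrN.
have e4 : 0 < e / 4 by lra.
have a2 : cn a <= 2 * r by lra.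
have := cn_Re a; have := cn_Im a; rewrite !ler_norml => /andP[a1 a3] /andP[a4 a5].
have [m1 h1] : small_tri F (e / 4) a (r -i* r) (r +i* r).
  apply: (goursat_corner (c := 1) Fd FB) => //; rewrite ?cn_corner //.
    by rewrite mul1r ReD ReN /=; lra.
  by rewrite mul1r ReD ReN /=; lra.
have [m2 h2] : small_tri F (e / 4) a (r +i* r) (- r +i* r).
  apply: (goursat_corner (c := - 'i%C) Fd FB) => //; rewrite ?cn_corner //.
    by rewrite ReM ReN ImN ImD ImN ReD ReN /=; lra.
  by rewrite ReM ReN ImN ImD ImN ReD ReN /=; lra.
have [m3 h3] : small_tri F (e / 4) a (- r +i* r) (- r -i* r).
  apply: (goursat_corner (c := - 1) Fd FB) => //; rewrite ?cn_corner //.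
    by rewrite mulN1r ReN ReD ReN /=; lra.
  by rewrite mulN1r ReN ReD ReN /=; lra.
have [m4 h4] : small_tri F (e / 4) a (- r -i* r) (r -i* r).
  apply: (goursat_corner (c := 'i%C) Fd FB) => //; rewrite ?cn_corner //.
    by rewrite ReM ImD ImN ReD ReN /=; lra.
  by rewrite ReM ImD ImN ReD ReN /=; lra.
exists (maxn (maxn m1 m2) (maxn m3 m4)) => m.
rewrite !geq_max => /andP[/andP[/h1 H1 /h2 H2] /andP[/h3 H3 /h4 H4]].
move: H1 H2 H3 H4.
have -> : square r F m =
    tri F m a (r -i* r) (r +i* r) + tri F m a (r +i* r) (- r +i* r) +
    tri F m a (- r +i* r) (- r -i* r) + tri F m a (- r -i* r) (r -i* r).
  rewrite /square /tri (trap_rev F m a (r -i* r)) (trap_rev F m a (r +i* r)).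
  rewrite (trap_rev F m a (- r +i* r)) (trap_rev F m a (- r -i* r)).
  by ring.
set t1 := tri _ _ _ _ _; set t2 := tri _ _ _ _ _; set t3 := tri _ _ _ _ _.
set t4 := tri _ _ _ _ _.
by have := cnD (t1 + t2 + t3) t4; have := cnD (t1 + t2) t3;
  have := cnD t1 t2; lra.
Qed.

Lemma trap_inv_scale m (c p q : C) : c != 0 ->
  trap GRing.inv m (c * p) (c * q) = trap GRing.inv m p q.
Proof.
move=> c0; elim: m p q => [|m IH] p q /=; last first.
  have -> : mid (c * p) (c * q) = c * mid p q by rewrite /mid; field.
  by rewrite !IH.
rewrite !invfM -!mulrDr -mulrBr.
have -> : c^-1 * (p^-1 + q^-1) / 2 * (c * (q - p)) =
          (c^-1 * c) * ((p^-1 + q^-1) / 2 * (q - p)) by ring.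
by rewrite mulVf // mul1r.
Qed.

Lemma Re_inv z : complex.Re z^-1 =
  complex.Re z / (complex.Re z ^+ 2 + complex.Im z ^+ 2).
Proof. by case: z. Qed.

Lemma Im_trap_inv r m (s t : R) : 0 < r -> s <= t -> `|s| <= r -> `|t| <= r ->
  (t - s) / (2 * r) <= complex.Im (trap GRing.inv m (r +i* s) (r +i* t)).
Proof.
move=> r0; elim: m s t => [|m IH] s t st hs ht; last first.
  rewrite trapS.
  have -> : mid (r +i* s) (r +i* t) = r +i* ((s + t) / 2).
    rewrite /mid; apply: (mulIf (x := 2)); first by rewrite pnatr_eq0.
    rewrite divfK ?pnatr_eq0 // mulr_natr; apply/eqP.
    by rewrite eq_complex /=; apply/andP; split; apply/eqP; field.
  move: hs ht; rewrite !ler_norml => /andP[s1 s2] /andP[t1 t2].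
  have hm : `|(s + t) / 2| <= r by rewrite ler_norml; apply/andP; split; lra.
  rewrite ImD.
  have := IH s ((s + t) / 2) ltac:(lra) _ hm.
  have := IH ((s + t) / 2) t ltac:(lra) hm.
  rewrite !ler_norml s1 s2 t1 t2 => /(_ isT) h1 /(_ isT) h2.
  apply: le_trans (lerD h2 h1); rewrite -mulrDl ler_wpM2r ?invr_ge0 //; lra.
rewrite trap0; have -> : (r +i* t) - (r +i* s) = 'i%C * (t - s)%:C.
  by apply/eqP; rewrite eq_complex /=; apply/andP; split; apply/eqP; ring.
have -> (x : C) : x / 2 * ('i%C * (t - s)%:C) = 'i%C * (x * ((t - s) / 2)%:C).
  by rewrite rmorphM /= fmorphV rmorph_nat; ring.
have key (y : R) : `|y| <= r -> (2 * r)^-1 <= complex.Re (r +i* y)^-1.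
  move=> hy; rewrite Re_inv /=.
  have y2 : y ^+ 2 <= r ^+ 2.
    by move: hy; rewrite ler_norml => /andP[h1 h2]; rewrite !expr2; nra.
  have p0 : 0 < r ^+ 2 + y ^+ 2 by rewrite ltr_wpDr ?sqr_ge0 // exprn_gt0.
  rewrite ler_pdivlMr // mulrC ler_pdivrMr ?mulr_gt0 //.
  by move: y2; rewrite !expr2; nra.
have ReMR (x : C) (c : R) : complex.Re (x * c%:C) = complex.Re x * c.
  by rewrite ReM /= mulr0 subr0.
rewrite (mulrC 'i%C) ImiRe ReMR ReD.
have := key s hs; have := key t ht.
set u := complex.Re _; set v := complex.Re _; set w := (2 * r)^-1 => h1 h2.
by nra.
Qed.

(** A lower bound for the winding number: by rotational symmetry the four
    sides contribute equally, and Re (1/z) is at least 1/(2r) on the right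
    side. *)
Lemma square_inv r m : 0 < r -> 4 <= cn (square r GRing.inv m).
Proof.
move=> r0; pose t := trap GRing.inv m (r -i* r) (r +i* r).
have i0 : ('i%C : C) != 0 by rewrite eq_complex /= oner_eq0 andbF.
have rot (x y x' y' : C) : x' = 'i%C * x -> y' = 'i%C * y ->
    trap GRing.inv m x' y' = trap GRing.inv m x y.
  by move=> -> ->; exact: trap_inv_scale.
have e2 : trap GRing.inv m (r +i* r) (- r +i* r) = t.
  by apply: rot; apply/eqP; rewrite eq_complex /=; apply/andP; split;
    apply/eqP; ring.
have e3 : trap GRing.inv m (- r +i* r) (- r -i* r) = t.
  by rewrite -e2; apply: rot; apply/eqP; rewrite eq_complex /=; apply/andP;
    split; apply/eqP; ring.
have e4 : trap GRing.inv m (- r -i* r) (r -i* r) = t.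
  by rewrite -e3; apply: rot; apply/eqP; rewrite eq_complex /=; apply/andP;
    split; apply/eqP; ring.
have -> : square r GRing.inv m = 4 * t by rewrite /square e2 e3 e4 -/t; ring.
rewrite cnM cn_nat.
have h : 1 <= complex.Im t.
  have := @Im_trap_inv r m (- r) r r0.
  rewrite normrN gtr0_norm // => /(_ ltac:(lra) (lexx _) (lexx _)).
  have -> : (r - - r) / (2 * r) = 1 by field; rewrite gt_eqF.
  by [].
have := cn_Im t; have := ler_norm (complex.Im t); lra.
Qed.

Section Estimate.
Variables (g : C -> C) (r B : R).
Hypothesis r0 : 0 < r.
Hypothesis gd : forall z, cn z <= 2 * r -> differentiable g z.
Hypothesis gB : forall z, cn z <= 2 * r -> cn (g z) <= B.

(** By square_small the boundary sum of Q a tends to 0: those of g(z)/(z -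
    a) and of g(a)/(z - a) agree in the limit. Cauchy's formula is used in
    this form. *)
Let Q a z := (g z - g a) / (z - a).

Lemma quotient_small a : cn a <= r / 2 -> forall e : R, 0 < e ->
  exists m0, forall m, (m0 <= m)%N -> cn (square r (Q a) m) <= e.
Proof.
have rp : 0 < r by []. move=> ar; have a2 : cn a <= 2 * r by lra.
have B0 : 0 <= B by apply: le_trans (cn_ge0 _) (gB a2).
have [d d0 hd] := dif_eps (gd a2) ltr01.
have [b b0 hb] := dif_bounded (gd a2).
have Qd z : cn z <= 2 * r -> z != a -> differentiable (Q a) z.
  move=> hz za; apply: differentiableM.
    by apply: differentiableB => //; exact: gd.
  by apply: differentiableV; [exact: differentiableB | rewrite subr_eq0].
apply: (@square_small r (Q a) a (b + 1 + 2 * B / d)) => // z hz.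
have BB : 0 <= 2 * B / d by rewrite divr_ge0 ?mulr_ge0 // ltW.
have [->|za] := eqVneq z a; first by rewrite /Q subrr mul0r cn0; lra.
have za0 : 0 < cn (z - a) by rewrite cn_gt0 subr_eq0.
rewrite /Q cnM cnV ler_pdivrMr //.
have [zd|zd] := ltP (cn (z - a)) d.
  have := hd (z - a) zd; have := hb (z - a).
  rewrite (addrC a) subrK /vn /= -/(cn (z - a)) mul1r => h1 h2.
  have -> : g z - g a = g z - g a - dv g a (z - a) + dv g a (z - a) by ring.
  apply: le_trans (cnD _ _) _.
  have := mulr_ge0 BB (ltW za0); rewrite !mulrDl mul1r; lra.
apply: (@le_trans _ _ (2 * B)).
  by have := cnDB (g z) (g a); have := gB hz; have := gB a2; lra.
apply: (@le_trans _ _ (2 * B / d * cn (z - a))).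
  by rewrite mulrAC ler_pdivlMr // ler_wpM2l // mulr_ge0.
by rewrite ler_wpM2r ?cn_ge0 //; lra.
Qed.

Lemma Q_bound a z : cn a <= r / 2 -> r <= cn z -> cn z <= 2 * r ->
  cn (Q a z) <= 4 * B / r.
Proof.
have rp : 0 < r by []. move=> ar rz zr; have a2 : cn a <= 2 * r by lra.
have za : r / 2 <= cn (z - a) by have := cn_subr z a; lra.
have za0 : 0 < cn (z - a) by lra.
rewrite /Q cnM cnV ler_pdivrMr // mulrAC ler_pdivlMr //.
have B0 : 0 <= B by apply: le_trans (cn_ge0 _) (gB a2).
have := cnDB (g z) (g a); have := gB zr; have := gB a2.
have := cn_ge0 (g z - g a); nra.
Qed.

(** On the square, (g(a) - g(0))/z = Q 0 z - Q a z + a Q a z / z, and the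
    boundary sums of Q 0 and Q a tend to 0. *)
Lemma cauchy_first a : cn a <= r / 2 -> cn (g a - g 0) <= 8 * B / r * cn a.
Proof.
have rp : 0 < r by []. move=> ar; apply/ler_addgt0Pl => e e0; have e1 : 0 < e * 2 by lra.
have [m1 h1] := quotient_small ar e1.
have [|m2 h2] := @quotient_small 0 _ _ e1; first by rewrite cn0; lra.
pose m := maxn m1 m2.
have := h1 m (leq_maxl _ _); have := h2 m (leq_maxr _ _) => H2 H1.
pose T := square r (fun z => z^-1 * Q a z) m.
have key : (g a - g 0) * square r GRing.inv m =
    square r (Q 0) m - square r (Q a) m + a * T.
  have -> : square r (Q 0) m - square r (Q a) m + a * T =
      square r (fun z => Q 0 z + (-1 * Q a z + a * (z^-1 * Q a z))) m.
    by rewrite !(squareD, squareZ) /T; ring.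
  rewrite -squareZ; apply: eq_square => // z rz zr.
  have z0 : z != 0 by rewrite -cn_gt0; lra.
  have za : z - a != 0 by rewrite -cn_gt0; have := cn_subr z a; lra.
  by rewrite /Q; field; rewrite z0 za.
have hT : cn T <= 8 * r * (r^-1 * (4 * B / r)).
  apply: square_bound => // z rz zr; rewrite cnM cnV.
  apply: ler_pM; rewrite ?invr_ge0 ?cn_ge0 ?Q_bound //.
  by rewrite lef_pV2 ?posrE //; lra.
have {}hT : cn T <= 32 * B / r.
  by apply: le_trans hT _; rewrite le_eqVlt; apply/orP; left; apply/eqP;
    field; rewrite gt_eqF.
have J4 := square_inv m r0.
have : cn (g a - g 0) * 4 <= cn ((g a - g 0) * square r GRing.inv m).
  by rewrite cnM ler_wpM2l // cn_ge0.
rewrite key => h.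
have := cnD (square r (Q 0) m - square r (Q a) m) (a * T).
have := cnDB (square r (Q 0) m) (square r (Q a) m).
rewrite cnM; have := ler_wpM2l (cn_ge0 a) hT.
have -> : cn a * (32 * B / r) = 4 * (8 * B / r * cn a) by ring.
lra.
Qed.

(** A second order estimate that does not mention the derivative of g at 0;
    that appears when b tends to 0. *)
Lemma cauchy_cross a b : cn a <= r / 2 -> cn b <= r / 2 ->
  cn (b * (g a - g 0) - a * (g b - g 0)) <=
  24 * B / r ^+ 2 * (cn a * cn b * (cn a + cn b)).
Proof.
have rp : 0 < r by []. move=> ar br; apply/ler_addgt0Pl => e e0.
have B0 : 0 <= B.
  by apply: le_trans (cn_ge0 _) (gB (z := a) _); lra.
have r20 : 0 < r ^+ 2 by rewrite exprn_gt0.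
have ex c (e' : R) : cn c <= r / 2 -> 0 < e' -> exists m0, forall m, (m0 <= m)%N ->
   cn ((g c - g 0) * square r GRing.inv m -
       c * square r (fun z => z^-1 * Q 0 z) m) <=
   e' + 96 * B / r ^+ 2 * cn c ^+ 2.
  move=> cr e'0; have e1 : 0 < e' / 2 by lra.
  have [m1 h1] := quotient_small cr e1.
  have [|m2 h2] := @quotient_small 0 _ _ e1; first by rewrite cn0; lra.
  exists (maxn m1 m2) => m; rewrite geq_max => /andP[/h1 H1 /h2 H2].
  pose T := square r (fun z => z^-1 ^+ 2 * Q c z) m.
  pose U := square r (fun z => z^-1 ^+ 2) m.
  have -> : (g c - g 0) * square r GRing.inv m -
       c * square r (fun z => z^-1 * Q 0 z) m =
     square r (Q 0) m - square r (Q c) m + c ^+ 2 * T - c * (g c - g 0) * U.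
    have -> : square r (Q 0) m - square r (Q c) m + c ^+ 2 * T -
          c * (g c - g 0) * U =
       square r (fun z => Q 0 z + (-1 * Q c z + (c ^+ 2 * (z^-1 ^+ 2 * Q c z) +
          - (c * (g c - g 0)) * z^-1 ^+ 2))) m.
      by rewrite !(squareD, squareZ) /T /U; ring.
    have -> : (g c - g 0) * square r GRing.inv m -
         c * square r (fun z => z^-1 * Q 0 z) m =
       square r (fun z => (g c - g 0) * z^-1 + - c * (z^-1 * Q 0 z)) m.
      by rewrite !(squareD, squareZ); ring.
    apply: eq_square => // z rz zr.
    have z0 : z != 0 by rewrite -cn_gt0; lra.
    have za : z - c != 0 by rewrite -cn_gt0; have := cn_subr z c; lra.
    by rewrite /Q; field; rewrite z0 za.
  have zinv z : r <= cn z -> cn z^-1 <= r^-1.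
    by move=> rz; rewrite cnV lef_pV2 ?posrE //; lra.
  have hT : cn T <= 8 * r * (r^-1 ^+ 2 * (4 * B / r)).
    apply: square_bound => // z rz zr; rewrite cnM cnX.
    apply: ler_pM; rewrite ?exprn_ge0 ?cn_ge0 ?Q_bound //.
    by rewrite lerXn2r ?nnegrE ?cn_ge0 ?invr_ge0 ?(ltW r0) ?zinv.
  have {}hT : cn T <= 32 * B / r ^+ 2.
    by apply: le_trans hT _; rewrite le_eqVlt; apply/orP; left; apply/eqP;
      field; rewrite gt_eqF.
  have hU : cn U <= 8 * r * (r^-1 ^+ 2).
    apply: square_bound => // z rz zr; rewrite cnX.
    by rewrite lerXn2r ?nnegrE ?cn_ge0 ?invr_ge0 ?(ltW r0) ?zinv.
  have {}hU : cn U <= 8 / r.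
    by apply: le_trans hU _; rewrite le_eqVlt; apply/orP; left; apply/eqP;
      field; rewrite gt_eqF.
  have hc := cauchy_first cr.
  have c2 : cn (c ^+ 2 * T) <= cn c ^+ 2 * (32 * B / r ^+ 2).
    by rewrite cnM cnX ler_wpM2l // exprn_ge0 ?cn_ge0.
  have cU : cn (c * (g c - g 0) * U) <= cn c * (8 * B / r * cn c) * (8 / r).
    rewrite !cnM; apply: ler_pM; rewrite ?mulr_ge0 ?cn_ge0 //.
    by rewrite ler_wpM2l ?cn_ge0.
  have e2 : cn c * (8 * B / r * cn c) * (8 / r) =
            cn c ^+ 2 * (64 * B / r ^+ 2).
    by field; rewrite gt_eqF.
  have := cnDB (square r (Q 0) m - square r (Q c) m + c ^+ 2 * T)
     (c * (g c - g 0) * U).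
  have := cnD (square r (Q 0) m - square r (Q c) m) (c ^+ 2 * T).
  have := cnDB (square r (Q 0) m) (square r (Q c) m).
  have -> : 96 * B / r ^+ 2 * cn c ^+ 2 =
    cn c ^+ 2 * (64 * B / r ^+ 2) + cn c ^+ 2 * (32 * B / r ^+ 2) by ring.
  move: cU; rewrite e2; lra.
have s0 : 0 < cn a + cn b + 1 by have := cn_ge0 a; have := cn_ge0 b; lra.
have e1 : 0 < 4 * e / (cn a + cn b + 1) by rewrite divr_gt0 ?mulr_gt0.
have [m1 h1] := ex a _ ar e1; have [m2 h2] := ex b _ br e1.
pose m := maxn m1 m2.
have := h1 m (leq_maxl _ _); have := h2 m (leq_maxr _ _).
set da := g a - g 0; set db := g b - g 0; set J := square _ GRing.inv _.
set D := square _ _ _; set K := 96 * B / r ^+ 2; set e' := 4 * e / _ => H2 H1.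
have K0 : 0 <= K by rewrite /K divr_ge0 ?mulr_ge0 // ltW.
have J4 : 4 <= cn J by exact: square_inv.
have h : cn ((b * da - a * db) * J) <=
   cn b * (e' + K * cn a ^+ 2) + cn a * (e' + K * cn b ^+ 2).
  have -> : (b * da - a * db) * J = b * (da * J - a * D) - a * (db * J - b * D).
    by ring.
  apply: le_trans (cnDB _ _) _; rewrite !cnM.
  by apply: lerD; rewrite ler_wpM2l ?cn_ge0.
have : 4 * cn (b * da - a * db) <= cn ((b * da - a * db) * J).
  by rewrite cnM mulrC ler_wpM2l ?cn_ge0.
have ee : e' * (cn a + cn b + 1) = 4 * e by rewrite /e' divfK // gt_eqF.
have e'0 : 0 < e' by [].
have -> : 24 * B / r ^+ 2 = K / 4 by rewrite /K; field; rewrite gt_eqF.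
move: h ee; rewrite !expr2; lra.
Qed.

(** The limit of cauchy_cross divided by b, as b tends to 0. *)
Lemma cauchy_second a : cn a <= r / 2 ->
  cn (g a - g 0 - dv g 0 a) <= 24 * B / r ^+ 2 * cn a ^+ 2.
Proof.
have rp : 0 < r by []. move=> ar; have [->|a0] := eqVneq a 0.
  by rewrite subrr dv0 subr0 cn0 expr0n mulr0.
have ca0 : 0 < cn a by rewrite cn_gt0.
have B0 : 0 <= B.
  by apply: le_trans (cn_ge0 _) (gB (z := a) _); lra.
have r20 : 0 < r ^+ 2 by rewrite exprn_gt0.
pose K := 24 * B / r ^+ 2.
have K0 : 0 <= K by rewrite /K divr_ge0 ?mulr_ge0 // ltW.
apply/ler_addgt0Pl => e e0; rewrite -/K.
have d0 : differentiable g 0 by apply: gd; rewrite cn0; lra.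
have e1 : 0 < e / (2 * cn a) by rewrite divr_gt0 ?mulr_gt0.
have [d dp hd] := dif_eps d0 e1.
have e2 : 0 < e / (2 * (K * cn a + 1)).
  by rewrite divr_gt0 ?mulr_gt0 // ltr_wpDl // mulr_ge0 // ltW.
pose s := Num.min (Num.min (d / 2) (r / 2)) (e / (2 * (K * cn a + 1))).
have s0 : 0 < s by rewrite !lt_min e2 andbT; apply/andP; split; lra.
have sd : s < d.
  by apply: (@le_lt_trans _ _ (d / 2)); rewrite ?ge_min ?lexx //; lra.
have sr : s <= r / 2 by rewrite !ge_min lexx orbT.
have se : s * (2 * (K * cn a + 1)) <= e.
  rewrite -ler_pdivlMr; last first.
    by rewrite mulr_gt0 // ltr_wpDl // mulr_ge0 // ltW.
  by rewrite !ge_min lexx orbT.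
pose b : C := s%:C.
have cb : cn b = s by rewrite cnR gtr0_norm.
have := hd b; rewrite add0r [vn b]cb => /(_ sd) h1.
have := cauchy_cross ar (b := b); rewrite cb -/K => /(_ sr) h2.
have h3 : s * cn (g a - g 0 - dv g 0 a) <=
   K * (cn a * s * (cn a + s)) + cn a * (e / (2 * cn a) * s).
  rewrite -{1}cb -cnM.
  have -> : b * (g a - g 0 - dv g 0 a) = b * (g a - g 0) - a * (g b - g 0)
     + a * (g b - g 0 - dv g 0 b).
    by rewrite (dif_mul1 _ _ a) (dif_mul1 _ _ b); ring.
  apply: le_trans (cnD _ _) _; apply: lerD => //.
  by rewrite cnM ler_wpM2l // ltW.
rewrite -(ler_pM2l s0); apply: le_trans h3 _.
have -> : cn a * (e / (2 * cn a) * s) = s * (e / 2) by field; rewrite gt_eqF.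
have -> : K * (cn a * s * (cn a + s)) = s * (K * cn a ^+ 2 + K * cn a * s).
  by ring.
rewrite -mulrDr ler_pM2l //.
have : K * cn a * s <= e / 2.
  by have := mulr_ge0 K0 (ltW ca0); move: se; nra.
lra.
Qed.

Lemma cauchy_deriv a : cn (dv g 0 a) <= 8 * B / r * cn a.
Proof.
have rp : 0 < r by []. have [->|a0] := eqVneq a 0; first by rewrite dv0 cn0 mulr0.
have ca0 : 0 < cn a by rewrite cn_gt0.
have d0 : differentiable g 0 by apply: gd; rewrite cn0; lra.
apply/ler_addgt0Pl => e e0.
have e1 : 0 < e / cn a by rewrite divr_gt0.
have [d dp hd] := dif_eps d0 e1.
pose s := Num.min (d / 2) (r / 2).
have s0 : 0 < s by rewrite lt_min !divr_gt0.
have sd : s < d by apply: (@le_lt_trans _ _ (d / 2)); rewrite ?ge_min ?lexx //; lra.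
have sr : s <= r / 2 by rewrite !ge_min lexx orbT.
pose b : C := s%:C.
have cb : cn b = s by rewrite cnR gtr0_norm.
have := hd b; rewrite add0r [vn b]cb => /(_ sd) h1.
have := cauchy_first (a := b); rewrite cb => /(_ sr) h2.
have h3 : s * cn (dv g 0 1) <= s * (8 * B / r + e / cn a).
  rewrite -{1}cb -cnM -dif_mul1.
  have -> : dv g 0 b = (g b - g 0) - (g b - g 0 - dv g 0 b) by ring.
  by apply: le_trans (cnDB _ _) _; lra.
move: h3; rewrite ler_pM2l // => h3; rewrite dif_mul1 cnM.
have : cn a * cn (dv g 0 1) <= cn a * (8 * B / r + e / cn a).
  by rewrite ler_pM2l.
by rewrite mulrDr (mulrC (cn a) (e / _)) divfK ?gt_eqF //; lra.
Qed.

End Estimate.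

End Cauchy.

(** * Uniform limits and Liouville's theorem *)

Section Limits.
Variable R : realType.
Local Notation C := R[i].

Lemma cauchy_limit (x : nat -> C) :
  (forall e : R, 0 < e -> exists N, forall n m, (N <= n)%N -> (N <= m)%N ->
     cn (x n - x m) <= e) ->
  exists l, forall e : R, 0 < e -> exists N, forall n, (N <= n)%N ->
     cn (x n - l) <= e.
Proof.
move=> h.
have h' k : exists N, forall n m, (N <= n)%N -> (N <= m)%N ->
     cn (x n - x m) <= 2^-1 ^+ k by apply: h; rewrite exprn_gt0.
pose N k := sval (cid (h' k)).
have hN k := svalP (cid (h' k)).
have [l hl] : exists l, forall k, cn (l - x (N k)) <= 4 * 2 * 2^-1 ^+ k.
  apply: geo_limitC => k; pose m := maxn (N k) (N k.+1).
  have := cn_dist (x (N k.+1)) (x m) (x (N k)).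
  have := hN k m (N k) (leq_maxl _ _) (leqnn _).
  have := hN k.+1 (N k.+1) m (leqnn _) (leq_maxr _ _).
  have := exprn_gt0 k (ltac:(lra) : (0 : R) < 2^-1); rewrite exprS; lra.
exists l => e e0; have [k hk] := half_mul_small 9 e0.
exists (N k) => n hn; have := cn_dist (x n) (x (N k)) l.
by have := hN k n (N k) hn (leqnn _); have := hl k; rewrite (cnB l); lra.
Qed.

End Limits.

Section VectorCauchy.
Variables (R : realType) (V : normedModType R[i]).
Local Notation C := R[i].
Implicit Types (f : V -> C) (q v x : V).

Lemma dif_line q v z : differentiable (fun z : C => q + z *: v) z.
Proof.
by apply: differentiableD => //; apply: differentiableZl.
Qed.

Lemma dif_slice f q v z : differentiable f (q + z *: v) ->
  differentiable (fun z : C => f (q + z *: v)) z.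
Proof. by move=> df; apply: (differentiable_comp (dif_line q v z)). Qed.

Lemma diff_slice f q v : differentiable f q ->
  forall w, dv (fun z : C => f (q + z *: v)) 0 w = w * dv f q v.
Proof.
move=> df.
have Llin : linear_for *%R (fun w : C => w * dv f q v).
  by move=> a x y; rewrite mulrDl -mulrA.
have [] := @dif_intro R C (fun z => f (q + z *: v))
  (fun w => w * dv f q v) 0 (cn (dv f q v)) Llin.
- by move=> w; rewrite cnM mulrC.
- move=> e e0; have vp : 0 < vn v + 1 by rewrite ltr_wpDl ?vn_ge0.
  have [d d0 hd] := dif_eps df (divr_gt0 e0 vp).
  exists (d / (vn v + 1)); first by rewrite divr_gt0.
  move=> w; rewrite ltr_pdivlMr // add0r scale0r addr0 => hw.
  have vw := vn_ge0 v; have wp := vn_ge0 w.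
  move: hw wp; rewrite -[vn w]/(cn w) => hw wp.
  have := hd (w *: v); rewrite dvZ vnZ => /(_ ltac:(nra)).
  move=> h; apply: (le_trans h); rewrite mulrAC ler_pdivrMr //.
  rewrite -mulrA ler_wpM2l ?(ltW e0) // ler_wpM2l //; lra.
by move=> _ h w; exact: h.
Qed.

Lemma difB f g q : differentiable f q -> differentiable g q ->
  differentiable (fun x => f x - g x) q /\
  forall v, dv (fun x => f x - g x) q v = dv f q v - dv g q v.
Proof.
move=> df dg.
have [bf bf0 hf] := dif_bounded df; have [bg bg0 hg] := dif_bounded dg.
apply: (@dif_intro _ _ _ _ _ (bf + bg)).
- by move=> a u v; rewrite !dv_linear; ring.
- by move=> v; have := cnDB (dv f q v) (dv g q v); have := hf v; have := hg v; lra.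
- move=> e e0; have e2 : 0 < e / 2 by lra.
  have [d1 d10 h1] := dif_eps df e2; have [d2 d20 h2] := dif_eps dg e2.
  exists (Num.min d1 d2); first by rewrite lt_min d10.
  move=> v; rewrite lt_min => /andP[/h1 H1 /h2 H2].
  have -> : f (q + v) - g (q + v) - (f q - g q) - (dv f q v - dv g q v) =
    (f (q + v) - f q - dv f q v) - (g (q + v) - g q - dv g q v) by ring.
  by apply: le_trans (cnDB _ _) _; lra.
Qed.

Section Bounds.
Variables (f : V -> C) (q : V) (rho B : R).
Hypothesis rho0 : 0 < rho.
Hypothesis fd : forall x, vn (x - q) < rho -> differentiable f x.
Hypothesis fB : forall x, vn (x - q) < rho -> cn (f x) <= B.

(** The estimates on a complex line q + z v: its intersection with the ball
    has radius rho / |v|. *)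
Let slice v (v0 : v != 0) : let r := rho / (4 * vn v) in [/\ 0 < r,
  forall z : C, cn z <= 2 * r -> differentiable (fun z : C => f (q + z *: v)) z &
  forall z : C, cn z <= 2 * r -> cn (f (q + z *: v)) <= B].
Proof.
have rp : 0 < rho by [].
have vp : 0 < vn v by rewrite lt_def vn_eq0 v0 vn_ge0.
have r0 : 0 < rho / (4 * vn v) by rewrite divr_gt0 ?mulr_gt0.
have key (z : C) : cn z <= 2 * (rho / (4 * vn v)) ->
    vn (q + z *: v - q) < rho.
  rewrite addrC addKr vnZ => hz; apply: (@le_lt_trans _ _ (rho / 2)); last lra.
  rewrite -ler_pdivlMr //; apply: (le_trans hz).
  by rewrite le_eqVlt; apply/orP; left; apply/eqP; field; rewrite gt_eqF.
split=> // z /key h; last exact: fB.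
by apply: dif_slice; exact: fd.
Qed.

Lemma vcauchy_deriv v : cn (dv f q v) <= 32 * B / rho * vn v.
Proof.
have [->|v0] := eqVneq v 0; first by rewrite dv0 cn0 vn0 mulr0.
have [r0 gd gB] := slice v0; have := cauchy_deriv r0 gd gB 1.
have vp : 0 < vn v by rewrite lt_def vn_eq0 v0 vn_ge0.
rewrite diff_slice; last by apply: fd; rewrite subrr vn0.
rewrite mul1r cn1 mulr1; congr (_ <= _).
by field; rewrite !gt_eqF.
Qed.

Lemma vcauchy_first v : vn v <= rho / 8 ->
  cn (f (q + v) - f q) <= 32 * B / rho * vn v.
Proof.
have [->|v0] := eqVneq v 0; first by rewrite addr0 subrr cn0 vn0 mulr0.
have [r0 gd gB] := slice v0.
have vp : 0 < vn v by rewrite lt_def vn_eq0 v0 vn_ge0.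
move=> hv; have := cauchy_first r0 gd gB (a := 1).
rewrite scale1r scale0r addr0 cn1 mulr1 => h.
apply: le_trans (h _) _.
  rewrite -ler_pdivrMr ?invr_gt0 // div1r invrK ler_pdivlMr ?mulr_gt0 //; lra.
by rewrite le_eqVlt; apply/orP; left; apply/eqP; field; rewrite !gt_eqF.
Qed.

End Bounds.

(** Weierstrass's theorem: by the Cauchy estimates the differentials form a
    Cauchy sequence. *)
Theorem uniform_limit (f_ : nat -> V -> C) f q (rho : R) : 0 < rho ->
  (forall n x, vn (x - q) < rho -> differentiable (f_ n) x) ->
  (forall e : R, 0 < e -> exists N, forall n, (N <= n)%N ->
     forall x, vn (x - q) < rho -> cn (f_ n x - f x) <= e) ->
  differentiable f q /\
  forall v (e : R), 0 < e -> exists N, forall n, (N <= n)%N ->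
    cn (dv (f_ n) q v - dv f q v) <= e.
Proof.
move=> rp fd fu.
have qq : vn (q - q) < rho by rewrite subrr vn0.
have close e : 0 < e -> exists N, forall n m, (N <= n)%N -> (N <= m)%N ->
    (forall v, cn (dv (f_ n) q v - dv (f_ m) q v) <= e * vn v) /\
    (forall v, vn v <= rho / 8 ->
      cn (f_ n (q + v) - f_ n q - (f_ m (q + v) - f_ m q)) <= e * vn v).
  move=> e0; have e1 : 0 < e * rho / 64 by rewrite divr_gt0 ?mulr_gt0.
  have [N hN] := fu _ e1; exists N => n m hn hm.
  have gd x : vn (x - q) < rho -> differentiable (fun x => f_ n x - f_ m x) x.
    by move=> hx; exact: (difB (fd n x hx) (fd m x hx)).1.
  have gB x : vn (x - q) < rho -> cn (f_ n x - f_ m x) <= e * rho / 32.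
    move=> hx.
    have := cn_dist (f_ n x) (f x) (f_ m x).
    by have := hN n hn x hx; have := hN m hm x hx; rewrite (cnB (f x)); lra.
  have ee : 32 * (e * rho / 32) / rho = e by field; rewrite gt_eqF.
  split=> v.
    have := vcauchy_deriv rp gd gB v; rewrite ee.
    by rewrite (difB (fd n q qq) (fd m q qq)).2.
  move=> hv; have := vcauchy_first rp gd gB hv; rewrite ee.
  by congr (cn _ <= _); ring.
have Lex v : exists l, forall e : R, 0 < e -> exists N, forall n, (N <= n)%N ->
     cn (dv (f_ n) q v - l) <= e.
  apply: cauchy_limit => e e0.
  have vp : 0 < vn v + 1 by rewrite ltr_wpDl ?vn_ge0.
  have [N hN] := close _ (divr_gt0 e0 vp); exists N => n m hn hm.
  apply: le_trans ((hN n m hn hm).1 v) _.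
  rewrite mulrAC ler_pdivrMr // ler_wpM2l ?(ltW e0) //; lra.
pose L v := sval (cid (Lex v)).
have hL v : forall e : R, 0 < e -> exists N, forall n, (N <= n)%N ->
     cn (dv (f_ n) q v - L v) <= e by exact: svalP (cid (Lex v)).
have Lclose e : 0 < e -> exists N, forall n, (N <= n)%N ->
    forall v, cn (dv (f_ n) q v - L v) <= e * vn v.
  move=> e0; have [N hN] := close e e0; exists N => n hn v.
  apply/ler_addgt0Pl => e' e'0; have [M hM] := hL v e' e'0.
  pose m := maxn N M; have := (hN n m hn (leq_maxl _ _)).1 v.
  have := hM m (leq_maxr _ _); have := cn_dist (dv (f_ n) q v) (dv (f_ m) q v) (L v).
  lra.
have Llin : linear_for *%R L.
  move=> a u v; apply/eqP; rewrite -subr_eq0; apply/eqP/cn_eps0 => e e0.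
  have ap : 0 < cn a + 2 by rewrite ltr_wpDl ?cn_ge0.
  have e1 := divr_gt0 e0 ap.
  have [N1 h1] := hL (a *: u + v) _ e1; have [N2 h2] := hL u _ e1.
  have [N3 h3] := hL v _ e1; pose n := maxn N1 (maxn N2 N3).
  have := h1 n (leq_maxl _ _).
  have := h2 n (leq_trans (leq_maxl _ _) (leq_maxr _ _)).
  have := h3 n (leq_trans (leq_maxr _ _) (leq_maxr _ _)).
  rewrite dv_linear.
  set x := dv _ _ u; set y := dv _ _ v => H3 H2 H1.
  have -> : L (a *: u + v) - (a * L u + L v) =
     (a * (x - L u) + (y - L v)) - (a * x + y - L (a *: u + v)) by ring.
  have := cnDB (a * (x - L u) + (y - L v)) (a * x + y - L (a *: u + v)).
  have := cnD (a * (x - L u)) (y - L v); rewrite cnM.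
  have := ler_wpM2l (cn_ge0 a) H2.
  have : e / (cn a + 2) * (cn a + 2) = e by rewrite divfK // gt_eqF.
  lra.
have [N0 hN0] := Lclose 1 ltr01.
have [b b0 hb] := dif_bounded (fd N0 q qq).
have Lb v : cn (L v) <= (b + 1) * vn v.
  have := hN0 N0 (leqnn _) v; have := hb v.
  have := cn_subr (L v) (dv (f_ N0) q v); rewrite (cnB (L v)); lra.
have [df dE] : differentiable f q /\ (forall v, dv f q v = L v).
  apply: (dif_intro Llin Lb) => e e0.
  have e4 : 0 < e / 4 by lra.
  have [N1 h1] := Lclose _ e4; have [N2 h2] := close _ e4.
  pose n := maxn N1 N2.
  have [d d0 hd] := dif_eps (fd n q qq) e4.
  exists (Num.min d (rho / 8)); first by rewrite lt_min d0 divr_gt0.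
  move=> v; rewrite lt_min => /andP[vd vr].
  have hf : cn (f (q + v) - f q - (f_ n (q + v) - f_ n q)) <= e / 4 * vn v.
    apply/ler_addgt0Pl => e' e'0; have e'2 : 0 < e' / 2 by lra.
    have [N3 h3] := fu _ e'2; pose m := maxn N2 N3.
    have hv : vn (q + v - q) < rho by rewrite addrC addKr; lra.
    have := (h2 m n (leq_maxl _ _) (leq_maxr _ _)).2 v (ltW vr).
    have := h3 m (leq_maxr _ _) _ hv; have := h3 m (leq_maxr _ _) _ qq.
    set X := f_ n _ - f_ n q => H1 H2 H3.
    have -> : f (q + v) - f q - X = (f_ m (q + v) - f_ m q - X) -
        (f_ m (q + v) - f (q + v)) + (f_ m q - f q) by ring.
    have := cnD ((f_ m (q + v) - f_ m q - X) -
        (f_ m (q + v) - f (q + v))) (f_ m q - f q).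
    have := cnDB (f_ m (q + v) - f_ m q - X) (f_ m (q + v) - f (q + v)).
    lra.
  have := hd v vd; have := h1 n (leq_maxl _ _) v.
  set X := dv (f_ n) q v => H1 H2.
  have -> : f (q + v) - f q - L v = (f (q + v) - f q - (f_ n (q + v) - f_ n q))
     + (f_ n (q + v) - f_ n q - X) + (X - L v) by ring.
  have := cnD ((f (q + v) - f q - (f_ n (q + v) - f_ n q))
     + (f_ n (q + v) - f_ n q - X)) (X - L v).
  have := cnD (f (q + v) - f q - (f_ n (q + v) - f_ n q))
     (f_ n (q + v) - f_ n q - X).
  have := vn_ge0 v; nra.
by split=> // v e e0; rewrite dE; exact: hL.
Qed.

End VectorCauchy.

Section Compactness.
Variable R : realType.
Local Notation C := R[i].

Lemma closed_eps (V : normedModType C) (A : set V) :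
  (forall z, (forall e : R, 0 < e -> exists2 x, A x & vn (x - z) < e) -> A z) ->
  closed A.
Proof.
move=> h z cz; apply: h => e e0.
have : nbhs z [set x | vn (x - z) < e] by apply/near_vnP; exists e.
by move=> /cz[x [Ax xz]]; exists x.
Qed.

Lemma compact_disc (M : R) : compact [set z : C | cn z <= M].
Proof.
pose phi (p : R * R) : C := p.1 +i* p.2.
have cphi : continuous phi.
  move=> p; apply/cvgrPdist_lt => e e0.
  have ee : e = (complex.Re e)%:C by rewrite RRe_real // gtr0_real.
  move: e0; rewrite ee ltcR; set e' := complex.Re e => e0.
  have e2 : 0 < e' / 2 by lra.
  have [h1 h2] : (\forall x \near p, `|p.1 - x.1| < e' / 2) /\
                 (\forall x \near p, `|p.2 - x.2| < e' / 2).
    split.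
      have : fst @ p --> p.1 by exact: cvg_fst.
      by move=> /cvgrPdist_lt /(_ _ e2).
    have : snd @ p --> p.2 by exact: cvg_snd.
    by move=> /cvgrPdist_lt /(_ _ e2).
  near=> x; rewrite normCE ltcR.
  have -> : phi p - phi x = (p.1 - x.1) +i* (p.2 - x.2) by [].
  apply: le_lt_trans (cn_ReIm _) _ => /=.
  have : `|p.1 - x.1| < e' / 2 by near: x.
  have : `|p.2 - x.2| < e' / 2 by near: x.
  lra.
have cA : compact (`[- M, M]%classic `*` `[- M, M]%classic : set (R * R)).
  by apply: compact_setX; exact: segment_compact.
have cI := continuous_compact (continuous_subspaceT cphi) cA.
apply: (subclosed_compact _ cI).
  apply: closed_eps => z h; rewrite /=; apply/ler_addgt0Pl => e e0.
  have [x /= hx hz] := h e e0; have := cn_subr z x; rewrite cnB.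
  move: hz; rewrite /vn /=; rewrite -/(cn (x - z)); lra.
move=> [a b] /= h; exists (a, b) => //=; split; rewrite /= in_itv /= -ler_norml.
  by apply: le_trans h; exact: (cn_Re (a +i* b)).
by apply: le_trans h; exact: (cn_Im (a +i* b)).
Unshelve. all: by end_near.
Qed.

Lemma bounded_on_disc (f : C -> C) (M : R) : continuous f ->
  exists B : R, forall z, cn z <= M -> cn (f z) <= B.
Proof.
move=> cf; have [M0|M0] := ltP M 0.
  by exists 0 => z hz; have := cn_ge0 z; lra.
have cg : continuous (fun z => cn (f z)).
  move=> z; apply/(@cvgrPdist_lt _ _ _ (nbhs z)) => e e0.
  have := cf z => /(@cvgrPdist_lt _ _ _ (nbhs z)) /(_ e%:C); rewrite ltcR => /(_ e0).
  apply: filterS => x; rewrite normCE ltcR; apply: le_lt_trans.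
  have := cn_subr (f z) (f x); have := cn_subr (f x) (f z).
  by rewrite (cnB (f x)) ler_norml; lra.
have [|c _ hc] := compact_EVT_max _ (@compact_disc M) (continuous_subspaceT cg).
  by exists 0 => /=; rewrite expr0n addr0 sqrtr0.
by exists (cn (f c)) => z hz; apply: hc; rewrite inE.
Qed.

(** The first order Cauchy estimate on discs of growing radius makes f
    constant. *)
Lemma liouville (f : C -> C) : (forall z, differentiable f z) ->
  (forall e : R, 0 < e -> exists M : R, forall z, M <= cn z -> cn (f z) <= e) ->
  forall z, f z = 0.
Proof.
move=> fd f0.
have cf : continuous f by move=> z; exact: differentiable_continuous.
have [M1 hM1] := f0 1 ltr01; have [B0 hB0] := bounded_on_disc M1 cf.
pose B := `|B0| + 1.
have fB z : cn (f z) <= B.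
  rewrite /B; have [/hM1|h] := leP M1 (cn z); first by have := normr_ge0 B0; lra.
  have := hB0 z (ltW h); have := ler_norm B0; lra.
have fc z : f z = f 0.
  apply/eqP; rewrite -subr_eq0; apply/eqP/cn_eps0 => e e0.
  have B1 : 0 < B by rewrite /B ltr_wpDl.
  pose r := 8 * B * cn z / e + 2 * cn z + 1.
  have t0 : 0 <= 8 * B * cn z / e.
    by rewrite divr_ge0 ?(ltW e0) ?mulr_ge0 ?cn_ge0 // ltW.
  have z0 := cn_ge0 z.
  have r0 : 0 < r by rewrite /r; lra.
  have := cauchy_first r0 (fun z _ => fd z) (fun z _ => fB z) (a := z).
  move=> /(_ ltac:(rewrite /r; lra)) h; apply: (le_trans h).
  rewrite mulrAC ler_pdivrMr //.
  have : 8 * B * cn z / e * e = 8 * B * cn z by rewrite divfK // gt_eqF.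
  by rewrite /r; nra.
move=> z; apply: cn_eps0 => e e0; have [M hM] := f0 e e0.
rewrite fc -(fc `|M|%:C); apply: hM; rewrite cnR ger0_norm //.
exact: ler_norm.
Qed.

End Compactness.

(** * Functions of two complex variables *)

Section TwoVariables.
Variable R : realType.
Local Notation C := R[i].
Implicit Types (p q : C * C).

Lemma vn_pair p : vn p = Num.max (cn p.1) (cn p.2).
Proof.
rewrite /vn prod_normE.
rewrite !normCE; have [h|h] := leP (cn p.1) (cn p.2).
  by rewrite max_r // lecR.
by rewrite max_l // lecR ltW.
Qed.

Lemma vn_pair_lt p (e : R) : (vn p < e) = (cn p.1 < e) && (cn p.2 < e).
Proof. by rewrite vn_pair gt_max. Qed.

Lemma vn_fst p : cn p.1 <= vn p.
Proof. by rewrite vn_pair le_max lexx. Qed.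

Lemma vn_snd p : cn p.2 <= vn p.
Proof. by rewrite vn_pair le_max lexx orbT. Qed.

Lemma near_pairP p (P : C * C -> Prop) :
  (\forall x \near p, P x) <-> (exists2 e : R, 0 < e &
    forall x, cn (x.1 - p.1) < e -> cn (x.2 - p.2) < e -> P x).
Proof.
split=> [/near_vnP[e e0 h]|[e e0 h]].
  by exists e => // x h1 h2; apply: h; rewrite vn_pair_lt h1 h2.
by apply/near_vnP; exists e => // x; rewrite vn_pair_lt => /andP[]; exact: h.
Qed.

Lemma dif_fst p : differentiable (fun x : C * C => x.1) p.
Proof.
have [] // := @dif_intro _ _ (fun x : C * C => x.1) (fun x => x.1) p 1.
- by move=> v; rewrite mul1r vn_fst.
- move=> e e0; exists 1 => // v _ /=.
  have -> : p.1 + v.1 - p.1 - v.1 = 0 by ring.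
  by rewrite cn0 mulr_ge0 ?vn_ge0 // ltW.
Qed.

Lemma dif_snd p : differentiable (fun x : C * C => x.2) p.
Proof.
have [] // := @dif_intro _ _ (fun x : C * C => x.2) (fun x => x.2) p 1.
- by move=> v; rewrite mul1r vn_snd.
- move=> e e0; exists 1 => // v _ /=.
  have -> : p.2 + v.2 - p.2 - v.2 = 0 by ring.
  by rewrite cn0 mulr_ge0 ?vn_ge0 // ltW.
Qed.

Lemma dif_comp_snd (f : C -> C) p : differentiable f p.2 ->
  differentiable (fun x : C * C => f x.2) p.
Proof. by move=> df; apply: (differentiable_comp (dif_snd p)). Qed.

Lemma dif_slice1 (f : C * C -> C) a b z : differentiable f (a + z, b) ->
  differentiable (fun z => f (a + z, b)) z.
Proof.
move=> df; apply: (@differentiable_comp _ _ _ _ (fun z => (a + z, b)) f) => //.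
Qed.

Lemma dif_slice2 (f : C * C -> C) a b : differentiable f (a, b) ->
  differentiable (fun z => f (a, z)) b.
Proof.
move=> df; apply: (@differentiable_comp _ _ _ _ (fun z => (a, z)) f) => //.
Qed.

Lemma dif_near (V : normedModType C) (f g : V -> C) (q : V) :
  (\forall x \near q, f x = g x) -> differentiable f q -> differentiable g q.
Proof.
move=> h df; have [B B0 hB] := dif_bounded df.
have [] // := @dif_intro _ _ g (dv f q) q B.
  by move=> a u v; rewrite dv_linear.
move=> e e0; have [d1 d10 h1] := dif_eps df e0.
have fq : f q = g q by apply: nbhs_singleton h.
move/near_vnP: h => [d2 d20 h2].
exists (Num.min d1 d2); first by rewrite lt_min d10.
move=> v; rewrite lt_min => /andP[/h1 H1 H2].
by rewrite -fq -h2 // addrC addKr.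
Qed.

Lemma dif_sum (V : normedModType C) n (f : 'I_n -> V -> C) (q : V) :
  (forall i, differentiable (f i) q) ->
  differentiable (fun x => \sum_(i < n) f i x) q.
Proof.
move=> h; have := differentiable_sum h; congr (differentiable _ _).
by apply/funext => x; rewrite fct_sumE.
Qed.

Lemma dif_prod (V : normedModType C) (I : Type) (r : seq I) (f : I -> V -> C) (q : V) :
  (forall i, differentiable (f i) q) ->
  differentiable (fun x => \prod_(i <- r) f i x) q.
Proof.
move=> h; elim: r => [|i r IH].
  have -> : (fun x => \prod_(i <- [::]) f i x) = cst 1.
    by apply/funext => x; rewrite big_nil.
  exact: differentiable_cst.
have -> : (fun x => \prod_(j <- i :: r) f j x) =
          (fun x => f i x * \prod_(j <- r) f j x).
  by apply/funext => x; rewrite big_cons.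
exact: differentiableM.
Qed.

Lemma dif_exp (V : normedModType C) (f : V -> C) n (q : V) :
  differentiable f q -> differentiable (fun x => f x ^+ n) q.
Proof.
move=> df; elim: n => [|n IH].
  have -> : (fun x => f x ^+ 0) = cst 1 by apply/funext => x; rewrite expr0.
  exact: differentiable_cst.
have -> : (fun x => f x ^+ n.+1) = (fun x => f x * f x ^+ n).
  by apply/funext => x; rewrite exprS.
exact: differentiableM.
Qed.

Lemma dif_horner (p : {poly C}) z : differentiable (fun x => p.[x]) z.
Proof.
have -> : (fun x => p.[x]) = (fun x => \sum_(i < size p) p`_i * x ^+ i).
  by apply/funext => x; rewrite horner_coef.
apply: dif_sum => i; apply: differentiableM; first exact: differentiable_cst.
exact: dif_exp.
Qed.

(** Division by a linear factor. The quotient is the average of difference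
    quotients with a fixed step, a uniform limit of functions without a
    denominator vanishing at c. *)
Lemma divide_linear (U D : C -> Prop) (f : C * C -> C) c (r B : R) :
  (forall b, D b -> exists2 e : R, 0 < e & forall b', cn (b' - b) < e -> D b') ->
  0 < r -> (forall a, cn (a - c) < r -> U a) ->
  (forall a b, U a -> D b -> differentiable f (a, b)) ->
  (forall a b, U a -> D b -> cn (f (a, b)) <= B) ->
  exists g : C * C -> C,
    [/\ forall a b, U a -> D b -> differentiable g (a, b),
        forall a b, U a -> D b -> cn (g (a, b)) <= 64 * B / r &
        forall a b, U a -> D b -> f (a, b) = f (c, b) + (a - c) * g (a, b)].
Proof.
move=> Do r0 Ur fd fB.
have Uc : U c by apply: Ur; rewrite subrr cn0.
pose h a b z := f (a + z, b).
pose quo a b z := if z == 0 then dv (h a b) 0 1 else (h a b z - h a b 0) / z.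
pose g (p : C * C) := quo c p.2 (p.1 - c).
have near_c a b : D b -> cn (a - c) <= r / 4 ->
    (forall z, cn z <= 2 * (r / 8) -> differentiable (h a b) z) /\
    (forall z, cn z <= 2 * (r / 8) -> cn (h a b z) <= B).
  move=> Db ha; have Uz z : cn z <= 2 * (r / 8) -> U (a + z).
    move=> hz; apply: Ur; have -> : a + z - c = (a - c) + z by ring.
    by have := cnD (a - c) z; lra.
  split=> z hz; last by apply: fB => //; exact: Uz.
  by apply: dif_slice1; apply: fd => //; exact: Uz.
have r8 : 0 < r / 8 by lra.
have quo_first b z : D b -> cn z <= r / 16 -> cn (quo c b z) <= 64 * B / r.
  move=> Db hz; have cc : cn (c - c) <= r / 4 by rewrite subrr cn0; lra.
  have [hd hB] := near_c c b Db cc.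
  have rE : 8 * B / (r / 8) = 64 * B / r by field; rewrite gt_eqF.
  rewrite /quo; have [_|z0] := eqVneq z 0.
    by have := cauchy_deriv r8 hd hB 1; rewrite cn1 mulr1 rE.
  rewrite cnM cnV ler_pdivrMr ?cn_gt0 // -rE.
  by apply: cauchy_first => //; lra.
have fE a b : D b -> f (a, b) = f (c, b) + (a - c) * g (a, b).
  move=> Db; rewrite /g /quo /=; have [/eqP|ac] := eqVneq (a - c) 0.
    by rewrite subr_eq0 => /eqP ->; rewrite subrr mul0r addr0.
  by rewrite mulrC divfK // /h subrKC addr0 subrKC.
exists g; split=> [a b Ua Db|a b Ua Db|a b _]; last exact: fE; last first.
  rewrite /g /=; have [ac|ac] := leP (cn (a - c)) (r / 16); first exact: quo_first.
  have ac0 : a - c != 0 by rewrite -cn_gt0; lra.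
  rewrite /quo (negbTE ac0) /h subrKC addr0 cnM cnV ler_pdivrMr ?cn_gt0 //.
  have := cnDB (f (a, b)) (f (c, b)); have := fB a b Ua Db; have := fB c b Uc Db.
  have B0 : 0 <= B by apply: le_trans (cn_ge0 _) (fB c b Uc Db).
  have : 4 * B <= 64 * B / r * cn (a - c).
    rewrite mulrAC ler_pdivlMr //; nra.
  lra.
have [->|ac] := eqVneq a c; last first.
  have da : differentiable f (a, b) by exact: fd.
  have dc : differentiable (fun x : C * C => f (c, x.2)) (a, b).
    by apply: (@dif_comp_snd (fun z => f (c, z))); apply: dif_slice2; exact: fd.
  have d1 : differentiable (fun x : C * C => x.1 - c) (a, b).
    by apply: differentiableB; [exact: dif_fst|].
  apply: (@dif_near _ (fun x => (f x - f (c, x.2)) / (x.1 - c))).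
    apply/near_pairP; exists (cn (a - c)); first by rewrite cn_gt0 subr_eq0.
    move=> x h1 _; rewrite /g /quo.
    have xc : x.1 - c != 0.
      have := cn_subr (a - c) (a - x.1); have -> : a - c - (a - x.1) = x.1 - c by ring.
      by rewrite -cn_gt0 (cnB a) /= in h1 *; lra.
    by rewrite (negbTE xc) /h subrKC addr0 -surjective_pairing.
  apply: differentiableM; first exact: differentiableB.
  by apply: differentiableV; rewrite //= subr_eq0.
have [e0 e00 hD] := Do b Db.
have B0 : 0 <= B by apply: le_trans (cn_ge0 _) (fB c b Uc Db).
pose K := 24 * B / (r / 8) ^+ 2.
have K0 : 0 <= K by rewrite /K divr_ge0 ?mulr_ge0 // ltW // exprn_gt0.
have quo_second a' b' z : D b' -> cn (a' - c) <= r / 4 -> cn z <= r / 16 ->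
    cn (quo a' b' z - dv (h a' b') 0 1) <= K * cn z.
  move=> Db' ha hz; have [hd hB] := near_c a' b' Db' ha.
  rewrite /quo; have [->|z0] := eqVneq z 0; first by rewrite subrr cn0 mulr0.
  have := cauchy_second r8 hd hB (a := z); rewrite -/K => /(_ ltac:(lra)).
  have -> : h a' b' z - h a' b' 0 - dv (h a' b') 0 z =
      ((h a' b' z - h a' b' 0) / z - dv (h a' b') 0 1) * z.
    by rewrite (dif_mul1 _ _ z) mulrBl divfK // (mulrC z).
  by rewrite cnM expr2 mulrA ler_pM2r ?cn_gt0.
(* quo a b z is the difference quotient of f in the first variable with step
   z. The quotient g(a,b), with step a - c, telescopes into the average of n+1
   quotients with step (a - c)/(n+1); replacing that step by eps n, which does
   not vanish at a = c, gives differentiable functions g_ n. *)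
pose eps n : C := (r / 64 / n.+1%:R)%:C.
have eps0 n : 0 < r / 64 / n.+1%:R :> R by rewrite !divr_gt0.
have ceps n : cn (eps n) = r / 64 / n.+1%:R by rewrite cnR gtr0_norm.
have epsr n : cn (eps n) <= r / 64.
  rewrite ceps ler_pdivrMr ?ltr0n // ler_peMr ?ler1n //; lra.
have epsn0 n : eps n != 0 by rewrite -cn_gt0 ceps.
pose pt n (j : 'I_n.+1) a' : C := c + j%:R / n.+1%:R * (a' - c).
pose g_ n (x : C * C) : C :=
  n.+1%:R^-1 * \sum_(j < n.+1) ((f (pt n j x.1 + eps n, x.2) -
                               f (pt n j x.1, x.2)) / eps n).
have ptc n j a' : cn (pt n j a' - c) <= cn (a' - c).
  rewrite /pt addrC addKr cnM ler_piMl ?cn_ge0 // cnM cnV !cn_nat.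
  by rewrite ler_pdivrMr ?ltr0n // mul1r ler_nat ltnW.
have e10 : 0 < Num.min e0 (r / 64) by rewrite lt_min e00; lra.
apply: (uniform_limit (f_ := g_) (f := g) e10 _ _).1.
  move=> n [a' b'] hx; have : vn ((a', b') - (c, b)) < Num.min e0 (r / 64) by [].
  rewrite vn_pair_lt /= !lt_min => /andP[/andP[_ a1] /andP[b1 _]].
  have Db' : D b' by exact: hD.
  apply: differentiableM; first exact: differentiable_cst.
  apply: dif_sum => j; apply: differentiableM; last exact: differentiable_cst.
  have ptd (e : C) : cn e <= r / 64 ->
      differentiable (fun x : C * C => f (pt n j x.1 + e, x.2)) (a', b').
    move=> he; apply: (@differentiable_comp _ _ _ _
      (fun x : C * C => (pt n j x.1 + e, x.2)) f) => /=.
      apply: differentiable_pair; last exact: dif_snd.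
      apply: differentiableD; last exact: differentiable_cst.
      apply: differentiableD; first exact: differentiable_cst.
      apply: differentiableM; first exact: differentiable_cst.
      apply: differentiableB; [exact: dif_fst | exact: differentiable_cst].
    apply: fd => //; apply: Ur.
    have -> : pt n j a' + e - c = pt n j a' - c + e by ring.
    by have := ptc n j a'; have := cnD (pt n j a' - c) e; lra.
  apply: differentiableB; first exact: ptd.
  have := ptd 0; rewrite cn0 => /(_ ltac:(lra)).
  by congr (differentiable _ _); apply/funext => x; rewrite addr0.
move=> e ep.
have [N hN] : exists N, forall n, (N <= n)%N -> 2 * K * cn (eps n) <= e.
  exists (Num.bound (2 * K * (r / 64) / e)) => n hn; rewrite ceps mulrA.
  rewrite ler_pdivrMr ?ltr0n // (mulrC e).
  have r64 : 0 <= r / 64 by lra.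
  have q0 : 0 <= 2 * K * (r / 64) / e.
    by apply: divr_ge0; [apply: mulr_ge0 => //; apply: mulr_ge0 | exact: ltW].
  rewrite -ler_pdivrMr //; apply: le_trans (ltW (archi_boundP q0)) _.
  by rewrite ler_nat (leq_trans hn).
exists N => n /hN hn [a' b'] hx; apply: le_trans hn.
have : vn ((a', b') - (c, b)) < Num.min e0 (r / 64) by [].
rewrite vn_pair_lt /= !lt_min => /andP[/andP[_ a1] /andP[b1 _]].
have Db' : D b' by exact: hD.
pose del := (a' - c) / n.+1%:R.
have cdel : cn del <= cn (eps n).
  rewrite ceps /del cnM cnV cn_nat ler_wpM2r ?invr_ge0 ?ler0n // ltW //.
have n0 : (n.+1%:R : C) != 0 by rewrite pnatr_eq0.
have gE : g (a', b') = n.+1%:R^-1 * \sum_(j < n.+1) quo (pt n j a') b' del.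
  rewrite /g /quo /= /del; have [ac|ac] := eqVneq (a' - c) 0.
    rewrite ac mul0r eqxx (eq_bigr (fun=> dv (h c b') 0 1)).
      by rewrite sumr_const card_ord -[dv _ _ _ *+ _]mulr_natl mulrA mulVf // mul1r.
    by move=> j _; rewrite /pt ac mulr0 addr0.
  rewrite mulf_eq0 (negbTE ac) invr_eq0 (negbTE n0) /=.
  rewrite -mulr_suml.
  have -> : \sum_(j < n.+1) (h (pt n j a') b' ((a' - c) / n.+1%:R) -
       h (pt n j a') b' 0) = h c b' (a' - c) - h c b' 0.
    pose F (j : nat) := f (c + j%:R / n.+1%:R * (a' - c), b').
    rewrite (eq_bigr (fun j : 'I_n.+1 => F j.+1 - F j)); last first.
      move=> j _; rewrite /h /F /pt addr0 -natr1; congr (f (_, _) - _).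
      by field.
    rewrite -(big_mkord xpredT (fun j => F j.+1 - F j)) telescope_sumr //.
    rewrite /F /h mul0r mul0r divff // mul1r addr0 //.
  by move: (n.+1%:R : C) n0 => m m0; field; rewrite m0 ac.
rewrite gE /g_ -mulrBr -sumrB cnM cnV cn_nat.
have hb : cn (\sum_(j < n.+1) ((f (pt n j a' + eps n, b') - f (pt n j a', b')) /
    eps n - quo (pt n j a') b' del)) <= n.+1%:R * (2 * K * cn (eps n)).
  apply: le_trans (cn_sum _ _ _) _.
  have -> : n.+1%:R * (2 * K * cn (eps n)) =
            \sum_(j < n.+1) (2 * K * cn (eps n)).
    by rewrite sumr_const card_ord mulr_natl.
  apply: ler_sum => j _.
  have -> : (f (pt n j a' + eps n, b') - f (pt n j a', b')) / eps n =
            quo (pt n j a') b' (eps n).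
    by rewrite /quo (negbTE (epsn0 n)) /h addr0.
  have pc := ptc n j a'; have er := epsr n.
  have := quo_second (pt n j a') b' (eps n) Db' ltac:(lra) ltac:(lra).
  have := quo_second (pt n j a') b' del Db' ltac:(lra) ltac:(lra).
  set d := dv _ _ _; set q1 := quo _ _ del; set q2 := quo _ _ (eps n) => h1 h2.
  have := cn_dist q2 d q1; rewrite (cnB d).
  have := ler_wpM2l K0 cdel; lra.
by rewrite mulrC ler_pdivrMr ?ltr0n // mulrC.
Qed.

End TwoVariables.

(** * Weierstrass division *)

Section Weierstrass.
Variable R : realType.
Local Notation C := R[i].

Definition opened (D : C -> Prop) :=
  forall b, D b -> exists2 e : R, 0 < e & forall b', cn (b' - b) < e -> D b'.

Lemma half_le m n : (m <= n)%N -> (2^-1 ^+ n : R) <= 2^-1 ^+ m.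
Proof. by move=> h; apply: ler_wiXn2l => //; lra. Qed.

Lemma half_mul_small_all (c x : R) : 0 <= c -> 0 < x ->
  exists N, forall n, (N <= n)%N -> c * 2^-1 ^+ n <= x.
Proof.
move=> c0 x0; have [N hN] := half_mul_small c x0; exists N => n hn.
by apply: le_trans (ltW hN); rewrite ler_wpM2l // half_le.
Qed.

Lemma geo_series (X : Type) (S : X -> Prop) (u : nat -> X -> C) (K : R) :
  (forall n x, S x -> cn (u n x) <= K * 2^-1 ^+ n) ->
  exists v : X -> C, forall n x, S x ->
    cn (\sum_(i < n) u i x - v x) <= 4 * K * 2^-1 ^+ n.
Proof.
move=> h.
have lim x : exists l, S x -> forall n,
    cn (l - \sum_(i < n) u i x) <= 4 * K * 2^-1 ^+ n.
  have [Sx|nS] := pselect (S x); last by exists 0.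
  have step n : cn (\sum_(i < n.+1) u i x - \sum_(i < n) u i x) <=
      K * 2^-1 ^+ n.
    by rewrite big_ord_recr /= (addrC (\sum_(i < n) u i x)) addrK; exact: h.
  by have [l hl] := geo_limitC step; exists l.
exists (fun x => sval (cid (lim x))) => n x Sx; rewrite cnB.
exact: (svalP (cid (lim x)) Sx n).
Qed.

(** Successive division by the linear factors. The bound M depends only on
    cs and r, so division stays uniform while D shrinks. *)
Lemma divide_list (U : C -> Prop) (r : R) (cs : seq C) :
  0 < r -> (forall c, c \in cs -> forall a, cn (a - c) < r -> U a) ->
  exists2 M : R, 0 <= M & forall D, opened D -> forall (f : C * C -> C) (B : R),
    (forall a b, U a -> D b -> differentiable f (a, b)) ->
    (forall a b, U a -> D b -> cn (f (a, b)) <= B) -> 0 <= B ->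
    exists (rho : nat -> C -> C) (H : C * C -> C),
      [/\ forall i b, D b -> differentiable (rho i) b,
          forall i b, D b -> cn (rho i b) <= M * B,
          forall a b, U a -> D b -> differentiable H (a, b),
          forall a b, U a -> D b -> cn (H (a, b)) <= M * B &
          forall a b, U a -> D b -> f (a, b) =
            \sum_(i < size cs) rho i b * a ^+ i +
            (\prod_(c <- cs) (a - c)) * H (a, b)].
Proof.
move=> r0; elim: cs => [|c cs IH] hU.
  exists 1 => // D Do f B fd fB B0; exists (fun _ _ => 0), f; split=> //.
  - by move=> i b _; rewrite cn0 mul1r.
  - by move=> a b Ua Db; rewrite mul1r fB.
  - by move=> a b _ _; rewrite big_ord0 big_nil add0r mul1r.
have [|M M0 hM] := IH _.
  by move=> c' c'cs; apply: hU; rewrite inE c'cs orbT.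
have Uc a : cn (a - c) < r -> U a by apply: hU; rewrite inE eqxx.
have Mr : 0 <= M * (64 / r) by rewrite mulr_ge0 // divr_ge0 // ltW.
exists (1 + (cn c + 1) * (M * (64 / r))).
  by rewrite addr_ge0 // mulr_ge0 // addr_ge0 ?cn_ge0.
move=> D Do f B fd fB B0.
have [g [gd gB gE]] := divide_linear Do r0 Uc fd fB.
have [|rho [H [rd rB Hd HB fE]]] := hM D Do g (64 * B / r) gd gB _.
  by rewrite divr_ge0 ?mulr_ge0 // ltW.
have Ucc : U c by apply: Uc; rewrite subrr cn0.
pose n := size cs.
pose low i b := if i is i'.+1 then rho i' b else f (c, b).
pose high i b := if (i < n)%N then rho i b else 0.
have MB : M * (64 * B / r) = M * (64 / r) * B by ring.
have c0 := cn_ge0 c.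
have MB0 : 0 <= M * (64 / r) * B by rewrite mulr_ge0.
exists (fun i b => low i b - c * high i b), H; split.
- move=> i b Db; apply: differentiableB.
    case: i => [|i] /=; last exact: rd.
    by apply: dif_slice2; exact: fd.
  apply: differentiableM; first exact: differentiable_cst.
  have -> : high i = if (i < n)%N then rho i else cst 0.
    by apply/funext => x; rewrite /high; case: ifP.
  by case: ifP => _; [exact: rd | exact: differentiable_cst].
- move=> i b Db; apply: le_trans (cnDB _ _) _; rewrite cnM.
  have h1 : cn (low i b) <= B + M * (64 / r) * B.
    case: i => [|i] /=; first by have := fB c b Ucc Db; lra.
    by have := rB i b Db; rewrite MB; lra.
  have h2 : cn (high i b) <= M * (64 / r) * B.
    by rewrite /high; case: ifP => _; rewrite ?cn0 -?MB ?rB // MB.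
  have := ler_wpM2l c0 h2.
  have -> : (1 + (cn c + 1) * (M * (64 / r))) * B =
    B + M * (64 / r) * B + cn c * (M * (64 / r) * B) by ring.
  lra.
- exact: Hd.
- move=> a b Ua Db; apply: le_trans (HB a b Ua Db) _; rewrite MB.
  have -> : (1 + (cn c + 1) * (M * (64 / r))) * B =
    B + M * (64 / r) * B + cn c * (M * (64 / r) * B) by ring.
  have := mulr_ge0 c0 MB0; lra.
- move=> a b Ua Db; rewrite gE // fE // big_cons /=.
  have -> : \sum_(i < n.+1) (low i b - c * high i b) * a ^+ i =
     f (c, b) + a * \sum_(i < n) rho i b * a ^+ i
     - c * \sum_(i < n) rho i b * a ^+ i.
    under eq_bigr do rewrite mulrBl.
    rewrite sumrB big_ord_recl /= expr0 mulr1; congr (_ + _ - _).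
      by rewrite mulr_sumr; apply: eq_bigr => i _; rewrite exprS; ring.
    rewrite big_ord_recr /= /high ltnn mulr0 mul0r addr0 mulr_sumr.
    by apply: eq_bigr => i _; rewrite ltn_ord; ring.
  by ring.
Qed.

(** As P is close to a product Q of linear factors, division by Q is
    corrected by iterating it on the error (Q - P) H. *)
Lemma weierstrass_division (U D : C -> Prop) (M : R) (cs : seq C)
    (P f : C * C -> C) (B : R) :
  opened U -> opened D ->
  (forall (f : C * C -> C) (B : R),
    (forall a b, U a -> D b -> differentiable f (a, b)) ->
    (forall a b, U a -> D b -> cn (f (a, b)) <= B) -> 0 <= B ->
    exists (rho : nat -> C -> C) (H : C * C -> C),
      [/\ forall i b, D b -> differentiable (rho i) b,
          forall i b, D b -> cn (rho i b) <= M * B,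
          forall a b, U a -> D b -> differentiable H (a, b),
          forall a b, U a -> D b -> cn (H (a, b)) <= M * B &
          forall a b, U a -> D b -> f (a, b) =
            \sum_(i < size cs) rho i b * a ^+ i +
            (\prod_(c <- cs) (a - c)) * H (a, b)]) ->
  0 <= M -> 0 <= B ->
  (forall a b, U a -> D b -> differentiable P (a, b)) ->
  (forall a b, U a -> D b ->
     cn (\prod_(c <- cs) (a - c) - P (a, b)) * M <= 2^-1) ->
  (forall a b, U a -> D b -> differentiable f (a, b)) ->
  (forall a b, U a -> D b -> cn (f (a, b)) <= B) ->
  exists (rho : nat -> C -> C) (H : C * C -> C),
    [/\ forall i b, D b -> differentiable (rho i) b,
        forall a b, U a -> D b -> differentiable H (a, b) &
        forall a b, U a -> D b -> f (a, b) =
          \sum_(i < size cs) rho i b * a ^+ i + P (a, b) * H (a, b)].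
Proof.
move=> Uo Do div M0 B0 Pd Pc fd fB.
(* the error left after n corrections is at most B / 2^n *)
pose ok n (F : C * C -> C) :=
  (forall a b, U a -> D b -> differentiable F (a, b)) /\
  (forall a b, U a -> D b -> cn (F (a, b)) <= B * 2^-1 ^+ n).
pose good n (F : C * C -> C) (t : (nat -> C -> C) * (C * C -> C) * (C * C -> C)) :=
  [/\ [/\ forall i b, D b -> differentiable (t.1.1 i) b,
          forall i b, D b -> cn (t.1.1 i b) <= M * B * 2^-1 ^+ n,
          forall a b, U a -> D b -> differentiable t.1.2 (a, b) &
          forall a b, U a -> D b -> cn (t.1.2 (a, b)) <= M * B * 2^-1 ^+ n],
      ok n.+1 t.2 &
      forall a b, U a -> D b -> F (a, b) =
        \sum_(i < size cs) t.1.1 i b * a ^+ i + P (a, b) * t.1.2 (a, b) +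
        t.2 (a, b)].
have step n F : ok n F -> exists t, good n F t.
  move=> [Fd FB].
  have [|rho [H [rd rB Hd HB FE]]] := div F _ Fd FB.
    by rewrite mulr_ge0 // exprn_ge0.
  exists (rho, H, fun x => (\prod_(c <- cs) (x.1 - c) - P x) * H x).
  split; first by split=> //= *; rewrite -mulrA; [exact: rB | exact: HB].
    split=> a b Ua Db /=.
      apply: differentiableM; last exact: Hd.
      apply: differentiableB; last exact: Pd.
      apply: dif_prod => c.
      by apply: differentiableB; [exact: dif_fst | exact: differentiable_cst].
    rewrite cnM; have h1 := HB a b Ua Db; have h2 := Pc a b Ua Db.
    have t0 : 0 <= B * 2^-1 ^+ n by rewrite mulr_ge0 // exprn_ge0.
    apply: (le_trans (ler_wpM2l (cn_ge0 _) h1)).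
    by have := ler_wpM2r t0 h2; rewrite exprS; lra.
  by move=> a b Ua Db /=; rewrite FE //; ring.
have ok0 : ok 0%N f by split=> // a b Ua Db; rewrite expr0 mulr1 fB.
pose pick n (s : {F | ok n F}) := cid (step n (sval s) (svalP s)).
pose next n (s : {F | ok n F}) : {F | ok n.+1 F} :=
  exist _ (sval (pick n s)).2 (let: And3 _ h _ := svalP (pick n s) in h).
pose sq := fix sq n : {F | ok n F} :=
  if n is n'.+1 then next n' (sq n') else exist _ f ok0.
pose F n := sval (sq n).
pose t n := sval (pick n (sq n)).
have tgood n : good n (F n) (t n) by exact: svalP (pick n (sq n)).
have FS n : F n.+1 = (t n).2 by [].
have MB0 : 0 <= M * B by rewrite mulr_ge0.
have rho_lim i : exists v : C -> C, forall n b, D b ->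
    cn (\sum_(m < n) (t m).1.1 i b - v b) <= 4 * (M * B) * 2^-1 ^+ n.
  apply: (@geo_series _ D (fun m => (t m).1.1 i)) => n b Db.
  by have [[_ h _ _] _ _] := tgood n; exact: h.
pose rho i := sval (cid (rho_lim i)).
have hrho i : forall n b, D b ->
    cn (\sum_(m < n) (t m).1.1 i b - rho i b) <= 4 * (M * B) * 2^-1 ^+ n.
  exact: svalP (cid (rho_lim i)).
have [H hH] : exists H : C * C -> C, forall n x, U x.1 /\ D x.2 ->
    cn (\sum_(m < n) (t m).1.2 x - H x) <= 4 * (M * B) * 2^-1 ^+ n.
  apply: (@geo_series _ _ (fun m => (t m).1.2)) => n [a b] [/= Ua Db].
  by have [[_ _ _ h] _ _] := tgood n; exact: h.
have K0 : 0 <= 4 * (M * B) by rewrite mulr_ge0.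
exists rho, H; split.
- move=> i b Db; have [e e0 he] := Do b Db.
  apply: (uniform_limit (f_ := fun n x => \sum_(m < n) (t m).1.1 i x)
    (f := rho i) e0 _ _).1.
    move=> n x /he Dx; apply: dif_sum => m.
    by have [[h _ _ _] _ _] := tgood m; exact: h.
  move=> d d0; have [N hN] := half_mul_small_all K0 d0.
  by exists N => n /hN hn x /he Dx; apply: le_trans hn; exact: hrho.
- move=> a b Ua Db; have [e1 e10 he1] := Uo a Ua; have [e2 e20 he2] := Do b Db.
  have e0 : 0 < Num.min e1 e2 by rewrite lt_min e10.
  have inUD x : vn (x - (a, b)) < Num.min e1 e2 -> U x.1 /\ D x.2.
    rewrite vn_pair_lt !lt_min => /andP[/andP[h1 _] /andP[_ h2]].
    by split; [exact: he1 | exact: he2].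
  apply: (uniform_limit (f_ := fun n x => \sum_(m < n) (t m).1.2 x)
    (f := H) e0 _ _).1.
    move=> n [x y] /inUD [Ux Dy]; apply: dif_sum => m.
    by have [[_ _ h _] _ _] := tgood m; exact: h.
  move=> d d0; have [N hN] := half_mul_small_all K0 d0.
  by exists N => n /hN hn x /inUD h; apply: le_trans hn; exact: hH.
- move=> a b Ua Db.
  have fN n : f (a, b) = \sum_(i < size cs) (\sum_(m < n) (t m).1.1 i b) * a ^+ i
      + P (a, b) * (\sum_(m < n) (t m).1.2 (a, b)) + F n (a, b).
    elim: n => [|n ->].
      by rewrite big_ord0 mulr0 addr0 big1 ?add0r // => i _; rewrite big_ord0 mul0r.
    have [_ _ hF] := tgood n; rewrite (hF a b Ua Db) FS big_ord_recr /=.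
    have -> : \sum_(i < size cs) (\sum_(m < n.+1) (t m).1.1 i b) * a ^+ i =
       \sum_(i < size cs) (\sum_(m < n) (t m).1.1 i b) * a ^+ i +
       \sum_(i < size cs) (t n).1.1 i b * a ^+ i.
      rewrite -big_split /=; apply: eq_bigr => i _.
      by rewrite big_ord_recr /= mulrDl.
    by ring.
  apply/eqP; rewrite -subr_eq0; apply/eqP/cn_eps0 => e e0.
  pose L := 4 * (M * B) * (\sum_(i < size cs) cn a ^+ i) +
     4 * (M * B) * cn (P (a, b)) + B.
  have S0 : 0 <= \sum_(i < size cs) cn a ^+ i.
    by apply: sumr_ge0 => i _; rewrite exprn_ge0 // cn_ge0.
  have L0 : 0 <= L.
    by rewrite /L !addr_ge0 // mulr_ge0 // cn_ge0.
  have [n hn] := half_mul_small_all L0 e0; apply: le_trans (hn n (leqnn _)).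
  rewrite (fN n).
  set x := \sum_(i < size cs) _; set y := \sum_(m < n) (t m).1.2 (a, b).
  set z := \sum_(i < size cs) _.
  have -> : x + P (a, b) * y + F n (a, b) - (z + P (a, b) * H (a, b)) =
     (x - z) + P (a, b) * (y - H (a, b)) + F n (a, b) by ring.
  have hF : cn (F n (a, b)) <= B * 2^-1 ^+ n by exact: (svalP (sq n)).2.
  have hy : cn (P (a, b) * (y - H (a, b))) <=
      cn (P (a, b)) * (4 * (M * B) * 2^-1 ^+ n).
    by rewrite cnM ler_wpM2l ?cn_ge0 //; exact: hH.
  have hx : cn (x - z) <=
      (\sum_(i < size cs) cn a ^+ i) * (4 * (M * B) * 2^-1 ^+ n).
    rewrite /x /z -sumrB mulr_suml; apply: le_trans (cn_sum _ _ _) _.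
    apply: ler_sum => i _; rewrite -mulrBl cnM cnX mulrC.
    by rewrite ler_wpM2l ?exprn_ge0 ?cn_ge0 // hrho.
  apply: le_trans (cnD _ _) _.
  have := cnD (x - z) (P (a, b) * (y - H (a, b))).
  have -> : L * 2^-1 ^+ n =
    (\sum_(i < size cs) cn a ^+ i) * (4 * (M * B) * 2^-1 ^+ n) +
    cn (P (a, b)) * (4 * (M * B) * 2^-1 ^+ n) + B * 2^-1 ^+ n.
    by rewrite /L; ring.
  lra.
Qed.

Lemma poly_bounded (p : {poly C}) (r : R) :
  exists2 K : R, 0 <= K & forall z, cn z <= r -> cn p.[z] <= K.
Proof.
have cp : continuous (fun z => p.[z]).
  by move=> z; apply: differentiable_continuous; exact: dif_horner.
have [B hB] := bounded_on_disc r cp; exists `|B| => // z /hB h.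
by apply: le_trans h (ler_norm _).
Qed.

(** Multiplicities are detected by the rate of growth near a root. *)
Lemma dvd_of_bounded (cs : seq C) (d : {poly C}) :
  (forall c, c \in cs -> exists b e : R, 0 < e /\
     forall z, z != c -> cn (z - c) < e ->
       cn d.[z] <= b * cn (\prod_(c <- cs) ('X - c%:P)).[z]) ->
  (\prod_(c <- cs) ('X - c%:P)) %| d.
Proof.
elim: cs d => [|c cs IH] d h; first by rewrite big_nil dvd1p.
pose Q := \prod_(c <- cs) ('X - c%:P).
have /factor_theorem [d' dE] : root d c.
  apply/rootP/cn_eps0 => eta eta0.
  have [b [e [e0 he]]] := h c (mem_head _ _).
  pose d1 := (d - (d.[c])%:P) %/ ('X - c%:P).
  have d1E : d = d1 * ('X - c%:P) + (d.[c])%:P.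
    apply/eqP; rewrite -subr_eq; apply/eqP; rewrite divpK //.
    by rewrite dvdp_XsubCl; apply/rootP; rewrite !hornerE subrr.
  have [K1 K10 hK1] := poly_bounded d1 (cn c + 1).
  have [K2 K20 hK2] := poly_bounded Q (cn c + 1).
  have L0 : 0 < K1 + `|b| * K2 + 1.
    by have := mulr_ge0 (normr_ge0 b) K20; lra.
  pose s := Num.min (Num.min (e / 2) 1) (eta / (K1 + `|b| * K2 + 1)).
  have s0 : 0 < s by rewrite !lt_min divr_gt0 // ltr01 divr_gt0.
  have se : s < e by apply: (@le_lt_trans _ _ (e / 2)); rewrite ?ge_min ?lexx //; lra.
  have s1 : s <= 1 by rewrite !ge_min lexx orbT.
  have sL : s * (K1 + `|b| * K2 + 1) <= eta.
    by rewrite -ler_pdivlMr // !ge_min lexx orbT.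
  pose z := c + s%:C.
  have zc : cn (z - c) = s by rewrite /z addrC addKr cnR gtr0_norm.
  have zc0 : z != c by rewrite -subr_eq0 -cn_gt0 zc.
  have zr : cn z <= cn c + 1 by have := cn_subr z c; lra.
  have := he z zc0; rewrite zc => /(_ se).
  rewrite big_cons -/Q hornerM hornerXsubC cnM zc => h1.
  have : d.[z] = d1.[z] * (z - c) + d.[c].
    by rewrite {1}d1E hornerD hornerM hornerXsubC hornerC.
  move=> h2; have -> : d.[c] = d.[z] - d1.[z] * (z - c) by rewrite h2; ring.
  apply: le_trans (cnDB _ _) _; rewrite cnM zc.
  have H1 := hK1 z zr; have H2 := hK2 z zr.
  have : b * (s * cn Q.[z]) <= s * (`|b| * K2).
    rewrite mulrCA ler_wpM2l ?(ltW s0) //.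
    apply: (@le_trans _ _ (`|b| * cn Q.[z])).
      by rewrite ler_wpM2r ?cn_ge0 ?ler_norm.
    by rewrite ler_wpM2l.
  have := ler_wpM2r (ltW s0) H1; lra.
rewrite dE big_cons mulrC dvdp_mul2r ?polyXsubC_eq0 //.
apply: IH => c' c'cs.
have [b [e [e0 he]]] := h c' ltac:(by rewrite inE c'cs orbT).
exists b, (if c' == c then e else Num.min e (cn (c - c'))); split.
  case: eqVneq => // cc; rewrite lt_min e0 cn_gt0 subr_eq0 eq_sym //.
move=> z zc' hz.
have ze : cn (z - c') < e.
  by move: hz; case: eqP => // _; rewrite lt_min => /andP[].
have zc : z != c.
  move: hz; case: eqP => [<- //|_]; rewrite lt_min => /andP[_].
  by apply: contraTneq => ->; rewrite ltxx.
have := he z zc' ze; rewrite big_cons -/Q dE !hornerM hornerXsubC !cnM.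
by rewrite mulrCA mulrC ler_pM2l // cn_gt0 subr_eq0.
Qed.

(** Uniqueness of the remainder. *)
Lemma poly_eq0_of_bounded (cs : seq C) (d : {poly C}) :
  (size d <= size cs)%N ->
  (forall c, c \in cs -> exists b e : R, 0 < e /\
     forall z, z != c -> cn (z - c) < e ->
       cn d.[z] <= b * cn (\prod_(c <- cs) ('X - c%:P)).[z]) -> d = 0.
Proof.
move=> sd /dvd_of_bounded dv; apply/eqP; apply: contraTT dv => d0.
by apply/negP => /(dvdp_leq d0); rewrite size_prod_XsubC ltnNge sd.
Qed.

End Weierstrass.

(** * Sections of the structure sheaf of a curve *)

Section Germs.
Variable R : realType.
Local Notation C := R[i].
Implicit Types (P f g h : C * C -> C) (p q : C * C).

Lemma germ_intro P p f g h (e : R) : 0 < e ->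
  (forall q, vn (q - p) < e -> differentiable h q) ->
  (forall q, vn (q - p) < e -> f q - g q = h q * P q) ->
  germ_eqmod P p f g.
Proof.
by move=> e0 hd he; exists h; split; apply/near_vnP; exists e.
Qed.

Lemma germ_sym P p f g : germ_eqmod P p f g -> germ_eqmod P p g f.
Proof.
move=> [h [hd he]]; exists (fun q => - h q); split.
  by apply: filterS hd => q; exact: differentiableN.
by apply: filterS he => q hq; rewrite mulNr -hq opprB.
Qed.

Lemma germ_trans P p f g h :
  germ_eqmod P p f g -> germ_eqmod P p g h -> germ_eqmod P p f h.
Proof.
move=> [u [ud ue]] [v [vd ve]]; exists (fun q => u q + v q); split.
  by apply: filterS2 ud vd => q; exact: differentiableD.
apply: filterS2 ue ve => q h1 h2.
by rewrite mulrDl -h1 -h2 addrA subrK.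
Qed.

Lemma germ_bounded P p f g : germ_eqmod P p f g ->
  exists b e : R, 0 < e /\ forall q, vn (q - p) < e ->
    cn (f q - g q) <= b * cn (P q).
Proof.
move=> [h [hd /near_vnP[e1 e10 h1]]].
have dh : differentiable h p by exact: nbhs_singleton hd.
have [b b0 hb] := dif_bounded dh; have [e2 e20 h2] := dif_eps dh ltr01.
exists (cn (h p) + (b + 1) * e2), (Num.min e1 e2); split.
  by rewrite lt_min e10.
move=> q; rewrite lt_min => /andP[q1 q2].
rewrite h1 // cnM ler_wpM2r ?cn_ge0 //.
have := h2 (q - p) q2; have := hb (q - p); rewrite subrKC mul1r => H1 H2.
have -> : h q = h p + dv h p (q - p) + (h q - h p - dv h p (q - p)) by ring.
have := cnD (h p + dv h p (q - p)) (h q - h p - dv h p (q - p)).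
have := cnD (h p) (dv h p (q - p)).
have := ler_wpM2l (ltW b0) (ltW q2); lra.
Qed.

End Germs.

Section Sections.
Variables (R : realType) (k : nat).
Local Notation C := R[i].
Variables (pc : nat -> C -> C) (P : C * C -> C).
Hypothesis pcd : forall i z, differentiable (pc i) z.
Hypothesis PE : forall p, P p = p.1 ^+ k + \sum_(i < k) pc i p.2 * p.1 ^+ i.

Definition poly_fun (rho : nat -> C -> C) (q : C * C) : C :=
  \sum_(i < k) rho i q.2 * q.1 ^+ i.

Lemma dif_poly_fun (rho : nat -> C -> C) q :
  (forall i, differentiable (rho i) q.2) -> differentiable (poly_fun rho) q.
Proof.
move=> h; apply: dif_sum => i; apply: differentiableM.
  exact: dif_comp_snd.
by apply: dif_exp; exact: dif_fst.
Qed.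

Lemma P_dif p : differentiable P p.
Proof.
have -> : P = fun p => p.1 ^+ k + poly_fun pc p by apply/funext => q; rewrite PE.
apply: differentiableD; first by apply: dif_exp; exact: dif_fst.
exact: dif_poly_fun.
Qed.

Lemma fibre_roots b : exists cs : seq C,
  [/\ size cs = k, forall a, P (a, b) = \prod_(c <- cs) (a - c) &
      forall a, P (a, b) = (\prod_(c <- cs) ('X - c%:P)).[a]].
Proof.
pose q : {poly C} := 'X^k + \poly_(i < k) pc i b.
have sz : (size (\poly_(i < k) pc i b) <= k)%N by exact: size_poly.
have qm : lead_coef q = 1.
  by rewrite /q lead_coefDl ?lead_coefXn // size_polyXn ltnS.
have qE a : q.[a] = P (a, b).
  by rewrite /q hornerD hornerXn horner_poly PE.
have [cs qcs] := closed_field_poly_normal q.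
rewrite qm scale1r in qcs.
exists cs; split=> [|a|a]; last by rewrite -qcs qE.
  have : size q = k.+1 by rewrite /q size_polyDl size_polyXn // ltnS.
  by rewrite qcs size_prod_XsubC => -[].
rewrite -qE qcs horner_prod; apply: eq_bigr => c _.
by rewrite hornerXsubC.
Qed.

(** Near each root over b, taken with multiplicity, P dominates the
    difference of the two polynomials. *)
Lemma poly_fun_unique b (rho rho' : nat -> C -> C) :
  (forall a, P (a, b) = 0 ->
     germ_eqmod P (a, b) (poly_fun rho) (poly_fun rho')) ->
  forall i, (i < k)%N -> rho i b = rho' i b.
Proof.
move=> h; have [cs [scs _ PcE]] := fibre_roots b.
pose d := \poly_(i < k) (rho i b - rho' i b).
have dE a : d.[a] = poly_fun rho (a, b) - poly_fun rho' (a, b).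
  rewrite /d horner_poly /poly_fun -sumrB; apply: eq_bigr => i _.
  by rewrite mulrBl.
have d0 : d = 0.
  apply: (@poly_eq0_of_bounded _ cs); first by rewrite scs size_poly.
  move=> c ccs; have Pc : P (c, b) = 0.
    by rewrite PcE; apply/rootP; rewrite root_prod_XsubC.
  have [B [e [e0 he]]] := germ_bounded (h c Pc).
  exists B, e; split=> // z _ zc; rewrite dE -PcE; apply: he.
  by rewrite vn_pair_lt /= zc subrr cn0.
move=> i ik; apply/eqP; rewrite -subr_eq0.
by have := coef_poly k (fun i => rho i b - rho' i b) i; rewrite -/d d0 coef0 ik => <-.
Qed.

Lemma seq_radius (T : eqType) (s : seq T) (Q : T -> R -> Prop) :
  (forall x, x \in s -> exists2 r : R, 0 < r & Q x r) ->
  (forall x (r r' : R), Q x r -> 0 < r' -> r' <= r -> Q x r') ->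
  exists2 r : R, 0 < r & forall x, x \in s -> Q x r.
Proof.
move=> h mono; elim: s h => [|x s IH] h; first by exists 1.
have [r1 r10 h1] := h x (mem_head _ _).
have [|r2 r20 h2] := IH.
  by move=> y ys; apply: h; rewrite inE ys orbT.
have m0 : 0 < Num.min r1 r2 by rewrite lt_min r10.
exists (Num.min r1 r2) => // y; rewrite inE => /orP[/eqP ->|ys].
  by apply: (mono _ _ _ h1) => //; rewrite ge_min lexx.
by apply: (mono _ _ _ (h2 _ ys)) => //; rewrite ge_min lexx orbT.
Qed.

Lemma coef_close b0 (e : R) : 0 < e -> exists2 d : R, 0 < d &
  forall i b, (i < k)%N -> cn (b - b0) < d -> cn (pc i b - pc i b0) <= e.
Proof.
move=> e0.
have [||d d0 hd] := @seq_radius nat (iota 0 k)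
  (fun i d => forall b, cn (b - b0) < d -> cn (pc i b - pc i b0) <= e).
- move=> i _; have := differentiable_continuous (pcd i b0).
  move=> /(@cvgrPdist_lt _ _ _ (nbhs b0)) /(_ e%:C); rewrite ltcR => /(_ e0).
  move=> /near_vnP[d d0 hd]; exists d => // b hb.
  by have := hd b hb; rewrite normCE ltcR cnB; exact: ltW.
- move=> i r r' h r'0 rr b hb; apply: h; exact: lt_le_trans rr.
- by exists d => // i b ik; apply: hd; rewrite mem_iota.
Qed.

(** The coefficients over b are close to those over b0. Far from the roots
    over b0 the product of linear factors dominates the difference, so P has
    no zero there. *)
Lemma roots_close b0 (cs : seq C) (r m : R) : 0 < r -> 0 < m ->
  size cs = k -> (forall a, P (a, b0) = \prod_(c <- cs) (a - c)) ->
  exists2 d : R, 0 < d & forall a b, cn (b - b0) < d ->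
    (P (a, b) = 0 -> exists2 c, c \in cs & cn (a - c) < r) /\
    ((exists2 c, c \in cs & cn (a - c) < r) ->
      cn (\prod_(c <- cs) (a - c) - P (a, b)) <= m).
Proof.
move=> r0 m0 scs PcE.
pose L := \sum_(c <- cs) cn c.
have L0 : 0 <= L by apply: sumr_ge0 => c _; exact: cn_ge0.
have cL c : c \in cs -> cn c <= L.
  move=> ccs; rewrite /L (big_rem c) //= lerDl.
  by apply: sumr_ge0 => c' _; exact: cn_ge0.
have err a b (e : R) : 0 <= e -> (forall i, (i < k)%N -> cn (pc i b - pc i b0) <= e) ->
    cn (\prod_(c <- cs) (a - c) - P (a, b)) <= e * (k%:R * (1 + cn a) ^+ k).
  move=> e0 he; rewrite -PcE !PE /=.
  have -> : a ^+ k + \sum_(i < k) pc i b0 * a ^+ i -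
      (a ^+ k + \sum_(i < k) pc i b * a ^+ i) =
      \sum_(i < k) (pc i b0 - pc i b) * a ^+ i.
    by under [RHS]eq_bigr do rewrite mulrBl; rewrite sumrB; ring.
  apply: le_trans (cn_sum _ _ _) _.
  have -> : e * (k%:R * (1 + cn a) ^+ k) = \sum_(i < k) e * (1 + cn a) ^+ k.
    by rewrite sumr_const card_ord -[RHS]mulr_natl; ring.
  apply: ler_sum => i _; rewrite cnM cnX cnB; apply: ler_pM.
  - exact: cn_ge0.
  - by rewrite exprn_ge0 // cn_ge0.
  - exact: he.
  - apply: (@le_trans _ _ ((1 + cn a) ^+ i)).
      by rewrite lerXn2r ?nnegrE ?addr_ge0 ?cn_ge0 // lerDr.
    by rewrite ler_weXn2l ?lerDl ?cn_ge0 // ltnW.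
pose G1 := k%:R * (1 + (r + L)) ^+ k.
pose G := 1 + (L + 1) / r.
pose G2 := k%:R * G ^+ k.
have G0 : 0 <= G by rewrite addr_ge0 // divr_ge0 ?addr_ge0 // ltW.
have G10 : 0 <= G1 by rewrite mulr_ge0 // exprn_ge0 // !addr_ge0 // ltW.
have G20 : 0 <= G2 by rewrite mulr_ge0 // exprn_ge0.
pose e := Num.min (m / (G1 + 1)) (2^-1 / (G2 + 1)).
have e0 : 0 < e by rewrite lt_min !divr_gt0 // ltr_wpDl.
have eG1 : e * G1 <= m.
  have : e * (G1 + 1) <= m by rewrite -ler_pdivlMr ?ltr_wpDl // ge_min lexx.
  lra.
have eG2 : e * G2 <= 2^-1.
  have : e * (G2 + 1) <= 2^-1.
    by rewrite -ler_pdivlMr ?ltr_wpDl // ge_min lexx orbT.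
  lra.
have [d d0 hd] := coef_close b0 e0; exists d => // a b hb.
have he := err a b e (ltW e0) (fun i ik => hd i b ik hb).
split; last first.
  move=> [c ccs hc]; apply: le_trans he _.
  apply: le_trans eG1; rewrite ler_wpM2l ?(ltW e0) // ler_wpM2l //.
  rewrite lerXn2r ?nnegrE ?addr_ge0 ?cn_ge0 // ?(ltW r0) // lerD2l.
  by have := cn_subr a c; have := cL c ccs; lra.
move=> Pab; apply: contrapT => far.
have farc c : c \in cs -> r <= cn (a - c).
  by move=> ccs; rewrite leNgt; apply/negP => hc; apply: far; exists c.
have prodE : \prod_(c <- cs) (a - c) - P (a, b) = \prod_(c <- cs) (a - c).
  by rewrite Pab subr0.
rewrite prodE in he.
have low : (1 + cn a) ^+ k <= G ^+ k * cn (\prod_(c <- cs) (a - c)).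
  rewrite -scs; elim: (cs) farc cL => [|c s IH] fc cl.
    by rewrite big_nil !expr0 mul1r cn1.
  rewrite big_cons cnM /= !exprS.
  have h1 : 1 + cn a <= G * cn (a - c).
    have rc := fc c (mem_head _ _); have lc := cl c (mem_head _ _).
    have : (L + 1) <= (L + 1) / r * cn (a - c).
      by rewrite mulrAC ler_pdivlMr // ler_wpM2l // addr_ge0.
    by have := cn_subr a c; rewrite /G; lra.
  have h2 : (1 + cn a) ^+ size s <= G ^+ size s * cn (\prod_(c <- s) (a - c)).
    by apply: IH => c' c's; [apply: fc | apply: cl]; rewrite inE c's orbT.
  rewrite mulrACA; apply: ler_pM => //.
    by rewrite addr_ge0 // cn_ge0.
  by rewrite exprn_ge0 // addr_ge0 // cn_ge0.
have pp : 0 < cn (\prod_(c <- cs) (a - c)).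
  rewrite cn_gt0 prodf_seq_neq0; apply/allP => c ccs /=.
  by rewrite -cn_gt0; apply: lt_le_trans (farc c ccs).
have : cn (\prod_(c <- cs) (a - c)) <= 2^-1 * cn (\prod_(c <- cs) (a - c)).
  apply: le_trans he _; apply: (@le_trans _ _ (e * G2 * cn (\prod_(c <- cs) (a - c)))).
    by rewrite /G2 -!mulrA ler_wpM2l ?(ltW e0) // ler_wpM2l.
  by rewrite ler_wpM2r // ltW.
lra.
Qed.

(** The representatives of s at the points of the fibre over b0 together
    form one function f on a union of disjoint discs around these points;
    division by P replaces f by a polynomial. *)
Lemma local_section s b0 : Osection P s ->
  exists (rho : nat -> C -> C) (d : R), [/\ 0 < d,
    forall i b, cn (b - b0) < d -> differentiable (rho i) b &
    forall p, cn (p.2 - b0) < d -> P p = 0 ->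
      germ_eqmod P p (s p) (poly_fun rho)].
Proof.
move=> Os; have [cs [scs PcE PrE]] := fibre_roots b0.
have Pcs c : c \in cs -> P (c, b0) = 0.
  by move=> h; rewrite PrE; apply/rootP; rewrite root_prod_XsubC.
have [r r0 hr] : exists2 r : R, 0 < r & forall c, c \in cs ->
  [/\ forall q, vn (q - (c, b0)) < r -> differentiable (s (c, b0)) q,
      forall q, vn (q - (c, b0)) < r -> P q = 0 ->
        germ_eqmod P q (s q) (s (c, b0)),
      forall q, vn (q - (c, b0)) < r -> cn (s (c, b0) q) <=
         cn (s (c, b0) (c, b0)) + 1 &
      forall c', c' \in cs -> c' != c -> 2 * r <= cn (c' - c)].
  apply: seq_radius; last first.
    move=> c r r' [h1 h2 h3 h4] r'0 rr; split=> *.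
    - by apply: h1; apply: lt_le_trans rr.
    - by apply: h2 => //; apply: lt_le_trans rr.
    - by apply: h3; apply: lt_le_trans rr.
    - by apply: le_trans (h4 _ _ _) => //; rewrite ler_pM2l.
  move=> c ccs; have [/near_vnP[e1 e10 h1] /near_vnP[e2 e20 h2]] := Os _ (Pcs c ccs).
  have dc : differentiable (s (c, b0)) (c, b0).
    by apply: h1; rewrite subrr vn0.
  have := differentiable_continuous dc.
  move=> /(@cvgrPdist_lt _ _ _ (nbhs (c, b0))) /(_ 1 ltr01).
  move=> /near_vnP[e3 e30 h3].
  have [e4 e40 h4] : exists2 e : R, 0 < e & forall c', c' \in cs ->
      c' != c -> 2 * e <= cn (c' - c).
    apply: (@seq_radius _ cs (fun c' e => c' != c -> 2 * e <= cn (c' - c))).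
      move=> c' _; have [->|cc] := eqVneq c' c; first by exists 1.
      exists (cn (c' - c) / 2) => [|_]; last lra.
      by rewrite divr_gt0 // cn_gt0 subr_eq0.
    by move=> c' e e' h e'0 ee /h; lra.
  exists (Num.min (Num.min e1 e2) (Num.min e3 e4)).
    by rewrite !lt_min e10 e20 e30.
  split=> [q|q|q|c' c'cs cc].
  - by rewrite !lt_min => /andP[/andP[/h1]].
  - by rewrite !lt_min => /andP[/andP[_ /h2]].
  - rewrite !lt_min => /andP[_ /andP[/h3 h _]].
    move: h; rewrite normCE -[1]/(1%:C) ltcR => h.
    by have := cn_subr (s (c, b0) q) (s (c, b0) (c, b0)); rewrite cnB; lra.
  - have := h4 c' c'cs cc; have : Num.min (Num.min e1 e2) (Num.min e3 e4) <= e4.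
      by rewrite !ge_min lexx !orbT.
    lra.
pose U a := exists2 c, c \in cs & cn (a - c) < r.
have Uo : opened U.
  move=> a [c ccs hc]; exists (r - cn (a - c)); first lra.
  by move=> a' ha; exists c => //; have := cn_dist a' a c; lra.
have uniq_c a c c' : c \in cs -> c' \in cs -> cn (a - c) < r ->
    cn (a - c') < r -> c' = c.
  move=> ccs ccs' h h'; apply/eqP; apply: contraT => cc.
  have [_ _ _ h4] := hr c ccs; have := h4 c' ccs' cc.
  by have := cn_dist c' a c; rewrite (cnB c' a); lra.
(* the root over b0 whose disc contains a *)
pose ctr a := nth 0 cs (find (fun c => cn (a - c) < r) cs).
have ctrP a c : c \in cs -> cn (a - c) < r -> ctr a = c.
  move=> ccs h; have hs : has (fun c => cn (a - c) < r) cs by apply/hasP; exists c.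
  apply: (uniq_c a) => //; last exact: (nth_find 0 hs).
  by rewrite mem_nth // -has_find.
have hU c : c \in cs -> forall a, cn (a - c) < r -> U a by move=> ccs a h; exists c.
pose f q := s (ctr q.1, b0) q.
pose B := \sum_(c <- cs) (cn (s (c, b0) (c, b0)) + 1).
have B0 : 0 <= B by apply: sumr_ge0 => c _; rewrite addr_ge0 // cn_ge0.
have [M M0 div] := divide_list r0 hU.
pose m : R := 2^-1 / (M + 1).
have m0 : 0 < m by rewrite divr_gt0 // ltr_wpDl.
have [d' d'0 hd'] := roots_close r0 m0 scs PcE.
pose d := Num.min d' r; have d0 : 0 < d by rewrite lt_min d'0.
pose D b := cn (b - b0) < d.
have Do : opened D.
  move=> b hb; exists (d - cn (b - b0)); first by rewrite subr_gt0.
  by move=> b' h; have := cn_dist b' b b0; rewrite /D; lra.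
have dr b : D b -> cn (b - b0) < r by rewrite /D lt_min => /andP[].
have dd' b : D b -> cn (b - b0) < d' by rewrite /D lt_min => /andP[].
have inr a b c : cn (a - c) < r -> D b -> vn ((a, b) - (c, b0)) < r.
  by move=> h /dr Db; rewrite vn_pair_lt /= h.
have fs c a b : c \in cs -> cn (a - c) < r -> 
    exists2 e : R, 0 < e & forall q, vn (q - (a, b)) < e -> s (c, b0) q = f q.
  move=> ccs h; exists (r - cn (a - c)); first by rewrite subr_gt0.
  move=> q; rewrite vn_pair_lt /= => /andP[h1 _]; rewrite /f (ctrP q.1 c) //.
  by have := cn_dist q.1 a c; lra.
have fd a b : U a -> D b -> differentiable f (a, b).
  move=> [c ccs h] Db; have [h1 _ _ _] := hr c ccs.
  apply: (@dif_near _ _ (s (c, b0))); first exact/near_vnP/fs.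
  apply: h1; exact: inr.
have fB a b : U a -> D b -> cn (f (a, b)) <= B.
  move=> [c ccs h] Db; have [_ _ h3 _] := hr c ccs.
  rewrite /f (ctrP a c) //; apply: le_trans (h3 _ (inr _ _ _ h Db)) _.
  rewrite /B (big_rem c) //= lerDl.
  by apply: sumr_ge0 => c' _; rewrite addr_ge0 // cn_ge0.
have Pd a b : U a -> D b -> differentiable P (a, b) by move=> _ _; exact: P_dif.
have Pc a b : U a -> D b -> cn (\prod_(c <- cs) (a - c) - P (a, b)) * M <= 2^-1.
  move=> Ua Db; have h := (hd' a b (dd' b Db)).2 Ua.
  apply: (le_trans (ler_wpM2r M0 h)); rewrite /m mulrAC ler_pdivrMr ?ltr_wpDl //.
  lra.
have [rho [H [rd Hd fE]]] :=
  weierstrass_division Uo Do (div D Do) M0 B0 Pd Pc fd fB.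
exists rho, d; split=> // -[a b] /= hb Pab.
have [c ccs hc] := (hd' a b (dd' b hb)).1 Pab.
have [_ h2 _ _] := hr c ccs.
apply: germ_trans (h2 _ (inr _ _ _ hc hb) Pab) _.
pose e := Num.min (r - cn (a - c)) (d - cn (b - b0)).
have e0 : 0 < e by rewrite lt_min !subr_gt0 hc.
have near_ab q : vn (q - (a, b)) < e -> cn (q.1 - c) < r /\ D q.2.
  rewrite vn_pair_lt /= !lt_min => /andP[/andP[q1 _] /andP[_ q2]].
  by have := cn_dist q.1 a c; have := cn_dist q.2 b b0; rewrite /D; split; lra.
apply: (@germ_intro _ P (a, b) _ _ H e) => //.
  by move=> [x y] /near_ab [/= h Dy]; apply: Hd => //; exists c.
move=> [x y] /near_ab [/= h Dy].
have := fE x y (hU c ccs x h) Dy; rewrite /f /= (ctrP x c) // => ->.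
by rewrite /poly_fun scs addrC addKr mulrC.
Qed.

(** The local polynomials agree on overlaps by uniqueness, so their
    coefficients glue to entire functions. *)
Theorem section_poly s : Osection P s -> exists rho : nat -> C -> C,
  (forall i z, differentiable (rho i) z) /\
  forall p, P p = 0 -> germ_eqmod P p (s p) (poly_fun rho).
Proof.
move=> Os.
have loc b := cid (local_section b Os).
have loc2 b := cid (svalP (loc b)).
pose lrho b := sval (loc b); pose d b := sval (loc2 b).
have hl b : [/\ 0 < d b,
    forall i b', cn (b' - b) < d b -> differentiable (lrho b i) b' &
    forall p, cn (p.2 - b) < d b -> P p = 0 ->
      germ_eqmod P p (s p) (poly_fun (lrho b))] by exact: svalP (loc2 b).
pose rho i b := if (i < k)%N then lrho b i b else 0.
have agree b b' i : cn (b' - b) < d b -> (i < k)%N -> rho i b' = lrho b i b'.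
  move=> hb ik; rewrite /rho ik; apply: poly_fun_unique ik => a Pa.
  have [_ _ h1] := hl b; have [d0 _ h2] := hl b'.
  apply: germ_trans (germ_sym (h2 (a, b') _ Pa)) (h1 (a, b') hb Pa).
  by rewrite /= subrr cn0.
exists rho; split=> [i b|[a b] Pp].
  have [ik|ik] := ltnP i k; last first.
    have -> : rho i = cst 0 by apply/funext => x; rewrite /rho ltnNge ik.
    exact: differentiable_cst.
  have [d0 h _] := hl b.
  apply: (@dif_near _ _ (lrho b i)); last by apply: h; rewrite subrr cn0.
  by apply/near_vnP; exists (d b) => // x hx; rewrite (agree b x i hx ik).
have [d0 _ h] := hl b.
apply: germ_trans (h (a, b) _ Pp) _; first by rewrite /= subrr cn0.
apply: (@germ_intro _ _ _ _ _ (fun=> 0) (d b)) => // -[x y].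
rewrite vn_pair_lt /= => /andP[_ hy].
rewrite mul0r /poly_fun -sumrB big1 // => i _ /=.
by rewrite (agree b y) // subrr.
Qed.

End Sections.

(** * Krylov matrices and cyclic vectors *)

Section CyclicVectors.
Variables (F : fieldType) (n : nat).
Implicit Types (a : F) (M G X : 'M[F]_n.+1) (v : 'cV[F]_n.+1) (b : 'cV[F]_n.+1).

Definition krylov M v : 'M[F]_n.+1 := \matrix_(i, j) (M ^+ j *m v) i 0.

Definition cyclic M v := krylov M v \in unitmx.

(** The polynomial in M with coefficient vector b; pmxE is the reason for
    using a column. *)
Definition pmx M b : 'M[F]_n.+1 := \sum_(j < n.+1) b j 0 *: M ^+ j.

Lemma mulmx_intertwine m p (G : 'M[F]_(m.+1, p.+1)) (M : 'M[F]_p.+1) (M' : 'M[F]_m.+1) j :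
  G *m M = M' *m G -> G *m M ^+ j = M' ^+ j *m G.
Proof.
move=> GM; elim: j => [|j IH]; first by rewrite !expr0 mulmx1 mul1mx.
rewrite !exprS -[M * _]/(M *m _) -[M' * _]/(M' *m _) mulmxA GM -!mulmxA.
by rewrite IH.
Qed.

Lemma expmxZ a M m : (a *: M) ^+ m = a ^+ m *: M ^+ m.
Proof.
elim: m => [|m IH]; first by rewrite !expr0 scale1r.
rewrite !exprS IH -[RHS]scalerA -[(a *: M) * _]/((a *: M) *m _).
by rewrite -scalemxAl -scalemxAr.
Qed.

Lemma krylov_col M v (j : 'I_n.+1) : col j (krylov M v) = M ^+ j *m v.
Proof. by apply/matrixP => i l; rewrite ord1 !mxE. Qed.

Lemma krylov_mul G M M' v : G *m M = M' *m G ->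
  G *m krylov M v = krylov M' (G *m v).
Proof.
move=> GM; apply/matrixP => i j.
have := congr1 (fun u : 'cV_n.+1 => u i 0) (krylov_col M' (G *m v) j).
rewrite mxE => ->; rewrite mulmxA -(mulmx_intertwine j GM) -mulmxA -krylov_col.
by rewrite !mxE; apply: eq_bigr => l _; rewrite !mxE.
Qed.

Lemma cyclic_conj G M M' v : G \in unitmx -> G *m M = M' *m G ->
  cyclic M v -> cyclic M' (G *m v).
Proof. by move=> uG GM cv; rewrite /cyclic -(krylov_mul v GM) unitmx_mul uG. Qed.

Lemma cyclic_kill X M v : X *m M = M *m X -> cyclic M v -> X *m v = 0 -> X = 0.
Proof.
move=> XM cv Xv; have := krylov_mul v XM; rewrite Xv => h.
have h0 : krylov M 0 = 0.
  by apply/matrixP => i j; rewrite mxE mulmx0 !mxE.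
by rewrite -(mulmxK cv X) h h0 mul0mx.
Qed.

Lemma pmxE M b v : pmx M b *m v = krylov M v *m b.
Proof.
rewrite /pmx mulmx_suml; apply/matrixP => i j; rewrite ord1 summxE !mxE.
by apply: eq_bigr => l _; rewrite -scalemxAl !mxE mulrC.
Qed.

Lemma pmx_comm M b : pmx M b *m M = M *m pmx M b.
Proof.
rewrite /pmx mulmx_suml mulmx_sumr; apply: eq_bigr => l _.
by rewrite -scalemxAl -scalemxAr (mulmx_intertwine (M' := M)).
Qed.

Lemma pmx_commr M b X : X *m M = M *m X -> X *m pmx M b = pmx M b *m X.
Proof.
move=> h; rewrite /pmx mulmx_suml mulmx_sumr; apply: eq_bigr => l _.
by rewrite -scalemxAl -scalemxAr (mulmx_intertwine _ h).
Qed.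

Lemma char_poly_detE M a :
  \det (a%:M - M) = a ^+ n.+1 + \sum_(i < n.+1) (char_poly M)`_i * a ^+ i.
Proof.
have -> : \det (a%:M - M) = (char_poly M).[a].
  rewrite /char_poly -[_.[a]]/(horner_eval a _) -det_map_mx; congr (\det _).
  apply/matrixP => i j; rewrite !mxE.
  by rewrite (rmorphB (horner_eval a)) /= rmorphMn /= /horner_eval hornerX hornerC.
rewrite horner_coef size_char_poly big_ord_recr /= addrC; congr (_ + _).
have := char_poly_monic M; rewrite monicE lead_coefE size_char_poly => /eqP ->.
by rewrite mul1r.
Qed.

Lemma cayley_hamilton_pow M :
  M ^+ n.+1 = - \sum_(i < n.+1) (char_poly M)`_i *: M ^+ i.
Proof.
apply/eqP; rewrite -addr_eq0; apply/eqP; rewrite -[RHS](Cayley_Hamilton M).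
rewrite -[char_poly M in RHS]coefK poly_def size_char_poly linear_sum /=.
rewrite [RHS]big_ord_recr /= [RHS]addrC; congr (_ + _); last first.
  by apply: eq_bigr => i _; rewrite linearZ /= rmorphXn /= horner_mx_X.
have := char_poly_monic M; rewrite monicE lead_coefE size_char_poly => /eqP ->.
by rewrite scale1r rmorphXn /= horner_mx_X.
Qed.

(** Evaluation at a of the coordinates in the basis v, M v, ..., M^n v is a left
    eigenvector of M modulo the characteristic polynomial. It realises the
    cokernel of a - M as the quotient ring by that polynomial. *)
Lemma krylov_row M v a : cyclic M v ->
  (\row_(j < n.+1) a ^+ j) *m invmx (krylov M v) *m (a%:M - M) =
  \det (a%:M - M) *: (delta_mx 0 ord_max *m invmx (krylov M v)).
Proof.
move=> cv; set K := krylov M v.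
suff h : \row_(j < n.+1) a ^+ j *m invmx K *m (a%:M - M) *m K =
         \det (a%:M - M) *: delta_mx 0 ord_max.
  by rewrite -(mulmxK cv (_ *m (a%:M - M))) h -scalemxAl.
(* the companion matrix of the characteristic polynomial *)
pose S : 'M[F]_n.+1 := \matrix_(i, j)
  (if j == ord_max then - (char_poly M)`_i else (i == j.+1 :> nat)%:R).
have MK : M *m K = K *m S.
  apply/matrixP => i j.
  have -> : (M *m K) i j = (M ^+ j.+1 *m v) i 0.
    rewrite exprS -mulmxA -krylov_col !mxE.
    by apply: eq_bigr => l _; rewrite !mxE.
  have -> : (K *m S) i j = \sum_l K i l * S l j by rewrite mxE.
  have [->|jn] := eqVneq j ord_max.
    rewrite cayley_hamilton_pow mulNmx mulmx_suml mxE summxE -sumrN.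
    apply: eq_bigr => l _; rewrite -scalemxAl !mxE eqxx.
    by rewrite mulrN mulrC.
  have jn' : (j.+1 < n.+1)%N.
    by rewrite ltnS ltn_neqAle -ltnS ltn_ord andbT; apply: contra jn => /eqP h;
      apply/eqP/val_inj.
  rewrite (bigD1 (Ordinal jn')) //= !mxE (negbTE jn) eqxx mulr1.
  rewrite [X in _ + X]big1 ?addr0 // => l lj; rewrite !mxE (negbTE jn).
  case: eqP => [h|_]; last by rewrite mulr0.
  by move: lj; rewrite -val_eqE /= h eqxx.
rewrite -mulmxA mulmxBl mul_scalar_mx MK.
have -> : a *: K - K *m S = K *m (a%:M - S) by rewrite mulmxBr mul_mx_scalar.
rewrite mulmxA mulmxKV // mulmxBr mul_mx_scalar.
apply/matrixP => i j; rewrite ord1 !mxE /= char_poly_detE.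
have [->|jn] := eqVneq j ord_max; last first.
  have jn' : (j.+1 < n.+1)%N.
    by rewrite ltnS ltn_neqAle -ltnS ltn_ord andbT; apply: contra jn => /eqP h;
      apply/eqP/val_inj.
  rewrite (bigD1 (Ordinal jn')) //= !mxE (negbTE jn) eqxx mulr1.
  rewrite [X in _ - (_ + X)]big1 ?addr0 => [|l lj]; first by rewrite /= -exprS subrr mulr0.
  rewrite !mxE (negbTE jn); case: eqP => [h|_]; last by rewrite mulr0.
  by move: lj; rewrite -val_eqE /= h eqxx.
rewrite mulr1 -exprS; congr (_ + _); rewrite -sumrN; apply: eq_bigr => l _.
by rewrite !mxE eqxx mulrN opprK mulrC.
Qed.

End CyclicVectors.

Section HolomorphicMatrices.
Variable R : realType.
Local Notation C := R[i].

Section Pointwise.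
Variables (V : normedModType C) (q : V).

Definition dmx m p (F : V -> 'M[C]_(m, p)) :=
  forall i j, differentiable (fun x => F x i j) q.

Lemma dif_bigsum (I : Type) (r : seq I) (P : pred I) (f : I -> V -> C) :
  (forall i, differentiable (f i) q) ->
  differentiable (fun x => \sum_(i <- r | P i) f i x) q.
Proof.
move=> h; elim: r => [|i r IH].
  have -> : (fun x => \sum_(i <- [::] | P i) f i x) = cst 0.
    by apply/funext => x; rewrite big_nil.
  exact: differentiable_cst.
have -> : (fun x => \sum_(j <- i :: r | P j) f j x) =
   (fun x => (if P i then f i x else 0) + \sum_(j <- r | P j) f j x).
  by apply/funext => x; rewrite big_cons; case: ifP => // _; rewrite add0r.
apply: differentiableD => //; case: (P i) => //; exact: differentiable_cst.
Qed.

Lemma dmx_cst m p (M : 'M[C]_(m, p)) : dmx (fun=> M).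
Proof. by move=> i j; exact: differentiable_cst. Qed.

Lemma dmx_eq m p (F G : V -> 'M[C]_(m, p)) : F =1 G -> dmx F -> dmx G.
Proof. by move=> /funext ->. Qed.

Lemma dmxD m p (F G : V -> 'M[C]_(m, p)) : dmx F -> dmx G ->
  dmx (fun x => F x + G x).
Proof.
move=> hF hG i j; have -> : (fun x => (F x + G x) i j) = (fun x => F x i j + G x i j).
  by apply/funext => x; rewrite mxE.
exact: differentiableD.
Qed.

Lemma dmxZ m p (f : V -> C) (F : V -> 'M[C]_(m, p)) : differentiable f q -> dmx F ->
  dmx (fun x => f x *: F x).
Proof.
move=> hf hF i j; have -> : (fun x => (f x *: F x) i j) = (fun x => f x * F x i j).
  by apply/funext => x; rewrite mxE.
exact: differentiableM.
Qed.

Lemma dmxM m p l (F : V -> 'M[C]_(m, p)) (G : V -> 'M[C]_(p, l)) :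
  dmx F -> dmx G -> dmx (fun x => F x *m G x).
Proof.
move=> hF hG i j.
have -> : (fun x => (F x *m G x) i j) = (fun x => \sum_l F x i l * G x l j).
  by apply/funext => x; rewrite mxE.
by apply: dif_bigsum => s; exact: differentiableM.
Qed.

Lemma dmxX m (F : V -> 'M[C]_m.+1) k : dmx F -> dmx (fun x => F x ^+ k).
Proof.
move=> hF; elim: k => [|k IH].
  by apply: dmx_eq (dmx_cst 1) => x; rewrite expr0.
by apply: dmx_eq (dmxM hF IH) => x; rewrite exprS.
Qed.

Lemma dif_det m (F : V -> 'M[C]_m) : dmx F -> differentiable (fun x => \det (F x)) q.
Proof.
move=> hF; apply: dif_bigsum => s; apply: differentiableM.
  exact: differentiable_cst.
by apply: dif_prod => i; exact: hF.
Qed.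

Lemma dmx_adj m (F : V -> 'M[C]_m) : dmx F -> dmx (fun x => \adj (F x)).
Proof.
move=> hF i j.
have -> : (fun x => (\adj (F x)) i j) =
   (fun x => (-1) ^+ (j + i) * \det (row' j (col' i (F x)))).
  by apply/funext => x; rewrite mxE.
apply: differentiableM; first exact: differentiable_cst.
apply: dif_det => a b.
have -> : (fun x => row' j (col' i (F x)) a b) =
          (fun x => F x (lift j a) (lift i b)).
  by apply/funext => x; rewrite !mxE.
exact: hF.
Qed.

Lemma dmx_inv m (F : V -> 'M[C]_m) : dmx F -> (forall x, F x \in unitmx) ->
  dmx (fun x => invmx (F x)).
Proof.
move=> hF uF; apply: (@dmx_eq _ _ (fun x => (\det (F x))^-1 *: \adj (F x))).
  by move=> x; rewrite /invmx uF.
apply: dmxZ; last exact: dmx_adj.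
apply: differentiableV; first exact: dif_det.
by have := uF q; rewrite unitmxE unitfE.
Qed.

Lemma dmx_krylov m (M : V -> 'M[C]_m.+1) (v : V -> 'cV[C]_m.+1) :
  dmx M -> dmx v -> dmx (fun x => krylov (M x) (v x)).
Proof.
move=> hM hv i j.
have -> : (fun x => krylov (M x) (v x) i j) = (fun x => (M x ^+ j *m v x) i 0).
  by apply/funext => x; rewrite mxE.
exact: (dmxM (dmxX j hM) hv).
Qed.

End Pointwise.

Lemma dmx_snd m p (F : C -> 'M[C]_(m, p)) (q : C * C) : dmx q.2 F ->
  dmx q (fun x => F x.2).
Proof.
by move=> hF i j; exact: (@dif_comp_snd R (fun z => F z i j) q (hF i j)).
Qed.

Definition entire m p (F : C -> 'M[C]_(m, p)) := forall z, dmx z F.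

(** This is how congruences modulo P are proved: by an identity of matrices
    at every point, with no reference to the multiplicities of the
    eigenvalues. *)
Lemma germ_vanish n (A : C -> 'M[C]_n.+1) (v : C -> 'cV[C]_n.+1)
    (P F : C * C -> C) (G : C * C -> 'M[C]_n.+1) p (e : R) :
  (forall q, P q = \det (q.1%:M - A q.2)) ->
  entire A -> entire v -> (forall z, cyclic (A z) (v z)) -> 0 < e ->
  (forall q, vn (q - p) < e -> dmx q G) ->
  (forall q, vn (q - p) < e -> (F q)%:M = (q.1%:M - A q.2) *m G q) ->
  germ_eqmod P p F (fun=> 0).
Proof.
move=> PE Ae ve cv e0 Gd FG.
pose K z := krylov (A z) (v z).
have Ke : entire K by move=> z; exact: dmx_krylov.
have Kie : entire (fun z => invmx (K z)) by move=> z; apply: dmx_inv.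
pose h q := ((delta_mx 0 ord_max : 'rV_n.+1) *m invmx (K q.2) *m (G q *m v q.2)) 0 0.
apply: (@germ_intro _ P p _ _ h e e0).
  move=> q hq; suff : dmx q (fun q : C * C =>
    (delta_mx 0 ord_max : 'rV_n.+1) *m invmx (K q.2) *m (G q *m v q.2)) by apply.
  apply: dmxM.
    apply: dmxM; first exact: dmx_cst.
    exact: (@dmx_snd _ _ (fun z => invmx (K z))).
  by apply: dmxM; [exact: Gd | exact: dmx_snd].
move=> q hq; rewrite subr0 /h.
(* the left eigenvector of krylov_row; it takes the value 1 on v, so
   applying it to F v = (eta - A) G v exhibits F as a multiple of P *)
pose phi := (\row_(j < n.+1) q.1 ^+ j) *m invmx (K q.2).
have phiv : phi *m v q.2 = 1%:M.
  have vE : v q.2 = K q.2 *m delta_mx ord0 0.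
    by rewrite -colE krylov_col expr0 mul1mx.
  rewrite vE.
  rewrite /phi mulmxA mulmxKV; last exact: cv.
  apply/matrixP => i j; rewrite !ord1 !mxE (bigD1 ord0) //= !mxE !eqxx mulr1.
  by rewrite big1 ?addr0 ?expr0 // => l l0; rewrite !mxE (negbTE l0) mulr0.
have : phi *m (F q)%:M *m v q.2 = (F q)%:M.
  by rewrite -mulmxA mul_scalar_mx -scalemxAr phiv scalemx1.
rewrite FG // mulmxA /phi krylov_row; last exact: cv.
rewrite -!scalemxAl -PE -mulmxA => /matrixP /(_ 0 0).
by rewrite [LHS]mxE [RHS]mxE eqxx mulr1n mulrC => <-.
Qed.

End HolomorphicMatrices.

(** * Power series and derivatives in a real variable *)

Section Convergence.
Variable R : realType.
Local Notation C := R[i].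
Implicit Types (u v c : nat -> C) (a b l z : C).

Definition conv u l := forall e : R, 0 < e ->
  exists N, forall n, (N <= n)%N -> cn (u n - l) <= e.

Lemma conv_unique u l l' : conv u l -> conv u l' -> l = l'.
Proof.
move=> h h'; apply/eqP; rewrite -subr_eq0; apply/eqP/cn_eps0 => e e0.
have e2 : 0 < e / 2 by lra.
have [N hN] := h _ e2; have [N' hN'] := h' _ e2.
have := hN _ (leq_maxl N N'); have := hN' _ (leq_maxr N N').
by have := cn_dist l (u (maxn N N')) l'; rewrite (cnB l (u _)); lra.
Qed.

Lemma eq_conv u v l : u =1 v -> conv u l -> conv v l.
Proof. by move=> /funext ->. Qed.

Lemma conv_cst l : conv (fun=> l) l.
Proof. by move=> e e0; exists 0%N => n _; rewrite subrr cn0 ltW. Qed.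

Lemma convD u v l l' : conv u l -> conv v l' ->
  conv (fun n => u n + v n) (l + l').
Proof.
move=> h h' e e0; have e2 : 0 < e / 2 by lra.
have [N hN] := h _ e2; have [N' hN'] := h' _ e2.
exists (maxn N N') => n; rewrite geq_max => /andP[/hN H /hN' H'].
have -> : u n + v n - (l + l') = (u n - l) + (v n - l') by ring.
by apply: le_trans (cnD _ _) _; lra.
Qed.

Lemma convZ a u l : conv u l -> conv (fun n => a * u n) (a * l).
Proof.
move=> h e e0; have a0 : 0 < cn a + 1 by rewrite ltr_wpDl ?cn_ge0.
have [N hN] := h _ (divr_gt0 e0 a0); exists N => n /hN H.
rewrite -mulrBr cnM.
apply: (@le_trans _ _ ((cn a + 1) * (e / (cn a + 1)))).
  by apply: ler_pM; rewrite ?cn_ge0 //; lra.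
by rewrite mulrC divfK // gt_eqF.
Qed.

Lemma conv_sum (I : Type) (r : seq I) (P : pred I) (F : I -> nat -> C) (L : I -> C) :
  (forall i, conv (F i) (L i)) ->
  conv (fun n => \sum_(i <- r | P i) F i n) (\sum_(i <- r | P i) L i).
Proof.
move=> h; elim: r => [|i r IH].
  by apply: (@eq_conv (fun=> 0)) => [n|]; rewrite big_nil //; exact: conv_cst.
apply: (@eq_conv (fun n => (if P i then F i n else 0) + \sum_(j <- r | P j) F j n)).
  by move=> n; rewrite big_cons; case: (P i) => //; rewrite add0r.
rewrite big_cons; have [Pi|Pi] := boolP (P i); first exact: convD.
by apply: (@eq_conv (fun n => \sum_(j <- r | P j) F j n)) => // n; rewrite add0r.
Qed.

Lemma conv_shift u l : conv u l -> conv (fun n => u n.+1) l.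
Proof.
by move=> h e /h[N hN]; exists N => n Nn; apply: hN; exact: leqW.
Qed.

Lemma conv_rate u l (K : R) : 0 <= K -> (forall n, cn (u n - l) <= K * 2^-1 ^+ n) ->
  conv u l.
Proof.
move=> K0 h e e0; have [N hN] := half_mul_small_all K0 e0.
by exists N => n /hN; apply: le_trans.
Qed.

Definition psum (c : nat -> C) (z : C) : C :=
  if pselect (exists l, conv (fun n => \sum_(i < n) c i * z ^+ i) l) is left h
  then sval (cid h) else 0.

Lemma psumE c z l : conv (fun n => \sum_(i < n) c i * z ^+ i) l -> psum c z = l.
Proof.
move=> h; rewrite /psum; case: pselect => [ex|nex]; last by case: nex; exists l.
exact: conv_unique (svalP (cid ex)) h.
Qed.

(** With such a bound the partial sums converge geometrically on the disc of
    radius s/2, the only one where sums are taken. *)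
Definition geo_bound (c : nat -> C) (s K : R) := forall n, cn (c n) * s ^+ n <= K.

Lemma geo_bound_ge0 c s K : geo_bound c s K -> 0 <= K.
Proof.
by move=> /(_ 0%N); rewrite expr0 mulr1; exact: le_trans (cn_ge0 _).
Qed.

Lemma geo_bound_term c s K z n (t : R) : 0 < s -> 0 <= t ->
  geo_bound c s K -> cn z <= t * s -> cn (c n * z ^+ n) <= K * t ^+ n.
Proof.
move=> s0 t0 h hz; rewrite cnM cnX.
apply: (@le_trans _ _ (cn (c n) * (t * s) ^+ n)).
  by rewrite ler_wpM2l ?cn_ge0 // lerXn2r ?nnegrE ?cn_ge0 // mulr_ge0 // ltW.
by rewrite exprMn mulrCA mulrC ler_wpM2r ?exprn_ge0.
Qed.

Lemma psum_rate c s K z : 0 < s -> geo_bound c s K -> cn z <= 2^-1 * s ->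
  forall n, cn (\sum_(i < n) c i * z ^+ i - psum c z) <= 4 * K * 2^-1 ^+ n.
Proof.
move=> s0 h hz.
have step n : cn (\sum_(i < n.+1) c i * z ^+ i - \sum_(i < n) c i * z ^+ i) <=
    K * 2^-1 ^+ n.
  rewrite big_ord_recr /= (addrC (\sum_(i < n) c i * z ^+ i)) addrK.
  by apply: geo_bound_term h hz => //; lra.
have [l hl] := geo_limitC step.
have -> : psum c z = l.
  apply: psumE; apply: (@conv_rate _ _ (4 * K)).
    by rewrite mulr_ge0 // (geo_bound_ge0 h).
  by move=> n; rewrite cnB.
by move=> n; rewrite cnB.
Qed.

Lemma psum_conv c s K z : 0 < s -> geo_bound c s K -> cn z <= 2^-1 * s ->
  conv (fun n => \sum_(i < n) c i * z ^+ i) (psum c z).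
Proof.
move=> s0 h hz; apply: (@conv_rate _ _ (4 * K)); last exact: psum_rate h hz.
by rewrite mulr_ge0 // (geo_bound_ge0 h).
Qed.

End Convergence.

Section Derivatives.
Variables (R : realType) (V : normedModType R[i]).
Local Notation C := R[i].
Implicit Types (f g : V -> C) (q v : V).

Lemma dvD f g q v : differentiable f q -> differentiable g q ->
  dv (fun x => f x + g x) q v = dv f q v + dv g q v.
Proof. by move=> df dg; rewrite dv.unlock;
  exact: (congr1 (fun F : V -> C => F v) (diffD df dg)). Qed.

Lemma dvM f g q v : differentiable f q -> differentiable g q ->
  dv (fun x => f x * g x) q v = f q * dv g q v + g q * dv f q v.
Proof. by move=> df dg; rewrite dv.unlock;
  exact: (congr1 (fun F : V -> C => F v) (diffM df dg)). Qed.

Lemma dv_cst (a : C) q v : dv (fun=> a) q v = 0.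
Proof. by rewrite dv.unlock (diff_cst a q). Qed.

End Derivatives.

Section PowerSeries.
Variable R : realType.
Local Notation C := R[i].
Implicit Types (c : nat -> C) (z : C).

Lemma dv_id z v : dv (fun x : C => x) z v = v.
Proof. by rewrite dv.unlock diff_val. Qed.

Lemma dv_exp n z : dv (fun x : C => x ^+ n) z 1 = n%:R * z ^+ n.-1.
Proof.
elim: n => [|n IH].
  have -> : (fun x : C => x ^+ 0) = (fun=> 1) by apply/funext => x; rewrite expr0.
  by rewrite dv_cst mul0r.
have -> : (fun x : C => x ^+ n.+1) = (fun x => x * x ^+ n).
  by apply/funext => x; rewrite exprS.
rewrite dvM //; last exact: dif_exp.
rewrite dv_id IH mulr1; case: n {IH} => [|n] /=; first by rewrite !mul0r mulr0 add0r expr0 mul1r.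
by rewrite -[n.+2%:R]natr1 exprS; ring.
Qed.

Lemma dv_poly_sum c n z :
  dv (fun x : C => \sum_(i < n) c i * x ^+ i) z 1 = \sum_(i < n) c i * (i%:R * z ^+ i.-1).
Proof.
have dterm m x : differentiable (fun x : C => c m * x ^+ m) x.
  apply: differentiableM; first exact: differentiable_cst.
  exact: dif_exp.
elim: n => [|n IH].
  have -> : (fun x : C => \sum_(i < 0) c i * x ^+ i) = (fun=> 0).
    by apply/funext => x; rewrite big_ord0.
  by rewrite dv_cst big_ord0.
have -> : (fun x : C => \sum_(i < n.+1) c i * x ^+ i) =
    (fun x => \sum_(i < n) c i * x ^+ i + c n * x ^+ n).
  by apply/funext => x; rewrite big_ord_recr.
rewrite dvD //; last by apply: dif_sum => i.
rewrite IH big_ord_recr /= dvM ?dv_cst ?dv_exp ?mulr0 ?addr0 //.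
exact: dif_exp.
Qed.

Lemma psum_dif c (s K : R) z : 0 < s -> geo_bound c s K -> cn z < 2^-1 * s ->
  differentiable (psum c) z /\
  conv (fun n => \sum_(i < n) (i.+1%:R * c i.+1) * z ^+ i) (dv (psum c) z 1).
Proof.
move=> s0 h hz; pose rho := 2^-1 * s - cn z.
have rho0 : 0 < rho by rewrite subr_gt0.
pose f_ n x := \sum_(i < n) c i * x ^+ i.
have K0 := geo_bound_ge0 h.
have [] := @uniform_limit R C f_ (psum c) z rho rho0.
- move=> n x _; apply: dif_sum => i; apply: differentiableM.
    exact: differentiable_cst.
  exact: dif_exp.
- move=> e e0; have K4 : 0 <= 4 * K by rewrite mulr_ge0.
  have [N hN] := half_mul_small_all K4 e0; exists N => n /hN hn x hx.
  apply: le_trans hn; apply: psum_rate h _ n => //.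
  have hx' : cn (x - z) < rho by [].
  by have := cn_subr x z; move: hx'; rewrite /rho; lra.
move=> dp hc; split=> //.
have {}hc : conv (fun n => dv (f_ n) z 1) (dv (psum c) z 1) by move=> e /hc.
apply: eq_conv (conv_shift hc) => n; rewrite /f_ dv_poly_sum big_ord_recl /=.
rewrite mul0r mulr0 add0r; apply: eq_bigr => i _.
by rewrite /bump add1n /= mulrCA mulrA.
Qed.

Lemma psum_param (V : normedModType C) (c : V -> nat -> C) (s K rho : R) z (q : V) :
  0 < s -> 0 < rho ->
  (forall x, vn (x - q) < rho -> geo_bound (c x) s K) ->
  (forall n x, vn (x - q) < rho -> differentiable (fun x => c x n) x) ->
  cn z <= 2^-1 * s -> differentiable (fun x => psum (c x) z) q.
Proof.
move=> s0 rho0 h cd hz.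
have K0 : 0 <= K by apply: (geo_bound_ge0 (h q _)); rewrite subrr vn0.
pose f_ n x := \sum_(i < n) c x i * z ^+ i.
have [] // := @uniform_limit R V f_ (fun x => psum (c x) z) q rho rho0.
  move=> n x hx; apply: dif_sum => i; apply: differentiableM; first exact: cd.
  exact: differentiable_cst.
move=> e e0; have K4 : 0 <= 4 * K by rewrite mulr_ge0.
have [N hN] := half_mul_small_all K4 e0; exists N => n /hN hn x hx.
by apply: le_trans hn; exact: psum_rate (h x hx) hz n.
Qed.

End PowerSeries.

Section RealDerivative.
Variable R : realType.
Local Notation C := R[i].
Implicit Types (f g : R -> C) (t : R) (d : C).

Definition rd f t d := forall e : R, 0 < e -> exists2 del : R, 0 < del &
  forall h : R, `|h| < del -> cn (f (t + h) - f t - h%:C * d) <= e * `|h|.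

Lemma rd_cst a t : rd (fun=> a) t 0.
Proof.
move=> e e0; exists 1 => // h _; rewrite subrr mulr0 subrr cn0.
by rewrite mulr_ge0 // ltW.
Qed.

Lemma rdD f g t d d' : rd f t d -> rd g t d' -> rd (fun x => f x + g x) t (d + d').
Proof.
move=> hf hg e e0; have e2 : 0 < e / 2 by lra.
have [a a0 ha] := hf _ e2; have [b b0 hb] := hg _ e2.
exists (Num.min a b); first by rewrite lt_min a0.
move=> h; rewrite lt_min => /andP[/ha H /hb H'].
have -> : f (t + h) + g (t + h) - (f t + g t) - h%:C * (d + d') =
  (f (t + h) - f t - h%:C * d) + (g (t + h) - g t - h%:C * d') by ring.
by apply: le_trans (cnD _ _) _; lra.
Qed.

Lemma rd_lip f t d : rd f t d -> exists2 del : R, 0 < del &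
  forall h : R, `|h| < del -> cn (f (t + h) - f t) <= (cn d + 1) * `|h|.
Proof.
move=> /(_ 1 ltr01)[a a0 ha]; exists a => // h /ha H.
have -> : f (t + h) - f t = (f (t + h) - f t - h%:C * d) + h%:C * d by ring.
by apply: le_trans (cnD _ _) _; rewrite cnM cnR; lra.
Qed.

Lemma rdM f g t d d' : rd f t d -> rd g t d' ->
  rd (fun x => f x * g x) t (d * g t + f t * d').
Proof.
move=> hf hg e e0.
have [b1 b10 hb1] := rd_lip hg; have [b2 b20 hb2] := rd_lip hf.
pose L := cn (g t) + cn (f t) + cn d * (cn d' + 1) + (cn d' + 1) + 1.
have d0 := cn_ge0 d; have d'0 := cn_ge0 d'.
have gt0 := cn_ge0 (g t); have ft0 := cn_ge0 (f t).
have dd0 : 0 <= cn d * (cn d' + 1) by rewrite mulr_ge0 // addr_ge0.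
have L0 : 0 < L by rewrite /L; lra.
have e1 := divr_gt0 e0 L0.
have [a1 a10 ha1] := hf _ e1; have [a2 a20 ha2] := hg _ e1.
pose del := Num.min (Num.min a1 a2) (Num.min b1 (Num.min 1 (e / L))).
exists del; first by rewrite !lt_min a10 a20 b10 e1 ltr01.
move=> h; rewrite !lt_min => /andP[/andP[/ha1 A1 /ha2 A2] /andP[/hb1 B1 /andP[h1 hL]]].
have h0 := normr_ge0 h.
have -> : f (t + h) * g (t + h) - f t * g t - h%:C * (d * g t + f t * d') =
  (f (t + h) - f t - h%:C * d) * g t + f t * (g (t + h) - g t - h%:C * d') +
  (f (t + h) - f t - h%:C * d) * (g (t + h) - g t) +
  (h%:C * d) * (g (t + h) - g t) by ring.
set x := f _ - _ - _ in A1 *; set y := g _ - _ - _ in A2 *.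
set w := g (t + h) - g t in B1 *.
have c1 : cn (x * g t) <= e / L * `|h| * cn (g t) by rewrite cnM ler_wpM2r.
have c2 : cn (f t * y) <= cn (f t) * (e / L * `|h|) by rewrite cnM ler_wpM2l.
have c3 : cn (x * w) <= e / L * `|h| * (cn d' + 1).
  rewrite cnM; apply: ler_pM => //; rewrite ?cn_ge0 //.
  by apply: le_trans B1 _; rewrite ler_piMr ?addr_ge0 // ltW.
have c4 : cn (h%:C * d * w) <= cn d * (cn d' + 1) * (e / L * `|h|).
  rewrite !cnM cnR.
  have : cn w <= (cn d' + 1) * (e / L).
    by apply: le_trans B1 _; rewrite ler_wpM2l ?addr_ge0 // ltW.
  move=> hw; have := ler_wpM2l (mulr_ge0 h0 d0) hw; lra.
have -> : e * `|h| = L * (e / L * `|h|).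
  by rewrite mulrA (mulrC L) divfK // gt_eqF.
have p0 : 0 <= e / L * `|h| by rewrite mulr_ge0 // ltW.
apply: le_trans (cnD _ _) _; apply: le_trans (lerD (cnD _ _) (lexx _)) _.
apply: le_trans (lerD (lerD (cnD _ _) (lexx _)) (lexx _)) _.
rewrite /L; lra.
Qed.

Lemma rd_eq f t d d' : d = d' -> rd f t d -> rd f t d'.
Proof. by move=> ->. Qed.

Lemma rd_near f g t d (e : R) : 0 < e -> (forall x, `|x - t| < e -> f x = g x) ->
  rd f t d -> rd g t d.
Proof.
move=> e0 fg hf e' e'0; have [a a0 ha] := hf _ e'0.
exists (Num.min a e); first by rewrite lt_min a0.
move=> h; rewrite lt_min => /andP[/ha H he].
by rewrite -!fg // ?subrr ?normr0 // addrC addKr.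
Qed.

Lemma rd_sum (I : Type) (r : seq I) (P : pred I) (F : I -> R -> C) (D : I -> C) t :
  (forall i, rd (F i) t (D i)) ->
  rd (fun x => \sum_(i <- r | P i) F i x) t (\sum_(i <- r | P i) D i).
Proof.
move=> h; elim: r => [|i r IH].
  rewrite big_nil; apply: (@rd_near (fun=> 0) _ _ _ 1) => // [x _|].
    by rewrite big_nil.
  exact: rd_cst.
apply: (@rd_near (fun x => (if P i then F i x else 0) +
    \sum_(j <- r | P j) F j x) _ _ _ 1) => // [x _|].
  by rewrite big_cons; case: (P i) => //; rewrite add0r.
rewrite big_cons; have [Pi|Pi] := boolP (P i); first exact: rdD.
by rewrite -[X in rd _ _ X]add0r; apply: rdD => //; exact: rd_cst.
Qed.

Lemma rd_dv (F : C -> C) (a b : C) t : differentiable F (a + t%:C * b) ->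
  rd (fun x => F (a + x%:C * b)) t (b * dv F (a + t%:C * b) 1).
Proof.
move=> dF e e0; have b0 : 0 < cn b + 1 by rewrite ltr_wpDl ?cn_ge0.
have [del del0 hd] := dif_eps dF (divr_gt0 e0 b0).
exists (del / (cn b + 1)); first by rewrite divr_gt0.
move=> h; rewrite ltr_pdivlMr // => hh.
have h0 := normr_ge0 h.
have hb : cn (h%:C * b) < del by rewrite cnM cnR; nra.
have := hd (h%:C * b) hb; rewrite /vn /= -/(cn (h%:C * b)) cnM cnR.
have -> : a + t%:C * b + h%:C * b = a + (t + h)%:C * b by rewrite rmorphD; ring.
rewrite (dif_mul1 F) => H.
have -> : h%:C * (b * dv F (a + t%:C * b) 1) = h%:C * b * dv F (a + t%:C * b) 1.
  by ring.
apply: le_trans H _; rewrite mulrAC ler_pdivrMr // -mulrA ler_wpM2l ?(ltW e0) //.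
by rewrite ler_wpM2l //; lra.
Qed.

(** The mean value theorem for the real and imaginary parts. *)
Lemma rd_const f a b : (forall t, a < t < b -> rd f t 0) ->
  forall x y, a < x < b -> a < y < b -> f x = f y.
Proof.
move=> h.
have real (g : R -> R) : (forall t, a < t < b -> forall e, 0 < e ->
     exists2 del : R, 0 < del & forall h, `|h| < del ->
       `|g (t + h) - g t| <= e * `|h|) ->
   forall x y, a < x < b -> a < y < b -> g x = g y.
  move=> hg; have hd t : a < t < b -> is_derive t 1 g 0.
    move=> /hg H.
    have L : (fun h => h^-1 *: ((g \o shift t) (h *: (1 : R)) - g t)) @ 0^' --> (0 : R).
      apply/cvgrPdist_le => e e0; have [del del0 hdel] := H e e0.
      near=> h'; rewrite sub0r normrN /=.
      have h0 : h' != 0 by near: h'; exact: nbhs_dnbhs_neq.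
      rewrite -![_ *: _]/(_ * _) mulr1 normrM normfV mulrC ler_pdivrMr ?normr_gt0 //.
      rewrite (addrC h'); apply: hdel; near: h'; exact: dnbhs0_lt.
    by apply: DeriveDef; [apply/cvg_ex; exists 0 | exact: cvg_lim].
  have main x y : a < x < b -> a < y < b -> x < y -> g x = g y.
    move=> /andP[ax xb] /andP[ay yb] xy.
    have [||c _] := @MVT _ g (fun=> 0) x y xy.
      move=> t; rewrite in_itv /= => /andP[xt ty]; apply: hd.
      by rewrite (lt_trans ax) //= (lt_trans ty).
      apply: continuous_in_subspaceT => t; rewrite inE /= in_itv /= => /andP[xt ty].
      apply: differentiable_continuous; apply/derivable1_diffP.
      have tab : a < t < b by rewrite (lt_le_trans ax) //= (le_lt_trans ty).
      by have [] := hd t tab.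
    by rewrite mul0r => /eqP; rewrite subr_eq0 => /eqP.
  move=> x y hx hy; have [xy|yx|->//] := ltgtP x y; first exact: main.
  by symmetry; exact: main.
have bound t : a < t < b -> forall e : R, 0 < e ->
    exists2 del : R, 0 < del & forall h0, `|h0| < del ->
      cn (f (t + h0) - f t) <= e * `|h0|.
  move=> /h ht e /ht[del del0 hdel]; exists del => // h0 /hdel.
  by rewrite mulr0 subr0.
have re x y : a < x < b -> a < y < b -> complex.Re (f x) = complex.Re (f y).
  apply: (real (fun t => complex.Re (f t))) => t /bound ht e /ht[del del0 hdel].
  exists del => // h0 /hdel; apply: le_trans; rewrite -ReN -ReD; exact: cn_Re.
have im x y : a < x < b -> a < y < b -> complex.Im (f x) = complex.Im (f y).
  apply: (real (fun t => complex.Im (f t))) => t /bound ht e /ht[del del0 hdel].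
  exists del => // h0 /hdel; apply: le_trans; rewrite -ImN -ImD; exact: cn_Im.
move=> x y hx hy; apply/eqP; rewrite eq_complex.
by rewrite (re x y) // (im x y) // !eqxx.
Unshelve. all: by end_near.
Qed.

End RealDerivative.

(** * The exponential of a matrix *)

Section MatrixSize.
Variable R : realType.
Local Notation C := R[i].

Definition mn m p (M : 'M[C]_(m, p)) : R := \sum_i \sum_j cn (M i j).

Lemma mn_ge0 m p (M : 'M[C]_(m, p)) : 0 <= mn M.
Proof. by apply: sumr_ge0 => i _; apply: sumr_ge0 => j _; exact: cn_ge0. Qed.

Lemma mn_entry m p (M : 'M[C]_(m, p)) i j : cn (M i j) <= mn M.
Proof.
rewrite /mn (bigD1 i) //= (bigD1 j) //= -addrA lerDl addr_ge0 //.
  by apply: sumr_ge0 => l _; exact: cn_ge0.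
by apply: sumr_ge0 => l _; apply: sumr_ge0 => l' _; exact: cn_ge0.
Qed.

Lemma mnM m p l (M : 'M[C]_(m, p)) (N : 'M[C]_(p, l)) :
  mn (M *m N) <= mn M * mn N.
Proof.
rewrite /mn mulr_suml; apply: ler_sum => i _; rewrite mulr_suml.
apply: (@le_trans _ _ (\sum_j \sum_s cn (M i s) * cn (N s j))).
  apply: ler_sum => j _; rewrite mxE; apply: le_trans (cn_sum _ _ _) _.
  by apply: ler_sum => s _; rewrite cnM.
rewrite exchange_big /=; apply: ler_sum => s _.
rewrite -mulr_sumr ler_wpM2l ?cn_ge0 //.
rewrite [leRHS](bigD1 s) //= lerDl.
by apply: sumr_ge0 => l' _; apply: sumr_ge0 => j _; exact: cn_ge0.
Qed.

Lemma mnX m (M : 'M[C]_m.+1) k (b : R) : mn M <= b ->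
  mn (M ^+ k) <= mn (1 : 'M[C]_m.+1) * b ^+ k.
Proof.
move=> hb; have b0 : 0 <= b := le_trans (mn_ge0 _) hb.
elim: k => [|k IH]; first by rewrite !expr0 mulr1.
rewrite !exprS; apply: le_trans (mnM _ _) _.
rewrite (mulrCA _ b); apply: ler_pM => //; exact: mn_ge0.
Qed.

Lemma fact_bound (b : R) : 0 <= b ->
  exists2 K : R, 0 <= K & forall m, b ^+ m / m`!%:R <= K.
Proof.
move=> b0; pose u m : R := b ^+ m / m`!%:R.
have u0 m : 0 <= u m by rewrite divr_ge0 ?exprn_ge0.
pose N := Num.bound b.
have hN : b < N%:R by exact: archi_boundP.
have uS m : (N <= m)%N -> u m.+1 <= u m.
  move=> Nm; rewrite /u exprS factS natrM invfM mulrACA ler_piMl //; first exact: u0.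
  by rewrite ler_pdivrMr ?ltr0n // mul1r (le_trans (ltW hN)) // ler_nat ltnW.
exists (\sum_(i < N.+1) u i); first by apply: sumr_ge0.
move=> m; rewrite -/(u m).
have small j : (j <= N)%N -> u j <= \sum_(i < N.+1) u i.
  move=> jN; have jN' : (j < N.+1)%N by rewrite ltnS.
  by rewrite (bigD1 (Ordinal jN')) //= lerDl; apply: sumr_ge0.
have [/small//|/ltnW] := leqP m N; elim: m => [|m IH].
  by rewrite leqn0 => /eqP N0; apply: small; rewrite N0.
rewrite leq_eqVlt => /orP[/eqP <-|]; first exact: small.
by rewrite ltnS => Nm; apply: le_trans (uS m Nm) (IH Nm).
Qed.

Definition mlim m p (S : nat -> 'M[C]_(m, p)) (L : 'M[C]_(m, p)) := forall i j,
  conv (fun n => S n i j) (L i j).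

Lemma mlim_unique m p (S : nat -> 'M[C]_(m, p)) L L' :
  mlim S L -> mlim S L' -> L = L'.
Proof. by move=> h h'; apply/matrixP => i j; exact: conv_unique (h i j) (h' i j). Qed.

Lemma eq_mlim m p (S S' : nat -> 'M[C]_(m, p)) L : S =1 S' -> mlim S L -> mlim S' L.
Proof. by move=> /funext ->. Qed.

Lemma mlimMl m p l (G : 'M[C]_(m, p)) (S : nat -> 'M[C]_(p, l)) L :
  mlim S L -> mlim (fun n => G *m S n) (G *m L).
Proof.
move=> h i j; rewrite mxE.
apply: (@eq_conv _ (fun n => \sum_s G i s * S n s j)) => [n|]; first by rewrite mxE.
by apply: conv_sum => s; apply: convZ; exact: h.
Qed.

Lemma mlimMr m p l (G : 'M[C]_(p, l)) (S : nat -> 'M[C]_(m, p)) L :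
  mlim S L -> mlim (fun n => S n *m G) (L *m G).
Proof.
move=> h i j; rewrite mxE.
apply: (@eq_conv _ (fun n => \sum_s G s j * S n i s)) => [n|].
  by rewrite mxE; apply: eq_bigr => s _; rewrite mulrC.
rewrite (eq_bigr (fun s => G s j * L i s)); last by move=> s _; rewrite mulrC.
by apply: conv_sum => s; apply: convZ; exact: h.
Qed.

End MatrixSize.

Section MatrixExponential.
Variables (R : realType) (n : nat).
Local Notation C := R[i].
Implicit Types (M G : 'M[C]_n.+1) (z w : C).

Definition expc M (i j : 'I_n.+1) (m : nat) : C := (M ^+ m) i j / m`!%:R.

(** This is exp(z M). The scalar is kept apart from the matrix because both
    differential equations in z and holomorphic dependence on M occur. *)
Definition ex M z : 'M[C]_n.+1 := \matrix_(i, j) psum (expc M i j) z.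

Lemma expc_bound (b s : R) : 0 <= b -> 0 <= s -> exists2 K : R, 0 <= K &
  forall M i j, mn M <= b -> geo_bound (expc M i j) s K.
Proof.
move=> b0 s0; have [K K0 hK] := fact_bound (mulr_ge0 b0 s0).
exists (mn (1 : 'M[C]_n.+1) * K); first by rewrite mulr_ge0 ?mn_ge0.
move=> M i j hM m; rewrite /expc cnM cnV cn_nat.
have h1 := le_trans (mn_entry (M ^+ m) i j) (mnX m hM).
apply: (@le_trans _ _ (mn (1 : 'M[C]_n.+1) * b ^+ m / m`!%:R * s ^+ m)).
  by rewrite ler_wpM2r ?exprn_ge0 // ler_wpM2r // invr_ge0.
have -> : mn (1 : 'M[C]_n.+1) * b ^+ m / m`!%:R * s ^+ m =
          mn (1 : 'M[C]_n.+1) * ((b * s) ^+ m / m`!%:R).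
  by rewrite exprMn; ring.
by rewrite ler_wpM2l ?mn_ge0.
Qed.

Definition exS M z N : 'M[C]_n.+1 := \sum_(m < N) (z ^+ m / m`!%:R) *: M ^+ m.

Lemma exSE M z N i j : exS M z N i j = \sum_(m < N) expc M i j m * z ^+ m.
Proof.
rewrite /exS summxE; apply: eq_bigr => m _; rewrite mxE /expc.
by rewrite mulrC mulrA mulrAC.
Qed.

Lemma ex_lim M z : mlim (exS M z) (ex M z).
Proof.
move=> i j; rewrite mxE.
have s0 : 0 < 2 * cn z + 1 by rewrite ltr_wpDl // mulr_ge0 // cn_ge0.
have [K K0 hK] := expc_bound (mn_ge0 M) (ltW s0).
apply: eq_conv (psum_conv s0 (hK M i j (lexx _)) _) => [N|].
  by rewrite exSE.
lra.
Qed.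

End MatrixExponential.

Lemma ex_intertwine (R : realType) m p (G : 'M[R[i]]_(m.+1, p.+1)) M M' z :
  G *m M = M' *m G -> G *m ex M z = ex M' z *m G.
Proof.
move=> GM; apply: (mlim_unique (mlimMl G (ex_lim M z))).
apply: (eq_mlim _ (mlimMr G (ex_lim M' z))) => N.
rewrite /exS mulmx_suml mulmx_sumr; apply: eq_bigr => l _.
by rewrite -scalemxAl -scalemxAr (mulmx_intertwine _ GM).
Qed.

Section ExponentialLaws.
Variables (R : realType) (n : nat).
Local Notation C := R[i].
Implicit Types (M G : 'M[C]_n.+1) (z w : C).

Lemma ex0 M : ex M 0 = 1%:M.
Proof.
apply/matrixP => i j; apply: (conv_unique (ex_lim M 0 i j)).
move=> e e0; exists 1%N => -[//|N] _; rewrite /exS big_ord_recl /=.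
rewrite expr0 fact0 divr1 scale1r expr0 big1 ?addr0 ?subrr ?cn0 ?ltW //.
by move=> m _; rewrite exprS mul0r mul0r scale0r.
Qed.

Lemma ex_scale M (a z : C) : ex (a *: M) z = ex M (a * z).
Proof.
apply: (mlim_unique (ex_lim _ z)); apply: (eq_mlim _ (ex_lim M (a * z))) => N.
rewrite /exS; apply: eq_bigr => m _.
by rewrite expmxZ scalerA exprMn; congr (_ *: _); ring.
Qed.

Lemma ex_dv M z i j : differentiable (fun z => ex M z i j) z /\
  dv (fun z => ex M z i j) z 1 = (M *m ex M z) i j.
Proof.
have s0 : 0 < 2 * (cn z + 1) by rewrite mulr_gt0 // ltr_wpDl ?cn_ge0.
have [K K0 hK] := expc_bound n (mn_ge0 M) (ltW s0).
have [] := @psum_dif _ _ _ K z s0 (hK M i j (lexx _)); first by lra.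
have -> : (fun z => ex M z i j) = psum (expc M i j).
  by apply/funext => x; rewrite mxE.
move=> d h; split=> //; apply: (conv_unique h).
apply: eq_conv (mlimMl M (ex_lim M z) i j) => N.
rewrite /exS mulmx_sumr summxE; apply: eq_bigr => m _.
rewrite -scalemxAr mxE -[M *m M ^+ m]/(M * M ^+ m) -exprS /expc factS natrM invfM.
have m0 : (m.+1%:R : C) != 0 by rewrite pnatr_eq0.
have f0 : (m`!%:R : C) != 0 by rewrite pnatr_eq0 -lt0n fact_gt0.
by move: (m.+1%:R : C) m0 (m`!%:R : C) f0 => a a0 b b0; field; rewrite a0 b0.
Qed.

Lemma ex_comm M z : M *m ex M z = ex M z *m M.
Proof. exact: ex_intertwine. Qed.

(** The product of exp((tz) M) and exp((z + w - tz) M) has derivative zero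
    in t. *)
Lemma ex_add M z w : ex M z *m ex M w = ex M (z + w).
Proof.
apply/matrixP => i j.
pose g (t : R) := \sum_s ex M (0 + t%:C * z) i s * ex M (z + w + t%:C * - z) s j.
have g0 t : rd g t 0.
  have rd1 s := rd_dv (ex_dv M (0 + t%:C * z) i s).1.
  have rd2 s := rd_dv (ex_dv M (z + w + t%:C * - z) s j).1.
  apply: rd_eq (rd_sum _ _ (fun s => rdM (rd1 s) (rd2 s))).
  under eq_bigr do rewrite (ex_dv _ _ _ _).2 (ex_dv _ _ _ _).2.
  set E1 := ex M _; set E2 := ex M _.
  have -> : \sum_s (z * (M *m E1) i s * E2 s j + E1 i s * (- z * (M *m E2) s j)) =
     z * ((M *m E1 *m E2) i j - (E1 *m (M *m E2)) i j).
    rewrite mulrBr [in RHS]mxE [(E1 *m _) i j]mxE !mulr_sumr -sumrB.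
    by apply: eq_bigr => s _; ring.
  by rewrite mulmxA -ex_comm subrr mulr0.
have := @rd_const _ g (-1) 2 (fun t _ => g0 t) 1 0.
rewrite /g !mul1r !mul0r !add0r !addr0 ex0 => h.
have -> : (ex M z *m ex M w) i j = \sum_s ex M z i s * ex M (z + w - z) s j.
  by rewrite mxE addrC addKr.
rewrite h; first by rewrite -[ex M (z + w) in RHS]mul1mx mxE.
all: by apply/andP; split; lra.
Qed.

Lemma ex_unit M z : ex M z \in unitmx.
Proof. by apply: (mulmx1_unit (B := ex M (- z)) _).1; rewrite ex_add subrr ex0. Qed.

Lemma dif_near_bounded (V : normedModType C) (f : V -> C) (q : V) :
  differentiable f q -> exists B : R, \forall x \near q, cn (f x) <= B.
Proof.
move=> df; exists (cn (f q) + 1).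
have := differentiable_continuous df.
move=> /(@cvgrPdist_lt _ _ _ (nbhs q)) /(_ 1 ltr01); apply: filterS => x.
rewrite normCE -[1]/(1%:C) ltcR; have := cn_subr (f x) (f q); rewrite cnB; lra.
Qed.

Lemma dmx_near_bounded (V : normedModType C) m p (F : V -> 'M[C]_(m, p)) (q : V) :
  dmx q F -> exists2 B : R, 0 <= B & \forall x \near q, mn (F x) <= B.
Proof.
move=> dF; have hb ij := cid (dif_near_bounded (dF ij.1 ij.2)).
exists (\sum_i \sum_j `|sval (hb (i, j))|).
  by apply: sumr_ge0 => i _; apply: sumr_ge0.
have : \forall x \near q, forall ij, cn (F x ij.1 ij.2) <= sval (hb ij).
  by apply: filter_forall => ij; exact: svalP (hb ij).
apply: filterS => x h; apply: ler_sum => i _; apply: ler_sum => j _.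
exact: le_trans (h (i, j)) (ler_norm _).
Qed.

(** Where the matrices are bounded the exponential series converges
    uniformly. *)
Lemma ex_param (V : normedModType C) (A : V -> 'M[C]_n.+1) z (q : V) :
  (\forall x \near q, dmx x A) -> dmx q (fun x => ex (A x) z).
Proof.
move=> nA i j; have dA : dmx q A by exact: nbhs_singleton nA.
have [b b0 hb] := dmx_near_bounded dA.
have s0 : 0 < 2 * (cn z + 1) by rewrite mulr_gt0 // ltr_wpDl ?cn_ge0.
have [K K0 hK] := expc_bound n b0 (ltW s0).
have -> : (fun x => ex (A x) z i j) = (fun x => psum (expc (A x) i j) z).
  by apply/funext => x; rewrite mxE.
have /(near_vnP q)[e e0 he] : \forall x \near q, dmx x A /\ mn (A x) <= b.
  by apply: filterS2 nA hb.
apply: (@psum_param _ _ _ (2 * (cn z + 1)) K e) => //.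
- by move=> x hx; apply: hK; exact: (he x hx).2.
- move=> m x hx; apply: differentiableM; last exact: differentiable_cst.
  exact: (dmxX m (he x hx).1).
- lra.
Qed.

End ExponentialLaws.

Section ScalarExponential.
Variable R : realType.
Local Notation C := R[i].
Implicit Types (w z : C).

Definition es w : C := ex (1%:M : 'M[C]_1) w 0 0.

Lemma es0 : es 0 = 1.
Proof. by rewrite /es ex0 mxE. Qed.

Lemma es_dv w : differentiable es w /\ dv es w 1 = es w.
Proof.
have [d h] := ex_dv (1%:M : 'M[C]_1) w 0 0.
by split=> //; rewrite h mul1mx.
Qed.

Lemma es_add w z : es w * es z = es (w + z).
Proof.
rewrite /es -ex_add [RHS]mxE (bigD1 ord0) //= [X in _ + X]big1 ?addr0 // => i.
by rewrite (ord1 i) eqxx.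
Qed.

Lemma rd_ReIm (u v : R -> R) (t du dw : R) :
  is_derive t 1 u du -> is_derive t 1 v dw ->
  rd (fun t => u t +i* v t) t (du +i* dw).
Proof.
have real (f : R -> R) d : is_derive t 1 f d -> forall e : R, 0 < e ->
   exists2 del : R, 0 < del & forall h, `|h| < del ->
     `|f (t + h) - f t - h * d| <= e * `|h|.
  move=> [df dE] e e0.
  have : (fun h => h^-1 *: ((f \o shift t) (h *: (1 : R)) - f t)) @ 0^' --> d.
    by rewrite -dE; exact: df.
  move/cvgrPdist_le => /(_ e e0); rewrite near_withinE /= => /nbhs_normP[del /= del0 h].
  exists del => // x hx; have [->|x0] := eqVneq x 0.
    by rewrite addr0 subrr mul0r subrr normr0 mulr0.
  have hx' : ball_ Num.Def.normr (0 : R) del x by rewrite /ball_ /= sub0r normrN.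
  have := h x hx' x0.
  rewrite -![_ *: _]/(_ * _) mulr1 [x + t]addrC => H.
  have -> : f (t + x) - f t - x * d = - (d - x^-1 * (f (t + x) - f t)) * x.
    by field.
  by rewrite normrM normrN ler_wpM2r.
move=> /real hu /real hv e e0; have e2 : 0 < e / 2 by lra.
have [a a0 ha] := hu _ e2; have [b b0 hb] := hv _ e2.
exists (Num.min a b); first by rewrite lt_min a0.
move=> h; rewrite lt_min => /andP[/ha H /hb H'].
apply: le_trans (cn_ReIm _) _.
rewrite !(ReD, ImD, ReN, ImN, ReM, ImM) /=; move: H H'.
by rewrite !(mul0r, subr0, addr0, add0r); lra.
Qed.

Lemma rd_cexp w t : rd (fun x => cexp (x%:C * w)) t (w * cexp (t%:C * w)).
Proof.
case: w => a b.
have E (x : R) : cexp (x%:C * (a +i* b)) =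
   (expR (x * a) * cos (x * b)) +i* (expR (x * a) * sin (x * b)).
  by rewrite /cexp /= !mul0r subr0 addr0.
rewrite E.
have -> : (fun x : R => cexp (x%:C * (a +i* b))) =
  (fun x => (expR (x * a) * cos (x * b)) +i* (expR (x * a) * sin (x * b))).
  by apply/funext.
have hl (c : R) : is_derive t 1 (fun x : R => x * c) c.
  have H := is_deriveM (is_derive_id t (1 : R)) (is_derive_cst c t (1 : R)).
  by apply: (is_derive_eq H); rewrite -![_ *: _]/(_ * _) mulr0 add0r mulr1.
have hE : is_derive t 1 (fun x => expR (x * a)) (expR (t * a) * a).
  exact: (@is_derive1_comp _ expR (fun x => x * a) t _ _ (is_derive_expR (t * a)) (hl a)).
have hC : is_derive t 1 (fun x => cos (x * b)) (- sin (t * b) * b).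
  exact: (@is_derive1_comp _ cos (fun x => x * b) t _ _ (is_derive_cos (t * b)) (hl b)).
have hS : is_derive t 1 (fun x => sin (x * b)) (cos (t * b) * b).
  exact: (@is_derive1_comp _ sin (fun x => x * b) t _ _ (is_derive_sin (t * b)) (hl b)).
have h1 := is_deriveM hE hC; have h2 := is_deriveM hE hS.
apply: rd_eq (rd_ReIm h1 h2).
rewrite -![_ *: _]/(_ * _); apply/eqP; rewrite eq_complex /=.
by apply/andP; split; apply/eqP; ring.
Qed.

(** The function exp(-tw) cexp(tw) of t is constant. *)
Lemma cexpE w : cexp w = es w.
Proof.
pose g (t : R) := cexp (t%:C * w) * es (0 + t%:C * - w).
have g0 t : rd g t 0.
  apply: rd_eq (rdM (rd_cexp w t) (rd_dv (es_dv (0 + t%:C * - w)).1)).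
  by rewrite (es_dv _).2; ring.
have := @rd_const _ g (-1) 2 (fun t _ => g0 t) 1 0.
rewrite /g !mul1r !mul0r !add0r es0 => h.
have cexp0 : cexp (0 : C) = 1.
  by rewrite /cexp /= expR0 cos0 sin0 mulr1 mulr0.
have {}h : cexp w * es (- w) = 1.
  rewrite h ?cexp0 ?mulr1 //; apply/andP; split; lra.
by rewrite -[LHS]mulr1 -es0 -(addNr w) -es_add mulrA h mul1r.
Qed.

End ScalarExponential.

Section DividedDifference.
Variables (R : realType) (n : nat).
Local Notation C := R[i].

Lemma ex_scalar (a z : C) : ex (a%:M : 'M[C]_n.+1) z = (es (a * z))%:M.
Proof.
rewrite -scalemx1 ex_scale; apply/matrixP => i j.
have h := @ex_intertwine R 0 n (delta_mx 0 i) 1%:M 1%:M (a * z).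
have {}h := h (etrans (mulmx1 _) (esym (mul1mx _))).
have rE (X : 'M[C]_n.+1) : X i j = row i X 0 j by rewrite mxE.
rewrite (rE (ex _ _)) rowE h [LHS]mxE big_ord1 [X in _ * X]mxE eqxx /= mxE eq_sym.
by rewrite [RHS]mxE /es mxE mulr_natr.
Qed.

(** The off-diagonal block of the exponential of a triangular block matrix is a
    divided difference, and commuting with the block matrix is its defining
    equation. *)
Lemma ex_divided (V : normedModType C) (e : V -> C) (A : V -> 'M[C]_n.+1) (q : V) :
  (\forall x \near q, differentiable e x /\ dmx x A) ->
  exists2 G : V -> 'M[C]_n.+1, \forall x \near q, dmx x G &
    forall x, (es (e x))%:M - ex (A x) 1 = ((e x)%:M - A x) *m G x.
Proof.
move=> dA.
pose N x : 'M[C]_((n + n.+1).+1) :=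
  (block_mx (e x)%:M 1%:M 0 (A x) : 'M[C]_(n.+1 + n.+1)).
pose E x : 'M[C]_(n.+1 + n.+1) := ex (N x) 1.
exists (fun x => ursubmx (E x)).
  have nN : \forall x \near q, dmx x N.
    apply: filterS dA => x [de dA] i j; rewrite /N.
    pose d2 y := block_mx (e y)%:M 1%:M 0 (A y) : 'M[C]_(n.+1 + n.+1).
    suff : dmx x d2 by exact.
    move=> {}i {}j; rewrite /d2.
    have [i' ->|i' ->] := split_ordP i; have [j' ->|j' ->] := split_ordP j.
    - have -> : (fun y => d2 y (lshift _ i') (lshift _ j')) = (fun y => (e y)%:M i' j').
        by apply/funext => y; rewrite /d2 block_mxEul.
      have -> : (fun y => (e y)%:M i' j') = (fun y => e y * (i' == j')%:R).
        by apply/funext => y; rewrite mxE mulr_natr.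
      by apply: differentiableM => //; exact: differentiable_cst.
    - have -> : (fun y => d2 y (lshift _ i') (rshift _ j')) = (fun=> 1%:M i' j').
        by apply/funext => y; rewrite /d2 block_mxEur.
      exact: differentiable_cst.
    - have -> : (fun y => d2 y (rshift _ i') (lshift _ j')) = (fun=> (0 : 'M[C]_n.+1) i' j').
        by apply/funext => y; rewrite /d2 block_mxEdl.
      exact: differentiable_cst.
    - have -> : (fun y => d2 y (rshift _ i') (rshift _ j')) = (fun y => A y i' j').
        by apply/funext => y; rewrite /d2 block_mxEdr.
      exact: dA.
  have := near_join nN; apply: filterS => x /(@ex_param _ _ _ N 1) dE i j.
  have -> : (fun x => ursubmx (E x) i j) = (fun x => E x (lshift _ i) (rshift _ j)).
    by apply/funext => y; rewrite !mxE.
  exact: dE.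
move=> x; set M := N x.
have [a [b [c [d EE]]]] : exists a b c d, E x = block_mx a b c d.
  by exists (ulsubmx (E x)), (ursubmx (E x)), (dlsubmx (E x)), (drsubmx (E x));
    rewrite submxK.
rewrite EE block_mxKur.
pose U : 'M[C]_((n + n.+1).+1, n.+1) := col_mx (1%:M : 'M[C]_n.+1) (0 : 'M[C]_n.+1).
pose W : 'M[C]_(n.+1, (n + n.+1).+1) := row_mx (0 : 'M[C]_n.+1) (1%:M : 'M[C]_n.+1).
have c1 : U *m (e x)%:M = M *m U.
  apply: (etrans (mul_col_mx (1%:M : 'M[C]_n.+1) 0 (e x)%:M)); apply: esym.
  apply: (etrans (mul_block_col (e x)%:M 1%:M 0 (A x) (1%:M : 'M[C]_n.+1) 0)).
  by rewrite !(mul0mx, mulmx0, addr0, mulmx1, mul1mx).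
have /(etrans (esym (mul_col_mx (1%:M : 'M[C]_n.+1) 0 (ex _ _)))) := ex_intertwine 1 c1.
rewrite -/(E x) EE ex_scalar mulr1.
move=> /(fun h => etrans h (mul_block_col a b c d (1%:M : 'M[C]_n.+1) 0)).
rewrite !(mul0mx, mulmx0, addr0, mulmx1, mul1mx).
move=> /eq_col_mx[aE cE].
have c2 : W *m M = A x *m W.
  apply: (etrans (mul_row_block (0 : 'M[C]_n.+1) 1%:M (e x)%:M 1%:M 0 (A x))).
  apply: esym; apply: (etrans (mul_mx_row (A x) (0 : 'M[C]_n.+1) 1%:M)).
  by rewrite !(mul0mx, mulmx0, add0r, mulmx1, mul1mx).
have := ex_intertwine 1 c2; rewrite -/(E x) EE.
move=> /(etrans (esym (mul_row_block (0 : 'M[C]_n.+1) 1%:M a b c d))).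
move=> /(fun h => etrans h (mul_mx_row (ex (A x) 1) (0 : 'M[C]_n.+1) 1%:M)).
rewrite !(mul0mx, mulmx0, add0r, mulmx1, mul1mx).
move=> /eq_row_mx[_ dE].
(* the upper right block of this identity is the claim, up to the order of
   the factors A and b, which commute by c4 *)
have c3 : M *m E x = E x *m M by exact: ex_comm.
pose D : 'M[C]_((n + n.+1).+1) := (block_mx (A x) 0 0 (A x) : 'M[C]_(n.+1 + n.+1)).
have c4 : D *m E x = E x *m D.
  apply: ex_intertwine; apply: (etrans (mulmx_block (A x) 0 0 (A x) (e x)%:M 1%:M 0 (A x))).
  apply: esym; apply: (etrans (mulmx_block (e x)%:M 1%:M 0 (A x) (A x) 0 0 (A x))).
  by rewrite !(mul0mx, mulmx0, add0r, addr0, mulmx1, mul1mx) scalar_mxC.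
move: c3; rewrite EE => /(etrans (esym (mulmx_block (e x)%:M 1%:M 0 (A x) a b c d))).
move=> /(fun h => etrans h (mulmx_block a b c d (e x)%:M 1%:M 0 (A x))).
move=> /eq_block_mx[_ h3 _ _].
move: c4; rewrite EE => /(etrans (esym (mulmx_block (A x) 0 0 (A x) a b c d))).
move=> /(fun h => etrans h (mulmx_block a b c d (A x) 0 0 (A x))).
move=> /eq_block_mx[_ h4 _ _].
rewrite mulmx1 mul1mx in h3; rewrite !(mul0mx, mulmx0, add0r, addr0) in h4.
by rewrite aE -dE mulmxBl h4; apply/eqP; rewrite subr_eq addrAC h3 addrK.
Qed.

End DividedDifference.

(** * Functional calculus for a holomorphic family of matrices *)

Section Near.
Variables (R : realType) (V : normedModType R[i]).
Implicit Types (p q : V).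

Lemma near_all p (P : V -> Prop) : (forall q, P q) -> \forall q \near p, P q.
Proof. by move=> h; apply/near_vnP; exists 1. Qed.

Lemma near_near p (P : V -> Prop) : (\forall q \near p, P q) ->
  \forall q \near p, \forall x \near q, P x.
Proof.
move=> /near_vnP[e e0 h]; apply/near_vnP; exists e => // q hq.
apply/near_vnP; exists (e - vn (q - p)); first by rewrite subr_gt0.
move=> x hx; apply: h; have := vnD (x - q) (q - p).
rewrite addrA subrK; lra.
Qed.

End Near.

Section PolynomialCoefficients.
Variables (R : realType) (V : normedModType R[i]) (q : V).
Local Notation C := R[i].

Definition dpoly (f : V -> {poly C}) := forall i, differentiable (fun x => (f x)`_i) q.

Lemma dpolyM f g : dpoly f -> dpoly g -> dpoly (fun x => f x * g x).
Proof.
move=> df dg i; have -> : (fun x => (f x * g x)`_i) =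
    (fun x => \sum_(j < i.+1) (f x)`_j * (g x)`_(i - j)).
  by apply/funext => x; rewrite coefM.
by apply: dif_sum => j; exact: differentiableM.
Qed.

Lemma dpoly_cst p : dpoly (fun=> p).
Proof. by move=> i; exact: differentiable_cst. Qed.

Lemma dpoly_sum (I : Type) (r : seq I) (f : I -> V -> {poly C}) :
  (forall i, dpoly (f i)) -> dpoly (fun x => \sum_(i <- r) f i x).
Proof.
move=> h i; have -> : (fun x => (\sum_(i <- r) f i x)`_i) =
  (fun x => \sum_(j <- r) (f j x)`_i) by apply/funext => x; rewrite coef_sum.
by apply: dif_bigsum => j; exact: h.
Qed.

Lemma dpoly_prod (I : Type) (r : seq I) (f : I -> V -> {poly C}) :
  (forall i, dpoly (f i)) -> dpoly (fun x => \prod_(i <- r) f i x).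
Proof.
move=> h; elim: r => [|j r IH].
  have -> : (fun x => \prod_(i <- [::]) f i x) = (fun=> 1).
    by apply/funext => x; rewrite big_nil.
  exact: dpoly_cst.
have -> : (fun x => \prod_(i <- j :: r) f i x) =
    (fun x => f j x * \prod_(i <- r) f i x).
  by apply/funext => x; rewrite big_cons.
exact: dpolyM.
Qed.

Lemma dif_char_poly n (A : V -> 'M[C]_n) i : dmx q A ->
  differentiable (fun x => (char_poly (A x))`_i) q.
Proof.
move=> dA; have dX j j' : dpoly (fun x => char_poly_mx (A x) j j').
  move=> l; have -> : (fun x => (char_poly_mx (A x) j j')`_l) =
      (fun x => ('X *+ (j == j') : {poly C})`_l - A x j j' * (l == 0%N)%:R).
    apply/funext => x; rewrite !mxE coefB coefC; congr (_ - _).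
    by case: eqP; rewrite ?mulr1 ?mulr0.
  apply: differentiableB; first exact: differentiable_cst.
  by apply: differentiableM; [exact: dA | exact: differentiable_cst].
have : dpoly (fun x => char_poly (A x)); last exact.
apply: dpoly_sum => s; apply: dpolyM; first exact: dpoly_cst.
by apply: dpoly_prod => j; exact: dX.
Qed.

End PolynomialCoefficients.

Section FunctionalCalculus.
Variables (R : realType) (n : nat).
Local Notation C := R[i].
Variable A : C -> 'M[C]_n.+1.
Hypothesis Ae : entire A.
Implicit Types (p q : C * C) (f g : C * C -> C) (X Y : C * C -> 'M[C]_n.+1).

(** The matrix X is obtained from the function f by substituting A for the
    coordinate eta: f - X is divisible by eta - A. *)
Definition fc p f X := exists G : C * C -> 'M[C]_n.+1, \forall q \near p,
  [/\ differentiable f q, dmx q X, dmx q G &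
      (f q)%:M - X q = (q.1%:M - A q.2) *m G q].

Lemma near_dif_snd (f : C -> C) p : (\forall z \near p.2, differentiable f z) ->
  \forall q \near p, differentiable (fun q : C * C => f q.2) q.
Proof.
move=> /near_vnP[e e0 h]; apply/near_pairP; exists e => // q _ hq.
by apply: dif_comp_snd; apply: h.
Qed.

Lemma fc_snd (c : C -> C) p : (\forall z \near p.2, differentiable c z) ->
  fc p (fun q => c q.2) (fun q => (c q.2)%:M).
Proof.
move=> /near_dif_snd h; exists (fun=> 0); apply: filterS h => q h; split=> //.
- apply: (@dmx_eq _ _ _ _ _ (fun q => c q.2 *: 1%:M)) => [x|].
    by rewrite scalemx1.
  by apply: dmxZ => //; exact: dmx_cst.
- by rewrite subrr mulmx0.
Qed.

Lemma fc_cst a p : fc p (fun=> a) (fun=> a%:M).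
Proof.
apply: (@fc_snd (fun=> a)); apply: near_all => z; exact: differentiable_cst.
Qed.

Lemma fc_fst p : fc p (fun q => q.1) (fun q => A q.2).
Proof.
exists (fun=> 1%:M); apply: near_all => q; split.
- exact: dif_fst.
- exact: dmx_snd.
- exact: dmx_cst.
- by rewrite mulmx1.
Qed.

Lemma fcD p f g X Y : fc p f X -> fc p g Y ->
  fc p (fun q => f q + g q) (fun q => X q + Y q).
Proof.
move=> [G hG] [H hH]; exists (fun q => G q + H q).
apply: filterS2 hG hH => q [df dX dG e] [dg dY dH e']; split.
- exact: differentiableD.
- exact: dmxD.
- exact: dmxD.
- by rewrite mulmxDr -e -e' raddfD /= opprD addrACA.
Qed.

Lemma fcM p f g X Y : fc p f X -> fc p g Y ->
  fc p (fun q => f q * g q) (fun q => X q *m Y q).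
Proof.
move=> [G hG] [H hH]; exists (fun q => f q *: H q + G q *m Y q).
apply: filterS2 hG hH => q [df dX dG e] [dg dY dH e']; split.
- exact: differentiableM.
- exact: dmxM.
- by apply: dmxD; [exact: dmxZ | exact: dmxM].
- rewrite mulmxDr -scalemxAr -e' mulmxA -e mulmxBl scalerBr mul_scalar_mx.
  by rewrite addrA subrK scale_scalar_mx.
Qed.

Lemma fc_near p f g X Y : (\forall q \near p, f q = g q) ->
  (\forall q \near p, X q = Y q) -> fc p f X -> fc p g Y.
Proof.
move=> fg XY [G hG]; exists G.
apply: filterS3 (near_near fg) (near_near XY) hG => q nfg nXY [df dX dG e].
split=> //.
- exact: dif_near df.
- move=> i j; apply: dif_near (dX i j).
  by apply: filterS nXY => x ->.
- by rewrite -(nbhs_singleton nfg) -(nbhs_singleton nXY).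
Qed.

Lemma fcX p f X m : fc p f X -> fc p (fun q => f q ^+ m) (fun q => X q ^+ m).
Proof.
move=> h; elim: m => [|m IH].
  apply: fc_near (fc_cst 1 p).
    by apply: near_all => q; rewrite expr0.
  by apply: near_all => q; rewrite expr0.
by apply: fc_near (fcM h IH); apply: near_all => q; rewrite exprS.
Qed.

Lemma fc_sum p m (f : 'I_m -> C * C -> C) (X : 'I_m -> C * C -> 'M[C]_n.+1) :
  (forall i, fc p (f i) (X i)) ->
  fc p (fun q => \sum_i f i q) (fun q => \sum_i X i q).
Proof.
elim: m f X => [|m IH] f X h.
  apply: fc_near (fc_cst 0 p).
    by apply: near_all => q; rewrite big_ord0.
  by apply: near_all => q; rewrite big_ord0 raddf0.
have := fcD (h ord0) (IH _ _ (fun i => h (lift ord0 i))).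
by apply: fc_near; apply: near_all => q; rewrite big_ord_recl.
Qed.

(** The quotient by eta - A is the divided difference of the exponential. *)
Lemma fc_exp p (c : C -> C) : (\forall z \near p.2, differentiable c z) ->
  fc p (fun q => cexp (q.1 * c q.2)) (fun q => ex (A q.2) (c q.2)).
Proof.
move=> /near_dif_snd h.
have [] := @ex_divided R n _ (fun q : C * C => q.1 * c q.2)
  (fun q : C * C => c q.2 *: A q.2) p.
  apply: filterS h => q h; split.
    by apply: differentiableM => //; exact: dif_fst.
  by apply: dmxZ => //; exact: dmx_snd.
move=> G dG GE; exists (fun q => c q.2 *: G q).
have nA : \forall q \near p, dmx q (fun q => c q.2 *: A q.2).
  by apply: filterS h => q h; apply: dmxZ => //; exact: dmx_snd.
apply: filterS3 (near_near h) dG (near_near nA) => q nh dG' nA'.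
have hq := nbhs_singleton nh; split.
- have -> : (fun q : C * C => cexp (q.1 * c q.2)) = @es R \o (fun q => q.1 * c q.2).
    by apply/funext => x /=; rewrite cexpE.
  apply: differentiable_comp; last exact: (es_dv _).1.
  by apply: differentiableM => //; exact: dif_fst.
- apply: dmx_eq (ex_param 1 nA') => x.
  by rewrite ex_scale mulr1.
- exact: dmxZ.
- rewrite cexpE -[ex _ _]/(ex _ (c q.2)) -[in ex _ _](mulr1 (c q.2)).
  rewrite -ex_scale GE -scalemxAr scalemxAl.
  by rewrite scalerBr scale_scalar_mx mulrC.
Qed.

Lemma fc_poly p (rho : nat -> C -> C) :
  (forall i, \forall z \near p.2, differentiable (rho i) z) ->
  fc p (poly_fun n.+1 rho) (fun q => pmx (A q.2) (\col_i rho i q.2)).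
Proof.
move=> h; have := fc_sum (fun i : 'I_n.+1 =>
  fcM (fc_snd (h i)) (fcX i (fc_fst p))).
apply: fc_near; apply: near_all => q //.
by apply: eq_bigr => i _; rewrite mul_scalar_mx mxE.
Qed.

Variables (P : C * C -> C) (v : C -> 'cV[C]_n.+1).
Hypothesis PE : forall q, P q = \det (q.1%:M - A q.2).
Hypothesis ve : entire v.
Hypothesis vc : forall z, cyclic (A z) (v z).

(** If f and g have the same matrix, then (f - g) 1 is divisible by eta - A. *)
Lemma fc_germ p f g X Y : fc p f X -> fc p g Y ->
  (\forall q \near p, X q = Y q) -> germ_eqmod P p f g.
Proof.
move=> hf hg XY.
have hg' := fcM (fc_cst (-1) p) hg.
have [G /near_vnP[e e0 h]] : fc p (fun q => f q - g q) (fun=> 0).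
  apply: fc_near (fcD hf hg'); first by apply: near_all => q; rewrite mulN1r.
  by apply: filterS XY => q ->; rewrite mul_scalar_mx scaleN1r subrr.
have [H [dH HE]] : germ_eqmod P p (fun q => f q - g q) (fun=> 0).
  apply: (germ_vanish (G := G) PE Ae ve vc e0) => q /h[//] _ _ _ <-.
  by rewrite subr0.
by exists H; split => //; apply: filterS HE => q; rewrite subr0.
Qed.

Let pc i z : C := (char_poly (A z))`_i.

Lemma spectral_coef q :
  P q = q.1 ^+ n.+1 + \sum_(i < n.+1) pc i q.2 * q.1 ^+ i.
Proof. by rewrite PE char_poly_detE. Qed.

Lemma spectral_coef_dif i z : differentiable (pc i) z.
Proof. exact: dif_char_poly. Qed.

(** Near a fibre a matrix commuting with A is a polynomial in A with holomorphic
    coefficients, and the coefficients of a function are determined by the fibre. *)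
Lemma calculus_faithful b (rho : nat -> C -> C) (f : C * C -> C) (X : C * C -> 'M[C]_n.+1)
    (Y : C -> 'M[C]_n.+1) :
  (\forall z \near b, dmx z Y) -> (\forall z \near b, Y z *m A z = A z *m Y z) ->
  (forall q, X q = Y q.2) ->
  (forall a, P (a, b) = 0 -> fc (a, b) f X) ->
  (forall a, P (a, b) = 0 -> germ_eqmod P (a, b) (poly_fun n.+1 rho) f) ->
  pmx (A b) (\col_i rho i b) = Y b.
Proof.
move=> dY cY XY hf hg.
pose gam z := invmx (krylov (A z) (v z)) *m (Y z *m v z).
have gamE z : Y z *m A z = A z *m Y z -> pmx (A z) (gam z) = Y z.
  move=> YA; apply/eqP; rewrite -subr_eq0; apply/eqP.
  apply: (cyclic_kill (M := A z) (v := v z)) => //.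
    by rewrite mulmxBl mulmxBr pmx_comm YA.
  by rewrite mulmxBl pmxE mulKVmx ?subrr //; exact: vc.
have dgam : \forall z \near b, dmx z gam.
  apply: filterS dY => z dY; apply: dmxM; last by apply: dmxM.
  apply: dmx_inv; last exact: vc.
  exact: dmx_krylov.
pose r i z := gam z (inord i) 0.
have rE z : \col_(i < n.+1) r i z = gam z.
  by apply/colP => i; rewrite mxE /r inord_val.
rewrite -(gamE b) ?(nbhs_singleton cY) // -rE; congr pmx; apply/colP => i.
rewrite [LHS]mxE [RHS]mxE.
apply: (@poly_fun_unique R n.+1 pc P spectral_coef b rho r) => // a Pa.
apply: germ_trans (hg a Pa) _; apply: germ_sym.
apply: (fc_germ (@fc_poly (a, b) r _) (hf a Pa)).
  by move=> j; apply: filterS dgam => z; apply.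
have /near_vnP[e e0 h] := cY; apply/near_pairP; exists e => // q _ hq.
by rewrite XY -(gamE q.2) ?rE //; exact: h.
Qed.

End FunctionalCalculus.

(** * Frames of the cokernel of eta - A *)

Section Spectral.
Variables (R : realType) (n : nat).
Local Notation C := R[i].
Implicit Types (M : nat -> 'M[C]_n.+1) (z : C) (p q : C * C).

Definition quart M z : 'M[C]_n.+1 :=
  M 0%N + z *: M 1%N + z ^+ 2 *: M 2 + z ^+ 3 *: M 3 + z ^+ 4 *: M 4.

Definition rev4 M j := M (4 - j)%N.

Lemma quart_rev4 M z : z != 0 -> quart (rev4 M) z^-1 = (z ^- 4) *: quart M z.
Proof.
move=> z0; apply/matrixP => i j; rewrite !mxE /rev4 /=.
by field.
Qed.

Lemma quart_entire M : entire (quart M).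
Proof.
move=> z; have h m X : dmx z (fun z : C => z ^+ m *: (X : 'M[C]_n.+1)).
  by apply: dmxZ; [exact: dif_exp | exact: dmx_cst].
apply: dmxD (h 4 _); apply: dmxD (h 3 _); apply: dmxD (h 2 _).
by apply: dmxD (h 1%N _); exact: dmx_cst.
Qed.

Definition spec M p : C := \det (p.1%:M - quart M p.2).

Lemma spec_transition M p : p.2 != 0 ->
  spec (rev4 M) (transition p) = (p.2 ^- 4) ^+ n.+1 * spec M p.
Proof.
move=> p0; rewrite /spec /transition /= quart_rev4 //.
rewrite -detZ; congr (\det _); rewrite scalerBr; congr (_ - _).
by rewrite scale_scalar_mx mulrC.
Qed.

Lemma spec_transition_eq0 M p : p.2 != 0 ->
  (spec (rev4 M) (transition p) == 0) = (spec M p == 0).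
Proof.
move=> p0; rewrite spec_transition // mulf_eq0 expf_eq0 invr_eq0 expf_eq0.
by rewrite (negbTE p0) /=.
Qed.

Lemma dif_expz (l : int) z : z != 0 -> differentiable (fun z : C => z ^ l) z.
Proof.
move=> z0; case: l => m.
  exact: dif_exp.
apply: differentiableV; first exact: dif_exp.
exact: expf_neq0.
Qed.

Lemma near_neq0 z : z != 0 -> \forall x \near z, x != 0.
Proof.
move=> z0; apply/near_vnP; exists (cn z); first by rewrite cn_gt0.
move=> x; apply: contraTneq => ->; rewrite sub0r /vn normrN normCE /= -leNgt.
by [].
Qed.

Lemma near_snd_neq0 p : p.2 != 0 -> \forall q \near p, q.2 != 0.
Proof.
move=> /near_neq0/near_vnP[e e0 h]; apply/near_pairP; exists e => // q _; exact: h.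
Qed.

Lemma transition_dif p : p.2 != 0 -> differentiable (@transition R) p.
Proof.
move=> p0; apply: (@differentiable_pair _ _ _ _
  (fun p : C * C => p.1 / p.2 ^+ 4) (fun p => p.2^-1)).
  apply: differentiableM; first exact: dif_fst.
  apply: differentiableV; last exact: expf_neq0.
  by apply: dif_exp; exact: dif_snd.
by apply: differentiableV => //; exact: dif_snd.
Qed.

Lemma near_transition p (Q : C * C -> Prop) : p.2 != 0 ->
  (\forall q \near transition p, Q q) -> \forall q \near p, Q (transition q).
Proof.
by move=> p0 hQ; apply: (differentiable_continuous (transition_dif p0)).
Qed.

Lemma germ_transition M p f g : p.2 != 0 ->
  germ_eqmod (spec (rev4 M)) (transition p) f g ->
  germ_eqmod (spec M) p (fun q => f (transition q)) (fun q => g (transition q)).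
Proof.
move=> p0 [h [hd he]].
have key q : q.2 != 0 -> f (transition q) - g (transition q) =
      h (transition q) * spec (rev4 M) (transition q) ->
    f (transition q) - g (transition q) =
      h (transition q) * (q.2 ^- 4) ^+ n.+1 * spec M q.
  by move=> q0 ->; rewrite spec_transition // mulrA.
exists (fun q => h (transition q) * (q.2 ^- 4) ^+ n.+1); split.
  apply: filterS2 (near_snd_neq0 p0) (near_transition p0 hd) => q q0 hq.
  apply: differentiableM.
    exact: (@differentiable_comp _ _ _ _ (@transition R) h q (transition_dif q0) hq).
  apply: dif_exp; apply: differentiableV; last exact: expf_neq0.
  by apply: dif_exp; exact: dif_snd.
exact: filterS2 key (near_snd_neq0 p0) (near_transition p0 he).
Qed.

(** The vectors x0 and x1 trivialise the cokernel of eta - A over the two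
    charts. The power of xi is such that a section of L^a(2k-3), with k = n
    + 1, becomes a pair of vectors related by xi^-1. *)
Definition frame M (a : C) (x0 x1 : C -> 'cV[C]_n.+1) :=
  [/\ entire x0, entire x1, (forall z, cyclic (quart M z) (x0 z)),
      (forall z, cyclic (quart (rev4 M) z) (x1 z)) &
      forall z : C, z != 0 ->
        ex (quart M z) (a / z ^+ 2) *m x0 z = (z ^- n) ^+ 2 *: x1 z^-1].

Section Pair.
Variables (M : nat -> 'M[C]_n.+1) (x0 x1 : C -> 'cV[C]_n.+1).
Hypothesis e0 : entire x0.
Hypothesis e1 : entire x1.
Hypothesis c0 : forall z, cyclic (quart M z) (x0 z).
Hypothesis c1 : forall z, cyclic (quart (rev4 M) z) (x1 z).
Implicit Types (rho : nat -> C -> C).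

(** The matrix of exp(a eta / xi^2) xi^l f(transition), where f is the
    polynomial with coefficients rho: rev4 M at 1/xi is xi^-4 A. *)
Definition gluemx (a : C) (l : int) rho z : 'M[C]_n.+1 :=
  z ^ l *: (ex (quart M z) (a / z ^+ 2) *m
            pmx (quart (rev4 M) z^-1) (\col_i rho i z^-1)).

Lemma fc_glue a l rho p : (forall i z, differentiable (rho i) z) -> p.2 != 0 ->
  fc (quart M) p (fun q => cexp (a * q.1 / q.2 ^+ 2) * q.2 ^ l *
      poly_fun n.+1 rho (transition q)) (fun q => gluemx a l rho q.2).
Proof.
move=> rd p0.
have n0 := near_neq0 p0.
have d1 : \forall z \near p.2, differentiable (fun z : C => a / z ^+ 2) z.
  apply: filterS n0 => z z0; apply: differentiableM; first exact: differentiable_cst.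
  by apply: differentiableV; [exact: dif_exp | exact: expf_neq0].
have d2 : \forall z \near p.2, differentiable (fun z : C => z ^ l) z.
  by apply: filterS n0 => z; exact: dif_expz.
have d3 : \forall z \near p.2, differentiable (fun z : C => z ^- 4) z.
  apply: filterS n0 => z z0.
  by apply: differentiableV; [exact: dif_exp | exact: expf_neq0].
have d4 i : \forall z \near p.2, differentiable (fun z : C => rho i z^-1) z.
  apply: filterS n0 => z z0.
  exact: (@differentiable_comp _ _ _ _ (fun z : C => z^-1) _ _ (dif_expz (-1) z0) (rd i _)).
have Me := @quart_entire M.
have h := fcM (fcM (fc_exp Me d1) (fc_snd (quart M) d2))
  (fc_sum (fun i : 'I_n.+1 => fcM (fc_snd (quart M) (d4 i))
     (fcX i (fcM (fc_fst Me p) (fc_snd (quart M) d3))))).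
apply: fc_near h; first by apply: near_all => q; rewrite mulrCA mulrA.
apply: filterS (near_snd_neq0 p0) => q q0.
rewrite /gluemx -!mulmxA mul_scalar_mx -scalemxAr; congr (_ *: (_ *m _)).
rewrite /pmx quart_rev4 //; apply: eq_bigr => i _.
by rewrite mul_scalar_mx mul_mx_scalar mxE.
Qed.

Lemma gluemx_near_dif a l rho b : (forall i z, differentiable (rho i) z) -> b != 0 ->
  \forall z \near b, dmx z (gluemx a l rho).
Proof.
move=> rd b0; have [G /near_pairP[e e0' h]] := @fc_glue a l rho (0, b) rd b0.
apply/near_vnP; exists e => // z hz i j.
have [|_ d _ _] := h (0, z) _ hz; first by rewrite subrr cn0.
exact: (dif_slice2 (d i j)).
Qed.

Lemma gluemx_comm a l rho z : z != 0 ->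
  gluemx a l rho z *m quart M z = quart M z *m gluemx a l rho z.
Proof.
move=> z0; rewrite /gluemx -scalemxAl -scalemxAr; congr (_ *: _).
rewrite mulmxA ex_comm -!mulmxA; congr (_ *m _).
apply: esym; apply: pmx_commr; rewrite quart_rev4 //.
by rewrite -scalemxAl -scalemxAr.
Qed.

Lemma glue_germ a l rho0 rho1 : (forall i z, differentiable (rho0 i) z) ->
  (forall i z, differentiable (rho1 i) z) ->
  (forall z, z != 0 -> pmx (quart M z) (\col_i rho0 i z) = gluemx a l rho1 z) ->
  forall p, p.2 != 0 -> germ_eqmod (spec M) p (poly_fun n.+1 rho0)
    (fun q => cexp (a * q.1 / q.2 ^+ 2) * q.2 ^ l * poly_fun n.+1 rho1 (transition q)).
Proof.
move=> d0 d1 h p p0.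
apply: (fc_germ (@quart_entire M) (fun=> erefl) e0 c0 (fc_poly (@quart_entire M) _)
  (fc_glue a l d1 p0)).
  by move=> i; apply: near_all.
by apply: filterS (near_snd_neq0 p0) => q; exact: h.
Qed.

(** The converse of glue_germ: a gluing rule for germs is an identity of
    matrices, since both sides commute with A. *)
Lemma germ_glue a l rho0 rho1 : (forall i z, differentiable (rho0 i) z) ->
  (forall i z, differentiable (rho1 i) z) ->
  (forall p, p.2 != 0 -> spec M p = 0 -> germ_eqmod (spec M) p (poly_fun n.+1 rho0)
    (fun q => cexp (a * q.1 / q.2 ^+ 2) * q.2 ^ l * poly_fun n.+1 rho1 (transition q))) ->
  forall z, z != 0 -> pmx (quart M z) (\col_i rho0 i z) = gluemx a l rho1 z.
Proof.
move=> d0 d1 h z z0.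
apply: (calculus_faithful (@quart_entire M) (fun=> erefl) e0 c0
  (f := fun q => cexp (a * q.1 / q.2 ^+ 2) * q.2 ^ l *
                 poly_fun n.+1 rho1 (transition q))
  (X := fun q => gluemx a l rho1 q.2)) => //.
- exact: gluemx_near_dif.
- by apply: filterS (near_neq0 z0) => x; exact: gluemx_comm.
- by move=> w _; exact: fc_glue.
- by move=> w; exact: h.
Qed.

End Pair.

End Spectral.

(** * Triviality and vanishing of line bundles from frames *)

Section ChangeOfVector.
Variables (R : realType) (n : nat).
Local Notation C := R[i].
Variables (A : C -> 'M[C]_n.+1) (P : C * C -> C).
Hypothesis Ae : entire A.
Hypothesis PE : forall q, P q = \det (q.1%:M - A q.2).
Implicit Types (v w : C -> 'cV[C]_n.+1).

(** Coefficients of the polynomial in A that maps v to w. *)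
Definition vcoef v w (i : nat) z : C := (invmx (krylov (A z) (v z)) *m w z) (inord i) 0.

Lemma col_vcoef v w z :
  \col_(i < n.+1) vcoef v w i z = invmx (krylov (A z) (v z)) *m w z.
Proof. by apply/colP => i; rewrite mxE /vcoef inord_val. Qed.

Lemma vcoef_dif v w i z : entire v -> entire w ->
  (forall z, cyclic (A z) (v z)) -> differentiable (vcoef v w i) z.
Proof.
move=> ve we vc; apply: dmxM; last exact: we.
apply: dmx_inv => //; apply: dmx_krylov; [exact: Ae | exact: ve].
Qed.

Lemma vcoefE v w z : cyclic (A z) (v z) ->
  pmx (A z) (\col_i vcoef v w i z) *m v z = w z.
Proof. by move=> vc; rewrite col_vcoef pmxE mulKVmx. Qed.

Lemma Osection_cst (Q f : C * C -> C) : (forall q, differentiable f q) ->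
  Osection Q (fun=> f).
Proof.
move=> df p _; split; first exact: near_all.
apply: near_all => q _; exists (fun=> 0); split.
  by apply: near_all => x; exact: differentiable_cst.
by apply: near_all => x; rewrite subrr mul0r.
Qed.

Lemma poly_fun_dif (rho : nat -> C -> C) q : (forall i z, differentiable (rho i) z) ->
  differentiable (poly_fun n.+1 rho) q.
Proof. by move=> h; apply: dif_poly_fun. Qed.

Lemma vcoef_unit v w : entire v -> entire w ->
  (forall z, cyclic (A z) (v z)) -> (forall z, cyclic (A z) (w z)) ->
  Oinvertible P (fun=> poly_fun n.+1 (vcoef v w)).
Proof.
move=> ve we vc wc.
have d1 i z := vcoef_dif i z ve we vc; have d2 i z := vcoef_dif i z we ve wc.
exists (fun=> poly_fun n.+1 (vcoef w v)).
  by apply: Osection_cst => q; exact: poly_fun_dif.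
have fcp p rho : (forall i z, differentiable (rho i) z) -> fc A p (poly_fun n.+1 rho)
    (fun q => pmx (A q.2) (\col_i rho i q.2)).
  by move=> h; apply: fc_poly => // i; apply: near_all.
move=> p _; apply: (fc_germ Ae PE ve vc (fcM (fcp p _ d1) (fcp p _ d2)) (fc_cst A 1 p)).
apply: near_all => q; apply/eqP; rewrite -subr_eq0; apply/eqP.
apply: (cyclic_kill (M := A q.2) (v := w q.2)) => //.
  rewrite mulmxBl mulmxBr mul1mx mulmx1; congr (_ - _).
  by rewrite -mulmxA pmx_comm mulmxA pmx_comm mulmxA.
by rewrite mulmxBl mul1mx -mulmxA !vcoefE // subrr.
Qed.

End ChangeOfVector.

Section FrameConsequences.
Variables (R : realType) (n : nat) (M : nat -> 'M[R[i]]_n.+1).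
Local Notation C := R[i].
Local Notation A := (quart M).
Local Notation B := (quart (rev4 M)).

Lemma ex_rev_comm z w b : z != 0 ->
  ex (A z) w *m pmx (B z^-1) b = pmx (B z^-1) b *m ex (A z) w.
Proof.
move=> z0; apply: pmx_commr; rewrite quart_rev4 // -scalemxAl -scalemxAr.
by rewrite ex_comm.
Qed.

(** Multiplication by the units taking x0 to y0 and x1 to y1. On the overlap
    they differ by exp((a - b) eta / xi^2). *)
Lemma frame_trivial (a b : C) x0 x1 y0 y1 : frame M a x0 x1 -> frame M b y0 y1 ->
  a - b = 2 -> Ltrivial (spec M) (spec (rev4 M)) 2 0.
Proof.
move=> [x0e x1e x0c x1c xE] [y0e y1e y0c y1c yE] ab.
have Ae := @quart_entire R n M; have Be := @quart_entire R n (rev4 M).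
have d0 i z := vcoef_dif Ae i z x0e y0e x0c.
have d1 i z := vcoef_dif Be i z x1e y1e x1c.
exists (fun=> poly_fun n.+1 (vcoef A x0 y0)), (fun=> poly_fun n.+1 (vcoef B x1 y1)).
split; last 2 first.
- exact: vcoef_unit.
- exact: vcoef_unit.
split; try by apply: Osection_cst => q; exact: poly_fun_dif.
move=> p p0 _; apply: (glue_germ x0e x0c) => // z z0.
apply/eqP; rewrite -subr_eq0; apply/eqP.
apply: (cyclic_kill (M := A z) (v := x0 z)) => //.
  by rewrite mulmxBl mulmxBr pmx_comm gluemx_comm.
rewrite mulmxBl vcoefE // /gluemx expr0z scale1r -mulmxA.
set X := pmx (B z^-1) _.
have h : ex (A z) (a / z ^+ 2) *m (X *m x0 z) = ex (A z) (b / z ^+ 2) *m y0 z.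
  by rewrite mulmxA ex_rev_comm // -mulmxA xE // -scalemxAr vcoefE // -yE.
have -> : 2 / z ^+ 2 = - (b / z ^+ 2) + a / z ^+ 2 by rewrite -ab; ring.
by rewrite -ex_add -mulmxA h mulmxA ex_add addNr ex0 mul1mx subrr.
Qed.

Lemma germ_mul (P f g u : C * C -> C) p : (\forall q \near p, differentiable u q) ->
  germ_eqmod P p f g -> germ_eqmod P p (fun q => u q * f q) (fun q => u q * g q).
Proof.
move=> du [h [dh he]]; exists (fun q => u q * h q); split.
  by apply: filterS2 du dh => q; exact: differentiableM.
by apply: filterS he => q hq; rewrite -mulrBr hq mulrA.
Qed.

(** The function w0 tends to 0 at infinity. *)
Lemma inverse_vanish (w0 w1 : C -> C) : (forall z, differentiable w0 z) ->
  (forall z, differentiable w1 z) -> (forall z : C, z != 0 -> w0 z = z^-1 * w1 z^-1) ->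
  forall z, w0 z = 0 /\ w1 z = 0.
Proof.
move=> d0 d1 h.
have c1 : continuous w1 by move=> z; exact: differentiable_continuous.
have [K0 hK0] := bounded_on_disc 1 c1.
have [K K1 hK] : exists2 K : R, 0 <= K & forall z, cn z <= 1 -> cn (w1 z) <= K.
  by exists `|K0| => // z /hK0 hz; exact: le_trans hz (ler_norm _).
have w00 : forall z, w0 z = 0.
  apply: liouville => // e e0; exists (1 + K / e) => z hz.
  have p0 : 0 <= K / e by rewrite divr_ge0 // ltW.
  have z0 : z != 0 by rewrite -cn_gt0; lra.
  have zp : 0 < cn z by rewrite cn_gt0.
  rewrite h // cnM cnV ler_pdivrMl //.
  apply: le_trans (hK _ _) _; first by rewrite cnV invf_le1 //; lra.
  have : K / e <= cn z by lra.
  by rewrite ler_pdivrMr.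
move=> z; split=> //.
have w1n (y : C) : y != 0 -> w1 y = 0.
  move=> y0; have := h y^-1; rewrite w00 invrK invr_eq0 => /(_ y0)/esym/eqP.
  by rewrite mulf_eq0 (negbTE y0) => /eqP.
have [->|] := eqVneq z 0; last exact: w1n.
apply: cn_eps0 => e e0; have := c1 0.
move=> /(@cvgrPdist_lt _ _ _ (nbhs (0 : C))) /(_ e%:C); rewrite ltcR => /(_ e0).
move=> /near_vnP[d d0' hd].
have d2 : (d / 2)%:C != 0 :> C by rewrite (inj_eq (@complexI R)); lra.
have := hd (d / 2)%:C; rewrite (w1n _ d2) !subr0 normCE ltcR /vn normCE /=.
rewrite expr0n addr0 sqrtr_sqr gtr0_norm; last by lra.
by move=> H; apply: ltW; apply: H; lra.
Qed.

(** A section is a pair of matrices commuting with A over the two charts.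
    Applied to the frame, they give entire vectors w0 and w1 with w0(xi) =
    xi^-1 w1(1/xi), which vanish; a matrix commuting with A that kills a
    cyclic vector is zero. *)
Lemma frame_vanish (a : C) x0 x1 : frame M a x0 x1 ->
  LH0_eq0 (spec M) (spec (rev4 M)) a (2 * n.+1%:Z - 3).
Proof.
move=> [x0e x1e x0c x1c xE] s0 s1 [os0 os1 rel].
have Ae := @quart_entire R n M; have Be := @quart_entire R n (rev4 M).
have [rho0 [d0 g0]] := section_poly (spectral_coef_dif Ae)
  (spectral_coef (A := A) (P := spec M) (fun=> erefl)) os0.
have [rho1 [d1 g1]] := section_poly (spectral_coef_dif Be)
  (spectral_coef (A := B) (P := spec (rev4 M)) (fun=> erefl)) os1.
set l := (_ - 3 : int) in rel.
have mrel (z : C) : z != 0 -> pmx (A z) (\col_i rho0 i z) = gluemx M a l rho1 z.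
  apply: (germ_glue x0e x0c) => // p p0 Pp.
  apply: germ_trans (germ_sym (g0 p Pp)) _; apply: germ_trans (rel p p0 Pp) _.
  apply: germ_mul.
    have n0 := near_snd_neq0 p0; apply: filterS n0 => q q0.
    apply: differentiableM; last by apply: (@dif_comp_snd _ (fun z => z ^ l)); exact: dif_expz.
    have -> : (fun q : C * C => cexp (a * q.1 / q.2 ^+ 2)) =
       @es R \o (fun q : C * C => a * q.1 / q.2 ^+ 2).
      by apply/funext => x /=; rewrite cexpE.
    apply: differentiable_comp; last exact: (es_dv _).1.
    apply: differentiableM.
      by apply: differentiableM; [exact: differentiable_cst | exact: dif_fst].
    apply: differentiableV; last exact: expf_neq0.
    by apply: dif_exp; exact: dif_snd.
  apply: (germ_transition p0); apply: g1; apply/eqP.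
  by rewrite spec_transition_eq0 // Pp.
pose w0 z := pmx (A z) (\col_i rho0 i z) *m x0 z.
pose w1 z := pmx (B z) (\col_i rho1 i z) *m x1 z.
have wE (z : C) : z != 0 -> w0 z = z^-1 *: w1 z^-1.
  move=> z0; rewrite /w0 mrel // /gluemx -scalemxAl ex_rev_comm // -mulmxA xE //.
  rewrite -scalemxAr scalerA; congr (_ *: _).
  have -> : (z ^- n) ^+ 2 = z ^ (- (2 * n%:Z)).
    by rewrite exprnN exprnP exprz_exp; congr (_ ^ _); lia.
  by rewrite -expfzDr // -exprN1; congr (_ ^ _); rewrite /l; lia.
have wd (D : C -> 'M[C]_n.+1) (rho : nat -> C -> C) (x : C -> 'cV[C]_n.+1) :
    entire D -> (forall i z, differentiable (rho i) z) ->
    entire x -> entire (fun z => pmx (D z) (\col_i rho i z) *m x z).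
  move=> De dr xe z.
  apply: (@dmx_eq _ _ _ _ _ (fun z => krylov (D z) (x z) *m \col_(i < n.+1) rho i z)).
    by move=> y; rewrite pmxE.
  apply: dmxM; first exact: dmx_krylov (De z) (xe z).
  move=> i j; have -> : (fun y => (\col_i0 rho i0 y) i j) = rho i.
    by apply/funext => y; rewrite mxE.
  exact: dr.
have w00 z : w0 z = 0 /\ w1 z = 0.
  have H i := inverse_vanish (fun z => wd _ _ _ Ae d0 x0e z i 0)
    (fun z => wd _ _ _ Be d1 x1e z i 0).
  have H' i : w0 z i 0 = 0 /\ w1 z i 0 = 0.
    apply: H => y y0.
    by have := wE y y0 => /(congr1 (fun X : 'cV[C]_n.+1 => X i 0)) ->; rewrite mxE.
  by split; apply/colP => i; rewrite [RHS]mxE; have [] := H' i.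
have kill (D : C -> 'M[C]_n.+1) (rho : nat -> C -> C) (x : C -> 'cV[C]_n.+1) z :
    cyclic (D z) (x z) ->
    pmx (D z) (\col_i rho i z) *m x z = 0 -> forall i : 'I_n.+1, rho i z = 0.
  move=> c; rewrite pmxE => h i.
  have := mulKmx c (\col_i rho i z); rewrite h mulmx0 => /colP/(_ i).
  by rewrite !mxE.
split=> p Pp.
  apply: germ_trans (g0 p Pp) _; exists (fun=> 0); split.
    by apply: near_all => q; exact: differentiable_cst.
  apply: near_all => q; rewrite mul0r subr0 /poly_fun big1 // => i _.
  by rewrite (kill _ _ _ _ (x0c q.2) (w00 q.2).1) mul0r.
apply: germ_trans (g1 p Pp) _; exists (fun=> 0); split.
  by apply: near_all => q; exact: differentiable_cst.
apply: near_all => q; rewrite mul0r subr0 /poly_fun big1 // => i _.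
by rewrite (kill _ _ _ _ (x1c q.2) (w00 q.2).2) mul0r.
Qed.

End FrameConsequences.

(** * Compactness of the curve *)

Section SupportCompactness.
Variables (R : realType) (n : nat).
Local Notation C := R[i].
Implicit Types (M : nat -> 'M[C]_n.+1).

Lemma chart_swap (b : bool) (p : C * C) : p.2 != 0 ->
  chart b p = chart (~~ b) (transition p).
Proof.
move=> p0; apply/eqmodP => /=; rewrite /glue /=; apply/orP; right.
by rewrite p0 eqxx /= andbT; case: b.
Qed.

Lemma chart_continuous (b : bool) : continuous (@chart R b).
Proof.
move=> p; apply: (@continuous_comp _ _ _ (fun p : C * C => (b, p))); last exact: pi_continuous.
move=> A [[U W] /= [bU pW] UW]; apply: filterS pW => q Wq.
by apply: UW; split=> //=; exact: nbhs_singleton bU.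
Qed.

Lemma spec_continuous M : continuous (spec M).
Proof.
move=> p; apply: differentiable_continuous.
exact: (P_dif (spectral_coef_dif (@quart_entire R n M)) (spectral_coef (fun=> erefl))).
Qed.

(** The coefficients of the monic polynomial are bounded on the disc. *)
Lemma spec_bounded M : exists B : R, forall p : C * C,
  cn p.2 <= 1 -> spec M p = 0 -> cn p.1 <= B.
Proof.
pose pc i z := (char_poly (quart M z))`_i.
have cb i := cid (bounded_on_disc 1
  (fun z => differentiable_continuous (spectral_coef_dif (@quart_entire R n M) i z))).
pose K := \sum_(i < n.+1) `|sval (cb i)|.
have K0 : 0 <= K by apply: sumr_ge0.
exists (1 + K) => p p2 /eqP; rewrite (spectral_coef (A := quart M)) // addr_eq0.
move=> /eqP h; rewrite leNgt; apply/negP => p1.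
have c1 : 1 <= cn p.1 by lra.
have : cn p.1 ^+ n.+1 <= K * cn p.1 ^+ n.
  rewrite -cnX h cnN; apply: le_trans (cn_sum _ _ _) _.
  rewrite /K mulr_suml; apply: ler_sum => i _; rewrite cnM cnX.
  apply: ler_pM; rewrite ?cn_ge0 ?exprn_ge0 ?cn_ge0 //.
    exact: le_trans (svalP (cb i) _ p2) (ler_norm _).
  by apply: ler_weXn2l => //; rewrite -ltnS.
rewrite exprS ler_pM2r; first by lra.
by rewrite exprn_gt0 //; lra.
Qed.

Lemma compact_chart (b : bool) M :
  compact (chart b @` [set p : C * C | spec M p = 0 /\ cn p.2 <= 1]).
Proof.
apply: continuous_compact.
  by apply: continuous_subspaceT; exact: chart_continuous.
have [B hB] := spec_bounded M.
apply: (subclosed_compact _ (compact_setX (@compact_disc R B) (@compact_disc R 1))).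
  apply: closed_eps => p h; split.
    apply: cn_eps0 => e e0; have := @spec_continuous M p.
    move=> /(@cvgrPdist_lt _ _ _ (nbhs p)) /(_ e%:C); rewrite ltcR => /(_ e0).
    move=> /near_vnP[d d0 hd]; have [x [sx _] xd] := h d d0.
    by have := hd x xd; rewrite sx subr0 normCE ltcR; exact: ltW.
  apply/ler_addgt0Pl => e e0; have [x [_ x1] xd] := h e e0.
  have := le_lt_trans (vn_snd (x - p)) xd.
  by have := cn_subr p.2 x.2; rewrite (cnB p.2) /=; lra.
by move=> p [sp p1]; split => //; exact: hB.
Qed.

(** Every point of the total space has coordinates with |xi| <= 1 in one of
    the two charts. *)
Lemma support_compact M : compact (divisor_support (spec M) (spec (rev4 M))).
Proof.
suff -> : divisor_support (spec M) (spec (rev4 M)) =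
    (chart false @` [set p : C * C | spec M p = 0 /\ cn p.2 <= 1]) `|`
    (chart true @` [set p : C * C | spec (rev4 M) p = 0 /\ cn p.2 <= 1]).
  by apply: compactU; exact: compact_chart.
have swap (b : bool) M' (p : C * C) : spec M' p = 0 -> 1 < cn p.2 ->
    (chart (~~ b) @` [set p : C * C | spec (rev4 M') p = 0 /\ cn p.2 <= 1]) (chart b p).
  move=> sp p1; have p0 : p.2 != 0 by rewrite -cn_gt0; lra.
  exists (transition p); last by rewrite -chart_swap.
  split; first by apply/eqP; rewrite spec_transition_eq0 // sp.
  by rewrite /transition /= cnV invf_le1 ?ltW //; lra.
apply/seteqP; split=> x.
  move=> [[p sp <-]|[p sp <-]]; have [p1|p1] := leP (cn p.2) 1.
  - by left; exists p.
  - by right; exact: (swap false).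
  - by right; exists p.
  - by left; apply: (swap true _ _ sp).
by move=> [[p [sp _] <-]|[p [sp _] <-]]; [left | right]; exists p.
Qed.

End SupportCompactness.

(** * Linear differential equations with a regular singularity *)

Section MatrixSizeMore.
Variable R : realType.
Local Notation C := R[i].

Lemma mnD m p (M N : 'M[C]_(m, p)) : mn (M + N) <= mn M + mn N.
Proof.
rewrite /mn -big_split /=; apply: ler_sum => i _; rewrite -big_split /=.
by apply: ler_sum => j _; rewrite mxE cnD.
Qed.

Lemma mn0 m p : mn (0 : 'M[C]_(m, p)) = 0.
Proof. by rewrite /mn big1 // => i _; rewrite big1 // => j _; rewrite mxE cn0. Qed.

Lemma mnZ m p (a : C) (M : 'M[C]_(m, p)) : mn (a *: M) = cn a * mn M.
Proof.
rewrite /mn mulr_sumr; apply: eq_bigr => i _; rewrite mulr_sumr.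
by apply: eq_bigr => j _; rewrite mxE cnM.
Qed.

Lemma mnN m p (M : 'M[C]_(m, p)) : mn (- M) = mn M.
Proof. by rewrite -scaleN1r mnZ cnN cn1 mul1r. Qed.

Lemma mn_sum m p (I : Type) (r : seq I) (P : pred I) (F : I -> 'M[C]_(m, p)) :
  mn (\sum_(i <- r | P i) F i) <= \sum_(i <- r | P i) mn (F i).
Proof.
elim/big_rec2: _ => [|i u v _ h]; first by rewrite mn0.
by apply: le_trans (mnD _ _) _; rewrite lerD2l.
Qed.

Lemma entire_bounded m p (F : C -> 'M[C]_(m, p)) (rho : R) : entire F ->
  exists2 B : R, 0 <= B & forall z, cn z <= rho -> mn (F z) <= B.
Proof.
move=> Fe; have hb ij := cid (bounded_on_disc rho
  (fun z => differentiable_continuous (Fe z ij.1 ij.2))).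
exists (\sum_i \sum_j `|sval (hb (i, j))|).
  by apply: sumr_ge0 => i _; apply: sumr_ge0.
move=> z hz; apply: ler_sum => i _; apply: ler_sum => j _.
exact: le_trans (svalP (hb (i, j)) z hz) (ler_norm _).
Qed.

End MatrixSizeMore.

Section RecursiveSolution.
Variables (R : realType) (n p : nat).
Local Notation C := R[i].
Variables (m : nat -> C -> 'M[C]_n.+1) (x0 : C -> 'M[C]_(n.+1, p)).

(** Course-of-values recursion: the entries of sol_table k up to k are the
    coefficients. *)
Fixpoint sol_table k : nat -> C -> 'M[C]_(n.+1, p) :=
  if k is k'.+1 then fun i => if (i <= k')%N then sol_table k' i else fun z =>
    - (invmx (k'.+1%:R%:M + m 0 z) *m
       \sum_(j < k'.+1) m j.+1 z *m sol_table k' (k' - j) z)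
  else fun=> x0.

(** Coefficients of the solution of t x' = - m x by a power series in t with
    constant term x0. *)
Definition sol k := sol_table k k.

Lemma sol_tableE k i : (i <= k)%N -> sol_table k i = sol i.
Proof.
elim: k => [|k IH]; first by rewrite leqn0 => /eqP ->.
rewrite leq_eqVlt => /orP[/eqP -> //|]; rewrite ltnS => ik /=.
by rewrite ik; exact: IH.
Qed.

Lemma solS k z : sol k.+1 z = - (invmx (k.+1%:R%:M + m 0 z) *m
       \sum_(j < k.+1) m j.+1 z *m sol (k - j) z).
Proof.
rewrite {1}/sol /= ltnn; congr (- (_ *m _)); apply: eq_bigr => j _.
by rewrite sol_tableE // leq_subr.
Qed.

Variable r : R.
Hypothesis r0 : 0 < r.
Hypothesis me : forall j, entire (m j).
Hypothesis mb : forall rho : R, exists K : R, forall j z, cn z <= rho ->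
  mn (m j z) * r ^+ j <= K.
Hypothesis x0e : entire x0.
Hypothesis mx0 : forall z, m 0 z *m x0 z = 0.
Hypothesis mu : forall k z, (k.+1%:R%:M + m 0 z) \in unitmx.

Lemma sol_eq k z : k%:R *: sol k z = - \sum_(j < k.+1) m j z *m sol (k - j) z.
Proof.
case: k => [|k]; first by rewrite scale0r big_ord1 mx0 oppr0.
rewrite big_ord_recl /= subn0.
have -> : \sum_(i < k.+1) m (bump 0 i) z *m sol (k.+1 - bump 0 i) z =
          \sum_(j < k.+1) m j.+1 z *m sol (k - j) z by [].
set S := \sum_(j < k.+1) _.
have h : (k.+1%:R%:M + m 0 z) *m sol k.+1 z = - S.
  by rewrite solS mulmxN mulKVmx.
rewrite opprD -h mulmxDl mul_scalar_mx addrCA.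
by rewrite addNr addr0.
Qed.

Lemma sol_entire k : entire (sol k).
Proof.
elim/ltn_ind: k => -[|k] IH z; first exact: x0e.
apply: (@dmx_eq _ _ _ _ _ (fun z => (-1) *: (invmx (k.+1%:R%:M + m 0 z) *m
       \sum_(j < k.+1) m j.+1 z *m sol (k - j) z))) => [y|].
  by rewrite solS scaleN1r.
apply: dmxZ; first exact: differentiable_cst.
apply: dmxM.
  by apply: dmx_inv => //; apply: dmxD; [exact: dmx_cst | exact: me].
move=> a b; have -> : (fun y => (\sum_(j < k.+1) m j.+1 y *m sol (k - j) y) a b) =
   (fun y => \sum_(j < k.+1) (m j.+1 y *m sol (k - j) y) a b).
  by apply/funext => y; rewrite summxE.
apply: dif_bigsum => j; apply: dmxM; first exact: me.
by apply: IH; rewrite ltnS leq_subr.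
Qed.

Lemma geo_sum_le N : \sum_(j < N) (2^-1 : R) ^+ j.+1 <= 1.
Proof.
suff : \sum_(j < N) (2^-1 : R) ^+ j.+1 = 1 - 2^-1 ^+ N.
  by move=> ->; rewrite lerBlDr lerDl exprn_ge0.
elim: N => [|N IH]; first by rewrite big_ord0 expr0 subrr.
by rewrite big_ord_recr /= IH exprS; field.
Qed.

(** In sol_eq the factor k dominates the term with m 0 when k > 2K, and
    halving the radius makes the other terms summable. *)
Lemma sol_bound (rho : R) : exists K : R, forall k z, cn z <= rho ->
  mn (sol k z) * (r / 2) ^+ k <= K.
Proof.
have [K0 hK0] := mb rho.
have [K Kge hK] : exists2 K : R, 0 <= K & forall j z, cn z <= rho -> mn (m j z) * r ^+ j <= K.
  by exists `|K0| => // j z hz; exact: le_trans (hK0 j z hz) (ler_norm _).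
have s0 : 0 < r / 2 by rewrite divr_gt0.
pose N := Num.bound (2 * K).
have hN : 2 * K < N%:R by apply: archi_boundP; rewrite mulr_ge0.
have fb k := cid2 (entire_bounded rho (sol_entire k)).
pose C0 := \sum_(k < N.+1) s2val (fb k) * (r / 2) ^+ k.
have t0 k : 0 <= s2val (fb k) * (r / 2) ^+ k.
  by rewrite mulr_ge0 ?(s2valP (fb k)) // exprn_ge0 // ltW.
have C00 : 0 <= C0 by apply: sumr_ge0 => k _.
exists C0 => k z hz; elim/ltn_ind: k => k IH.
have [kN|Nk] := leqP k N.
  apply: (@le_trans _ _ (s2val (fb k) * (r / 2) ^+ k)).
    by rewrite ler_wpM2r ?exprn_ge0 ?(ltW s0) //; exact: (s2valP' (fb k)).
  have kN' : (k < N.+1)%N by rewrite ltnS.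
  by rewrite /C0 (bigD1 (Ordinal kN')) //= lerDl; apply: sumr_ge0.
set y := mn (sol k z) * _.
have y0 : 0 <= y by rewrite mulr_ge0 ?mn_ge0 // exprn_ge0 // ltW.
have main : k%:R * y <= K * y + K * C0.
  have -> : k%:R * y = mn (k%:R *: sol k z) * (r / 2) ^+ k.
    by rewrite mnZ cn_nat mulrA.
  rewrite sol_eq mnN big_ord_recl subn0 /=.
  apply: (@le_trans _ _ ((mn (m 0 z *m sol k z) +
      mn (\sum_(i < k) m (bump 0 i) z *m sol (k - bump 0 i) z)) * (r / 2) ^+ k)).
    by rewrite ler_wpM2r ?exprn_ge0 ?(ltW s0) //; exact: mnD.
  rewrite mulrDl lerD //.
    apply: (@le_trans _ _ (mn (m 0 z) * mn (sol k z) * (r / 2) ^+ k)).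
      by rewrite ler_wpM2r ?exprn_ge0 ?(ltW s0) // mnM.
    rewrite -mulrA ler_wpM2r //; have := hK 0 z hz.
    by rewrite expr0 mulr1.
  apply: (@le_trans _ _ (\sum_(i < k) (2^-1 : R) ^+ i.+1 * (K * C0))); last first.
    by rewrite -mulr_suml ler_piMl ?mulr_ge0 // geo_sum_le.
  apply: (@le_trans _ _ ((\sum_(i < k) mn (m i.+1 z *m sol (k - i.+1) z)) * (r / 2) ^+ k)).
    by rewrite ler_wpM2r ?exprn_ge0 ?(ltW s0) //; exact: mn_sum.
  rewrite mulr_suml; apply: ler_sum => i _.
  apply: (@le_trans _ _ (mn (m i.+1 z) * mn (sol (k - i.+1) z) * (r / 2) ^+ k)).
    by rewrite ler_wpM2r ?exprn_ge0 ?(ltW s0) // mnM.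
  have -> : (r / 2) ^+ k = r ^+ i.+1 * 2^-1 ^+ i.+1 * (r / 2) ^+ (k - i.+1).
    by rewrite -exprMn -exprD subnKC.
  have -> : mn (m i.+1 z) * mn (sol (k - i.+1) z) *
      (r ^+ i.+1 * 2^-1 ^+ i.+1 * (r / 2) ^+ (k - i.+1)) =
    2^-1 ^+ i.+1 * ((mn (m i.+1 z) * r ^+ i.+1) *
      (mn (sol (k - i.+1) z) * (r / 2) ^+ (k - i.+1))) by ring.
  rewrite ler_wpM2l ?exprn_ge0 //; apply: ler_pM.
  - by rewrite mulr_ge0 ?mn_ge0 // exprn_ge0 // ltW.
  - by rewrite mulr_ge0 ?mn_ge0 // exprn_ge0 // ltW.
  - exact: hK.
  - by apply: IH; rewrite ltn_subrL /= (leq_ltn_trans _ Nk).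
have kK : 2 * K + 1 <= k%:R.
  have : (N%:R : R) + 1 <= k%:R by rewrite natr1 ler_nat.
  by move: hN; lra.
rewrite leNgt; apply/negP => Cy.
have : K * C0 <= K * y by rewrite ler_wpM2l // ltW.
have yp : 0 < y by apply: le_lt_trans Cy.
have : (2 * K + 1) * y <= k%:R * y by rewrite ler_wpM2r.
nra.
Qed.

End RecursiveSolution.

Section MatrixPowerSeries.
Variable R : realType.
Local Notation C := R[i].

(** At radius s/4 the i-th term of the double sum is smaller by 2^-i than
    the bound at radius s/2, so the errors add up to a geometric one. *)
Lemma cauchy_product (a b : nat -> C) (s K L : R) z : 0 < s ->
  geo_bound a s K -> geo_bound b s L -> cn z <= 4^-1 * s ->
  conv (fun N => \sum_(k < N) (\sum_(j < k.+1) a j * b (k - j)%N) * z ^+ k)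
    (psum a z * psum b z).
Proof.
move=> s0 ha hb hz.
have K0 := geo_bound_ge0 ha; have L0 := geo_bound_ge0 hb.
have hz2 : cn z <= 2^-1 * s by apply: le_trans hz _; rewrite ler_wpM2r ?(ltW s0) //; lra.
pose S N := \sum_(j < N) b j * z ^+ j.
have PE N : \sum_(k < N) (\sum_(j < k.+1) a j * b (k - j)%N) * z ^+ k =
            \sum_(i < N) a i * z ^+ i * S (N - i)%N.
  elim: N => [|N IH]; first by rewrite !big_ord0.
  rewrite big_ord_recr /= IH mulr_suml.
  have -> : \sum_(i < N.+1) a i * z ^+ i * S (N.+1 - i)%N =
     \sum_(i < N.+1) (a i * z ^+ i * S (N - i)%N + a i * b (N - i)%N * z ^+ N).
    apply: eq_bigr => i _; rewrite subSn -1?ltnS // {1}/S big_ord_recr /= -/(S _).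
    have -> : z ^+ N = z ^+ i * z ^+ (N - i) by rewrite -exprD subnKC // -ltnS.
    by ring.
  rewrite big_split /= [X in _ = X + _]big_ord_recr /= subnn /S big_ord0 mulr0.
  by rewrite addr0.
pose A N := \sum_(i < N) a i * z ^+ i.
apply: (@eq_conv _ (fun N => \sum_(i < N) a i * z ^+ i * (S (N - i)%N - psum b z) +
   psum b z * A N)) => [N|].
  rewrite PE /A mulr_sumr -big_split /=; apply: eq_bigr => i _; ring.
rewrite -[X in conv _ X]add0r (mulrC (psum a z)); apply: convD; last first.
  by apply: convZ; exact: psum_conv hz2.
apply: (@conv_rate _ _ _ (8 * K * L)); first by rewrite !mulr_ge0.
move=> N; rewrite subr0; apply: le_trans (cn_sum _ _ _) _.
apply: (@le_trans _ _ (\sum_(i < N) (2^-1 : R) ^+ i.+1 * (8 * K * L * 2^-1 ^+ N))); last first.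
  rewrite -mulr_suml ler_piMl ?geo_sum_le // mulr_ge0 ?exprn_ge0 //.
  by rewrite !mulr_ge0.
apply: ler_sum => i _; rewrite cnM.
have h1 := geo_bound_term i s0 (_ : 0 <= 4^-1) ha hz.
have h2 := psum_rate s0 hb hz2 (N - i).
apply: le_trans (ler_pM (cn_ge0 _) (cn_ge0 _) (h1 _) h2) _ => //.
have -> : (2^-1 : R) ^+ N = 2^-1 ^+ i * 2^-1 ^+ (N - i) by rewrite -exprD subnKC // ltnW.
have -> : (4^-1 : R) ^+ i = 2^-1 ^+ i * 2^-1 ^+ i.
  by rewrite -exprMn; congr (_ ^+ _); field.
by rewrite exprS le_eqVlt; apply/orP; left; apply/eqP; field.
Qed.

Section Evaluation.
Variables (a b : nat).
Implicit Types (c : nat -> 'M[C]_(a, b)).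

Definition ev c z : 'M[C]_(a, b) := \matrix_(i, j) psum (fun k => c k i j) z.

Definition gbmx c (s K : R) := forall i j, geo_bound (fun k => c k i j) s K.

Lemma ev0 c : ev c 0 = c 0%N.
Proof.
apply/matrixP => i j; rewrite mxE; apply: psumE => e e0; exists 1%N => -[//|N] _.
rewrite big_ord_recl /= expr0 mulr1 big1 ?addr0 ?subrr ?cn0 ?ltW // => k _.
by rewrite exprS mul0r mulr0.
Qed.

Lemma ev_dif c s K z : 0 < s -> gbmx c s K -> cn z < 2^-1 * s -> dmx z (ev c).
Proof.
move=> s0 h hz i j; have [d _] := psum_dif s0 (h i j) hz.
by have -> : (fun z => ev c z i j) = psum (fun k => c k i j);
  [apply/funext => x; rewrite mxE | exact: d].
Qed.

Lemma ev_dv_conv c s K z i j : 0 < s -> gbmx c s K -> cn z < 2^-1 * s ->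
  conv (fun N => \sum_(k < N) (k.+1%:R * c k.+1 i j) * z ^+ k)
    (dv (fun z => ev c z i j) z 1).
Proof.
move=> s0 h hz; have [_] := psum_dif s0 (h i j) hz.
by have -> : (fun z => ev c z i j) = psum (fun k => c k i j) by
  apply/funext => x; rewrite mxE.
Qed.

End Evaluation.

Lemma ev_mul a b d (c : nat -> 'M[C]_(a, b)) (c' : nat -> 'M[C]_(b, d)) s K L z :
  0 < s -> gbmx c s K -> gbmx c' s L -> cn z <= 4^-1 * s ->
  mlim (fun N => \sum_(k < N) z ^+ k *: \sum_(j < k.+1) c j *m c' (k - j)%N)
    (ev c z *m ev c' z).
Proof.
move=> s0 h h' hz i j; rewrite mxE.
rewrite (eq_bigr (fun l => psum (fun k => c k i l) z * psum (fun k => c' k l j) z));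
  last by move=> l _; rewrite !mxE.
apply: eq_conv (conv_sum _ _ (fun l => cauchy_product s0 (h i l) (h' l j) hz)) => N /=.
rewrite summxE exchange_big /=; apply: eq_bigr => k _.
rewrite mxE summxE mulr_sumr -mulr_suml mulrC; rewrite exchange_big /= mulr_sumr.
by apply: eq_bigr => l _; rewrite mxE.
Qed.

(** Comparison of coefficients; t d/dt multiplies the k-th one by k. *)
Lemma ev_ode a b (m : nat -> 'M[C]_a) (x : nat -> 'M[C]_(a, b)) s K L z i j :
  0 < s -> gbmx m s K -> gbmx x s L -> cn z <= 4^-1 * s ->
  (forall k, k%:R *: x k = - \sum_(l < k.+1) m l *m x (k - l)%N) ->
  z * dv (fun z => ev x z i j) z 1 = - (ev m z *m ev x z) i j.
Proof.
move=> s0 hm hx hz rec.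
have hz2 : cn z < 2^-1 * s.
  by apply: le_lt_trans hz _; rewrite ltr_pM2r //; lra.
have h1 := convZ z (ev_dv_conv i j s0 hx hz2).
have h2 := convZ (-1) (conv_shift (ev_mul s0 hm hx hz i j)).
rewrite -[RHS]mulN1r; apply: (conv_unique h1); apply: eq_conv h2 => N.
rewrite summxE !mulr_sumr big_ord_recl /=.
have rec' k : \sum_(l < k.+1) m l *m x (k - l)%N = - (k%:R *: x k).
  by rewrite rec opprK.
rewrite (rec' 0%N) scale0r oppr0 scaler0 mxE mulr0 add0r.
apply: eq_bigr => k _; rewrite (rec' (bump 0 k)) /bump add1n !mxE exprS.
by ring.
Qed.

Lemma ev_ode_regular a b (m : nat -> 'M[C]_a) (x : nat -> 'M[C]_(a, b)) s K L z i j :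
  0 < s -> gbmx m s K -> gbmx x s L -> cn z <= 4^-1 * s ->
  (forall k, k.+1%:R *: x k.+1 = - \sum_(l < k.+1) m l *m x (k - l)%N) ->
  dv (fun z => ev x z i j) z 1 = - (ev m z *m ev x z) i j.
Proof.
move=> s0 hm hx hz rec.
have hz2 : cn z < 2^-1 * s.
  by apply: le_lt_trans hz _; rewrite ltr_pM2r //; lra.
have h1 := ev_dv_conv i j s0 hx hz2.
have h2 := convZ (-1) (ev_mul s0 hm hx hz i j).
rewrite -[RHS]mulN1r; apply: (conv_unique h1); apply: eq_conv h2 => N.
rewrite summxE mulr_sumr; apply: eq_bigr => k _.
have rec' : \sum_(l < k.+1) m l *m x (k - l)%N = - (k.+1%:R *: x k.+1).
  by rewrite rec opprK.
by rewrite rec' !mxE; ring.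
Qed.

End MatrixPowerSeries.

Section SolutionFunction.
Variables (R : realType) (n p : nat).
Local Notation C := R[i].
Variables (m : nat -> C -> 'M[C]_n.+1) (x0 : C -> 'M[C]_(n.+1, p)) (r : R).
Hypothesis r0 : 0 < r.
Hypothesis me : forall j, entire (m j).
Hypothesis mb : forall rho : R, exists K : R, forall j z, cn z <= rho ->
  mn (m j z) * r ^+ j <= K.
Hypothesis x0e : entire x0.
Hypothesis mx0 : forall z, m 0 z *m x0 z = 0.
Hypothesis mu : forall k z, (k.+1%:R%:M + m 0 z) \in unitmx.

Definition sol_fun (t z : C) : 'M[C]_(n.+1, p) := ev (fun k => sol m x0 k z) t.

Lemma mn_gbmx a b (c : nat -> 'M[C]_(a, b)) (s s' K : R) : 0 < s' -> s' <= s ->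
  (forall k, mn (c k) * s ^+ k <= K) -> gbmx c s' K.
Proof.
move=> s0 ss h i j k; apply: le_trans (h k); apply: ler_pM.
- exact: cn_ge0.
- by rewrite exprn_ge0 // ltW.
- exact: mn_entry.
- by rewrite lerXn2r ?nnegrE ?(ltW s0) // (le_trans (ltW s0)).
Qed.

Let s0 : 0 < r / 2. Proof. by rewrite divr_gt0. Qed.

Lemma sol_gbmx rho : exists K : R, forall z, cn z <= rho ->
  gbmx (fun k => sol m x0 k z) (r / 2) K.
Proof.
have [K hK] := sol_bound r0 me mb x0e mx0 mu rho; exists K => z hz.
by apply: (mn_gbmx s0 (lexx _)) => k; exact: hK.
Qed.

Lemma m_gbmx z : exists K, gbmx (fun k => m k z) (r / 2) K.
Proof.
have [K hK] := mb (cn z); exists K.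
have rp : 0 < r by [].
by apply: (mn_gbmx (s := r) s0) => [|k]; [lra | exact: hK].
Qed.

Lemma sol_fun0 z : sol_fun 0 z = x0 z.
Proof. by rewrite /sol_fun ev0. Qed.

Lemma sol_fun_entire t : cn t <= 8^-1 * r -> entire (sol_fun t).
Proof.
move=> ht z i j; have [K hK] := sol_gbmx (cn z + 1).
have -> : (fun z => sol_fun t z i j) = (fun z => psum (fun k => sol m x0 k z i j) t).
  by apply/funext => y; rewrite mxE.
apply: (@psum_param _ _ _ (r / 2) K 1) => //.
- move=> y hy; apply: hK; have hy' : cn (y - z) < 1 by [].
  by have := cn_subr y z; lra.
- by move=> k y _; exact: (sol_entire me x0e mu k y).
- have rp : 0 < r by [].
  lra.
Qed.

Lemma sol_fun_dif t z : cn t <= 8^-1 * r -> dmx t (sol_fun^~ z).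
Proof.
move=> ht; have [K hK] := sol_gbmx (cn z).
have rp : 0 < r by [].
by apply: (ev_dif s0 (hK z (lexx _))); lra.
Qed.

Lemma sol_fun_ode t z i j : cn t <= 8^-1 * r ->
  t * dv (fun t => sol_fun t z i j) t 1 =
    - (ev (fun k => m k z) t *m sol_fun t z) i j.
Proof.
move=> ht; have [K hK] := sol_gbmx (cn z); have [L hL] := m_gbmx z.
have rp : 0 < r by [].
apply: (ev_ode i j s0 hL (hK z (lexx _))); first by lra.
by move=> k; exact: (sol_eq mx0 mu).
Qed.

End SolutionFunction.

(** * Analytic families of matrices *)

Section MatrixDerivative.
Variable R : realType.
Local Notation C := R[i].

Definition rdm a b (F : R -> 'M[C]_(a, b)) t (D : 'M[C]_(a, b)) :=
  forall i j, rd (fun x => F x i j) t (D i j).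

Lemma rdm_eq a b (F : R -> 'M[C]_(a, b)) t D D' : D = D' -> rdm F t D -> rdm F t D'.
Proof. by move=> ->. Qed.

Lemma rdm_near a b (F G : R -> 'M[C]_(a, b)) t D (e : R) : 0 < e ->
  (forall x, `|x - t| < e -> F x = G x) -> rdm F t D -> rdm G t D.
Proof.
by move=> e0 h hF i j; apply: rd_near e0 _ (hF i j) => x /h ->.
Qed.

Lemma rdm_cst a b (D : 'M[C]_(a, b)) t : rdm (fun=> D) t 0.
Proof. by move=> i j; rewrite mxE; exact: rd_cst. Qed.

Lemma rdmD a b (F G : R -> 'M[C]_(a, b)) t D E : rdm F t D -> rdm G t E ->
  rdm (fun x => F x + G x) t (D + E).
Proof.
move=> hF hG i j; rewrite mxE.
by apply: (rd_near (e := 1)) (rdD (hF i j) (hG i j)) => // x _; rewrite mxE.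
Qed.

Lemma rdmM a b c (F : R -> 'M[C]_(a, b)) (G : R -> 'M[C]_(b, c)) t D E :
  rdm F t D -> rdm G t E -> rdm (fun x => F x *m G x) t (D *m G t + F t *m E).
Proof.
move=> hF hG i j.
have h := @rd_sum _ _ (index_enum _) xpredT _ _ t (fun s => rdM (hF i s) (hG s j)).
apply: (rd_near (e := 1)) (rd_eq _ h) => // [x _|]; first by rewrite mxE.
by rewrite !mxE -big_split.
Qed.

Lemma rdmZ a b (k : C) (F : R -> 'M[C]_(a, b)) t D : rdm F t D ->
  rdm (fun x => k *: F x) t (k *: D).
Proof.
move=> hF i j; apply: (rd_near (e := 1)) (rd_eq _ (rdM (rd_cst k t) (hF i j))) => // [x _|].
  by rewrite mxE.
by rewrite mxE mul0r add0r.
Qed.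

Lemma rdmN a b (F : R -> 'M[C]_(a, b)) t D : rdm F t D -> rdm (fun x => - F x) t (- D).
Proof.
move=> hF; apply: (rdm_near ltr01 _ (rdm_eq _ (rdmZ (-1) hF))) => [x _|];
by rewrite scaleN1r.
Qed.

Lemma rdm_tr a b (F : R -> 'M[C]_(a, b)) t D : rdm F t D -> rdm (fun x => (F x)^T) t D^T.
Proof.
move=> hF i j; rewrite mxE; apply: (rd_near (e := 1)) (hF j i) => // x _.
by rewrite mxE.
Qed.

Lemma rdm_const a b (F : R -> 'M[C]_(a, b)) (lo hi : R) :
  (forall t, lo < t < hi -> rdm F t 0) ->
  forall x y, lo < x < hi -> lo < y < hi -> F x = F y.
Proof.
move=> h x y hx hy; apply/matrixP => i j.
apply: (@rd_const _ (fun x => F x i j) lo hi _ x y hx hy) => t /h/(_ i j).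
by rewrite mxE.
Qed.

Lemma rd_affine (f : R -> C) (s c t : R) d : rd f (s * t + c) d ->
  rd (fun x => f (s * x + c)) t (s%:C * d).
Proof.
move=> hf e e0; have s0 : 0 < `|s| + 1 by rewrite ltr_wpDl.
have [del del0 hd] := hf _ (divr_gt0 e0 s0).
exists (del / (`|s| + 1)); first by rewrite divr_gt0.
move=> h; rewrite ltr_pdivlMr // => hh.
have h0 := normr_ge0 h; have n0 := normr_ge0 s.
have hs : `|s * h| < del by rewrite normrM; nra.
have -> : s * (t + h) + c = s * t + c + s * h by ring.
have := hd _ hs; rewrite rmorphM => H.
have -> : h%:C * (s%:C * d) = s%:C * h%:C * d by ring.
apply: le_trans H _; rewrite normrM -mulrA ler_wpM2l ?(ltW e0) //.
rewrite mulrA ler_piMl // mulrC ler_pdivrMr //; lra.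
Qed.

Lemma rdm_affine a b (F : R -> 'M[C]_(a, b)) (s c t : R) D : rdm F (s * t + c) D ->
  rdm (fun x => F (s * x + c)) t (s%:C *: D).
Proof. by move=> hF i j; rewrite mxE; exact: rd_affine (hF i j). Qed.

Lemma rdm_dv a b (F : C -> 'M[C]_(a, b)) (D : 'M[C]_(a, b)) (c : C) (t : R) :
  dmx (c + t%:C) F -> (forall i j, dv (fun z => F z i j) (c + t%:C) 1 = D i j) ->
  rdm (fun x => F (c + x%:C)) t D.
Proof.
move=> dF FD i j; have := @rd_dv R (fun z => F z i j) c 1 t.
rewrite mulr1 mul1r FD => /(_ (dF i j)); apply: rd_near (ltr01) _ => x _.
by rewrite mulr1.
Qed.

End MatrixDerivative.

Section FromTopology.
Variables (R : realType) (k : nat).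
Local Notation C := R[i].

Lemma cvg_mlim (S : nat -> 'M[C]_k) (L : 'M[C]_k) : S @ \oo --> L -> mlim S L.
Proof.
move=> h i j e e0.
have : (fun N => S N i j) @ \oo --> L i j.
  apply: (@cvg_comp _ _ _ S (fun M : 'M[C]_k => M i j) _ _ _ h).
  exact: (@coord_continuous C k k i j L).
move/(@cvgrPdist_le C C) => /(_ e%:C); rewrite ltcR => /(_ e0) [N _ hN].
by exists N => m /hN; rewrite /= normCE lecR cnB.
Qed.

Lemma conv_bounded (u : nat -> C) l : conv u l -> exists K : R, forall m, cn (u m) <= K.
Proof.
move=> /(_ 1 ltr01)[N hN]; exists (cn l + 1 + \sum_(i < N) cn (u i)) => m.
have s0 : 0 <= \sum_(i < N) cn (u i) by apply: sumr_ge0 => i _; exact: cn_ge0.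
have [Nm|mN] := leqP N m.
  by have := hN m Nm; have := cn_subr (u m) l; lra.
have : cn (u m) <= \sum_(i < N) cn (u i).
  by rewrite (bigD1 (Ordinal mN)) //= lerDl; apply: sumr_ge0 => i _; exact: cn_ge0.
by have := cn_ge0 l; lra.
Qed.

(** Convergence at the single point t + s bounds all coefficients at radius
    s. *)
Lemma analytic_ev (A : R -> 'M[C]_k) t : analytic_at A t ->
  exists c (s K : R), [/\ 0 < s, (forall i, mn (c i) * s ^+ i <= K) &
    forall x, `|x - t| <= 2^-1 * s -> A x = ev c (x - t)%:C].
Proof.
move=> [c /nbhs_normP[e /= e0 h]].
have h' x : `|x - t| < e -> forall i j,
    conv (fun N => \sum_(m < N) c m i j * (x - t)%:C ^+ m) (A x i j).
  move=> hx i j; have := h x; rewrite /= distrC => /(_ hx)/cvg_mlim/(_ i j).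
  apply: eq_conv => N; rewrite summxE; apply: eq_bigr => m _.
  by rewrite mxE rmorphXn mulrC.
pose s := e / 2; have s0 : 0 < s by rewrite divr_gt0.
have se : `|t + s - t| < e by rewrite addrC addKr gtr0_norm // /s; lra.
have bd ij := cid (conv_bounded (h' _ se ij.1 ij.2)).
exists c, s, (\sum_i \sum_j (2 * sval (bd (i, j)))); split=> //.
  move=> m; rewrite /mn mulr_suml; apply: ler_sum => i _.
  rewrite mulr_suml; apply: ler_sum => j _.
  have := svalP (bd (i, j)) m.+1; have := svalP (bd (i, j)) m; set K := sval _.
  rewrite /= [t + s]addrC addrK big_ord_recr /=; set u := \sum_(l < m) _; set w := _ * _.
  have -> : cn (c m i j) * s ^+ m = cn w.
    by rewrite /w cnM cnX cnR gtr0_norm.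
  have := cn_subr w (- u); rewrite opprK cnN addrC; lra.
move=> x hx; apply/matrixP => i j; rewrite mxE; apply: esym; apply: psumE.
by apply: h'; apply: le_lt_trans hx _; rewrite /s; lra.
Qed.

Lemma has_derivative_rdm (A : R -> 'M[C]_k) t D : has_derivative A t D -> rdm A t D.
Proof.
move=> h i j e e0.
have : (fun x : R => ((x^-1)%:C *: (A (t + x) - A t)) i j) @ 0^' --> D i j.
  apply: (@cvg_comp _ _ _ _ (fun M : 'M[C]_k => M i j) _ _ _ h).
  exact: (@coord_continuous C k k i j D).
move/(@cvgrPdist_le C C) => /(_ e%:C); rewrite ltcR => /(_ e0).
rewrite near_withinE /= => /nbhs_normP[del /= del0 hd].
exists del => // x hx; have [->|x0] := eqVneq x 0.
  by rewrite addr0 subrr mul0r subrr cn0 normr0 mulr0.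
have := hd x; rewrite /= sub0r normrN => /(_ hx x0).
rewrite !mxE normCE lecR => H.
have xc : x%:C != 0 :> C by rewrite (inj_eq (@complexI R)).
have -> : A (t + x) i j - A t i j - x%:C * D i j =
   - (x%:C * (D i j - (x^-1)%:C * (A (t + x) i j - A t i j))).
  by rewrite fmorphV; field.
by rewrite cnN cnM cnR mulrC ler_wpM2r.
Qed.

End FromTopology.

(** * Nahm's equations and parallel transport *)

Section RegularSolution.
Variables (R : realType) (n : nat).
Local Notation C := R[i].

Lemma rdm_dv0 a b (F : C -> 'M[C]_(a, b)) (D : 'M[C]_(a, b)) (t : R) :
  dmx t%:C F -> (forall i j, dv (fun z => F z i j) t%:C 1 = D i j) ->
  rdm (fun x => F x%:C) t D.
Proof.
rewrite -[t%:C]add0r => dF FD.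
by apply: (rdm_near (e := 1)) (rdm_dv dF FD) => // x _; rewrite add0r.
Qed.

(** The equation x' = - a x is t x' = - m x with m = t a. *)
Lemma regular_solution (a : nat -> C -> 'M[C]_n.+1) (r : R) : 0 < r ->
  (forall j, entire (a j)) ->
  (forall rho : R, exists K : R, forall j z, cn z <= rho -> mn (a j z) * r ^+ j <= K) ->
  exists X : R -> C -> 'M[C]_n.+1, (forall z, X 0 z = 1%:M) /\
    forall t, `|t| < 8^-1 * r -> entire (X t) /\
      forall z, rdm (X^~ z) t (- (ev (a^~ z) t%:C *m X t z)).
Proof.
move=> r0 ae ab.
pose m k : C -> 'M[C]_n.+1 := if k is k'.+1 then a k' else fun=> 0.
have me k : entire (m k) by case: k => [|k]; [move=> z; exact: dmx_cst | exact: ae].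
have mb rho : exists K : R, forall j z, cn z <= rho -> mn (m j z) * r ^+ j <= K.
  have [K hK] := ab rho; exists (`|K| * r) => -[|j] z hz /=.
    by rewrite mn0 mul0r mulr_ge0 // ltW.
  rewrite exprSr mulrA ler_wpM2r ?(ltW r0) //.
  exact: le_trans (hK j z hz) (ler_norm _).
pose x0 (z : C) : 'M[C]_n.+1 := 1%:M.
have x0e : entire x0 by move=> z; exact: dmx_cst.
have mx0 z : m 0 z *m x0 z = 0 by rewrite mul0mx.
have mu k z : (k.+1%:R%:M + m 0 z) \in unitmx.
  by rewrite addr0 unitmxE det_scalar unitfE expf_neq0 // pnatr_eq0.
exists (fun t z => sol_fun m x0 t%:C z); split=> [z|t ht].
  by rewrite sol_fun0.
have ht' : cn t%:C <= 8^-1 * r by rewrite cnR ltW.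
split=> [|z]; first exact: sol_fun_entire r0 me mb x0e mx0 mu _ ht'.
apply: (@rdm_dv0 _ _ (fun t => sol_fun m x0 t z)).
  exact: sol_fun_dif r0 me mb x0e mx0 mu _ _ ht'.
move=> i j; rewrite [RHS]mxE.
have [K hK] := sol_gbmx r0 me mb x0e mx0 mu (cn z).
have [L hL] := ab (cn z).
have s0 : 0 < r / 2 by rewrite divr_gt0.
apply: (ev_ode_regular i j s0 _ (hK z (lexx _))) => [||k].
- by apply: (mn_gbmx (s := r) s0) => [|k]; [lra | exact: hL].
- lra.
have := sol_eq mx0 mu k.+1 z; rewrite big_ord_recl /= mul0mx add0r => ->.
by congr (- _); apply: eq_bigr.
Qed.

(** Y is the transpose of the solution for - a^T; then Y X is constant. *)
Lemma regular_pair (a : nat -> C -> 'M[C]_n.+1) (r : R) : 0 < r ->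
  (forall j, entire (a j)) ->
  (forall rho : R, exists K : R, forall j z, cn z <= rho -> mn (a j z) * r ^+ j <= K) ->
  exists X Y : R -> C -> 'M[C]_n.+1, (forall z, X 0 z = 1%:M /\ Y 0 z = 1%:M) /\
    forall t, `|t| < 8^-1 * r -> entire (X t) /\ entire (Y t) /\ forall z,
     [/\ rdm (X^~ z) t (- (ev (a^~ z) t%:C *m X t z)),
         rdm (Y^~ z) t (Y t z *m ev (a^~ z) t%:C) & Y t z *m X t z = 1%:M].
Proof.
move=> r0 ae ab; have [X [X0 hX]] := regular_solution r0 ae ab.
have [||Y [Y0 hY]] := @regular_solution (fun j z => - (a j z)^T) _ r0.
- move=> j z i l; have -> : (fun z => (- (a j z)^T) i l) = (fun z => - a j z l i).
    by apply/funext => y; rewrite !mxE.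
  by apply: differentiableN; exact: ae.
- move=> rho; have [K hK] := ab rho; exists K => j z hz.
  rewrite mnN; suff -> : mn (a j z)^T = mn (a j z) by exact: hK.
  rewrite /mn exchange_big /=; apply: eq_bigr => i _; apply: eq_bigr => l _.
  by rewrite mxE.
have eT z (t : R) : `|t| < 8^-1 * r ->
    ev (fun j => - (a j z)^T) t%:C = - (ev (a^~ z) t%:C)^T.
  move=> ht; have [K hK] := ab (cn z).
  have g : gbmx (a^~ z) r K by apply: (mn_gbmx r0 (lexx r)) => k; exact: hK.
  apply/matrixP => i j; rewrite !mxE; apply: psumE.
  have rp : 0 < r by [].
  have := convZ (-1) (psum_conv r0 (g j i) (z := t%:C) _); rewrite mulN1r => H.
  apply: eq_conv (H _) => [N|]; last by rewrite cnR; lra.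
  by rewrite mulr_sumr; apply: eq_bigr => k _; rewrite !mxE mulN1r mulNr.
have hY' t z : `|t| < 8^-1 * r ->
    rdm (fun x => (Y x z)^T) t ((Y t z)^T *m ev (a^~ z) t%:C).
  move=> ht; have [_ /(_ z)] := hY t ht; rewrite eT // => /rdm_tr.
  by apply: rdm_eq; rewrite mulNmx opprK trmx_mul trmxK.
exists X, (fun t z => (Y t z)^T); split=> [z|t ht].
  by rewrite X0 Y0 trmx1.
have [Xe Xd] := hX t ht; have [Ye _] := hY t ht; split=> //; split.
  move=> z i j; have -> : (fun y => (Y t y)^T i j) = (fun y => Y t y j i).
    by apply/funext => y; rewrite mxE.
  exact: Ye.
move=> z; split; [exact: Xd | exact: hY' |].
have YX0 : (Y 0 z)^T *m X 0 z = 1%:M by rewrite X0 Y0 trmx1 mulmx1.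
rewrite -YX0; have rp : 0 < r by [].
apply: (@rdm_const _ _ _ (fun x => (Y x z)^T *m X x z) (- (8^-1 * r)) (8^-1 * r)).
- move=> x; rewrite -ltr_norml => hx; have [_ Xd'] := hX x hx.
  apply: rdm_eq (rdmM (hY' x z hx) (Xd' z)).
  by rewrite mulmxN mulmxA subrr.
- by rewrite -ltr_norml.
- by apply/andP; split; lra.
Qed.

End RegularSolution.

Section NahmFlow.
Variables (R : realType) (n : nat).
Local Notation C := R[i].
Implicit Types (A : nat -> R -> 'M[C]_n.+1) (t T : R).

(** The polynomial part of A / xi^2 with half of its constant term. The rest
    is its counterpart in the other chart: plus_opp4. *)
Definition plus (M : nat -> 'M[C]_n.+1) z : 'M[C]_n.+1 :=
  2^-1 *: M 2 + z *: M 3 + z ^+ 2 *: M 4.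

(** Indexing the five functions by nat lets opp4 and back act on the family. *)
Definition nahm A t :=
  [/\ rdm (A 0%N) t (2^-1 *: lie (A 0%N t) (A 2 t)),
      rdm (A 1%N) t (lie (A 0%N t) (A 3 t) + 2^-1 *: lie (A 1%N t) (A 2 t)),
      rdm (A 2) t (lie (A 1%N t) (A 3 t) + lie (A 0%N t) (A 4 t)),
      rdm (A 3) t (lie (A 1%N t) (A 4 t) + 2^-1 *: lie (A 2 t) (A 3 t)) &
      rdm (A 4) t (2^-1 *: lie (A 2 t) (A 4 t))].

Lemma lieDl (X Y Z : 'M[C]_n.+1) : lie (X + Y) Z = lie X Z + lie Y Z.
Proof. by rewrite /lie mulmxDl mulmxDr opprD addrACA. Qed.

Lemma lieC (X Y : 'M[C]_n.+1) : lie X Y = - lie Y X.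
Proof. by rewrite /lie opprB. Qed.

Lemma lieDr (X Y Z : 'M[C]_n.+1) : lie X (Y + Z) = lie X Y + lie X Z.
Proof. by rewrite lieC lieDl opprD -!lieC. Qed.

Lemma lieZl a (X Y : 'M[C]_n.+1) : lie (a *: X) Y = a *: lie X Y.
Proof. by rewrite /lie -scalemxAl -scalemxAr scalerBr. Qed.

Lemma lieZr a (X Y : 'M[C]_n.+1) : lie X (a *: Y) = a *: lie X Y.
Proof. by rewrite lieC lieZl -scalerN -lieC. Qed.

Lemma liexx (X : 'M[C]_n.+1) : lie X X = 0.
Proof. by rewrite /lie subrr. Qed.

Lemma lieNN (X Y : 'M[C]_n.+1) : lie (- X) (- Y) = lie X Y.
Proof. by rewrite /lie !mulNmx !mulmxN !opprK. Qed.

(** Lax form: together the five equations say that A' = [A, plus]. *)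
Lemma lie_quart (M : nat -> 'M[C]_n.+1) z :
  lie (quart M z) (plus M z) = 2^-1 *: lie (M 0%N) (M 2) +
    z *: (lie (M 0%N) (M 3) + 2^-1 *: lie (M 1%N) (M 2)) +
    z ^+ 2 *: (lie (M 1%N) (M 3) + lie (M 0%N) (M 4)) +
    z ^+ 3 *: (lie (M 1%N) (M 4) + 2^-1 *: lie (M 2) (M 3)) +
    z ^+ 4 *: (2^-1 *: lie (M 2) (M 4)).
Proof.
rewrite /quart /plus !(lieDl, lieDr, lieZl, lieZr) !liexx.
rewrite (lieC (M 3) (M 2)) (lieC (M 4) (M 2)) (lieC (M 4) (M 3)).
move: (lie (M 0%N) _) (lie (M 0%N) _) (lie (M 0%N) _) => a b c.
move: (lie (M 1%N) _) (lie (M 1%N) _) (lie (M 1%N) _) => d e f.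
move: (lie (M 2) _) (lie (M 2) _) (lie (M 3) _) => g h l.
have half (X : 'M[C]_n.+1) : X = 2^-1 *: X + 2^-1 *: X.
  by have := splitr (1 : C); rewrite !mul1r -scalerDl => <-; rewrite scale1r.
rewrite !(scaler0, add0r, addr0, scalerDr, scalerN, scalerA).
rewrite {1}(half h) {1}(half g) !(scalerDr, scalerA).
rewrite -!exprSr -!exprS -!exprD.
apply/matrixP => i j.
do 3 rewrite mxE.
rewrite ![in RHS]mxE.
rewrite !mxE.
ring.
Qed.

Lemma quart_rdm A t z : nahm A t ->
  rdm (fun x => quart (A^~ x) z) t (lie (quart (A^~ t) z) (plus (A^~ t) z)).
Proof.
move=> [h0 h1 h2 h3 h4].
have := rdmD (rdmD (rdmD (rdmD h0 (rdmZ z h1)) (rdmZ (z ^+ 2) h2))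
  (rdmZ (z ^+ 3) h3)) (rdmZ (z ^+ 4) h4).
by apply: rdm_eq; rewrite lie_quart.
Qed.

(** The symmetry of Nahm's equations that exchanges the two charts of the
    base. *)
Definition opp4 A j t := - A (4 - j)%N t.

Lemma quart_opp4 A t z : quart (opp4 A ^~ t) z = - quart (rev4 (A^~ t)) z.
Proof. by rewrite /quart /opp4 /rev4 !scalerN -!opprD. Qed.

Lemma opp4_nahm A t : nahm A t -> nahm (opp4 A) t.
Proof.
have L (X Y : 'M[C]_n.+1) : - lie X Y = lie Y X by rewrite (lieC Y X).
move=> [h0 h1 h2 h3 h4]; split; rewrite /opp4.
- by apply: rdm_eq (rdmN h4); rewrite lieNN -scalerN L.
- by apply: rdm_eq (rdmN h3); rewrite !lieNN opprD -scalerN !L.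
- by apply: rdm_eq (rdmN h2); rewrite !lieNN opprD !L addrC.
- by apply: rdm_eq (rdmN h1); rewrite !lieNN opprD -scalerN !L.
- by apply: rdm_eq (rdmN h0); rewrite lieNN -scalerN L.
Qed.

(** Time reversal, which carries the endpoint 2 to 0. *)
Definition back A j t := - A j (2 - t).

Lemma back_nahm A t : nahm A (2 - t) -> nahm (back A) t.
Proof.
have E (F : R -> 'M[C]_n.+1) D : rdm F (2 - t) D -> rdm (fun x => - F (2 - x)) t D.
  move=> h; have h' : rdm F (-1 * t + 2) D by rewrite mulN1r addrC.
  apply: (rdm_near (e := 1)) (rdm_eq _ (rdmN (rdm_affine h'))) => // [x _|].
    by rewrite mulN1r addrC.
  by rewrite rmorphN scaleN1r opprK.
by move=> [/E h0 /E h1 /E h2 /E h3 /E h4]; split; rewrite /back;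
   [apply: rdm_eq h0|apply: rdm_eq h1|apply: rdm_eq h2|apply: rdm_eq h3|apply: rdm_eq h4];
   rewrite /lie !(mulNmx, mulmxN, opprK).
Qed.

Lemma ev_plus (c c' c'' : nat -> 'M[C]_n.+1) (s K K' K'' : R) (w z : C) : 0 < s ->
  gbmx c s K -> gbmx c' s K' -> gbmx c'' s K'' -> cn w <= 2^-1 * s ->
  ev (fun j => 2^-1 *: c j + z *: c' j + z ^+ 2 *: c'' j) w =
  2^-1 *: ev c w + z *: ev c' w + z ^+ 2 *: ev c'' w.
Proof.
move=> s0 h h' h'' hw; apply/matrixP => i j; rewrite !mxE; apply: psumE.
have := convD (convD (convZ 2^-1 (psum_conv s0 (h i j) hw))
  (convZ z (psum_conv s0 (h' i j) hw))) (convZ (z ^+ 2) (psum_conv s0 (h'' i j) hw)).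
apply: eq_conv => N; rewrite !mulr_sumr -!big_split /=; apply: eq_bigr => k _.
by rewrite !mxE; ring.
Qed.

Lemma plus_coef_bound (c c' c'' : nat -> 'M[C]_n.+1) (s K K' K'' : R) : 0 < s ->
  (forall i, mn (c i) * s ^+ i <= K) -> (forall i, mn (c' i) * s ^+ i <= K') ->
  (forall i, mn (c'' i) * s ^+ i <= K'') -> forall rho : R, exists L : R,
  forall j z, cn z <= rho ->
    mn (2^-1 *: c j + z *: c' j + z ^+ 2 *: c'' j) * s ^+ j <= L.
Proof.
move=> s0 h h' h'' rho; exists (K + `|rho| * K' + `|rho| ^+ 2 * K'') => j z hz.
have zr : cn z <= `|rho| := le_trans hz (ler_norm _).
have sj : 0 <= s ^+ j by rewrite exprn_ge0 // ltW.
apply: le_trans (ler_wpM2r sj (mnD _ _)) _.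
rewrite mulrDl lerD //.
  apply: le_trans (ler_wpM2r sj (mnD _ _)) _; rewrite mulrDl lerD //.
    rewrite mnZ -mulrA; apply: le_trans (h j).
    by rewrite ler_piMl ?mulr_ge0 ?mn_ge0 // cnV cn_nat; lra.
  by rewrite mnZ -mulrA ler_pM ?cn_ge0 ?mulr_ge0 ?mn_ge0.
rewrite mnZ cnX -mulrA ler_pM ?exprn_ge0 ?cn_ge0 ?mulr_ge0 ?mn_ge0 //.
by rewrite lerXn2r ?nnegrE ?cn_ge0.
Qed.

Lemma plus_coef_entire (c c' c'' : 'M[C]_n.+1) :
  entire (fun z => 2^-1 *: c + z *: c' + z ^+ 2 *: c'').
Proof.
move=> z; apply: dmxD; last by apply: dmxZ; [exact: dif_exp | exact: dmx_cst].
apply: dmxD; first exact: dmx_cst.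
by apply: dmxZ; [exact: (dif_exp 1) | exact: dmx_cst].
Qed.

(** Parallel transport from time T for the connection d/dt + plus, and its inverse. *)
Definition transport A T (d : R) (X Y : R -> C -> 'M[C]_n.+1) :=
  (forall z, X T z = 1%:M) /\ forall t, `|t - T| < d -> [/\ entire (X t), entire (Y t),
    (forall z, Y t z *m X t z = 1%:M),
    (forall z, rdm (X^~ z) t (- (plus (A^~ t) z *m X t z))) &
    (forall z, rdm (Y^~ z) t (Y t z *m plus (A^~ t) z))].

Lemma mn_shrink a b (c : nat -> 'M[C]_(a, b)) (r s K : R) : 0 < r -> r <= s ->
  (forall i, mn (c i) * s ^+ i <= K) -> forall i, mn (c i) * r ^+ i <= K.
Proof.
move=> r0 rs h i; apply: le_trans (h i); rewrite ler_wpM2l ?mn_ge0 //.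
by rewrite lerXn2r ?nnegrE ?(ltW r0) // (le_trans (ltW r0)).
Qed.

Lemma transport_exists A T : analytic_at (A 2) T -> analytic_at (A 3) T ->
  analytic_at (A 4) T -> exists (d : R) X Y, 0 < d /\ transport A T d X Y.
Proof.
move=> /analytic_ev[c [s [K [s0 h E]]]] /analytic_ev[c' [s' [K' [s0' h' E']]]].
move=> /analytic_ev[c'' [s'' [K'' [s0'' h'' E'']]]].
pose r := Num.min s (Num.min s' s'').
have r0 : 0 < r by rewrite !lt_min s0 s0'.
have [rs rs' rs''] : [/\ r <= s, r <= s' & r <= s''].
  by rewrite /r !ge_min !lexx !orbT.
have {}h := mn_shrink r0 rs h; have {}h' := mn_shrink r0 rs' h'.
have {}h'' := mn_shrink r0 rs'' h''.
have [X [Y [XY0 hXY]]] := regular_pair r0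
  (fun j => @plus_coef_entire (c j) (c' j) (c'' j)) (plus_coef_bound r0 h h' h'').
have evE t z : `|t - T| < 8^-1 * r ->
    ev (fun j => 2^-1 *: c j + z *: c' j + z ^+ 2 *: c'' j) (t - T)%:C = plus (A^~ t) z.
  move=> ht; have rp : 0 < r by [].
  have g := mn_gbmx r0 (lexx r) h; have g' := mn_gbmx r0 (lexx r) h'.
  have g'' := mn_gbmx r0 (lexx r) h''.
  rewrite (ev_plus z r0 g g' g''); last by rewrite cnR; lra.
  by rewrite /plus E ?E' ?E'' //; lra.
exists (8^-1 * r), (fun t => X (t - T)), (fun t => Y (t - T)); split.
  by rewrite mulr_gt0.
split=> [z|t ht]; first by rewrite subrr (XY0 z).1.
have [Xe [Ye h3]] := hXY _ ht; split=> //.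
- by move=> z; have [] := h3 z.
- move=> z; have [hX _ _] := h3 z; rewrite evE // in hX.
  have hX' : rdm (X^~ z) (1 * t + - T) (- (plus (A^~ t) z *m X (t - T) z)).
    by rewrite mul1r.
  apply: (rdm_near (e := 1)) (rdm_eq _ (rdm_affine hX')) => // [x _|].
    by rewrite mul1r.
  by rewrite scale1r.
- move=> z; have [_ hY _] := h3 z; rewrite evE // in hY.
  have hY' : rdm (Y^~ z) (1 * t + - T) (Y (t - T) z *m plus (A^~ t) z).
    by rewrite mul1r.
  apply: (rdm_near (e := 1)) (rdm_eq _ (rdm_affine hY')) => // [x _|].
    by rewrite mul1r.
  by rewrite scale1r.
Qed.

End NahmFlow.

(** * Propagation of frames in time *)

Section Continuation.
Variable R : realType.
Local Notation C := R[i].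

(** The indicator function of Q has derivative zero. *)
Lemma interval_induction (Q : R -> Prop) (lo hi : R) :
  (forall T, lo < T < hi -> exists2 d : R, 0 < d &
     forall t, `|t - T| < d -> Q t <-> Q T) ->
  forall s t, lo < s < hi -> lo < t < hi -> Q s -> Q t.
Proof.
move=> h s t hs ht Qs; pose f x : C := if `[<Q x>] then 1 else 0.
have fst : f s = f t.
  apply: (rd_const _ hs ht) => T /h[d d0 hd]; apply: (rd_near d0) (rd_cst (f T) T).
  by move=> x /hd QxT; rewrite /f (asbool_equiv_eq QxT).
move: fst; rewrite /f asboolT //; case: asboolP => // _ /eqP.
by rewrite oner_eq0.
Qed.

End Continuation.

Section Parallel.
Variables (R : realType) (n : nat).
Local Notation C := R[i].
Implicit Types (A : nat -> R -> 'M[C]_n.+1) (t T : R).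

Lemma frame_conj (M M' : nat -> 'M[C]_n.+1) (a a' : C) (G0 G1 : C -> 'M[C]_n.+1) x0 x1 :
  entire G0 -> entire G1 -> (forall z, G0 z \in unitmx) -> (forall z, G1 z \in unitmx) ->
  (forall z, G0 z *m quart M z = quart M' z *m G0 z) ->
  (forall z, G1 z *m quart (rev4 M) z = quart (rev4 M') z *m G1 z) ->
  (forall z : C, z != 0 -> ex (quart M' z) (a' / z ^+ 2) *m G0 z =
     G1 z^-1 *m ex (quart M z) (a / z ^+ 2)) ->
  frame M a x0 x1 -> frame M' a' (fun z => G0 z *m x0 z) (fun z => G1 z *m x1 z).
Proof.
move=> e0 e1 u0 u1 c0 c1 h [x0e x1e x0c x1c xE]; split.
- by move=> z; apply: dmxM; [exact: e0 | exact: x0e].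
- by move=> z; apply: dmxM; [exact: e1 | exact: x1e].
- by move=> z; exact: cyclic_conj (u0 z) (c0 z) (x0c z).
- by move=> z; exact: cyclic_conj (u1 z) (c1 z) (x1c z).
- by move=> z z0; rewrite mulmxA h // -mulmxA xE // scalemxAr.
Qed.

Lemma transport_inv A T d X Y t z : transport A T d X Y -> `|t - T| < d ->
  X t z *m Y t z = 1%:M.
Proof. by move=> [_ h] /h[_ _ YX _ _]; apply: mulmx1C. Qed.

(** By the Lax equation Y A X is constant. *)
Lemma transport_conj A T d X Y : transport A T d X Y ->
  (forall t, `|t - T| < d -> nahm A t) -> forall t z, `|t - T| < d ->
  quart (A^~ t) z *m X t z = X t z *m quart (A^~ T) z.
Proof.
move=> hT hN t z ht; have [XT h] := hT.
have d0 : 0 < d by apply: le_lt_trans ht.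
have dT : `|T - T| < d by rewrite subrr normr0.
have c : Y t z *m quart (A^~ t) z *m X t z = quart (A^~ T) z.
  have YT : Y T z = 1%:M by have [_ _ /(_ z)] := h T dT; rewrite XT mulmx1.
  rewrite -[RHS]mul1mx -YT -[RHS]mulmx1 -[in RHS](XT z).
  apply: (@rdm_const _ _ _ (fun t => Y t z *m quart (A^~ t) z *m X t z) (T - d) (T + d)).
  - move=> x hx; have hx' : `|x - T| < d by rewrite ltr_distl.
    have [_ _ _ /(_ z) dX /(_ z) dY] := h x hx'.
    apply: rdm_eq (rdmM (rdmM dY (quart_rdm z (hN x hx'))) dX).
    rewrite /lie; set Q := quart _ _; set P := plus _ _.
    rewrite -[Y x z *m P *m Q]mulmxA -mulmxDr (addrC (P *m Q)) subrK.
    by rewrite mulmxN !mulmxA subrr.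
  - by rewrite -ltr_distl.
  - by rewrite -ltr_distl.
by rewrite -c !mulmxA (transport_inv z hT ht) mul1mx.
Qed.

Lemma plus_opp4 A t z : z != 0 ->
  plus (A^~ t) z = (z ^- 2) *: quart (A^~ t) z + plus (opp4 A ^~ t) z^-1.
Proof.
move=> z0; rewrite /plus /quart /opp4 /= !scalerDr !scalerA !scalerN.
have -> : z ^- 2 * z = z^-1 by field.
have -> : z ^- 2 * z ^+ 2 = 1 by field.
have -> : z ^- 2 * z ^+ 3 = z by field.
have -> : z ^- 2 * z ^+ 4 = z ^+ 2 by field.
rewrite exprVn scale1r.
have half (X : 'M[C]_n.+1) : X = 2^-1 *: X + 2^-1 *: X.
  by have := splitr (1 : C); rewrite !mul1r -scalerDl => <-; rewrite scale1r.
rewrite [X in _ + X + _ + _](half (A 2 t)).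
move: (2^-1 *: A 2 t) (z *: A 3 t) (z ^+ 2 *: A 4 t) (z^-1 *: A 1%N t) => a b c e.
move: (z ^- 2 *: A 0%N t) => f.
by apply/matrixP => i j; rewrite !mxE; ring.
Qed.

Lemma rdm_ex (M : 'M[C]_n.+1) (b : C) T t :
  rdm (fun x => ex M ((x - T)%:C * b)) t (b *: (M *m ex M ((t - T)%:C * b))).
Proof.
move=> i j; rewrite mxE.
have E (x : R) : (x - T)%:C * b = - (T%:C * b) + x%:C * b.
  by rewrite rmorphB; ring.
have H := @rd_dv R (fun z => ex M z i j) (- (T%:C * b)) b t (ex_dv M _ i j).1.
move: H; rewrite (ex_dv M _ i j).2 -E => H.
by apply: (rd_near ltr01 _ H) => x _; rewrite E.
Qed.

Lemma transport_ex_algebra (Y1 P1 X E P Q M : 'M[C]_n.+1) (w : C) :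
  Q *m X = X *m M -> P = w *: Q + P1 ->
  Y1 *m P1 *m (X *m E) + Y1 *m (- (P *m X) *m E + X *m (w *: (M *m E))) = 0.
Proof.
move=> QX ->; rewrite -scalemxAr (mulmxA X) -QX mulmxDl -scalemxAl mulNmx mulmxDl.
by rewrite -scalemxAl opprD addrAC addNr add0r mulmxN -!mulmxA subrr.
Qed.

(** By plus_opp4 the two connections differ by A / xi^2, so the exponential
    carries the transport of one chart into that of the other. *)
Lemma transport_ex A T d X Y X1 Y1 : transport A T d X Y ->
  transport (opp4 A) T d X1 Y1 -> (forall t, `|t - T| < d -> nahm A t) ->
  forall t z, `|t - T| < d -> z != 0 ->
  X t z *m ex (quart (A^~ T) z) ((t - T)%:C / z ^+ 2) = X1 t z^-1.
Proof.
move=> hX hX1 hN t z ht z0; have [XT h] := hX; have [X1T h1] := hX1.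
have d0 : 0 < d by apply: le_lt_trans ht.
have dT : `|T - T| < d by rewrite subrr normr0.
pose E t := ex (quart (A^~ T) z) ((t - T)%:C / z ^+ 2).
have c : Y1 t z^-1 *m (X t z *m E t) = 1%:M.
  have YT : Y1 T z^-1 = 1%:M by have [_ _ /(_ z^-1)] := h1 T dT; rewrite X1T mulmx1.
  have ET : E T = 1%:M by rewrite /E subrr mul0r ex0.
  have cT : Y1 T z^-1 *m (X T z *m E T) = 1%:M by rewrite YT XT ET !mul1mx.
  rewrite -cT.
  apply: (@rdm_const _ _ _ (fun t => Y1 t z^-1 *m (X t z *m E t)) (T - d) (T + d)).
  - move=> x hx; have hx' : `|x - T| < d by rewrite ltr_distl.
    have [_ _ _ /(_ z) dX _] := h x hx'; have [_ _ _ _ /(_ z^-1) dY] := h1 x hx'.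
    apply: rdm_eq (rdmM dY (rdmM dX (rdm_ex _ _ T x))).
    exact: transport_ex_algebra (transport_conj hX hN z hx') (plus_opp4 A x z0).
  - by rewrite -ltr_distl.
  - by rewrite -ltr_distl.
by rewrite -[LHS]mul1mx -(transport_inv z^-1 hX1 ht) -mulmxA c mulmx1.
Qed.

Variable A : nat -> R -> 'M[C]_n.+1.
Hypothesis nA : forall t, 0 < t < 2 -> nahm A t.
Hypothesis anA : forall j t, (j <= 4)%N -> 0 < t < 2 -> analytic_at (A j) t.

Lemma analytic_opp (F : R -> 'M[C]_n.+1) t : analytic_at F t -> analytic_at (fun x => - F x) t.
Proof.
move=> [c h]; exists (fun j => - c j); apply: filterS h => x hx.
have -> : (fun N => \sum_(n0 < N) ((x - t) ^+ n0)%:C *: - c n0) =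
   (fun N => - \sum_(n0 < N) ((x - t) ^+ n0)%:C *: c n0).
  by apply/funext => N; rewrite -sumrN; apply: eq_bigr => i _; rewrite scalerN.
exact: cvgN.
Qed.

Lemma local_transport T : 0 < T < 2 -> exists (d : R) X Y X1 Y1,
  [/\ 0 < d, transport A T d X Y, transport (opp4 A) T d X1 Y1 &
      forall t, `|t - T| < d -> 0 < t < 2].
Proof.
move=> hT.
have [d [X [Y [d0 tX]]]] := transport_exists (anA (j := 2) isT hT)
  (anA (j := 3) isT hT) (anA (j := 4) isT hT).
have [d1 [X1 [Y1 [d10 tX1]]]] := @transport_exists _ _ (opp4 A) T
  (analytic_opp (anA (j := 2) isT hT)) (analytic_opp (anA (j := 1%N) isT hT))
  (analytic_opp (anA (j := 0%N) isT hT)).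
pose e := Num.min (Num.min d d1) (Num.min T (2 - T)).
have shrink B (d' : R) X' Y' : e <= d' -> transport B T d' X' Y' -> transport B T e X' Y'.
  by move=> ed [h1 h2]; split=> // t ht; apply: h2; exact: lt_le_trans ed.
exists e, X, Y, X1, Y1; split.
- by rewrite !lt_min d0 d10 /=; lra.
- by apply: shrink tX; rewrite !ge_min lexx.
- by apply: shrink tX1; rewrite !ge_min lexx orbT.
- move=> t; rewrite !lt_min => /andP[_ /andP[h1 h2]].
  by move: h1 h2; rewrite !ltr_distl; lra.
Qed.

(** The parameter of the frame is the time. *)
Definition framed (t : R) := exists x0 x1, frame (A^~ t) t%:C x0 x1.

(** Transport in the two charts moves the vectors of a frame; by
    transport_ex this changes the parameter by t - T. *)
Lemma framed_local T : 0 < T < 2 -> exists2 d : R, 0 < d &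
  forall t, `|t - T| < d -> framed t <-> framed T.
Proof.
move=> hT; have [d [X [Y [X1 [Y1 [d0 tX tX1 ht2]]]]]] := local_transport hT.
have hN t : `|t - T| < d -> nahm A t by move=> /ht2; exact: nA.
have hN1 t : `|t - T| < d -> nahm (opp4 A) t by move=> /hN; exact: opp4_nahm.
exists d; first exact: d0.
move=> t ht.
have [_ h] := tX; have [Xe Ye YX _ _] := h t ht.
have [_ h1] := tX1; have [X1e Y1e YX1 _ _] := h1 t ht.
have XY z := transport_inv z tX ht; have XY1 z := transport_inv z tX1 ht.
have cX z := transport_conj tX hN z ht.
have cX1 z : quart (rev4 (A^~ t)) z *m X1 t z = X1 t z *m quart (rev4 (A^~ T)) z.
  have := transport_conj tX1 hN1 z ht; rewrite !quart_opp4 mulNmx mulmxN.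
  by move=> /oppr_inj.
have key (z : C) : z != 0 -> ex (quart (A^~ t) z) (t%:C / z ^+ 2) *m X t z =
    X1 t z^-1 *m ex (quart (A^~ T) z) (T%:C / z ^+ 2).
  move=> z0; rewrite -(ex_intertwine _ (esym (cX z))).
  have -> : t%:C / z ^+ 2 = (t - T)%:C / z ^+ 2 + T%:C / z ^+ 2.
    by rewrite rmorphB -mulrDl subrK.
  by rewrite -ex_add mulmxA (transport_ex tX tX1 hN ht z0).
split=> [[x0 [x1 hx]]|[x0 [x1 hx]]].
  exists (fun z => Y t z *m x0 z), (fun z => Y1 t z *m x1 z).
  apply: (frame_conj Ye Y1e _ _ _ _ _ hx).
  - by move=> z; have [] := mulmx1_unit (YX z).
  - by move=> z; have [] := mulmx1_unit (YX1 z).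
  - by move=> z; rewrite -[LHS]mulmx1 -(XY z) -mulmxA (mulmxA (quart _ _)) cX
      !mulmxA YX mul1mx.
  - by move=> z; rewrite -[LHS]mulmx1 -(XY1 z) -mulmxA (mulmxA (quart _ _)) cX1
      !mulmxA YX1 mul1mx.
  - move=> z z0; rewrite -[LHS]mul1mx -(YX1 z^-1) -mulmxA (mulmxA (X1 _ _)) -key //.
    by rewrite -mulmxA XY mulmx1.
exists (fun z => X t z *m x0 z), (fun z => X1 t z *m x1 z).
apply: (frame_conj Xe X1e _ _ _ _ key hx).
- by move=> z; have [] := mulmx1_unit (XY z).
- by move=> z; have [] := mulmx1_unit (XY1 z).
- by move=> z; rewrite cX.
- by move=> z; rewrite cX1.
Qed.

Lemma framed_all s : 0 < s < 2 -> framed s -> forall t, 0 < t < 2 -> framed t.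
Proof.
move=> hs fs t ht; apply: (interval_induction (lo := 0) (hi := 2)) hs ht fs => T.
exact: framed_local.
Qed.

Lemma spec_constant s t : 0 < s < 2 -> 0 < t < 2 -> spec (A^~ t) = spec (A^~ s).
Proof.
move=> hs ht; pose Q t := spec (A^~ t) = spec (A^~ s).
apply: (@interval_induction R Q 0 2 _ s t hs ht) => // T hT.
have [d [X [Y [X1 [Y1 [d0 tX tX1 ht2]]]]]] := local_transport hT.
have hN x : `|x - T| < d -> nahm A x by move=> /ht2; exact: nA.
exists d; first exact: d0.
move=> x hx; suff : spec (A^~ x) = spec (A^~ T) by rewrite /Q => ->.
apply/funext => p; rewrite /spec.
have XY := transport_inv p.2 tX hx.
have c := transport_conj tX hN p.2 hx.
have -> : p.1%:M - quart (A^~ x) p.2 =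
    X x p.2 *m (p.1%:M - quart (A^~ T) p.2) *m Y x p.2.
  rewrite mulmxBr mulmxBl -c -[quart _ _ *m _ *m _]mulmxA XY mulmx1 mul_mx_scalar.
  by rewrite -scalemxAl XY scalemx1.
rewrite !det_mulmx mulrAC -det_mulmx XY det1 mul1r //.
Qed.

End Parallel.

(** * Irreducible representations of sl(2) *)

Section LowestVector.
Variables (R : realType) (n : nat).
Local Notation C := R[i].
Variables a0 a2 a4 : 'M[C]_n.+1.
Hypothesis r0 : a2 *m a0 = a0 *m a2 + 2 *: a0.
Hypothesis r2 : a4 *m a0 = a0 *m a4 + a2.
Hypothesis r4 : a2 *m a4 = a4 *m a2 - 2 *: a4.

(** Otherwise w 0, ..., w n.+1 are eigenvectors for n + 2 different
    eigenvalues. *)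
Lemma few_eigenvalues (M : 'M[C]_n.+1) (w : nat -> 'cV[C]_n.+1) (l : nat -> C) :
  injective l -> (forall i, M *m w i = l i *: w i) ->
  (forall i, w i = 0 -> w i.+1 = 0) -> w n.+1 = 0.
Proof.
move=> li hw w0; apply/eqP/negP => /negP wn.
have wi i : (i <= n.+1)%N -> w i != 0.
  move=> ile; apply: contra wn => /eqP h.
  have : forall k, w (i + k)%N = 0.
    by elim=> [|k IH]; rewrite ?addn0 // addnS; exact: w0.
  by move=> /(_ (n.+1 - i)%N); rewrite subnKC // => ->.
pose rs := [seq l i | i <- iota 0 n.+2].
have root_l i : (i <= n.+1)%N -> root (char_poly M^T) (l i).
  move=> ile; rewrite -eigenvalue_root_char; apply/eigenvalueP; exists (w i)^T.
    by rewrite -trmx_mul hw linearZ.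
  by apply: contra (wi i ile) => /eqP h; rewrite -[w i]trmxK h trmx0.
have p0 : char_poly M^T != 0 by apply: monic_neq0; exact: char_poly_monic.
suff : (size rs < size (char_poly M^T))%N.
  by rewrite size_char_poly size_map size_iota ltnn.
apply: max_poly_roots => //.
  rewrite all_map; apply/allP => i; rewrite mem_iota /= add0n ltnS.
  exact: root_l.
by rewrite map_inj_uniq // iota_uniq.
Qed.

Lemma eigenvector_exists (M : 'M[C]_n.+1) : exists (l : C) (v : 'cV[C]_n.+1),
  v != 0 /\ M *m v = l *: v.
Proof.
have /closed_rootP[l] : size (char_poly M^T) != 1%N by rewrite size_char_poly.
rewrite -eigenvalue_root_char => /eigenvalueP[w wE w0]; exists l, w^T; split.
  by apply: contra w0 => /eqP h; rewrite -[w]trmxK h trmx0.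
by rewrite -[M]trmxK -trmx_mul wE linearZ.
Qed.

Lemma natr_shift_inj (l c : C) : c != 0 -> injective (fun i : nat => l + c * i%:R).
Proof.
move=> c0 i j /addrI /(mulfI c0) /eqP.
by rewrite eqr_nat => /eqP.
Qed.

(** The last nonzero vector among the a4^i v, for an eigenvector v of a2. *)
Lemma lowest_exists : exists (l : C) (v : 'cV[C]_n.+1),
  [/\ v != 0, a2 *m v = l *: v & a4 *m v = 0].
Proof.
have [l [v [v0 vE]]] := eigenvector_exists a2.
pose w i := a4 ^+ i *m v.
have wS i : w i.+1 = a4 *m w i by rewrite /w exprS -mulmxA.
have wE i : a2 *m w i = (l + - 2 * i%:R) *: w i.
  elim: i => [|i IH]; first by rewrite /w expr0 mul1mx mulr0 addr0.
  rewrite wS mulmxA r4 mulmxBl -mulmxA IH -scalemxAl -scalemxAr -scalerBl.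
  by congr (_ *: _); rewrite -natr1; ring.
have wn : w n.+1 = 0.
  apply: few_eigenvalues wE _; first by apply: natr_shift_inj; rewrite oppr_eq0 pnatr_eq0.
  by move=> i h; rewrite wS h mulmx0.
have ex : exists i, w i == 0 by exists n.+1; rewrite wn.
case: (ex_minnP ex) => -[|i] /eqP wi0 imin.
  by move: wi0 v0; rewrite /w expr0 mul1mx => ->; rewrite eqxx.
exists (l + - 2 * i%:R), (w i); split=> //; last by rewrite -wS.
by apply/negP => /imin; rewrite ltnn.
Qed.

Section Ladder.
Variables (l : C) (v : 'cV[C]_n.+1).
Hypothesis v2 : a2 *m v = l *: v.
Hypothesis v4 : a4 *m v = 0.

Lemma ladder2 i : a2 *m (a0 ^+ i *m v) = (l + 2 * i%:R) *: (a0 ^+ i *m v).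
Proof.
elim: i => [|i IH]; first by rewrite expr0 mul1mx mulr0 addr0.
rewrite exprS -[a0 * _]/(a0 *m _) -mulmxA mulmxA r0 mulmxDl -mulmxA IH.
by rewrite -scalemxAr -scalemxAl -scalerDl -natr1; congr (_ *: _); ring.
Qed.

Lemma ladder4 i : a4 *m (a0 ^+ i.+1 *m v) =
  (i.+1%:R * (l + i%:R)) *: (a0 ^+ i *m v).
Proof.
elim: i => [|i IH].
  rewrite expr1 expr0 mul1mx mulmxA r2 mulmxDl -mulmxA v4 mulmx0 add0r v2.
  by rewrite mul1r addr0.
rewrite exprS -[a0 * _]/(a0 *m _) -mulmxA mulmxA r2 mulmxDl -mulmxA IH ladder2.
rewrite -scalemxAr mulmxA -[a0 *m _]/(a0 * _) -exprS -scalerDl; congr (_ *: _).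
by rewrite -[i.+2%:R]natr1 -[i.+1%:R]natr1; ring.
Qed.

Lemma ladder_top : a0 ^+ n.+1 *m v = 0.
Proof.
apply: (few_eigenvalues (w := fun i => a0 ^+ i *m v) _ ladder2).
  by apply: natr_shift_inj; rewrite pnatr_eq0.
by move=> i h; rewrite exprS -mulmxA h mulmx0.
Qed.

End Ladder.

Hypothesis irr : forall U : 'M[C]_n.+1, stablemx U a0^T -> stablemx U a2^T ->
  stablemx U a4^T -> \rank U = 0%N \/ \rank U = n.+1.

(** The span of the vectors a0^i v is invariant, so it is the whole space. *)
Lemma sl2_lowest : exists v : 'cV[C]_n.+1,
  [/\ a4 *m v = 0, a2 *m v = - n%:R *: v, a0 ^+ n.+1 *m v = 0 & cyclic a0 v].
Proof.
have [l [v [v0 v2 v4]]] := lowest_exists.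
have vt := ladder_top v2.
pose U : 'M[C]_n.+1 := (krylov a0 v)^T.
have rowU (i : 'I_n.+1) : row i U = (a0 ^+ i *m v)^T by rewrite -tr_col krylov_col.
have subU i (c : C) : (c *: (a0 ^+ i *m v)^T <= U)%MS.
  apply: scalemx_sub; have [ile|ige] := ltnP i n.+1.
    by rewrite -(rowU (Ordinal ile)) row_sub.
  have -> : a0 ^+ i *m v = 0.
    rewrite -(subnK ige) exprD -[_ * _]/(_ *m _) -mulmxA vt mulmx0 //.
  by rewrite trmx0 sub0mx.
have st (X : 'M[C]_n.+1) : (forall i : nat, exists (j : nat) (c : C),
    X *m (a0 ^+ i *m v) = c *: (a0 ^+ j *m v)) -> stablemx U X^T.
  move=> h; apply/row_subP => i; rewrite row_mul rowU -trmx_mul.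
  by have [j [c ->]] := h i; rewrite linearZ /= subU.
have U0 : U != 0.
  apply: contra v0 => /eqP h; have := rowU ord0.
  by rewrite h row0 expr0 mul1mx => /esym h0; rewrite -[v]trmxK h0 trmx0.
have cv : cyclic a0 v.
  have [|||/eqP|rU] := irr (U := U).
  - apply: st => i; exists i.+1, 1.
    by rewrite scale1r exprS -[a0 * _]/(a0 *m _) mulmxA.
  - by apply: st => i; exists i, (l + 2 * i%:R); exact: ladder2.
  - apply: st => -[|i]; first by exists 0%N, 0; rewrite expr0 mul1mx v4 scale0r.
    by exists i, (i.+1%:R * (l + i%:R)); exact: ladder4.
  - by rewrite mxrank_eq0 (negbTE U0).
  - by rewrite /cyclic -unitmx_tr -row_full_unit /row_full -/U rU.
(* ladder4 at the top of the ladder reads 0 = (n + 1)(l + n) a0^n v *)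
have ln : l = - n%:R.
  have := ladder4 v2 v4 n; rewrite vt mulmx0 => /esym/eqP.
  rewrite scalemx_eq0 mulf_eq0 pnatr_eq0 /= addr_eq0 => /orP[/eqP //|/eqP h].
  have := rowU ord_max; rewrite /= h trmx0 => h0.
  have := cv; rewrite /cyclic -unitmx_tr -/U unitmxE unitfE.
  by rewrite (expand_det_row _ ord_max) big1 ?eqxx // => j _;
     have := congr1 (fun X : 'rV[C]_n.+1 => X 0 j) h0; rewrite !mxE => ->; rewrite mul0r.
by exists v; split=> //; rewrite v2 ln.
Qed.

End LowestVector.

(** The weight basis e i = a0^i v of an irreducible representation: a0
    raises, a2 is diagonal and a4 lowers. *)
Section WeightBasis.
Variables (R : realType) (n : nat).
Local Notation C := R[i].
Variables (a0 a2 a4 : 'M[C]_n.+1) (v : 'cV[C]_n.+1).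
Hypothesis r0 : a2 *m a0 = a0 *m a2 + 2 *: a0.
Hypothesis r2 : a4 *m a0 = a0 *m a4 + a2.
Hypothesis v4 : a4 *m v = 0.
Hypothesis v2 : a2 *m v = - n%:R *: v.
Hypothesis vt : a0 ^+ n.+1 *m v = 0.
Hypothesis cv : cyclic a0 v.

Let e i : 'cV[C]_n.+1 := a0 ^+ i *m v.

Let a0e i : a0 *m e i = e i.+1.
Proof. by rewrite /e mulmxA exprS. Qed.

Let a2e i : a2 *m e i = (- n%:R + 2 * i%:R) *: e i.
Proof. exact: ladder2. Qed.

Let a4e i : exists c : C, a4 *m e i = (i%:R * c) *: e i.-1.
Proof.
case: i => [|i]; first by exists 0; rewrite /e expr0 mul1mx v4 mul0r scale0r.
by exists (- n%:R + i%:R); exact: (ladder4 r0 r2 v2 v4 i).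
Qed.

Let e_big i : (n < i)%N -> e i = 0.
Proof.
by move=> ni; rewrite /e -(subnK ni) exprD -[_ * _]/(_ *m _) -mulmxA vt mulmx0.
Qed.

Let Kinv_e (i : 'I_n.+1) : invmx (krylov a0 v) *m e i = delta_mx i 0.
Proof. by rewrite /e -krylov_col colE mulKmx. Qed.

Lemma eq_on_weights (X Y : 'M[C]_n.+1) : (forall i : nat, X *m e i = Y *m e i) -> X = Y.
Proof.
move=> h; rewrite -[X](mulmxK cv) -[Y](mulmxK cv); congr (_ *m _).
apply/matrixP => i j; have := congr1 (fun x : 'cV[C]_n.+1 => x i 0) (h j).
by rewrite /e -krylov_col !colE !mulmxA -!colE !mxE.
Qed.

Definition below j (x : 'cV[C]_n.+1) := exists g : nat -> C, x = \sum_(i < j) g i *: e i.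

Let belowD j x y : below j x -> below j y -> below j (x + y).
Proof.
move=> [g ->] [h ->]; exists (fun i => g i + h i); rewrite -big_split /=.
by apply: eq_bigr => i _; rewrite scalerDl.
Qed.

Let belowZ j c x : below j x -> below j (c *: x).
Proof.
move=> [g ->]; exists (fun i => c * g i); rewrite scaler_sumr.
by apply: eq_bigr => i _; rewrite scalerA.
Qed.

Let below_e j i : (i < j)%N -> below j (e i).
Proof.
move=> ij; exists (fun l => (l == i)%:R); rewrite (bigD1 (Ordinal ij)) //= eqxx scale1r.
rewrite big1 ?addr0 // => l li; have -> : (l == i :> nat) = false.
  by apply: contraNF li => /eqP h; apply/eqP/val_inj.
by rewrite scale0r.
Qed.

Let belowS j x : below j x -> below j.+1 x.
Proof.
move=> [g ->]; exists (fun i => if i == j then 0 else g i).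
rewrite big_ord_recr /= eqxx scale0r addr0; apply: eq_bigr => i _.
by rewrite ltn_eqF.
Qed.

Let below_coord j x (i : 'I_n.+1) : (j <= i)%N -> below j x ->
  (invmx (krylov a0 v) *m x) i 0 = 0.
Proof.
move=> ji [g ->]; rewrite mulmx_sumr summxE big1 // => l _.
have ln : (l < n.+1)%N by rewrite (leq_trans (ltn_ord l)) // (leq_trans ji) // ltnW.
rewrite -scalemxAr (Kinv_e (Ordinal ln)) !mxE -val_eqE /=.
by rewrite gtn_eqF ?mulr0 // (leq_trans (ltn_ord l)).
Qed.

(** In the weight basis Z is triangular with diagonal entries al j. *)
Lemma triangular_unit (Z : 'M[C]_n.+1) (al : nat -> C) (y : nat -> 'cV[C]_n.+1) :
  (forall j, al j != 0) -> (forall j : 'I_n.+1, col j Z = al j *: e j + y j) ->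
  (forall j, below j (y j)) -> Z \in unitmx.
Proof.
move=> al0 ZE yb; set K := krylov a0 v.
have -> : Z = K *m (invmx K *m Z) by rewrite mulKVmx.
rewrite unitmx_mul [K \in unitmx]cv /= -unitmx_tr unitmxE.
have DE i j : (invmx K *m Z) i j = al j * (i == j)%:R + (invmx K *m y j) i 0.
  have -> : (invmx K *m Z) i j = (invmx K *m col j Z) i 0.
    by rewrite colE mulmxA -colE [RHS]mxE.
  rewrite ZE mulmxDr -scalemxAr Kinv_e mxE; congr (_ + _).
  by rewrite !mxE andbT.
rewrite det_trig; last first.
  apply/is_trig_mxP => i j ij; rewrite mxE DE (below_coord (ltnW ij) (yb i)).
  by rewrite addr0 -val_eqE /= gtn_eqF // mulr0.
rewrite unitfE; apply/prodf_neq0 => i _; rewrite mxE DE (below_coord (leqnn i) (yb i)) addr0.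
by rewrite eqxx mulr1.
Qed.

(** In the weight basis the i-th diagonal entry is k + 1 + i. These are the
    matrices to be inverted in the recursion for the solution at the
    endpoint. *)
Lemma indicial_unit (c : C) k :
  (k.+1%:R%:M + (2^-1 *: a2 + c *: a4 + (n%:R / 2)%:M)) \in unitmx.
Proof.
set X := _ + _; suff : X *m krylov a0 v \in unitmx by rewrite unitmx_mul => /andP[].
apply: (@triangular_unit _ (fun j => k.+1%:R + j%:R) (fun j => c *: (a4 *m e j))).
- by move=> j; rewrite -natrD pnatr_eq0.
- move=> j; rewrite colE -mulmxA -colE krylov_col -/(e j) /X !mulmxDl.
  rewrite !mul_scalar_mx -!scalemxAl a2e scalerA.
  have -> : (k.+1%:R + j%:R : C) =
     k.+1%:R + 2^-1 * (- n%:R + 2 * j%:R) + n%:R / 2 by field.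
  by rewrite !scalerDl !addrA addrAC.
- move=> j; apply: belowZ; have [d ->] := a4e j.
  case: j => [|j]; last by apply: belowZ; exact: below_e.
  by rewrite mul0r scale0r; exists (fun=> 0); rewrite big_ord0.
Qed.

(** The j-th power of the pencil maps v to e j plus lower terms. *)
Lemma pencil_cyclic (u : C) : cyclic (a0 + u *: a2 + u ^+ 2 *: a4) v.
Proof.
set X := (_ + _)%R.
have Xe i : exists2 y, below i.+1 y & X *m e i = e i.+1 + y.
  have [d hd] := a4e i.
  exists (u *: (a2 *m e i) + u ^+ 2 *: (a4 *m e i)).
    apply: belowD; apply: belowZ; first by rewrite a2e; apply: belowZ; exact: below_e.
    rewrite hd; apply: belowZ; apply: below_e; rewrite ltnS; exact: leq_pred.
  by rewrite /X !mulmxDl -!scalemxAl a0e addrA.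
have Xb j y : below j y -> below j.+1 (X *m y).
  move=> [g ->]; rewrite mulmx_sumr; elim: (j) => [|l IH].
    by rewrite big_ord0; exists (fun=> 0); rewrite big1 // => i _; rewrite scale0r.
  rewrite big_ord_recr /=; apply: belowD; first exact: belowS.
  rewrite -scalemxAr; apply: belowZ; have [y' hy ->] := Xe l.
  by apply: belowD; [exact: below_e | exact: belowS].
have H j : exists y, below j y /\ X ^+ j *m v = e j + y.
  elim: j => [|j [y [yb IH]]].
    exists 0; split; last by rewrite /e !expr0 addr0.
    by exists (fun=> 0); rewrite big_ord0.
  have [y' yb' hy'] := Xe j; exists (y' + X *m y); split.
    by apply: belowD => //; exact: Xb.
  by rewrite exprS -[X * _]/(X *m _) -mulmxA IH mulmxDr hy' addrA.
pose y j := sval (cid (H j)); have yP j := svalP (cid (H j)).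
apply: (@triangular_unit _ (fun=> 1) y) => [_|j|j]; first exact: oner_neq0.
  by rewrite krylov_col scale1r; exact: (yP j).2.
exact: (yP j).1.
Qed.

Lemma ker_raising x : a0 *m x = 0 -> exists c : C, x = c *: e n.
Proof.
move=> ax; set K := krylov a0 v; pose b := invmx K *m x.
have xE : x = \sum_(i < n.+1) b i 0 *: e i.
  rewrite -[x](mulKVmx cv) -/b; apply/colP => s; rewrite mxE summxE.
  by apply: eq_bigr => i _; rewrite !mxE mulrC.
exists (b ord_max 0); rewrite xE big_ord_recr /= big1 ?add0r // => i _.
suff -> : b (widen_ord (leqnSn n) i) 0 = 0 by rewrite scale0r.
move: ax; rewrite xE mulmx_sumr big_ord_recr /= -scalemxAr a0e e_big //.
rewrite scaler0 addr0 => h.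
have i1 : (i.+1 < n.+1)%N by rewrite ltnS.
have := congr1 (fun y => (invmx K *m y) (Ordinal i1) 0) h.
rewrite mulmx0 mulmx_sumr summxE [RHS]mxE (bigD1 i) //= big1 ?addr0 => [|j ji].
  by rewrite -!scalemxAr a0e (Kinv_e (Ordinal i1)) !mxE !eqxx mulr1.
have j1 : (j.+1 < n.+1)%N by rewrite ltnS.
rewrite -!scalemxAr a0e (Kinv_e (Ordinal j1)) !mxE -val_eqE /= eqSS.
have -> : (i == j :> nat) = false by rewrite eq_sym; apply: contraNF ji => /eqP/val_inj/eqP.
by rewrite mulr0.
Qed.

(** The diagonal matrix D of the powers of u in the weight basis conjugates
    u^-1 times the pencil at u into the pencil at 1. It fixes v and
    multiplies w, a vector of highest weight, by u^n. *)
Lemma ex_lowest_scaling (u b b1 : C) w : u != 0 -> a0 *m w = 0 -> w != 0 ->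
  ex (a0 + u *: a2 + u ^+ 2 *: a4) u^-1 *m v = b *: w ->
  ex (a0 + a2 + a4) 1 *m v = b1 *: w -> b = u ^- n * b1.
Proof.
move=> u0 aw w0 h h1; set K := krylov a0 v.
pose D := K *m diag_mx (\row_(i < n.+1) u ^+ i) *m invmx K.
have De i : D *m e i = u ^+ i *: e i.
  have [ni|ni] := ltnP n i; first by rewrite e_big // mulmx0 scaler0.
  rewrite /D -!mulmxA (Kinv_e (Ordinal (ni : (i < n.+1)%N))).
  have -> : diag_mx (\row_(i < n.+1) u ^+ i) *m delta_mx (Ordinal (ni : (i < n.+1)%N)) 0 =
    u ^+ i *: delta_mx (Ordinal (ni : (i < n.+1)%N)) (0 : 'I_1).
    apply/colP => s; rewrite mul_diag_mx !mxE; case: eqP => [->|_]; first by [].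
    by rewrite !mulr0.
  by rewrite -scalemxAr -colE krylov_col.
pose N := u^-1 *: (a0 + u *: a2 + u ^+ 2 *: a4).
have DN : D *m N = (a0 + a2 + a4) *m D.
  apply: eq_on_weights => i; have [d hd] := a4e i.
  rewrite -[LHS]mulmxA -[RHS]mulmxA De /N -scalemxAl !mulmxDl -!scalemxAl a0e a2e hd -!scalemxAr.
  rewrite a0e a2e hd !mulmxDr -!scalemxAr !De !scalerDr !scalerA.
  congr (_ + _ + _).
  - by congr (_ *: _); rewrite exprS; field.
  - by congr (_ *: _); field.
  - case: i hd => [|i] hd /=; first by rewrite !mul0r !mulr0 mul0r.
    by congr (_ *: _); rewrite [u ^+ i.+1]exprS; field.
have Dv : D *m v = v by have := De 0%N; rewrite /e !expr0 mul1mx scale1r.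
have [c wE] := ker_raising aw.
have Dw : D *m w = u ^+ n *: w by rewrite wE -scalemxAr De !scalerA mulrC.
clearbody D.
have hN : ex N 1 *m v = b *: w by rewrite /N ex_scale mulr1.
have E : D *m (ex N 1 *m v) = ex (a0 + a2 + a4) 1 *m (D *m v).
  by rewrite mulmxA (ex_intertwine 1 DN) -mulmxA.
move: (ex N 1) (ex (a0 + a2 + a4) 1) hN h1 E => X Y hN hY E.
rewrite hN Dv hY -scalemxAr Dw scalerA in E.
have /eqP : (b * u ^+ n - b1) *: w = 0 by rewrite scalerBl E subrr.
rewrite scalemx_eq0 (negbTE w0) orbF subr_eq0 => /eqP <-.
by rewrite mulrCA mulVf ?mulr1 // expf_neq0.
Qed.

End WeightBasis.

(** * Residues at an endpoint *)

Section EndpointLimits.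
Variable R : realType.
Local Notation C := R[i].

Lemma dif_vanish0 (f : C -> C) (d : R) : differentiable f 0 -> 0 < d ->
  (forall t : R, 0 < t < d -> f t%:C = 0) -> f 0 = 0.
Proof.
move=> df d0 h; apply: cn_eps0 => e e0.
have := differentiable_continuous df.
move=> /(@cvgrPdist_lt _ _ _ (nbhs (0 : C))) /(_ e%:C); rewrite ltcR => /(_ e0).
move=> /near_vnP[c c0 hc]; pose t := Num.min d c / 2.
have m0 : 0 < Num.min d c by rewrite lt_min d0.
have t0 : 0 < t by rewrite divr_gt0.
have [td tc] : t < d /\ t < c.
  have : Num.min d c <= d by rewrite ge_min lexx.
  have : Num.min d c <= c by rewrite ge_min lexx orbT.
  by move: m0; rewrite /t; set m := Num.min d c; split; lra.
have vt : vn (t%:C - 0 : C) < c by rewrite subr0 /vn normCE -/(cn _) cnR gtr0_norm.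
have := hc _ vt; rewrite (h t); last by apply/andP.
by rewrite subr0 normCE ltcR; exact: ltW.
Qed.

Lemma dmx_vanish0 a b (F : C -> 'M[C]_(a, b)) (d : R) : dmx 0 F -> 0 < d ->
  (forall t : R, 0 < t < d -> F t%:C = 0) -> F 0 = 0.
Proof.
move=> dF d0 h; apply/matrixP => i j; rewrite [RHS]mxE.
by apply: (dif_vanish0 (dF i j) d0) => t /h ->; rewrite mxE.
Qed.

Lemma rd_unique (f : R -> C) t a b : rd f t a -> rd f t b -> a = b.
Proof.
move=> ha hb; apply/eqP; rewrite -subr_eq0; apply/eqP/cn_eps0 => e e0.
have e2 : 0 < e / 2 by lra.
have [c c0 hc] := ha _ e2; have [d d0 hd] := hb _ e2.
pose h := Num.min c d / 2; have m0 : 0 < Num.min c d by rewrite lt_min c0.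
have h0 : 0 < h by rewrite divr_gt0.
have [hc' hd'] : h < c /\ h < d.
  have : Num.min c d <= c by rewrite ge_min lexx.
  have : Num.min c d <= d by rewrite ge_min lexx orbT.
  by move: m0; rewrite /h; set m := Num.min c d; split; lra.
have := hc h; have := hd h; rewrite gtr0_norm // => /(_ hd') H1 /(_ hc') H2.
have E : h%:C * (a - b) = (f (t + h) - f t - h%:C * b) - (f (t + h) - f t - h%:C * a) by ring.
have : cn (h%:C * (a - b)) <= e * h.
  by rewrite E; apply: le_trans (cnDB _ _) _; lra.
by rewrite cnM cnR gtr0_norm // mulrC ler_pM2r.
Qed.

Lemma rdm_unique a b (F : R -> 'M[C]_(a, b)) t D E : rdm F t D -> rdm F t E -> D = E.
Proof. by move=> h h'; apply/matrixP => i j; exact: rd_unique (h i j) (h' i j). Qed.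

Lemma ler_half_pow (k : nat) : k%:R * (2^-1 : R) ^+ k <= 1.
Proof.
rewrite exprVn ler_pdivrMr ?exprn_gt0 // mul1r -natrX ler_nat.
exact/ltnW/ltn_expl.
Qed.

Lemma ev_euler a b (c : nat -> 'M[C]_(a, b)) (r K : R) (t : R) : 0 < r ->
  (forall i, mn (c i) * r ^+ i <= K) -> 0 < t -> t < 4^-1 * r ->
  exists2 D, rdm (fun x => ev c x%:C) t D &
    t%:C *: D = ev (fun k => k%:R *: c k) t%:C.
Proof.
move=> r0 h t0 tr; have g := mn_gbmx r0 (lexx r) h.
have ht : cn t%:C < 2^-1 * r by rewrite cnR gtr0_norm //; lra.
exists (\matrix_(i, j) dv (fun z => ev c z i j) t%:C 1).
  apply: rdm_dv0; first exact: ev_dif r0 g ht.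
  by move=> i j; rewrite mxE.
apply/matrixP => i j; rewrite !mxE; apply: esym; apply: psumE.
have := convZ t%:C (ev_dv_conv i j r0 g ht).
move=> H e e0; have [N hN] := H e e0; exists N.+1 => -[//|m]; rewrite ltnS => /hN.
rewrite big_ord_recl /= mxE mul0r mul0r add0r mulr_sumr.
congr (cn (_ - _) <= e); apply: eq_bigr => k _.
by rewrite /bump add1n mxE exprS; ring.
Qed.

Lemma euler_bound a b (c : nat -> 'M[C]_(a, b)) (r K : R) : 0 < r ->
  (forall i, mn (c i) * r ^+ i <= K) ->
  forall i, mn (i%:R *: c i) * (r / 2) ^+ i <= K.
Proof.
move=> r0 h i; apply: le_trans (h i); rewrite mnZ cn_nat exprMn.
have -> : i%:R * mn (c i) * (r ^+ i * 2^-1 ^+ i) =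
  (i%:R * 2^-1 ^+ i) * (mn (c i) * r ^+ i) by ring.
rewrite ler_piMl ?ler_half_pow // mulr_ge0 ?mn_ge0 // exprn_ge0 //.
exact: ltW.
Qed.

End EndpointLimits.

Section Pole.
Variables (R : realType) (n : nat).
Local Notation C := R[i].
Implicit Types (A : nat -> R -> 'M[C]_n.+1) (d : nat -> nat -> 'M[C]_n.+1).

Lemma evN a b (c : nat -> 'M[C]_(a, b)) (s K : R) z : 0 < s -> gbmx c s K ->
  cn z <= 2^-1 * s -> ev (fun i => - c i) z = - ev c z.
Proof.
move=> s0 g hz; apply/matrixP => i j; rewrite !mxE; apply: psumE.
have := convZ (-1) (psum_conv s0 (g i j) hz); rewrite mulN1r.
by apply: eq_conv => N; rewrite mulr_sumr; apply: eq_bigr => k _; rewrite !mxE; ring.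
Qed.

(** Near the endpoint 0 the functions t A_j(t) have power series d j; those of
    the regular functions have no constant term. *)
Definition pole A d (r : R) :=
  [/\ 0 < r, r <= 2, (exists K : R, forall j i, mn (d j i) * r ^+ i <= K),
      (forall j t, 0 < t -> t < 2^-1 * r -> t%:C *: A j t = ev (d j) t%:C) &
      d 1%N 0%N = 0 /\ d 3 0%N = 0].

Lemma pole_opp4 A d r : pole A d r -> pole (opp4 A) (fun j i => - d (4 - j)%N i) r.
Proof.
move=> [r0 r2 [K hK] h [d1 d3]]; split=> //.
- by exists K => j i; rewrite mnN.
- move=> j t t0 tr; rewrite /opp4 scalerN h //.
  have g := mn_gbmx r0 (lexx r) (hK (4 - j)%N).
  by rewrite (evN r0 g) // cnR gtr0_norm // ltW.
- by rewrite /= d1 d3 oppr0.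
Qed.

Section Residues.
Variables (A : nat -> R -> 'M[C]_n.+1) (d : nat -> nat -> 'M[C]_n.+1) (r : R).
Hypothesis pA : pole A d r.
Hypothesis nA : forall t, 0 < t < 2 -> nahm A t.

Lemma ev_dmx0 j : dmx 0 (ev (d j)).
Proof.
have [r0 _ [K hK] _ _] := pA; have g := mn_gbmx r0 (lexx r) (hK j).
by apply: (ev_dif r0 g); rewrite cn0 mulr_gt0.
Qed.

(** The identity t (t A_j)' = t A_j + t^2 A_j' at t = 0, where the left hand
    side vanishes. *)
Lemma residue_relation j (Z : C -> 'M[C]_n.+1) :
  dmx 0 Z -> (forall t, 0 < t < 4^-1 * r -> exists2 D, rdm (A j) t D &
     (t%:C * t%:C) *: D = Z t%:C) ->
  d j 0%N + Z 0 = 0.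
Proof.
move=> dZ h; have [r0 r2 [K hK] hA _] := pA.
have rp : 0 < r by [].
have s0 : 0 < r / 2 by rewrite divr_gt0.
have g := mn_gbmx s0 (lexx _) (euler_bound r0 (hK j)).
have dE : dmx 0 (ev (fun k => k%:R *: d j k)).
  by apply: (ev_dif s0 g); rewrite cn0 mulr_gt0.
have : dmx 0 (fun z => (ev (d j) z + Z z) + (-1) *: ev (fun k => k%:R *: d j k) z).
  apply: dmxD; first by apply: dmxD => //; exact: ev_dmx0.
  by apply: dmxZ => //; exact: differentiable_cst.
have q0 : 0 < 4^-1 * r by rewrite mulr_gt0.
move=> /dmx_vanish0 => /(_ _ q0) H.
have := H; rewrite !ev0 scale0r scaler0 addr0; apply.
move=> t /andP[t0 tr]; have [D hD DZ] := h t ltac:(by rewrite t0).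
have [E hE tE] := ev_euler r0 (hK j) t0 tr.
have tr2 : t < 2^-1 * r by lra.
have hT : rdm (fun x : R => x%:C *: A j x) t (A j t + t%:C *: D).
  move=> a b; rewrite !mxE; have idd : rd (fun x : R => x%:C) t 1.
    move=> e e0; exists 1 => // y _; 
    have -> : (t + y)%:C - t%:C - y%:C * 1 = 0 :> C by rewrite rmorphD; ring.
    rewrite cn0; by rewrite mulr_ge0 // ltW.
  have := rdM idd (hD a b); rewrite mul1r; apply: (rd_near (e := 1)) => // x _.
  by rewrite mxE.
pose e := Num.min t (2^-1 * r - t).
have e0 : 0 < e by rewrite lt_min t0 subr_gt0.
have : A j t + t%:C *: D = E.
  apply: (rdm_unique hT); apply: (rdm_near e0) hE => x.
  rewrite lt_min !ltr_distl => /andP[/andP[h1 _] /andP[_ h2]].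
  have x1 : 0 < x by lra.
  have x2 : x < 2^-1 * r by lra.
  exact: esym (hA j x x1 x2).
move=> /(congr1 (fun X => t%:C *: X)); rewrite tE scalerDr hA // scalerA DZ => ->.
by rewrite scaleN1r subrr.
Qed.

(** The coefficients of t^-2 in Nahm's equations: up to normalisation the
    residues satisfy the relations of the standard basis of sl(2). *)
Lemma residue_relations :
  [/\ d 2 0%N *m d 0%N 0%N = d 0%N 0%N *m d 2 0%N + 2 *: d 0%N 0%N,
      d 4 0%N *m d 0%N 0%N = d 0%N 0%N *m d 4 0%N + d 2 0%N &
      d 2 0%N *m d 4 0%N = d 4 0%N *m d 2 0%N - 2 *: d 4 0%N].
Proof.
have [r0 r2 [K hK] hA [d1 d3]] := pA; have rp : 0 < r by [].
have dl i j : dmx 0 (fun z => lie (ev (d i) z) (ev (d j) z)).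
  have := @dmxD R C 0 _ _ (fun z => ev (d i) z *m ev (d j) z)
    (fun z => (-1) *: (ev (d j) z *m ev (d i) z)).
  move=> H; apply: (dmx_eq _ (H _ _)) => [z||].
  - by rewrite scaleN1r.
  - by apply: dmxM; exact: ev_dmx0.
  - apply: dmxZ; first exact: differentiable_cst.
    by apply: dmxM; exact: ev_dmx0.
have rng t : 0 < t < 4^-1 * r -> [/\ 0 < t, t < 2^-1 * r & 0 < t < 2].
  by move=> /andP[t0 tr]; split; lra.
have sc t i j : 0 < t < 4^-1 * r ->
    (t%:C * t%:C) *: lie (A i t) (A j t) = lie (ev (d i) t%:C) (ev (d j) t%:C).
  by move=> /rng[t0 tr _]; rewrite -!hA // lieZl lieZr scalerA.
have half : (2 : C) * 2^-1 = 1 by rewrite mulfV // pnatr_eq0.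
split.
- have := @residue_relation 0 (fun z => 2^-1 *: lie (ev (d 0%N) z) (ev (d 2) z)).
  rewrite !ev0 => H; have {}H : d 0%N 0%N + 2^-1 *: lie (d 0%N 0%N) (d 2 0%N) = 0.
    apply: H.
      by apply: dmxZ; [exact: differentiable_cst | exact: dl].
    move=> t ht; have [_ _ /nA[h _ _ _ _]] := rng t ht.
    by exists (2^-1 *: lie (A 0%N t) (A 2 t)) => //; rewrite scalerA mulrC -scalerA sc.
  have := congr1 (fun X => 2 *: X) H; rewrite scalerDr scaler0 scalerA half scale1r.
  by rewrite /lie addrA => /eqP; rewrite subr_eq add0r addrC => /eqP.
- have := @residue_relation 2 (fun z => lie (ev (d 1%N) z) (ev (d 3) z) +
    lie (ev (d 0%N) z) (ev (d 4) z)).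
  rewrite !ev0 d1 => H.
  have {}H : d 2 0%N + (lie 0 (d 3 0%N) + lie (d 0%N 0%N) (d 4 0%N)) = 0.
    apply: H; first by apply: dmxD; exact: dl.
    move=> t ht; have [_ _ /nA[_ _ h _ _]] := rng t ht.
    by exists (lie (A 1%N t) (A 3 t) + lie (A 0%N t) (A 4 t)) => //; rewrite scalerDr !sc.
  move: H; rewrite /lie mul0mx mulmx0 subrr add0r addrA => /eqP.
  by rewrite subr_eq add0r addrC => /eqP.
- have := @residue_relation 4 (fun z => 2^-1 *: lie (ev (d 2) z) (ev (d 4) z)).
  rewrite !ev0 => H; have {}H : d 4 0%N + 2^-1 *: lie (d 2 0%N) (d 4 0%N) = 0.
    apply: H.
      by apply: dmxZ; [exact: differentiable_cst | exact: dl].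
    move=> t ht; have [_ _ /nA[_ _ _ _ h]] := rng t ht.
    by exists (2^-1 *: lie (A 2 t) (A 4 t)) => //; rewrite scalerA mulrC -scalerA sc.
  have := congr1 (fun X => 2 *: X) H; rewrite scalerDr scaler0 scalerA half scale1r.
  rewrite /lie addrA => /eqP; rewrite subr_eq add0r => /eqP <-.
  by rewrite addrAC subrr add0r.
Qed.

End Residues.

End Pole.

(** * Horizontal sections near an endpoint *)

Section LowestSolution.
Variables (R : realType) (n : nat).
Local Notation C := R[i].

Lemma rdmZf a b (f : R -> C) (F : R -> 'M[C]_(a, b)) t c D : rd f t c -> rdm F t D ->
  rdm (fun x => f x *: F x) t (c *: F t + f t *: D).
Proof.
move=> hf hF i j; rewrite !mxE; apply: (rd_near (e := 1)) (rdM hf (hF i j)) => // x _.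
by rewrite mxE.
Qed.

(** The power t^(n/2). *)
Definition half_power (t : R) : C := (expR (n%:R / 2 * ln t))%:C.

Lemma half_power_neq0 t : half_power t != 0.
Proof. by rewrite (inj_eq (@complexI R)) gt_eqF // expR_gt0. Qed.

Lemma rd_half_power t : 0 < t ->
  rd half_power t (n%:R / 2 / t%:C * half_power t).
Proof.
move=> t0; have h1 := is_derive1_ln t0.
have h2 : is_derive t 1 (fun x => n%:R / 2 * ln x) (n%:R / 2 * t^-1).
  have H := is_deriveM (is_derive_cst (n%:R / 2 : R) t (1 : R)) h1.
  by apply: (is_derive_eq H); rewrite -![_ *: _]/(_ * _) mulr0 addr0.
have h3 := @is_derive1_comp _ expR (fun x => n%:R / 2 * ln x) t _ _
  (is_derive_expR (n%:R / 2 * ln t)) h2.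
have h4 := rd_ReIm h3 (is_derive_cst (0 : R) t (1 : R)).
apply: rd_eq h4.
have -> : n%:R / 2 / t%:C = (n%:R / 2 * t^-1)%:C :> C.
  by rewrite !rmorphM !fmorphV !rmorph_nat.
by rewrite /half_power -rmorphM /= mulrC.
Qed.

Variables (A : nat -> R -> 'M[C]_n.+1) (d : nat -> nat -> 'M[C]_n.+1) (r : R).
Variable v : 'cV[C]_n.+1.
Hypothesis pA : pole A d r.
Hypothesis v2 : d 2 0%N *m v = - n%:R *: v.
Hypothesis v4 : d 4 0%N *m v = 0.
Hypothesis indicial : forall c k,
  (k.+1%:R%:M + (2^-1 *: d 2 0%N + c *: d 4 0%N + (n%:R / 2)%:M)) \in unitmx.

(** The coefficients of t A_2 + n and of m = t plus + n/2: the substitution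
    x = t^(n/2) X turns x' = - plus x into t X' = - m X with m 0 v = 0. *)
Let c2 (i : nat) : 'M[C]_n.+1 := d 2 i + (i == 0%N)%:R *: n%:R%:M.

Let m (i : nat) z : 'M[C]_n.+1 := 2^-1 *: c2 i + z *: d 3 i + z ^+ 2 *: d 4 i.

Let c2_bound K : (forall j i, mn (d j i) * r ^+ i <= K) ->
  forall i, mn (c2 i) * r ^+ i <= K + mn (n%:R%:M : 'M[C]_n.+1).
Proof.
have [r0 _ _ _ _] := pA; have rp : 0 < r by [].
move=> hK i; have ri : 0 <= r ^+ i by rewrite exprn_ge0 // ltW.
apply: le_trans (ler_wpM2r ri (mnD _ _)) _; rewrite mulrDl lerD //.
case: i {ri} => [|i]; first by rewrite eqxx expr0 mulr1 scale1r.
by rewrite scale0r mn0 mul0r mn_ge0.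
Qed.

Let ev_c2 z : cn z <= 2^-1 * r -> ev c2 z = ev (d 2) z + n%:R%:M.
Proof.
have [r0 _ [K hK] _ _] := pA; have g := mn_gbmx r0 (lexx r) (hK 2).
move=> hz; apply/matrixP => i j; rewrite mxE [RHS]mxE [X in X + _]mxE.
apply: psumE; have := convD (conv_shift (psum_conv r0 (g i j) hz)) (conv_cst (n%:R%:M i j)).
move=> H e e0; have [N hN] := H e e0; exists N.+1 => -[//|l]; rewrite ltnS => /hN.
congr (cn (_ - _) <= e); rewrite !big_ord_recl /= !expr0 !mulr1 !mxE !mul1r.
rewrite addrAC; congr (_ + _); apply: eq_bigr => k _.
by rewrite !mxE mul0r addr0.
Qed.

Lemma lowest_solution : exists (del : R) (X : C -> C -> 'cV[C]_n.+1),
  [/\ 0 < del, del < 2^-1 * r, forall z, X 0 z = v, forall z, dmx 0 (X^~ z) &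
   forall t, 0 < t < del -> entire (X t%:C) /\ forall z,
     rdm (fun x => half_power x *: X x%:C z) t
       (- (plus (A^~ t) z *m (half_power t *: X t%:C z)))].
Proof.
have [r0 _ [K hK] hA [d1 d3]] := pA; have rp : 0 < r by [].
have me j : entire (m j) by exact: plus_coef_entire.
have mb := plus_coef_bound r0 (c2_bound hK) (hK 3) (hK 4).
pose x0 (z : C) := v.
have x0e : entire x0 by move=> z; exact: dmx_cst.
have mx0 z : m 0%N z *m x0 z = 0.
  rewrite /m /c2 /x0 !mulmxDl -!scalemxAl mulmxDl -scalemxAl v2 v4 d3 mul0mx.
  by rewrite !scaler0 !addr0 mul_scalar_mx scale1r -scalerDl addNr scale0r scaler0.
have mu k z : (k.+1%:R%:M + m 0%N z) \in unitmx.
  have -> : m 0%N z = 2^-1 *: d 2 0%N + z ^+ 2 *: d 4 0%N + (n%:R / 2)%:M.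
    rewrite /m /c2 d3 scaler0 addr0 scale1r scalerDr scale_scalar_mx mulrC.
    by rewrite addrAC.
  exact: indicial.
exists (8^-1 * r), (sol_fun m x0); split.
- by rewrite mulr_gt0.
- lra.
- by move=> z; rewrite sol_fun0.
- move=> z; apply: (sol_fun_dif r0 me mb x0e mx0 mu).
  by rewrite cn0 mulr_ge0 // ltW.
move=> t /andP[t0 tr]; have ht : cn t%:C <= 8^-1 * r by rewrite cnR gtr0_norm // ltW.
have tr2 : t < 2^-1 * r by lra.
split=> [|z]; first exact: (sol_fun_entire r0 me mb x0e mx0 mu).
pose D : 'cV[C]_n.+1 := \matrix_(i, j) dv (fun t => sol_fun m x0 t z i j) t%:C 1.
have hD : rdm (fun x => sol_fun m x0 x%:C z) t D.
  apply: (@rdm_dv0 _ _ _ (fun t => sol_fun m x0 t z)).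
    exact: (sol_fun_dif r0 me mb x0e mx0 mu).
  by move=> i j; rewrite mxE.
have hz : cn t%:C <= 2^-1 * r by lra.
have evm : ev (fun k => m k z) t%:C = t%:C *: plus (A^~ t) z + (n%:R / 2)%:M.
  have g2 := mn_gbmx r0 (lexx r) (c2_bound hK).
  have g3 := mn_gbmx r0 (lexx r) (hK 3); have g4 := mn_gbmx r0 (lexx r) (hK 4).
  rewrite (ev_plus z r0 g2 g3 g4 hz) ev_c2 // -!hA // /plus.
  rewrite !scalerDr !scalerA !(mulrC t%:C) scale_scalar_mx (mulrC _ n%:R).
  by rewrite -!addrA; congr (_ + _); rewrite addrC -addrA.
have tD : t%:C *: D = - ((t%:C *: plus (A^~ t) z + (n%:R / 2)%:M) *m sol_fun m x0 t%:C z).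
  rewrite -evm; apply/matrixP => i j; rewrite !mxE.
  have := sol_fun_ode r0 me mb x0e mx0 mu z i j ht.
  by rewrite mxE.
have tc : t%:C != 0 :> C by rewrite (inj_eq (@complexI R)) gt_eqF.
apply: rdm_eq (rdmZf (rd_half_power t0) hD).
have -> : D = t%:C^-1 *: (t%:C *: D) by rewrite scalerA mulVf // scale1r.
rewrite tD mulmxDl -scalemxAl mul_scalar_mx -scalemxAr.
set X := sol_fun _ _ _ _; set h := half_power t; set Y := plus _ _ *m X.
rewrite scalerN scalerDr !scalerA mulVf // scale1r scalerN scalerDr opprD scalerA.
rewrite addrCA [X in _ + (X - _)](_ : _ = (h * (t%:C^-1 * (n%:R / 2))) *: X).
  by rewrite subrr addr0.
by congr (_ *: _); ring.
Qed.

End LowestSolution.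

Section Horizontal.
Variables (R : realType) (n : nat).
Local Notation C := R[i].
Implicit Types (A : nat -> R -> 'M[C]_n.+1) (z : C) (del t T : R).

Definition horizontal A z del (y : R -> 'cV[C]_n.+1) := forall t, 0 < t < del ->
  rdm y t (- (plus (A^~ t) z *m y t)).

Lemma horizontal_transport A z del y T e X Y : horizontal A z del y ->
  transport A T e X Y -> (forall t, `|t - T| < e -> 0 < t < del) ->
  forall t, `|t - T| < e -> y t = X t z *m y T.
Proof.
move=> hy hX he t ht; have [XT h] := hX.
have e0 : 0 < e by apply: le_lt_trans ht.
have eT : `|T - T| < e by rewrite subrr normr0.
have YT : Y T z = 1%:M by have [_ _ /(_ z)] := h T eT; rewrite XT mulmx1.
have c : Y t z *m y t = Y T z *m y T.
  apply: (@rdm_const _ _ _ (fun t => Y t z *m y t) (T - e) (T + e)).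
  - move=> x hx; have hx' : `|x - T| < e by rewrite ltr_distl.
    have [_ _ _ _ /(_ z) dY] := h x hx'.
    apply: rdm_eq (rdmM dY (hy x (he x hx'))).
    by rewrite mulmxN mulmxA subrr.
  - by rewrite -ltr_distl.
  - by rewrite -ltr_distl.
by rewrite -[LHS]mul1mx -(transport_inv z hX ht) -mulmxA c YT mul1mx.
Qed.

Variables (A : nat -> R -> 'M[C]_n.+1) (del : R).
Hypothesis nA : forall t, 0 < t < 2 -> nahm A t.
Hypothesis anA : forall j t, (j <= 4)%N -> 0 < t < 2 -> analytic_at (A j) t.
Hypothesis del2 : del <= 2.

Lemma small_transport T : 0 < T < del -> exists (e : R) X Y X1 Y1,
  [/\ 0 < e, transport A T e X Y, transport (opp4 A) T e X1 Y1 &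
      forall t, `|t - T| < e -> 0 < t < del].
Proof.
move=> /andP[T0 Td]; have hT : 0 < T < 2 by rewrite T0 (lt_le_trans Td).
have [d [X [Y [X1 [Y1 [d0 tX tX1 ht]]]]]] := local_transport anA hT.
pose e := Num.min d (del - T).
have shrink B X' Y' : transport B T d X' Y' -> transport B T e X' Y'.
  by move=> [h1 h2]; split=> // t; rewrite lt_min => /andP[/h2].
exists e, X, Y, X1, Y1; split; [|exact: shrink|exact: shrink|].
  by rewrite lt_min d0 subr_gt0.
move=> t; rewrite lt_min => /andP[/ht /andP[t0 _] h2].
by move: h2; rewrite t0 ltr_distl => /andP[_]; lra.
Qed.

Lemma del_nahm t : 0 < t < del -> nahm A t.
Proof. by move=> /andP[t0 td]; apply: nA; rewrite t0 (lt_le_trans td). Qed.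

Lemma horizontal_cyclic z y s t : horizontal A z del y -> 0 < s < del -> 0 < t < del ->
  cyclic (quart (A^~ s) z) (y s) -> cyclic (quart (A^~ t) z) (y t).
Proof.
move=> hy; apply: (interval_induction (Q := fun t => cyclic (quart (A^~ t) z) (y t))).
move=> T hT; have [e [X [Y [_ [_ [e0 hX _ he]]]]]] := small_transport hT.
exists e; first exact: e0.
move=> x hx; have XY := transport_inv z hX hx.
have yE := horizontal_transport hy hX he hx.
have [uX _] := mulmx1_unit XY.
have c := transport_conj hX (fun x hx => del_nahm (he x hx)) z hx.
rewrite yE; split; last exact: (cyclic_conj uX (esym c)).
move=> h; rewrite /cyclic; have := h; rewrite /cyclic -(krylov_mul _ (esym c)).
by rewrite unitmx_mul => /andP[].
Qed.

(** The form of transport_ex for a single section. *)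
Lemma horizontal_ex z y : z != 0 -> horizontal A z del y ->
  horizontal (opp4 A) z^-1 del (fun t => ex (quart (A^~ t) z) (t%:C / z ^+ 2) *m y t).
Proof.
move=> z0 hy T hT.
have [e [X [Y [X1 [Y1 [e0 hX hX1 he]]]]]] := small_transport hT.
have hN x (hx : `|x - T| < e) := del_nahm (he x hx).
have eT : `|T - T| < e by rewrite subrr normr0.
pose w := ex (quart (A^~ T) z) (T%:C / z ^+ 2) *m y T.
have E x : `|x - T| < e ->
    X1 x z^-1 *m w = ex (quart (A^~ x) z) (x%:C / z ^+ 2) *m y x.
  move=> hx; rewrite (horizontal_transport hy hX he hx) mulmxA.
  rewrite -(ex_intertwine _ (esym (transport_conj hX hN z hx))).
  have -> : x%:C / z ^+ 2 = (x - T)%:C / z ^+ 2 + T%:C / z ^+ 2.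
    by rewrite rmorphB -mulrDl subrK.
  by rewrite -ex_add mulmxA (transport_ex hX hX1 hN hx z0) mulmxA.
have [_ h1] := hX1; have [_ _ _ /(_ z^-1) dX _] := h1 T eT.
apply: (rdm_near e0 E); apply: rdm_eq (rdmM dX (rdm_cst w T)).
by rewrite mulmx0 addr0 -E // mulmxA mulNmx.
Qed.

(** Transport carries the Krylov basis at T to the one at t. *)
Lemma horizontal_coords z x y : horizontal A z del x -> horizontal A z del y ->
  (forall t, 0 < t < del -> cyclic (quart (A^~ t) z) (x t)) ->
  exists b : 'cV[C]_n.+1, forall t, 0 < t < del ->
    y t = krylov (quart (A^~ t) z) (x t) *m b.
Proof.
move=> hx hy cx.
pose f t := invmx (krylov (quart (A^~ t) z) (x t)) *m y t.
have fE t : 0 < t < del -> y t = krylov (quart (A^~ t) z) (x t) *m f t.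
  by move=> ht; rewrite /f mulKVmx //; exact: cx.
have fc s t : 0 < s < del -> 0 < t < del -> f s = f t.
  apply: rdm_const => T hT; have [e [X [Y [_ [_ [e0 hX _ he]]]]]] := small_transport hT.
  apply: (rdm_near e0 _ (rdm_cst (f T) T)) => u hu.
  have hN w (hw : `|w - T| < e) := del_nahm (he w hw).
  have c := transport_conj hX hN z hu.
  have [uX _] := mulmx1_unit (transport_inv z hX hu).
  rewrite {2}/f (horizontal_transport hx hX he hu) (horizontal_transport hy hX he hu).
  rewrite -(krylov_mul _ (esym c)) (fE T hT) [X u z *m (_ *m f T)]mulmxA mulKmx //.
  by rewrite unitmx_mul uX; exact: cx.
have [d0|d0] := ltP 0 del; last first.
  by exists 0 => t /andP[t0 td]; have := lt_trans t0 (lt_le_trans td d0); rewrite ltxx.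
have hd : 0 < del / 2 < del by apply/andP; split; lra.
by exists (f (del / 2)) => t ht; rewrite (fc _ t hd ht) -fE.
Qed.

End Horizontal.

(** * The frame near an endpoint *)

Section KrylovScaling.
Variables (F : fieldType) (n : nat).
Implicit Types (M : 'M[F]_n.+1) (v : 'cV[F]_n.+1).

Lemma krylovZ c M v : krylov M (c *: v) = c *: krylov M v.
Proof. apply/matrixP => i j; rewrite [LHS]mxE -scalemxAr [LHS]mxE [RHS]mxE.
by congr (_ * _); rewrite [RHS]mxE. Qed.

Lemma cyclicZ c M v : c != 0 -> cyclic M (c *: v) = cyclic M v.
Proof. by move=> c0; rewrite /cyclic krylovZ unitmxZ // unitfE. Qed.

Lemma krylov_scale c M v :
  krylov (c *: M) v = krylov M v *m diag_mx (\row_(j < n.+1) c ^+ j).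
Proof.
apply/matrixP => i j; rewrite mul_mx_diag [LHS]mxE [RHS]mxE.
rewrite [krylov M v i j]mxE [X in _ = _ * X]mxE.
by rewrite expmxZ -scalemxAl mxE mulrC.
Qed.

Lemma cyclic_scale c M v : c != 0 -> cyclic (c *: M) v = cyclic M v.
Proof.
move=> c0; rewrite /cyclic krylov_scale unitmx_mul.
suff -> : diag_mx (\row_(j < n.+1) c ^+ j) \in unitmx by rewrite andbT.
rewrite unitmxE det_diag unitfE; apply/prodf_neq0 => i _.
by rewrite mxE expf_neq0.
Qed.

Lemma cyclic_neq0 M v : cyclic M v -> v != 0.
Proof.
rewrite /cyclic => h; apply: contraTneq h => ->.
rewrite -(scale0r (0 : 'cV[F]_n.+1)) krylovZ scale0r.
by rewrite unitmxE det0 unitr0.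
Qed.

End KrylovScaling.

Section EndpointFrame.
Variables (R : realType) (n : nat).
Local Notation C := R[i].
Implicit Types (A : nat -> R -> 'M[C]_n.+1) (d : nat -> nat -> 'M[C]_n.+1).
Implicit Types (z : C) (t : R).

Definition irreducible_triple (a0 a2 a4 : 'M[C]_n.+1) := forall U : 'M[C]_n.+1,
  stablemx U a0^T -> stablemx U a2^T -> stablemx U a4^T ->
  \rank U = 0%N \/ \rank U = n.+1.

(** The family t A(t), which extends holomorphically to t = 0. *)
Definition scaled_quart d (tau : C) z := quart (fun j => ev (d j) tau) z.

Lemma scaled_quart_dmx_at A d r z w : pole A d r -> cn w < 2^-1 * r ->
  dmx w ((scaled_quart d)^~ z).
Proof.
move=> [r0 _ [K hK] _ _] hw.
have h j : dmx w (ev (d j)) := ev_dif r0 (mn_gbmx r0 (lexx r) (hK j)) hw.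
have hZ j m : dmx w (fun tau => z ^+ m *: ev (d j) tau).
  exact: (dmxZ (@differentiable_cst _ _ _ (z ^+ m) w) (h j)).
have := dmxD (dmxD (dmxD (dmxD (h 0%N) (hZ 1%N 1%N)) (hZ 2 2)) (hZ 3 3)) (hZ 4 4).
exact.
Qed.

Lemma scaled_quart_dmx A d r z : pole A d r -> dmx 0 ((scaled_quart d)^~ z).
Proof.
move=> pA; have [r0 _ _ _ _] := pA; apply: (scaled_quart_dmx_at z pA).
by rewrite cn0 mulr_gt0.
Qed.

Lemma scaled_quartE A d r t z : pole A d r -> 0 < t -> t < 2^-1 * r ->
  scaled_quart d t%:C z = t%:C *: quart (A^~ t) z.
Proof.
move=> [_ _ _ hA _] t0 tr; rewrite /scaled_quart /quart -!hA //.
by rewrite !scalerDr !scalerA !(mulrC t%:C).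
Qed.

Lemma scaled_quart0 A d r z : pole A d r ->
  scaled_quart d 0 z = d 0%N 0%N + z ^+ 2 *: d 2 0%N + (z ^+ 2) ^+ 2 *: d 4 0%N.
Proof.
move=> [_ _ _ _ [d1 d3]]; rewrite /scaled_quart /quart !ev0 d1 d3 !scaler0 !addr0.
by rewrite -exprM.
Qed.

Definition lowest (a0 a2 a4 : 'M[C]_n.+1) (v : 'cV[C]_n.+1) :=
  [/\ a4 *m v = 0, a2 *m v = - n%:R *: v, a0 ^+ n.+1 *m v = 0 & cyclic a0 v].

(** X t is cyclic for A(t) because it is so for t A(t) at t = 0, by
    pencil_cyclic: hence it is for some small t and, being horizontal, for
    all. *)
Lemma endpoint_solution A d r : pole A d r -> (forall t, 0 < t < 2 -> nahm A t) ->
  (forall j t, (j <= 4)%N -> 0 < t < 2 -> analytic_at (A j) t) ->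
  irreducible_triple (d 0%N 0%N) (d 2 0%N) (d 4 0%N) ->
  exists v (del : R) (X : C -> C -> 'cV[C]_n.+1),
  [/\ lowest (d 0%N 0%N) (d 2 0%N) (d 4 0%N) v, 0 < del /\ del < 2^-1 * r,
    forall z, X 0 z = v /\ dmx 0 (X^~ z),
    forall z, horizontal A z del (fun t => half_power n t *: X t%:C z) &
    forall t, 0 < t < del -> entire (X t%:C) /\
      forall z, cyclic (quart (A^~ t) z) (X t%:C z)].
Proof.
move=> pA nA anA irr; have [r0 r2' _ _ _] := pA; have rp : 0 < r by [].
have [e0 e2 e4] := residue_relations pA nA.
have [v [v4 v2 vt cv]] := sl2_lowest e0 e2 e4 irr.
have [del [X [d0 dr X0 Xd hX]]] := lowest_solution pA v2 v4
  (fun c k => indicial_unit e0 e2 v4 v2 cv c k).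
have hor z : horizontal A z del (fun t => half_power n t *: X t%:C z).
  by move=> t ht; exact: (hX t ht).2.
exists v, del, X; split.
- by [].
- by [].
- by move=> z; split; [exact: X0 | exact: Xd].
- exact: hor.
move=> t ht; split=> [|z]; first exact: (hX t ht).1.
have [s hs cs] : exists2 s : R, 0 < s < del & cyclic (quart (A^~ s) z) (X s%:C z).
  apply: contrapT => none.
  have df : differentiable (fun tau => \det (krylov (scaled_quart d tau z) (X tau z))) (0 : C).
    by apply: dif_det; apply: dmx_krylov; [exact: scaled_quart_dmx pA | exact: Xd].
  have := dif_vanish0 df d0; rewrite X0 (scaled_quart0 z pA) => H.
  have := pencil_cyclic e0 e2 v4 v2 cv (z ^+ 2).
  rewrite /cyclic unitmxE unitfE H ?eqxx // => s /andP[s0 sd].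
  apply/eqP/negPn/negP => ds; apply: none; exists s; first by rewrite s0.
  have sc : s%:C != 0 :> C by rewrite (inj_eq (@complexI R)) gt_eqF.
  have sr : s < 2^-1 * r by lra.
  by rewrite -(cyclic_scale _ _ sc) -(scaled_quartE z pA s0 sr) /cyclic unitmxE unitfE.
have d2 : del <= 2 by lra.
have := horizontal_cyclic nA anA d2 (hor z) hs ht.
by rewrite (cyclicZ _ _ (half_power_neq0 n s)) (cyclicZ _ _ (half_power_neq0 n t)); apply.
Qed.

Lemma opp4_analytic A : (forall j t, (j <= 4)%N -> 0 < t < 2 -> analytic_at (A j) t) ->
  forall j t, (j <= 4)%N -> 0 < t < 2 -> analytic_at (opp4 A j) t.
Proof. by move=> h j t _ ht; apply: analytic_opp; apply: h; rewrite ?leq_subr. Qed.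

Lemma irreducible_opp4 a0 a2 a4 : irreducible_triple a0 a2 a4 ->
  irreducible_triple (- a4) (- a2) (- a0).
Proof.
have st (U X : 'M[C]_n.+1) : stablemx U (- X)^T -> stablemx U X^T.
  move=> h; have : (U *m (- X)^T <= U)%MS by [].
  by rewrite linearN mulmxN eqmx_opp.
by move=> irr U /st h4 /st h2 /st h0; exact: irr.
Qed.

Section Combine.
Variables (A : nat -> R -> 'M[C]_n.+1) (d : nat -> nat -> 'M[C]_n.+1) (r : R).
Hypothesis pA : pole A d r.
Hypothesis nA : forall t, 0 < t < 2 -> nahm A t.
Hypothesis anA : forall j t, (j <= 4)%N -> 0 < t < 2 -> analytic_at (A j) t.

(** By horizontal_coords the coordinates beta_i of exp(t A/xi^2) X in the
    Krylov basis of X1 are constant, while t^(-i) beta_i stays bounded as t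
    tends to 0; hence beta_i = 0 for positive i. *)
Lemma endpoint_match (v v1 : 'cV[C]_n.+1) (del : R) (X X1 : C -> C -> 'cV[C]_n.+1) z :
  0 < del -> del < 2^-1 * r -> z != 0 ->
  X 0 z = v -> dmx 0 (X^~ z) -> X1 0 z^-1 = v1 -> dmx 0 (X1^~ z^-1) ->
  horizontal A z del (fun t => half_power n t *: X t%:C z) ->
  horizontal (opp4 A) z^-1 del (fun t => half_power n t *: X1 t%:C z^-1) ->
  (forall t, 0 < t < del -> cyclic (quart (opp4 A ^~ t) z^-1) (X1 t%:C z^-1)) ->
  cyclic (scaled_quart (fun j i => - d (4 - j)%N i) 0 z^-1) v1 ->
  exists b : C, ex (scaled_quart d 0 z) (z ^- 2) *m v = b *: v1 /\
    forall t, 0 < t < del ->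
      ex (quart (A^~ t) z) (t%:C / z ^+ 2) *m X t%:C z = b *: X1 t%:C z^-1.
Proof.
move=> d0 dr z0 X0 Xd X10 X1d hX hX1 cX1 cv1.
have [r0 r2' _ _ _] := pA; have rp : 0 < r by [].
have d2 : del <= 2 by lra.
have pA1 := pole_opp4 pA.
set d' := (fun j i => - d (4 - j)%N i) in pA1 cv1.
have nA1 t : 0 < t < 2 -> nahm (opp4 A) t by move=> /nA; exact: opp4_nahm.
have anA1 := opp4_analytic anA.
have hy := horizontal_ex nA anA d2 z0 hX.
have cX1' t : 0 < t < del ->
    cyclic (quart (opp4 A ^~ t) z^-1) (half_power n t *: X1 t%:C z^-1).
  by move=> ht; rewrite (cyclicZ _ _ (half_power_neq0 n t)); exact: cX1.
have [b hb] := horizontal_coords nA1 anA1 d2 hX1 hy cX1'.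
have hb' t : 0 < t < del -> ex (quart (A^~ t) z) (t%:C / z ^+ 2) *m X t%:C z =
    krylov (quart (opp4 A ^~ t) z^-1) (X1 t%:C z^-1) *m b.
  move=> ht; have := hb t ht; rewrite -scalemxAr krylovZ -scalemxAl.
  by move/(can_inj (scalerK (half_power_neq0 n t))).
pose G tau := krylov (scaled_quart d' tau z^-1) (X1 tau z^-1).
have Gd : dmx 0 G by apply: dmx_krylov => //; exact: scaled_quart_dmx pA1.
pose Y tau := ex (scaled_quart d tau z) (z ^- 2) *m X tau z.
have Yd : dmx 0 Y.
  apply: dmxM => //; apply: ex_param.
  apply/near_vnP; exists (2^-1 * r); first by rewrite mulr_gt0.
  by move=> w; rewrite subr0 => hw; apply: (scaled_quart_dmx_at z pA).
have YE t : 0 < t < del -> Y t%:C = ex (quart (A^~ t) z) (t%:C / z ^+ 2) *m X t%:C z.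
  move=> /andP[t0 td]; have tr : t < 2^-1 * r by lra.
  by rewrite /Y (scaled_quartE z pA t0 tr) ex_scale.
(* in the basis of t A(t) the coordinates are t^-i beta_i *)
have GE t : 0 < t < del -> exists c : 'cV[C]_n.+1, Y t%:C = G t%:C *m c /\
    forall i : 'I_n.+1, b i 0 = t%:C ^+ i * c i 0.
  move=> ht; have /andP[t0 td] := ht; have tr : t < 2^-1 * r by lra.
  have tc : t%:C != 0 :> C by rewrite (inj_eq (@complexI R)) gt_eqF.
  exists (\col_i (t%:C ^- i * b i 0)); split; last first.
    by move=> i; rewrite mxE mulrA mulfV ?mul1r // expf_neq0.
  rewrite (YE t ht) hb' // /G (scaled_quartE _ pA1 t0 tr) krylov_scale -mulmxA.
  congr (_ *m _); apply/colP => i; rewrite mul_diag_mx !mxE mulrA mulfV ?mul1r //.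
  exact: expf_neq0.
have G0 : G 0 \in unitmx by rewrite /G X10.
(* the determinant of G times beta_i is t^i times a function that is
   differentiable at t = 0 *)
have bi (i : 'I_n.+1) : i != ord0 -> b i 0 = 0.
  move=> i0; have i1 : (0 < i)%N.
    by rewrite lt0n; apply: contra i0 => /eqP h; apply/eqP/val_inj.
  have H : \det (G 0) * b i 0 + (- 1) * (0 ^+ i * (\adj (G 0) *m Y 0) i 0) = 0.
    apply: (@dif_vanish0 R (fun tau => \det (G tau) * b i 0 +
      (- 1) * (tau ^+ i * (\adj (G tau) *m Y tau) i 0)) del _ d0).
      apply: differentiableD.
        by apply: differentiableM; [exact: dif_det | exact: differentiable_cst].
      apply: differentiableM; first exact: differentiable_cst.
      apply: differentiableM; first exact: dif_exp.
      exact: (dmxM (dmx_adj Gd) Yd).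
    move=> t ht; have [c [cE bE]] := GE t ht.
    by rewrite cE mulmxA mul_adj_mx mul_scalar_mx mxE bE; ring.
  move: H; rewrite expr0n gtn_eqF // mul0r mulr0 addr0 => /eqP.
  rewrite mulf_eq0; have := G0; rewrite unitmxE unitfE => /negbTE ->.
  by move=> /eqP.
exists (b ord0 0).
have main t : 0 < t < del ->
    ex (quart (A^~ t) z) (t%:C / z ^+ 2) *m X t%:C z = b ord0 0 *: X1 t%:C z^-1.
  move=> ht; rewrite hb' //; apply/colP => s; rewrite [LHS]mxE (bigD1 ord0) //=.
  rewrite big1 ?addr0 => [|i i0]; last by rewrite bi // mulr0.
  by rewrite mxE expr0 mul1mx [RHS]mxE mulrC.
split=> //.
have := @dmx_vanish0 R _ _ (fun tau => Y tau + (- b ord0 0) *: X1 tau z^-1) del.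
rewrite /Y X0 X10 => H; apply/eqP; rewrite -subr_eq0 -scaleNr; apply/eqP; apply: H => //.
  by apply: dmxD => //; apply: dmxZ => //; exact: differentiable_cst.
by move=> t ht; rewrite -/(Y t%:C) YE // main // scaleNr subrr.
Qed.

Hypothesis irr : irreducible_triple (d 0%N 0%N) (d 2 0%N) (d 4 0%N).

(** By ex_lowest_scaling the factor b of endpoint_match depends on xi as
    xi^(-2n); the remaining constant is absorbed in x1. *)
Lemma endpoint_framed : exists2 t : R, 0 < t < 2 & framed A t.
Proof.
have [r0 r2' _ _ [d1 d3]] := pA; have rp : 0 < r by [].
have pA1 := pole_opp4 pA.
have nA1 t : 0 < t < 2 -> nahm (opp4 A) t by move=> /nA; exact: opp4_nahm.
have [v [e [X [low [e0 er] Xv hX hXt]]]] := endpoint_solution pA nA anA irr.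
have [v1 [e1 [X1 [low1 [e10 e1r] X1v hX1 hX1t]]]] :=
  endpoint_solution pA1 nA1 (opp4_analytic anA) (irreducible_opp4 irr).
have [q0 q2 q4] := residue_relations pA nA.
have [v4 v2 vt cv] := low; have [w4 w2 wt cw] := low1.
have [p0 p2 p4] := residue_relations pA1 nA1.
pose del := Num.min e e1.
have d0 : 0 < del by rewrite lt_min e0.
have de : del <= e by rewrite ge_min lexx.
have de1 : del <= e1 by rewrite ge_min lexx orbT.
have shr (B : nat -> R -> 'M[C]_n.+1) z x (f : R) :
    del <= f -> horizontal B z f x -> horizontal B z del x.
  by move=> df h t /andP[t0 td]; apply: h; rewrite t0 (lt_le_trans td).
have rng (f : R) t : del <= f -> 0 < t < del -> 0 < t < f.
  by move=> df /andP[-> td]; exact: lt_le_trans df.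
have dr : del < 2^-1 * r by exact: le_lt_trans er.
have cyc1 z : cyclic (scaled_quart (fun j i => - d (4 - j)%N i) 0 z) v1.
  rewrite (scaled_quart0 z pA1); exact: (pencil_cyclic p0 p2 w4 w2 cw).
have mt z (z0 : z != 0) := endpoint_match d0 dr z0 (Xv z).1 (Xv z).2 (X1v z^-1).1 (X1v z^-1).2
  (shr _ _ _ _ de (hX z)) (shr _ _ _ _ de1 (hX1 z^-1))
  (fun t ht => (hX1t t (rng _ _ de1 ht)).2 z^-1) (cyc1 z^-1).
have [b1 [hb1 _]] := mt 1 (oner_neq0 _).
have aw : d 0%N 0%N *m v1 = 0.
  by move: w4; rewrite /= mulNmx => /eqP; rewrite oppr_eq0 => /eqP.
have v10 : v1 != 0 := cyclic_neq0 cw.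
have b10 : b1 != 0.
  apply: contra (cyclic_neq0 cv) => /eqP b0; move: hb1; rewrite b0 scale0r.
  move=> /(congr1 (fun x => invmx (ex (scaled_quart d 0 1) (1 ^- 2)) *m x)).
  by rewrite mulKmx ?ex_unit // mulmx0 => ->.
pose t := del / 2; have ht : 0 < t < del by rewrite /t; apply/andP; split; lra.
have t2 : 0 < t < 2 by move: ht => /andP[-> td] /=; lra.
exists t => //; exists (X t%:C), (fun z => b1 *: X1 t%:C z); split.
- exact: (hXt t (rng _ _ de ht)).1.
- move=> z; apply: dmxZ; first exact: differentiable_cst.
  exact: (hX1t t (rng _ _ de1 ht)).1.
- exact: (hXt t (rng _ _ de ht)).2.
- move=> z; rewrite (cyclicZ _ _ b10); have := (hX1t t (rng _ _ de1 ht)).2 z.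
  have m1 : (-1 : C) != 0 by rewrite oppr_eq0 oner_neq0.
  by rewrite quart_opp4 -scaleN1r (cyclic_scale _ _ m1).
- move=> z z0; have [b [hb hbt]] := mt z z0.
  rewrite hbt // scalerA; congr (_ *: _).
  rewrite (scaled_quart0 z pA) in hb; rewrite (scaled_quart0 1 pA) in hb1.
  have z20 : z ^+ 2 != 0 by rewrite expf_neq0.
  have := ex_lowest_scaling q0 q2 v4 v2 vt cv z20 aw v10 hb.
  move: hb1; rewrite !expr1n invr1 !scale1r => hb1 /(_ _ hb1) ->.
  by congr (_ * _); rewrite -exprM mulnC exprM -exprVn.
Qed.

End Combine.

End EndpointFrame.

(** * The spectral curve of a solution of Nahm's equations *)

Section Hypotheses.
Variables (R : realType) (n : nat).
Local Notation C := R[i].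
Implicit Types (A B : R -> 'M[C]_n.+1) (t : R).

Lemma near_refl t (P : R -> Prop) : (\forall x \near (2 - t), P x) ->
  \forall x \near t, P (2 - x).
Proof.
move=> /nbhs_normP[e /= e0 h]; apply/nbhs_normP; exists e => //= x hx.
apply: h => /=; have -> : 2 - t - (2 - x) = - (t - x) by ring.
by rewrite normrN.
Qed.

Lemma analytic_refl B t : analytic_at B (2 - t) -> analytic_at (fun x => B (2 - x)) t.
Proof.
move=> [c h]; exists (fun i => ((-1) ^+ i)%:C *: c i).
have := near_refl h; apply: filterS => x.
have -> : (fun N => \sum_(i < N) ((2 - x - (2 - t)) ^+ i)%:C *: c i) =
    (fun N => \sum_(i < N) ((x - t) ^+ i)%:C *: (((-1) ^+ i)%:C *: c i)).
  apply/funext => N; apply: eq_bigr => i _.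
  rewrite scalerA -rmorphM -exprMn; congr (_%:C *: _); congr (_ ^+ _); ring.
exact.
Qed.

Lemma analytic_near B B' t : (\forall x \near t, B x = B' x) -> analytic_at B t ->
  analytic_at B' t.
Proof. by move=> e [c h]; exists c; apply: filterS2 e h => x ->. Qed.

Lemma near_inside t : 0 < t < 2 -> \forall x \near t, 0 < x < 2.
Proof.
move=> /andP[t0 t2]; apply/nbhs_normP; exists (Num.min t (2 - t)) => /=.
  by rewrite lt_min t0 subr_gt0.
by move=> x /=; rewrite lt_min !ltr_distl => /andP[/andP[h1 h2] /andP[h3 h4]]; lra.
Qed.

Lemma analytic_closed_at A t : analytic_closed A -> 0 < t < 2 -> analytic_at A t.
Proof.
move=> [B hB BA] /[dup] ht /andP[t0 t2].
apply: (@analytic_near B); last by apply: hB; rewrite !ltW.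
by apply: filterS (near_inside ht) => x; exact: BA.
Qed.

Lemma analytic_closed_back A : analytic_closed A -> analytic_closed (fun x => - A (2 - x)).
Proof.
move=> [B hB BA]; exists (fun x => - B (2 - x)).
  move=> t /andP[t0 t2]; apply: analytic_opp; apply: analytic_refl; apply: hB.
  by apply/andP; split; lra.
by move=> t /andP[t0 t2]; rewrite BA //; apply/andP; split; lra.
Qed.

Lemma simple_pole_back A b : simple_pole A 2 b -> simple_pole (fun x => - A (2 - x)) 0 b.
Proof.
move=> [B [hB Bb near2]]; exists (fun x => B (2 - x)); split.
- by apply: analytic_refl; rewrite subr0.
- by rewrite subr0.
- have near2' : \forall x \near (2 - 0 : R), 0 < x < 2 -> A x = ((x - 2)^-1)%:C *: B x.
    by rewrite subr0.
  apply: filterS (near_refl near2') => x h /andP[x0 x2].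
  rewrite h; last by apply/andP; split; lra.
  have -> : 2 - x - 2 = - x by ring.
  by rewrite subr0 invrN rmorphN scaleNr opprK.
Qed.

(** Power series of t A(t) at the endpoint 0. *)
Definition scaled_series A (c : nat -> 'M[C]_n.+1) (s K : R) :=
  [/\ 0 < s, s <= 2, forall i, mn (c i) * s ^+ i <= K &
   forall t, 0 < t -> t < 2^-1 * s -> t%:C *: A t = ev c t%:C].

Lemma scaled_shrink A c s K (r : R) : scaled_series A c s K -> 0 < r -> r <= s ->
  scaled_series A c r K.
Proof.
move=> [s0 s2 h hA] r0 rs; split=> //; first exact: le_trans rs s2.
  exact: mn_shrink rs h.
by move=> t t0 tr; apply: hA => //; lra.
Qed.

Lemma scaled_pole A a : simple_pole A 0 a ->
  exists c s K, scaled_series A c s K /\ c 0%N = a.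
Proof.
move=> [B [/analytic_ev[c [s [K [s0 h E]]]] Ba /nbhs_normP[e /= e0 hA]]].
have cK : c 0%N = a.
  by rewrite -Ba E ?subrr ?normr0 ?mulr_ge0 ?ltW // ev0.
pose r := Num.min s (Num.min e 2).
have r0 : 0 < r by rewrite !lt_min s0 e0 ltr0n.
have [rs re r2] : [/\ r <= s, r <= e & r <= 2] by rewrite /r !ge_min !lexx !orbT.
exists c, r, K; split=> //; split=> //; first exact: mn_shrink rs h.
move=> t t0 tr; have te : `|0 - t| < e by rewrite sub0r normrN gtr0_norm //; lra.
rewrite (hA t te) ?t0 /=; last by lra.
have tc : t%:C != 0 :> C by rewrite (inj_eq (@complexI R)) gt_eqF.
rewrite subr0 scalerA fmorphV mulfV // scale1r E ?subr0 //.
by rewrite gtr0_norm //; lra.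
Qed.

Lemma scaled_regular A : analytic_closed A ->
  exists c s K, scaled_series A c s K /\ c 0%N = 0.
Proof.
move=> [B hB BA]; have /analytic_ev[c [s [K [s0 h E]]]] : analytic_at B 0.
  by apply: hB; rewrite lexx ler0n.
pose c' i : 'M[C]_n.+1 := if i is i'.+1 then c i' else 0.
pose r := Num.min s 2; have r0 : 0 < r by rewrite lt_min s0 ltr0n.
have [rs r2] : r <= s /\ r <= 2 by rewrite /r !ge_min !lexx !orbT.
have hr := mn_shrink r0 rs h; have g := mn_gbmx r0 (lexx r) hr.
exists c', r, (`|K| * r); split=> //; split=> //.
  move=> [|i] /=; first by rewrite mn0 mul0r mulr_ge0 // ltW.
  rewrite exprSr mulrA ler_wpM2r ?(ltW r0) //.
  exact: le_trans (hr i) (ler_norm _).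
move=> t t0 tr; have t2 : 0 < t < 2 by rewrite t0 /=; lra.
have tn : `|t - 0| <= 2^-1 * s by rewrite subr0 gtr0_norm //; lra.
have tz : cn t%:C <= 2^-1 * r by rewrite cnR gtr0_norm // ltW.
rewrite -BA // (E t tn) subr0; apply/matrixP => i j; rewrite mxE [RHS]mxE mxE.
apply: esym; apply: psumE; have := convZ t%:C (psum_conv r0 (g i j) tz).
move=> H e e0; have [N hN] := H e e0; exists N.+1 => -[//|m]; rewrite ltnS => /hN.
congr (cn (_ - _) <= e); rewrite big_ord_recl /= mxE mul0r add0r mulr_sumr.
by apply: eq_bigr => k _; rewrite /bump add1n exprS mulrCA.
Qed.

Definition family5 A0 A1 A2 A3 A4 (j : nat) : R -> 'M[C]_n.+1 :=
  match j with 0 => A0 | 1 => A1 | 2 => A2 | 3 => A3 | _ => A4 end.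

Lemma pole_exists A0 A1 A2 A3 A4 a0 a2 a4 : simple_pole A0 0 a0 -> simple_pole A2 0 a2 ->
  simple_pole A4 0 a4 -> analytic_closed A1 -> analytic_closed A3 ->
  exists d r, [/\ pole (family5 A0 A1 A2 A3 A4) d r, d 0%N 0%N = a0, d 2 0%N = a2 &
    d 4 0%N = a4].
Proof.
move=> /scaled_pole[c0 [s0 [K0 [h0 e0]]]] /scaled_pole[c2 [s2 [K2 [h2 e2]]]].
move=> /scaled_pole[c4 [s4 [K4 [h4 e4]]]] /scaled_regular[c1 [s1 [K1 [h1 e1]]]].
move=> /scaled_regular[c3 [s3 [K3 [h3 e3]]]].
pose r := Num.min (Num.min s0 s1) (Num.min s2 (Num.min s3 s4)).
have r0 : 0 < r.
  have [? _ _ _] := h0; have [? _ _ _] := h1; have [? _ _ _] := h2.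
  have [? _ _ _] := h3; have [? _ _ _] := h4.
  by rewrite !lt_min; do !(apply/andP; split).
have [l0 l1 l2 l3 l4] : [/\ r <= s0, r <= s1, r <= s2, r <= s3 & r <= s4].
  by rewrite /r !ge_min !lexx !orbT.
have {}h0 := scaled_shrink h0 r0 l0; have {}h1 := scaled_shrink h1 r0 l1.
have {}h2 := scaled_shrink h2 r0 l2; have {}h3 := scaled_shrink h3 r0 l3.
have {}h4 := scaled_shrink h4 r0 l4.
exists (fun j => match j with 0 => c0 | 1 => c1 | 2 => c2 | 3 => c3 | _ => c4 end), r.
split=> //; have [_ r2 b0 E0] := h0; have [_ _ b1 E1] := h1; have [_ _ b2 E2] := h2.
have [_ _ b3 E3] := h3; have [_ _ b4 E4] := h4.
split=> //.
  exists (Num.max (Num.max K0 K1) (Num.max K2 (Num.max K3 K4))) => -[|[|[|[|j]]]] i;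
    rewrite !le_max ?b0 ?b1 ?b2 ?b3 ?b4 ?orbT //.
by move=> [|[|[|[|j]]]].
Qed.

Lemma nahm_family5 A0 A1 A2 A3 A4 : Nahm A0 A1 A2 A3 A4 ->
  forall t, 0 < t < 2 -> nahm (family5 A0 A1 A2 A3 A4) t.
Proof.
move=> nE t /nE[h0 h1 h2 h3 h4]; rewrite /nahm /family5.
by split; [exact: (has_derivative_rdm h0) | exact: (has_derivative_rdm h1) |
  exact: (has_derivative_rdm h2) | exact: (has_derivative_rdm h3) |
  exact: (has_derivative_rdm h4)].
Qed.

(** An invariant subspace of the residues is invariant under their span. *)
Lemma irreducible_of_defines (a0 a2 a4 : 'M[C]_n.+1) :
  defines_irreducible a0 a2 a4 -> irreducible_triple a0 a2 a4.
Proof.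
move=> [rho [_ _ irr] hspan] U s0 s2 s4; apply: irr => X trX.
have : rho X \in <<[:: a0; a2; a4]>>%VS by apply/hspan; exists X.
move=> /(@coord_span _ _ _ [tuple a0; a2; a4]) ->.
rewrite linear_sum mulmx_sumr; apply: summx_sub => i _.
rewrite linearZ /= -scalemxAr; apply: scalemx_sub.
by case: i => -[|[|[|i]]].
Qed.

End Hypotheses.

Section Assembly.
Variables (R : realType) (n : nat).
Local Notation C := R[i].
Variables (A : nat -> R -> 'M[C]_n.+1).
Hypothesis nA : forall t, 0 < t < 2 -> nahm A t.
Hypothesis anA : forall j t, (j <= 4)%N -> 0 < t < 2 -> analytic_at (A j) t.

Lemma spec_rev4_constant s t : 0 < s < 2 -> 0 < t < 2 ->
  spec (rev4 (A^~ t)) = spec (rev4 (A^~ s)).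
Proof.
move=> hs ht; apply/funext => p.
have E u : spec (rev4 (A^~ u)) p = (-1) ^+ n.+1 * spec (opp4 A ^~ u) (- p.1, p.2).
  rewrite /spec -detZ /= quart_opp4 scaleN1r opprB addrC; congr (\det (_ + _)).
  by rewrite rmorphN opprK.
have nA1 u : 0 < u < 2 -> nahm (opp4 A) u by move=> /nA; exact: opp4_nahm.
by rewrite !E (spec_constant nA1 (opp4_analytic anA) hs ht).
Qed.

(** Time reversal changes the sign of A, hence that of the parameter. *)
Lemma frame_back (t : R) x0 x1 : frame (back A ^~ (2 - t)) (2 - t)%:C x0 x1 ->
  frame (A^~ t) (t - 2)%:C x0 x1.
Proof.
have qE z : quart (back A ^~ (2 - t)) z = -1 *: quart (A^~ t) z.
  by rewrite /quart /back subKr !scalerN -!opprD scaleN1r.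
have qE1 z : quart (rev4 (back A ^~ (2 - t))) z = -1 *: quart (rev4 (A^~ t)) z.
  by rewrite /quart /rev4 /back subKr !scalerN -!opprD scaleN1r.
have m1 : (-1 : C) != 0 by rewrite oppr_eq0 oner_neq0.
move=> [e0 e1 c0 c1 h]; split; [exact: e0 | exact: e1 | | |].
- by move=> z; have := c0 z; rewrite qE (cyclic_scale _ _ m1).
- by move=> z; have := c1 z; rewrite qE1 (cyclic_scale _ _ m1).
- move=> z z0; have := h z z0; rewrite qE ex_scale.
  by have -> : -1 * ((2 - t)%:C / z ^+ 2) = (t - 2)%:C / z ^+ 2
    by rewrite mulN1r -mulNr -rmorphN opprB.
Qed.

End Assembly.

Theorem proposition4p15 (R : realType) (k : nat) (k_gt0 : (0 < k)%N)
  (A0 A1 A2 A3 A4 : R -> 'M[R[i]]_k)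
  (nahm : Nahm A0 A1 A2 A3 A4)
  (A1_an : analytic_closed A1) (A3_an : analytic_closed A3)
  (A0_an : analytic_open A0) (A4_an : analytic_open A4)
  (A2_an : analytic_open A2)
  (a0 a4 a2 b0 b4 b2 : 'M[R[i]]_k)
  (A0_pole0 : simple_pole A0 0 a0) (A4_pole0 : simple_pole A4 0 a4)
  (A2_pole0 : simple_pole A2 0 a2)
  (A0_pole2 : simple_pole A0 2 b0) (A4_pole2 : simple_pole A4 2 b4)
  (A2_pole2 : simple_pole A2 2 b2)
  (irr0 : defines_irreducible a0 a2 a4)
  (irr2 : defines_irreducible b0 b2 b4) :
  forall t : R, 0 < t < 2 ->
    let P0 := spectral0 (A0 t) (A1 t) (A2 t) (A3 t) (A4 t) in
    let P1 := spectral1 (A0 t) (A1 t) (A2 t) (A3 t) (A4 t) in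
    [/\ compact (divisor_support P0 P1),
        Ltrivial P0 P1 2 0 &
        forall z : R, 0 < z < 2 -> LH0_eq0 P0 P1 z%:C (2 * k%:Z - 3)].
Proof.
case: k k_gt0 A0 A1 A2 A3 A4 nahm A1_an A3_an A0_an A4_an A2_an a0 a4 a2 b0 b4 b2
  A0_pole0 A4_pole0 A2_pole0 A0_pole2 A4_pole2 A2_pole2 irr0 irr2 => [//|n] _.
move=> A0 A1 A2 A3 A4 nE A1_an A3_an A0_an A4_an A2_an a0 a4 a2 b0 b4 b2.
move=> A0_pole0 A4_pole0 A2_pole0 A0_pole2 A4_pole2 A2_pole2 irr0 irr2 t ht P0 P1.
pose A := family5 A0 A1 A2 A3 A4.
have nA := nahm_family5 nE.
have anA j s : (j <= 4)%N -> 0 < s < 2 -> analytic_at (A j) s.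
  case: j => [|[|[|[|j]]]] _ hs; [exact: A0_an | exact: analytic_closed_at |
    exact: A2_an | exact: analytic_closed_at | exact: A4_an].
have P0E : P0 = spec (A^~ t) by [].
have P1E : P1 = spec (rev4 (A^~ t)).
  apply/funext => p; rewrite /P1 /spectral1 /spec /quart /rev4 /=; congr (\det (_ - _)).
  move: (_ *: A0 t) (_ *: A1 t) (_ *: A2 t) (_ *: A3 t) (A4 t) => a b c e f.
  by rewrite (addrC _ f) (addrC _ e) (addrC _ c) (addrC a) !addrA.
have [d [r [pA d0 d2 d4]]] := pole_exists A0_pole0 A2_pole0 A4_pole0 A1_an A3_an.
have framedA s : 0 < s < 2 -> framed A s.
  have [|s0 hs0 fs0] := endpoint_framed pA nA anA.
    by rewrite d0 d2 d4; exact: irreducible_of_defines.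
  by move=> hs; exact: (framed_all nA anA hs0 fs0 hs).
(* the endpoint 2, by way of the reversed family *)
have nB s : 0 < s < 2 -> nahm (back A) s.
  by move=> /andP[s0 s2]; apply: back_nahm; apply: nA; apply/andP; split; lra.
have anB j s : (j <= 4)%N -> 0 < s < 2 -> analytic_at (back A j) s.
  move=> hj /andP[s0 s2]; apply: analytic_opp; apply: analytic_refl.
  by apply: anA => //; apply/andP; split; lra.
have [d' [r' [pB d0' d2' d4']]] := pole_exists (simple_pole_back A0_pole2)
  (simple_pole_back A2_pole2) (simple_pole_back A4_pole2)
  (analytic_closed_back A1_an) (analytic_closed_back A3_an).
have famE : family5 (fun x => - A0 (2 - x)) (fun x => - A1 (2 - x)) (fun x => - A2 (2 - x))
    (fun x => - A3 (2 - x)) (fun x => - A4 (2 - x)) = back A.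
  by apply/funext => -[|[|[|[|j]]]].
rewrite famE in pB.
have framedB s : 0 < s < 2 -> framed (back A) s.
  have [|s0 hs0 fs0] := endpoint_framed pB nB anB.
    by rewrite d0' d2' d4'; exact: irreducible_of_defines.
  by move=> hs; exact: (framed_all nB anB hs0 fs0 hs).
rewrite P0E P1E; split.
- exact: support_compact.
- have [x0 [x1 fx]] := framedA t ht.
  have ht' : 0 < 2 - t < 2 by move: ht => /andP[t0 t2]; apply/andP; split; lra.
  have [y0 [y1 fy]] := framedB _ ht'.
  apply: (frame_trivial fx (frame_back fy)).
  by rewrite -rmorphB opprB addrC subrK rmorph_nat.
- move=> z hz; have [x0 [x1 fx]] := framedA z hz.
  rewrite (spec_constant nA anA hz ht) (spec_rev4_constant nA anA hz ht).
  exact: frame_vanish fx.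
Qed.
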